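(* Let $x=x(t)=-a\sqrt{t}+b$ for some $a>0$, $b\in\mathbb{R}$. In the limit $t\to\infty$, the conditional law of the point process $\sum_{k\le n(t)}\delta_{x+x_k(t)-\sqrt{2}t}$, given the event $\{x+\max_k x_k(t)-\sqrt{2}t>0\}$, exists and does not depend on $x$ (i.e. on $a$ and $b$). Moreover, $x+\max_k x_k(t)-\sqrt{2}t$, conditionally on the event $\{x+\max_k x_k(t)-\sqrt{2}t>0\}$, converges weakly to an exponential random variable.
   Context: Branching Brownian motion (BBM): a single particle starts at $0$ and performs a standard Brownian motion; after an exponential time of mean $1$, independent of the motion, it splits into $k$ offspring with probability $p_k$ ($k\ge1$), where $\sum_{k\ge1}p_k=1$, $\sum_k kp_k=2$, $\sum_k k(k-1)p_k<\infty$. The offspring continue along independent Brownian paths started from the splitting location, subject to the same splitting rule. At time $t$ there are $n(t)$ particles at positions $x_1(t),\dots,x_{n(t)}(t)$. Point processes are random elements of the space of Radon measures on $\mathbb{R}$ with the vague topology; convergence of (conditional) laws means convergence in law of integrals against every continuous compactly supported function. *)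

(* Defs.v *)
From HB Require Import structures.
From mathcomp Require Import all_boot all_order all_algebra.
From mathcomp Require Import all_classical all_reals all_analysis.

Set Implicit Arguments.
Unset Strict Implicit.
Unset Printing Implicit Defensive.

Import Order.TTheory GRing.Theory Num.Theory.
Import numFieldNormedType.Exports.

Local Open Scope classical_set_scope.
Local Open Scope ring_scope.

Definition sigma_rv d d' (T : measurableType d) (T' : measurableType d')
    (X : T -> T') : set (set T) :=
  preimage_set_system setT X measurable.

Definition sigma_process (R : realType) d (T : measurableType d)
    (B : R -> T -> R) : set (set T) :=
  <<s \bigcup_(t in [set t | 0 <= t]) sigma_rv (B t) >>.

Definition mutual_indep (R : realType) d (T : measurableType d)
    (P : probability T R) (I : eqType) (F : I -> set (set T)) : Prop :=
  forall (s : seq I) (A : I -> set T), uniq s ->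
    (forall i, i \in s -> F i (A i)) ->
    P (\big[setI/setT]_(i <- s) A i) = (\prod_(i <- s) P (A i))%E.

(* Only the values at times t >= 0 are meaningful. In bm_increments the second
   parameter of normal_prob is the standard deviation. *)
Record brownian_motion (R : realType) d (T : measurableType d)
    (P : probability T R) (B : R -> T -> R) : Prop := {
  bm_measurable : forall t, 0 <= t -> measurable_fun setT (B t);
  bm_start : forall w, B 0 w = 0;
  bm_continuous : forall w,
    {within `[0, +oo[%classic, continuous (fun t => B t w)};
  bm_increments : forall s t, 0 <= s -> s < t ->
    forall A : set R, measurable A ->
    P ((fun w => B t w - B s w) @^-1` A) =
      normal_prob 0 (Num.sqrt (t - s)) A;
  bm_indep_increments : forall t : nat -> R, 0 <= t 0%N ->
    {homo t : m n / (m <= n)%N >-> m <= n} ->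
    mutual_indep P
      (fun i : nat => sigma_rv (fun w => B (t i.+1) w - B (t i) w))
}.

Record offspring_law (R : realType) (p : nat -> R) : Prop := {
  offspring_none : p 0%N = 0;
  offspring_ge0 : forall k, 0 <= p k;
  offspring_total : (\sum_(1 <= k <oo) (p k)%:E = 1)%E;
  offspring_mean : (\sum_(1 <= k <oo) (k%:R * p k)%:E = 2%:E)%E;
  offspring_moment2 : (\sum_(1 <= k <oo) ((k * k.-1)%:R * p k)%:E < +oo)%E
}.

(* Ulam-Harris labels read from the youngest generation: [::] is the initial
   particle and j :: u is the j-th child (counted from 0) of u. *)
Definition label := seq nat.

Record bbm_data (R : realType) (T : Type) := BBMData {
  lifetime : label -> T -> R;
  offspring : label -> T -> nat;
  (* displacement of the particle as a function of its age *)
  motion : label -> R -> T -> R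
}.

Record is_bbm (R : realType) d (T : measurableType d) (P : probability T R)
    (p : nat -> R) (X : bbm_data R T) : Prop := {
  lifetime_measurable : forall u, measurable_fun setT (lifetime X u);
  lifetime_ge0 : forall u w, 0 <= lifetime X u w;
  lifetime_law : forall u (A : set R), measurable A ->
    P (lifetime X u @^-1` A) = exponential_prob 1 A;
  offspring_measurable : forall u, measurable_fun setT (offspring X u);
  offspring_lawE : forall u k, P (offspring X u @^-1` [set k]) = (p k)%:E;
  motion_brownian : forall u, brownian_motion P (motion X u);
  bbm_indep : mutual_indep P (fun i : label + label + label =>
    match i with
    | inl (inl u) => sigma_rv (lifetime X u)
    | inl (inr u) => sigma_rv (offspring X u)
    | inr u => sigma_process (motion X u)
    end)
}.

Section particles.
Context (R : realType) (T : Type) (X : bbm_data R T).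

Fixpoint realized (u : label) (w : T) : Prop :=
  if u is j :: v then realized v w /\ (j < offspring X v w)%N else True.

Fixpoint birth_time (u : label) (w : T) : R :=
  if u is _ :: v then birth_time v w + lifetime X v w else 0.

Fixpoint birth_place (u : label) (w : T) : R :=
  if u is _ :: v then birth_place v w + motion X v (lifetime X v w) w else 0.

Definition alive (t : R) (w : T) (u : label) : Prop :=
  realized u w /\
  birth_time u w <= t < birth_time u w + lifetime X u w.

Definition position (u : label) (t : R) (w : T) : R :=
  birth_place u w + motion X u (t - birth_time u w) w.

(* sup is 0 on the null event that the set of positions is empty or
   unbounded above *)
Definition max_position (t : R) (w : T) : R :=
  sup [set position u t w | u in alive t w].

Definition particle_measure (t : R) (f : R -> R) (w : T) (u : label) :
    {measure set R -> \bar R} :=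
  if `[< alive t w u >] then (dirac (f (position u t w)) : {measure set R -> \bar R})
  else mzero.

(* The point process sum_k delta_(f (x_k t)); labels are summed over through
   the injection pickle : label -> nat. *)
Definition bbm_point_process (t : R) (f : R -> R) (w : T) :
    {measure set R -> \bar R} :=
  mseries (fun n : nat =>
    if @pickle_inv label n is Some u then particle_measure t f w u
    else mzero : {measure set R -> \bar R}) 0.

End particles.

Definition test_function (R : realType) (phi : R -> R) : Prop :=
  continuous phi /\ compact (closure [set y | phi y != 0]).

(* A kernel is a measurable family of measures; being finite on compact sets
   makes every N w a Radon measure. *)
Definition random_radon_measure (R : realType) d (T : measurableType d)
    (N : R.-ker T ~> measurableTypeR R) : Prop :=
  forall w (K : set R), compact K -> (N w K < +oo)%E.

(* The law of Y t under P conditioned on E t converges weakly, as t --> +oo,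
   to the law of Y' under Q. *)
Definition cond_cvg_law (R : realType) d (T : measurableType d)
    (P : probability T R) (E : R -> set T) (Y : R -> T -> R)
    d' (T' : measurableType d') (Q : set T' -> \bar R) (Y' : T' -> R) : Prop :=
  forall g : R -> R, continuous g -> bounded_fun g ->
    (\int[P]_(w in E t) g (Y t w)) / fine (P (E t)) @[t --> +oo] -->
    fine (\int[Q]_w (g (Y' w))%:E)%E.

Definition cond_cvg_point_process (R : realType) d (T : measurableType d)
    (P : probability T R) (E : R -> set T)
    (N : R -> T -> {measure set R -> \bar R})
    d' (T' : measurableType d') (Q : probability T' R)
    (N' : R.-ker T' ~> measurableTypeR R) : Prop :=
  forall phi : R -> R, test_function phi ->
    cond_cvg_law P E (fun t w => \int[N t w]_y phi y)
                 Q (fun w => \int[N' w]_y phi y).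

(* Main.v *)
(* Let U_F(t, x) be one minus the expected product of F over the positions at time t of
   the particles of a branching Brownian motion started from x. It solves the FKPP
   equation, and after passing to the frame moving at speed sqrt 2 and multiplying by
   e^(sqrt 2 z) it becomes a solution v of the heat equation with a nonnegative
   absorption kap <= C e^(-sqrt 2 z) v^2. Reflecting at a large negative level bounds v,
   hence kap, well enough for dominated convergence: at z = a sqrt t - b, t * v(t, z)
   tends to a constant depending on a only, times the mass m(F) = first moment of the initial datum
   minus first moment of the total absorption. The constant cancels in ratios, so that
     E[prod F; max > 0] / P(max > 0) --> (m(F 1_(<= 0)) - m(F)) / m(1_(<= 0)),
   which does not depend on a and b.
   Taking F to be a step function, the generating functions of the numbers of particles
   above finitely many levels converge; these numbers are tight because m(F) -> 0 as
   F -> 1. Their limit at all rational levels is realised on the unit interval, and its jumps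
   are the atoms of the limit process; test functions are approximated by step functions.
   The maximum is treated the same way: shifting F by c multiplies m(F) by e^(sqrt 2 c),
   so that P(max > y | max > 0) --> e^(-sqrt 2 y). *)
Require Import Defs.
From HB Require Import structures.
From mathcomp Require Import all_boot all_order all_algebra.
From mathcomp Require Import all_classical all_reals all_analysis.
From mathcomp Require Import measurable_realfun.
From mathcomp Require Import ring lra.

Set Implicit Arguments.
Unset Strict Implicit.
Unset Printing Implicit Defensive.

Import Order.TTheory GRing.Theory Num.Theory.
Import numFieldNormedType.Exports.

Local Open Scope classical_set_scope.
Local Open Scope ring_scope.

(** * Heat kernel *)

(** The only nonlinear facts used about v are 0 <= kap <= v, kap <= C e^(- sqrt 2 z) v^2 and v <=
    e^(sqrt 2 z). The obstacle is that y kap(s, y) must be integrable over all times, so that v must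
    decay in s faster than 1 / s near the origin, which none of these bounds gives. Reflecting at -
    K with K = 4 ln s yields s^(-3/2) up to logarithms, kept as s^(-5/4). Far ahead, at z of order
    sqrt t, a second reflection, at 0, makes the kernel odd: this is where first moments come from
    and why the rate is 1 / t. That m(1_(<= 0)) > 0, needed for the ratio, is not visible in a
    difference of two moments. It is proved for small data, where the absorption is of second order,
    and transferred by monotonicity and by the shift rule. The constants depend on F only through
    the level - L below which F = 1, whence uniformity over families of F. Generating functions
    determine the joint laws of the counts directly, so no subsequence is extracted; a single filter
    over (a, b, t) yields one limit for all a and b. *)

Section lebesgue_invariance.
Context {R : realType}.
Local Notation mu := (@lebesgue_measure R).
Local Open Scope ereal_scope.

Lemma lebesgue_measure_shift (c : R) (A : set R) : measurable A ->
  pushforward mu ((fun x : R => (x + c)%R) : _ -> measurableTypeR R) A = mu A.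
Proof.
move=> mA; apply/esym.
have mf : measurable_fun setT ((fun x : measurableTypeR R => (x + c)%R) : _ -> measurableTypeR R).
  have h : measurable_fun setT (fun x : R => x + c)%R by exact: measurable_funD.
  by move=> _ Y mY; exact: (h measurableT Y mY).
pose f : {mfun measurableTypeR R >-> measurableTypeR R} :=
  HB.pack ((fun x : measurableTypeR R => (x + c)%R) : _ -> measurableTypeR R)
    (@isMeasurableFun.Build _ _ (measurableTypeR R) (measurableTypeR R) _ mf).
apply: (lebesgue_measure_unique (mu := pushforward mu f)) => // X [[a b]] _ <- /=.
rewrite /pushforward /=.
rewrite (_ : _ @^-1` _ = `](a - c)%R, (b - c)%R]%classic); last first.
  by apply/seteqP; split=> x /=; rewrite !in_itv/= ltrBlDr lerBrDr.
rewrite lebesgue_measure_itv/= lebesgue_measure_itv/= !lte_fin ltrD2r.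
by case: ifP => // _; rewrite -!EFinB; congr (_%:E); ring.
Qed.

Lemma integral_shift (f : R -> \bar R) (c : R) :
  measurable_fun setT f -> (forall x, 0 <= f x) ->
  \int[mu]_x f (x + c)%R = \int[mu]_x f x.
Proof.
move=> mf f0.
have mphi : measurable_fun setT ((fun x : R => (x + c)%R) : R -> measurableTypeR R).
  exact: measurable_funD.
rewrite -[RHS](@eq_measure_integral _ _ _ _ _
   (pushforward mu ((fun x : R => (x + c)%R) : _ -> measurableTypeR R))).
  rewrite ge0_integral_pushforward //=.
move=> A mA _; exact: lebesgue_measure_shift.
Qed.

Lemma integral_reflect (f : R -> \bar R) :
  measurable_fun setT f -> (forall x, 0 <= f x) ->
  \int[mu]_x f (- x)%R = \int[mu]_x f x.
Proof.
move=> mf f0.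
rewrite -[RHS](@eq_measure_integral _ _ _ _ _
   (pushforward mu (-%R : _ -> measurableTypeR R))).
  rewrite ge0_integral_pushforward //=.
move=> A mA _; exact: lebesgue_measureN.
Qed.

End lebesgue_invariance.

Section heat_kernel.
Context {R : realType}.
Local Notation mu := (@lebesgue_measure R).

Lemma measurable_invr : measurable_fun setT (@GRing.inv R).
Proof.
(* The power -1 is the inverse only on nonnegative reals, hence the square; at 0 the factor x makes
   both sides vanish. *)
rewrite (_ : GRing.inv = fun x : R => x * (x ^+ 2) `^ (-1)).
  apply: measurable_funM => //.
  have m2 : measurable_fun setT (fun x : R => x ^+ 2) by exact: measurable_funX.
  exact: (measurableT_comp (measurable_powR (-1)) m2).
apply/funext => x; rewrite powR_inv1 ?sqr_ge0//.
by have [->|x0] := eqVneq x 0; [rewrite invr0 mul0r|field].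
Qed.

Lemma measurable_funV d (S : measurableType d) (f : S -> R) :
  measurable_fun setT f -> measurable_fun setT (fun s => (f s)^-1).
Proof. by move=> mf; exact: (measurableT_comp measurable_invr). Qed.

Lemma measurable_sqrtr d (S : measurableType d) (f : S -> R) :
  measurable_fun setT f -> measurable_fun setT (fun s => Num.sqrt (f s)).
Proof.
move=> mf.
have ms : measurable_fun setT (@Num.sqrt R).
  by apply: continuous_measurable_fun; exact: sqrt_continuous.
exact: (measurableT_comp ms mf).
Qed.

(* For t <= 0 the square root is 0, hence so is hk t x. *)
Definition hk (t x : R) : R :=
  (Num.sqrt (2 * pi * t))^-1 * expR (- x ^+ 2 / (2 * t)).

Lemma hk_ge0 t x : 0 <= hk t x.
Proof. by rewrite mulr_ge0 ?invr_ge0 ?sqrtr_ge0 ?expR_ge0. Qed.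

Lemma hk_le0 t x : t <= 0 -> hk t x = 0.
Proof.
move=> t0; rewrite /hk ler0_sqrtr ?invr0 ?mul0r//.
by rewrite mulr_ge0_le0// mulr_ge0// pi_ge0.
Qed.

Lemma hkN t x : hk t (- x) = hk t x.
Proof. by rewrite /hk sqrrN. Qed.

Lemma hk_normal t x : 0 < t -> hk t x = normal_pdf 0 (Num.sqrt t) x.
Proof.
move=> t0; rewrite normal_pdfE ?gt_eqF ?sqrtr_gt0//.
rewrite /hk /normal_peak /normal_fun subr0 sqr_sqrtr ?ltW//.
by congr ((Num.sqrt _)^-1 * expR (_ / _)); rewrite -mulr_natl; ring.
Qed.

Lemma measurable_hk : measurable_fun setT (fun p : R * R => hk p.1 p.2).
Proof.
apply: measurable_funM.
  by apply/measurable_funV/measurable_sqrtr/measurable_funM.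
apply: (measurableT_comp (f := @expR R)) => //.
apply: measurable_funM.
  by apply: measurableT_comp => //; apply: measurable_funX.
by apply/measurable_funV/measurable_funM.
Qed.

Lemma measurable_hk2 d (S : measurableType d) (f g : S -> R) :
  measurable_fun setT f -> measurable_fun setT g ->
  measurable_fun setT (fun s => hk (f s) (g s)).
Proof.
move=> mf mg.
apply: (measurableT_comp measurable_hk (g := fun s => (f s, g s))).
exact: measurable_fun_pair.
Qed.

Lemma integral_hk t x : 0 < t -> (\int[mu]_y (hk t (x - y))%:E = 1)%E.
Proof.
move=> t0.
have m : measurable_fun setT (fun y : R => (hk t (x - y))%:E).
  by apply/measurable_EFinP; apply: measurable_hk2 => //; exact: measurable_funB.
have h0 y : (0 <= (hk t (x - y))%:E)%E by rewrite lee_fin hk_ge0.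
rewrite -(integral_shift x m h0).
rewrite -(integral_normal_pdf 0 (Num.sqrt t)); apply: eq_integral => y _.
by rewrite -hk_normal// -hkN; congr (hk _ _)%:E; ring.
Qed.

(** Completing the square in y: the last factor is the density at y of a Brownian bridge from x to z
    at time s out of s + t. Its integral in y is 1, which gives the semigroup property. *)
Lemma hk_mul s t x y z : 0 < s -> 0 < t ->
  hk s (x - y) * hk t (y - z) =
  hk (s + t) (x - z) * hk (s * t / (s + t)) ((t * x + s * z) / (s + t) - y).
Proof.
move=> s0 t0; rewrite /hk.
have st0 : 0 < s + t by exact: addr_gt0.
have h0 r : 0 < r -> 0 <= 2 * pi * r by move=> r0; rewrite !mulr_ge0 ?pi_ge0// ltW.
rewrite mulrACA [RHS]mulrACA -!invfM -!sqrtrM ?h0// -!expRD.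
congr ((Num.sqrt _)^-1 * expR _).
  by field; rewrite gt_eqF.
by field; rewrite !gt_eqF.
Qed.

Lemma hk_semigroup s t x z : 0 < s -> 0 < t ->
  (\int[mu]_y (hk s (x - y) * hk t (y - z))%:E = (hk (s + t) (x - z))%:E)%E.
Proof.
move=> s0 t0.
under eq_integral do rewrite hk_mul// EFinM.
rewrite ge0_integralZl_EFin ?hk_ge0//.
- by rewrite integral_hk ?mule1// divr_gt0// ?mulr_gt0// addr_gt0.
- by move=> y _; rewrite lee_fin hk_ge0.
- by apply/measurable_EFinP; apply: measurable_hk2 => //; exact: measurable_funB.
Qed.

End heat_kernel.

(** * The heat equation with absorption *)

Ltac pos := repeat first
  [ done | assumption | apply: sqrtr_ge0 | apply: expR_ge0 | apply: powR_ge0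
  | apply: normr_ge0 | apply: sqr_ge0 | apply: hk_ge0 | apply: pi_ge0 | apply: ltW; assumption
  | apply: mulr_ge0 | apply: divr_ge0 | apply: addr_ge0 | rewrite invr_ge0
  | apply: exprn_ge0 ].

(** * Bounds on the reflected heat kernel, and integrable majorants *)

Section kernel_bounds.
Context {R : realType}.
Local Notation mu := (@lebesgue_measure R).

Lemma hk_lt (t x y : R) : x ^+ 2 <= y ^+ 2 -> hk t y <= hk t x.
Proof.
move=> xy; have [t0|t0] := leP t 0; first by rewrite !hk_le0.
rewrite ler_wpM2l ?invr_ge0 ?sqrtr_ge0// ler_expR !mulNr lerN2.
by rewrite ler_pM2r ?invr_gt0 ?mulr_gt0.
Qed.

(** Convexity: the exponential lies above its tangent at - B. *)
Lemma expR_sub_ge (A B : R) : (B - A) * expR (- B) <= expR (- A) - expR (- B).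
Proof.
have -> : expR (- A) = expR (- B) * expR (B - A) by rewrite -expRD; congr expR; ring.
rewrite -{3}[expR (- B)]mulr1 -mulrBr mulrC ler_wpM2l ?expR_ge0//.
by have := expR_ge1Dx (B - A); lra.
Qed.

(** The two exponents differ by 2 x y / t, so the tangent inequality, used from either end, bounds
    the difference whatever the signs of x and y. *)
Lemma hk_sub_bounds (t x y : R) : 0 < t ->
  (Num.sqrt (2 * pi * t))^-1 * (2 * x * y / t) * expR (- (x + y) ^+ 2 / (2 * t))
  <= hk t (x - y) - hk t (x + y) <=
  (Num.sqrt (2 * pi * t))^-1 * (2 * x * y / t) * expR (- (x - y) ^+ 2 / (2 * t)).
Proof.
move=> t0; rewrite /hk -mulrBr.
have i0 : 0 <= (Num.sqrt (2 * pi * t))^-1 by rewrite invr_ge0 sqrtr_ge0.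
have E : (x + y) ^+ 2 / (2 * t) - (x - y) ^+ 2 / (2 * t) = 2 * x * y / t.
  by field; rewrite gt_eqF.
rewrite !mulNr -!E.
set A := (x - y) ^+ 2 / _; set B := (x + y) ^+ 2 / _.
rewrite -!mulrA !ler_wpM2l//; first last.
- by rewrite expR_sub_ge.
- have := expR_sub_ge B A.
  by move=> h; rewrite -lerN2 opprB -mulNr opprB.
Qed.

Lemma sqrt_2pi_ge2 : 2 <= Num.sqrt (2 * pi) :> R.
Proof.
have {1}-> : 2 = Num.sqrt (2 ^+ 2) :> R by rewrite sqrtr_sqr ger0_norm.
by rewrite ler_wsqrtr//; have := pi_ge2 R; nra.
Qed.

Lemma sqrt_pi_inv_le (t : R) : 0 < t ->
  (Num.sqrt (2 * pi * t))^-1 <= 2^-1 * (Num.sqrt t)^-1 :> R.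
Proof.
move=> t0; rewrite sqrtrM ?mulr_ge0 ?pi_ge0// invfM ler_wpM2r ?invr_ge0 ?sqrtr_ge0//.
by rewrite lef_pV2 ?posrE ?(lt_le_trans _ sqrt_2pi_ge2) ?sqrt_2pi_ge2.
Qed.

(** For x, y >= 0 this is the kernel of Brownian motion killed at 0. The extra 1 / t compared with
    the free kernel is the gain of every reflection argument below. *)
Lemma hk_sub_le (t x y : R) : 0 < t -> 0 <= x -> 0 <= y ->
  hk t (x - y) - hk t (x + y) <= x * y / (t * Num.sqrt t).
Proof.
move=> t0 x0 y0; have /andP[_] := hk_sub_bounds x y t0.
move/le_trans; apply.
have := @sqrt_pi_inv_le t t0; set u := (_)^-1 => u_le.
have u0 : 0 <= u by rewrite invr_ge0 sqrtr_ge0.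
have : expR (- (x - y) ^+ 2 / (2 * t)) <= 1.
  by rewrite -[leRHS]expR0 ler_expR mulNr oppr_le0 divr_ge0 ?sqr_ge0// mulr_ge0// ltW.
move=> e1; apply: (@le_trans _ _ (2^-1 * (Num.sqrt t)^-1 * (2 * x * y / t) * 1)).
  apply: ler_pM => //; rewrite ?expR_ge0//.
    by pos.
  by apply: ler_wpM2r => //; pos.
rewrite le_eqVlt; apply/orP; left; apply/eqP.
by field; rewrite !gt_eqF ?sqrtr_gt0.
Qed.

(** From (1 + w / 16) e^(- w / 16) <= 1, squared, since w (1 + w) <= (16 + w)^2; whence 256. *)
Lemma mul_expR_le (w : R) : 0 <= w -> w * (1 + w) * expR (- (w / 8)) <= 256.
Proof.
move=> w0.
have E : expR (- (w / 8)) = expR (- (w / 16)) ^+ 2.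
  by rewrite expr2 -expRD; congr expR; lra.
have k : (1 + w / 16) * expR (- (w / 16)) <= 1.
  rewrite expRN ler_pdivrMr ?expR_gt0// mul1r.
  by have := expR_ge1Dx (w / 16); lra.
have e0 := expR_ge0 (- (w / 16)).
have k0 : 0 <= (1 + w / 16) * expR (- (w / 16)) by rewrite mulr_ge0//; lra.
rewrite E.
have : ((1 + w / 16) * expR (- (w / 16))) ^+ 2 <= 1 by rewrite exprn_ile1.
rewrite exprMn; have := sqr_ge0 (expR (- (w / 16))); nra.
Qed.

(** The bound does not involve t, hence survives at the singular end of the time integral, where t -
    s is small. When |y| <= x / 2 both Gaussian factors are at most e^(- x^2 / (8 t)), and with w =
    x^2 / t what remains is w^(3/2) e^(- w / 8) / x^2. *)
Lemma hk_sub_abs_le (t x y : R) : 0 < t -> 0 < x -> `|y| <= x / 2 ->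
  `|hk t (x - y) - hk t (x + y)| <= 256 * `|y| / x ^+ 2.
Proof.
move=> t0 x0 yx.
have := hk_sub_bounds x y t0 => /=.
have u_le := @sqrt_pi_inv_le t t0.
have u0 : 0 <= (Num.sqrt (2 * pi * t))^-1 by rewrite invr_ge0 sqrtr_ge0.
have st : 0 < Num.sqrt t by rewrite sqrtr_gt0.
pose B := `|y| * (x / (t * Num.sqrt t)) * expR (- (x ^+ 2 / (8 * t))).
have eb z : (x / 2) ^+ 2 <= z ^+ 2 -> expR (- z ^+ 2 / (2 * t)) <= expR (- (x ^+ 2 / (8 * t))).
  move=> xz; rewrite ler_expR mulNr lerN2.
  have -> : x ^+ 2 / (8 * t) = (x / 2) ^+ 2 / (2 * t) by field; rewrite gt_eqF.
  by rewrite ler_pM2r ?invr_gt0 ?mulr_gt0.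
have cb : `|(Num.sqrt (2 * pi * t))^-1 * (2 * x * y / t)| <= `|y| * (x / (t * Num.sqrt t)).
  rewrite normrM (ger0_norm u0).
  have -> : `|2 * x * y / t| = `|y| * (2 * x / t).
    have -> : 2 * x * y / t = y * (2 * x / t) by ring.
    by rewrite normrM (@ger0_norm _ (2 * x / t))// divr_ge0 ?mulr_ge0 ?ltW.
  apply: (@le_trans _ _ (2^-1 * (Num.sqrt t)^-1 * (`|y| * (2 * x / t)))).
    by apply: ler_wpM2r => //; pos.
  by rewrite le_eqVlt; apply/orP; left; apply/eqP; field; rewrite !gt_eqF.
have ceb z : (x / 2) ^+ 2 <= z ^+ 2 ->
   `|(Num.sqrt (2 * pi * t))^-1 * (2 * x * y / t) * expR (- z ^+ 2 / (2 * t))| <= B.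
  move=> xz; rewrite normrM (ger0_norm (expR_ge0 _)).
  by apply: ler_pM => //; rewrite ?expR_ge0// eb.
move: yx; rewrite ler_norml => /andP[y1 y2].
have c1 := ceb (x - y); have c2 := ceb (x + y).
have {}c1 := c1 ltac:(nra); have {}c2 := c2 ltac:(nra).
move=> /andP[q1 q2].
apply: (@le_trans _ _ B).
  rewrite ler_norml; move: c1 c2; rewrite !ler_norml => /andP[_ c1] /andP[c2 _].
  by rewrite (le_trans c2 q1) (le_trans q2 c1).
rewrite /B -mulrA [256 * `|y|]mulrC -[leRHS]mulrA; apply: ler_wpM2l => //.
pose w := x ^+ 2 / t.
have w0 : 0 <= w by rewrite divr_ge0 ?sqr_ge0 ?ltW.
have sw : Num.sqrt w = x / Num.sqrt t.
  by rewrite /w sqrtrM ?sqr_ge0// sqrtr_sqr gtr0_norm// sqrtrV// ltW.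
have := mul_expR_le w0.
have -> : - (w / 8) = - (x ^+ 2 / (8 * t)) by rewrite /w; field; rewrite gt_eqF.
have e0 := expR_ge0 (- (x ^+ 2 / (8 * t))).
have swle : Num.sqrt w <= 1 + w.
  have := sqr_sqrtr w0; have := sqrtr_ge0 w; nra.
have -> : x / (t * Num.sqrt t) = w * Num.sqrt w / x ^+ 2.
  by rewrite sw /w; field; rewrite !gt_eqF.
move=> h; rewrite mulrAC ler_pM2r ?invr_gt0 ?exprn_gt0//.
apply: le_trans h; rewrite ler_wpM2r// ler_wpM2l//.
Qed.

Lemma integral_expR_abs (c : R) : 0 < c ->
  (\int[mu]_y (expR (- (c * `|y|)))%:E < +oo)%E.
Proof.
move=> c0.
pose f (y : R) : \bar R := (exponential_pdf c y)%:E.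
have mf : measurable_fun setT f.
  by apply/measurable_EFinP; exact: measurable_exponential_pdf.
have f0 y : (0 <= f y)%E by rewrite lee_fin exponential_pdf_ge0// ltW.
have mfN : measurable_fun setT (fun y : R => f (- y)).
  by apply/measurable_EFinP; apply: (measurableT_comp (measurable_exponential_pdf c)).
apply: (@le_lt_trans _ _ (\int[mu]_y ((c^-1)%:E * (f y + f (- y)%R)))%E).
  apply: ge0_le_integral => //.
  - apply/measurable_EFinP; apply: measurableT_comp => //.
    by apply: measurableT_comp => //; apply: measurable_funM => //; exact: measurableT_comp.
  - by apply: measurable_funeM; exact: emeasurable_funD.
  move=> y _; rewrite /f -EFinD -EFinM lee_fin.
  rewrite [c^-1 * _]mulrC ler_pdivlMr// [_ * c]mulrC.
  have p0 z := exponential_pdf_ge0 (ltW c0) z.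
  have [y0|y0] := leP 0 y.
    by rewrite ger0_norm// (exponential_pdfE _ y0) -mulNr lerDl.
  rewrite ltr0_norm// (@exponential_pdfE _ _ (- y)); last by rewrite oppr_ge0 ltW.
  by rewrite mulNr lerDr.
rewrite ge0_integralZl_EFin//; last 3 first.
- by move=> y _; rewrite adde_ge0.
- exact: emeasurable_funD.
- by rewrite invr_ge0 ltW.
rewrite ge0_integralD//.
by rewrite (integral_reflect mf f0) integral_exponential_pdf// -EFinD -EFinM ltry.
Qed.

Lemma integral_indic_oo (t : R) : 0 <= t ->
  (\int[mu]_s (\1_(`]0, t[ : set R) s)%:E = t%:E)%E.
Proof.
move=> t0; rewrite integral_indic//= setIT lebesgue_measure_itv/= lte_fin.
by case: ltP => [|t0']; rewrite -?EFinB ?subr0//; congr EFin; lra.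
Qed.

(** Time profile of the majorant of the absorption. The exponent 9/8 lies strictly between 1, needed
    for integrability, and 5/4, the decay rate of v; the gap to 5/4 pays for the decay in space. *)
Definition theta (s : R) : R :=
  if s <= 0 then 0 else if s <= 1 then 1 else s `^ (- (9 / 8)).

Lemma theta_ge0 s : 0 <= theta s.
Proof. by rewrite /theta; do 2 case: ifP => // _; exact: powR_ge0. Qed.

Lemma thetaE (s : R) : 1 < s -> theta s = expR (- (9 / 8 * ln s)).
Proof.
move=> s1; have s0 : 0 < s by exact: lt_trans s1.
by rewrite /theta leNgt s0/= leNgt s1/= /powR gt_eqF// mulNr.
Qed.

Lemma theta1 (s : R) : 0 < s -> s <= 1 -> theta s = 1.
Proof. by move=> s0 s1; rewrite /theta leNgt s0/= s1. Qed.

Lemma measurable_theta : measurable_fun setT theta.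
Proof.
apply: measurable_fun_ifT => //; first exact: measurable_fun_ler.
apply: measurable_fun_ifT => //; first exact: measurable_fun_ler.
Qed.

Lemma integral_theta : (\int[mu]_s (theta s)%:E < +oo)%E.
Proof.
pose f (s : R) := s `^ (- (9 / 8)).
pose F (s : R) := - 8 * s `^ (- (1 / 8)).
have f0 s : 0 <= f s by exact: powR_ge0.
have If : (\int[mu]_(s in `[1%R, +oo[) (f s)%:E = 0%:E - (F 1)%:E)%E.
  have dF (x : R) : 0 < x -> is_derive x 1 F (f x).
    move=> x0; have h : is_derive x 1 (fun z : R => z `^ (- (1 / 8))) (- (1 / 8) * f x).
      apply: is_derive_eq (is_derive1_powR _ x0) _.
      by rewrite /f; congr (_ * _ `^ _); lra.
    have h2 := @is_deriveM R R^o (cst (-8)) (fun z : R => z `^ (- (1 / 8))) x 1 _ _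
      (is_derive_cst _ _ _) h.
    apply: is_derive_eq h2 _.
    rewrite scaler0 addr0 /GRing.scale/= mulrA.
    by rewrite (_ : - 8 * _ = 1) ?mul1r//; lra.
  apply: (@ge0_continuous_FTC2y R f F 1 0); first by move=> *; exact: f0.
  - apply: continuous_in_subspaceT => x; rewrite inE/= in_itv/= andbT => x1.
    have [dx _] := @is_derive1_powR R (- (9 / 8)) x (lt_le_trans ltr01 x1).
    by apply: differentiable_continuous; apply/derivable1_diffP.
  - rewrite -(mulr0 (- 8)); apply: cvgMl_tmp.
    apply/cvgrPdist_le => e e0; near=> s.
    have s0 : 0 < s by near: s; exact: nbhs_pinfty_gt.
    rewrite sub0r normrN ger0_norm ?powR_ge0// powRN invf_ple ?posrE ?powR_gt0//.
    have se : (e^-1) ^+ 8 <= s by near: s; apply: nbhs_pinfty_ge; rewrite num_real.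
    apply: (@le_trans _ _ (((e^-1) ^+ 8) `^ (1 / 8))).
      have ei : 0 <= e^-1 by rewrite invr_ge0 ltW.
      by rewrite -powR_mulrn// -powRrM mulrC divfK// powRr1.
    by apply: ge0_ler_powR; rewrite ?nnegrE; [lra|pos|pos|].
  - by move=> x x1; have [] := dF x (lt_trans ltr01 x1).
  - have [dF1 _] := dF 1 ltr01; apply: cvg_at_right_filter.
    by apply: differentiable_continuous; apply/derivable1_diffP.
  - by move=> x; rewrite in_itv/= andbT => x1; rewrite derive1E; apply: derive_val; apply: dF; apply: lt_trans x1.
have mf : measurable_fun setT f by exact: measurable_powR.
have mEf : measurable_fun setT (EFin \o f) by exact/measurable_EFinP.
have mD : measurable (`[1%R, +oo[ : set R) by [].
have mEp : measurable_fun setT ((EFin \o f) \_ `[1%R, +oo[).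
  exact: (measurable_restrictT _ mD).1 (measurable_funTS mEf).
apply: (@le_lt_trans _ _ (\int[mu]_s ((\1_(`[0, 1] : set R) s)%:E + ((EFin \o f) \_ `[1%R, +oo[) s))%E).
  apply: ge0_le_integral => //.
  - by move=> s _; rewrite lee_fin theta_ge0.
  - by apply/measurable_EFinP; exact: measurable_theta.
  - apply: emeasurable_funD; first by apply/measurable_EFinP; exact: measurable_indic.
    by exact: mEp.
  move=> s _; rewrite patchE /theta indicE !mem_setE !in_itv/= andbT.
  have [s0|s0] := leP s 0.
    by apply: adde_ge0 => //; case: ifP => // _; rewrite lee_fin.
  rewrite (ltW s0)/=; have [s1|s1] := leP s 1.
    by rewrite leeDl//; case: ifP => // _; rewrite lee_fin.
  by rewrite (ltW s1) add0e.
rewrite ge0_integralD//; last 2 first.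
- by apply/measurable_EFinP; exact: measurable_indic.
- by move=> s _; rewrite patchE; case: ifP => // _; rewrite lee_fin.
rewrite integral_indic//= setIT -integral_mkcond If lebesgue_measure_itv/=.
by rewrite lte_fin ltr01 -!EFinB -EFinD ltry.
Unshelve. all: by end_near.
Qed.


(** Majorant, up to a constant, of |y| kap(s, y): the spatial rate 1/16 of kap is halved to absorb
    the factor |y|. *)
Definition dom (p : R * R) : R := expR (- (`|p.2| / 32)) * theta p.1.

Lemma dom_ge0 p : 0 <= dom p.
Proof. by rewrite mulr_ge0 ?expR_ge0 ?theta_ge0. Qed.

Lemma measurable_dom : measurable_fun setT dom.
Proof.
apply: measurable_funM; last exact: (measurableT_comp measurable_theta).
apply: measurableT_comp => //; apply: measurableT_comp => //.
by apply: measurable_funM => //; apply: measurableT_comp.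
Qed.

Lemma integrable_dom : (mu \x mu)%E.-integrable setT (EFin \o dom).
Proof.
apply/integrable12ltyP; first by apply/measurable_EFinP; exact: measurable_dom.
have E s : (\int[mu]_y `|(EFin \o dom) (s, y)| =
    (theta s)%:E * \int[mu]_y (expR (- (32^-1 * `|y|)))%:E)%E.
  rewrite -ge0_integralZl_EFin//.
  - by apply: eq_integral => y _ /=; rewrite ger0_norm ?dom_ge0// /dom/= EFinM muleC [32^-1 * _]mulrC.
  - apply/measurable_EFinP; apply: measurableT_comp => //.
    by apply: measurableT_comp => //; apply: measurable_funM => //; exact: measurableT_comp.
  - exact: theta_ge0.
under eq_integral do rewrite E.
rewrite ge0_integralZr//.
- rewrite lte_mul_pinfty ?integral_theta//.
  + by apply: integral_ge0 => s _; rewrite lee_fin theta_ge0.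
  + rewrite ge0_fin_numE ?integral_theta//.
    by apply: integral_ge0 => s _; rewrite lee_fin theta_ge0.
  + by apply: integral_expR_abs; rewrite invr_gt0.
- by apply/measurable_EFinP; exact: measurable_theta.
- by move=> s _; rewrite lee_fin theta_ge0.
- by apply: integral_ge0 => y _; rewrite lee_fin expR_ge0.
Qed.

End kernel_bounds.

(** * Decay of solutions of the heat equation with absorption *)

Section absorbed_heat.
Context {R : realType}.
Local Notation mu := (@lebesgue_measure R).

Local Notation r2 := (Num.sqrt 2 : R).

Lemma r2_bounds : 5 / 4 <= r2 <= 3 / 2.
Proof.
have h : r2 ^+ 2 = 2 by rewrite sqr_sqrtr.
have := sqrtr_ge0 (2 : R); move: h; set x := Num.sqrt _ => h x0.
by apply/andP; split; nra.
Qed.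

(* In the coordinates moving at speed sqrt 2, after multiplication by
   e^(sqrt 2 z), the FKPP equation is the heat equation with absorption [kap]. *)
Record absorbed_heat (L C : R) (v0 : R -> R) (v kap : R -> R -> R) : Prop := {
  ah_mv0 : measurable_fun setT v0;
  ah_v0_ge0 : forall y, 0 <= v0 y;
  ah_v0_le : forall y, v0 y <= expR (r2 * y);
  ah_v0_supp : forall y, L < y -> v0 y = 0;
  ah_mkap : measurable_fun setT (fun p : R * R => kap p.1 p.2);
  ah_kap_ge0 : forall s y, 0 <= kap s y;
  ah_kap0 : forall s y, s <= 0 -> kap s y = 0;
  ah_kap_v : forall s y, 0 < s -> kap s y <= v s y;
  ah_v_le : forall s y, 0 < s -> v s y <= expR (r2 * y);
  ah_kap_sq : forall s y, 0 < s -> kap s y <= C * expR (- (r2 * y)) * v s y ^+ 2;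
  ah_duhamel : forall t z, 0 < t ->
    ((v t z)%:E + \int[mu]_s \int[mu]_y (hk (t - s) (z - y) * kap s y)%:E =
     \int[mu]_y (hk t (z - y) * v0 y)%:E)%E
}.

Variables (L C : R).
Hypothesis C0 : 0 <= C.

Section one_solution.
Variables (v0 : R -> R) (v kap : R -> R -> R).
Hypothesis H : absorbed_heat L C v0 v kap.

Lemma ah_v_ge0 s y : 0 < s -> 0 <= v s y.
Proof. by move=> s0; rewrite (le_trans (ah_kap_ge0 H s y))// (ah_kap_v H). Qed.

Lemma measurable_hk_kap t z :
  measurable_fun setT (fun p : R * R => (hk (t - p.1) (z - p.2) * kap p.1 p.2)%:E).
Proof.
apply/measurable_EFinP; apply: measurable_funM; last exact: ah_mkap H.
by apply: measurable_hk2; exact: measurable_funB.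
Qed.

Lemma measurable_hk_kap2 t z s :
  measurable_fun setT (fun y : R => (hk (t - s) (z - y) * kap s y)%:E).
Proof.
have := measurableT_comp (measurable_hk_kap t z) (@pair1_measurable _ _ R R s).
by apply.
Qed.

Lemma measurable_hk_kap1 t z :
  measurable_fun setT (fun s : R => \int[mu]_y (hk (t - s) (z - y) * kap s y)%:E)%E.
Proof.
apply: (measurable_fun_fubini_tonelli_F (m2 := mu) _ (measurable_hk_kap t z)).
by move=> p; rewrite lee_fin mulr_ge0 ?hk_ge0 ?(ah_kap_ge0 H).
Qed.

Lemma measurable_hk_v0 t z : measurable_fun setT (fun y : R => (hk t (z - y) * v0 y)%:E).
Proof.
apply/measurable_EFinP; apply: measurable_funM; last exact: ah_mv0 H.
by apply: measurable_hk2 => //; exact: measurable_funB.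
Qed.

Lemma hk_kap_ge0 t z s y : (0 <= (hk (t - s) (z - y) * kap s y)%:E)%E.
Proof. by rewrite lee_fin mulr_ge0 ?hk_ge0 ?(ah_kap_ge0 H). Qed.

Lemma hk_v0_ge0 t z y : (0 <= (hk t (z - y) * v0 y)%:E)%E.
Proof. by rewrite lee_fin mulr_ge0 ?hk_ge0 ?(ah_v0_ge0 H). Qed.

Lemma ah_v_le_heat t z : 0 < t ->
  ((v t z)%:E <= \int[mu]_y (hk t (z - y) * v0 y)%:E)%E.
Proof.
move=> t0; rewrite -(ah_duhamel H z t0) leeDl// integral_ge0// => s _.
by apply: integral_ge0 => y _; exact: hk_kap_ge0.
Qed.

Lemma ah_v_le_sup M t z : (forall y, v0 y <= M) -> 0 < t -> v t z <= M.
Proof.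
move=> v0M t0; have M0 : 0 <= M by apply: le_trans (v0M 0); exact: ah_v0_ge0 H _.
rewrite -lee_fin; apply: (le_trans (ah_v_le_heat z t0)).
apply: (@le_trans _ _ (\int[mu]_y (M%:E * (hk t (z - y))%:E))%E).
  apply: ge0_le_integral => //.
  - by move=> y _; exact: hk_v0_ge0.
  - exact: measurable_hk_v0.
  - apply: measurable_funeM; apply/measurable_EFinP.
    by apply: measurable_hk2 => //; exact: measurable_funB.
  - by move=> y _; rewrite -EFinM lee_fin mulrC ler_wpM2r ?hk_ge0// v0M.
rewrite ge0_integralZl_EFin// ?integral_hk ?mule1//.
- by move=> y _; rewrite lee_fin hk_ge0.
- by apply/measurable_EFinP; apply: measurable_hk2 => //; exact: measurable_funB.
Qed.

Lemma v0_le_L y : v0 y <= expR (3 / 2 * `|L|).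
Proof.
have [Ly|yL] := ltP L y; first by rewrite (ah_v0_supp H Ly) expR_ge0.
apply: (le_trans (ah_v0_le H y)); rewrite ler_expR.
have /andP[h1 h2] := r2_bounds; have := ler_norm L; have := normr_ge0 L.
by have [y0|y0] := leP 0 y; nra.
Qed.

(** At - oo the bound e^(sqrt 2 y) beats the linear factor, at + oo the support does. The constant
    involves L only, so that the estimates built on it are uniform over all data with the same
    cutoff. *)
Lemma v0_decay y : (1 + `|y|) * v0 y <= expR (3 * `|L|) * expR (- (4^-1 * `|y|)).
Proof.
have [Ly|yL] := ltP L y; first by rewrite (ah_v0_supp H Ly) mulr0 mulr_ge0 ?expR_ge0.
have h1 := expR_ge1Dx `|y|.
apply: (le_trans (ler_pM _ _ h1 (ah_v0_le H y))); rewrite ?(ah_v0_ge0 H) ?addr_ge0//.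
rewrite -!expRD ler_expR.
have /andP[h3 h2] := r2_bounds; have := ler_norm L; have := normr_ge0 L.
have [y0|y0] := leP 0 y; first by rewrite (ger0_norm y0); nra.
by rewrite (ltr0_norm y0); nra.
Qed.

End one_solution.

Definition M1 : R := expR (3 * `|L|) * fine (\int[mu]_y (expR (- (4^-1 * `|y|)))%:E)%E.

Lemma M1_ge0 : 0 <= M1.
Proof. by rewrite mulr_ge0 ?expR_ge0 ?fine_ge0// integral_ge0// => y _; rewrite lee_fin expR_ge0. Qed.

Section bound.
Variables (v0 : R -> R) (v kap : R -> R -> R).
Hypothesis H : absorbed_heat L C v0 v kap.

Lemma measurable_moment : measurable_fun setT (fun y : R => ((1 + `|y|) * v0 y)%:E).
Proof.
apply/measurable_EFinP; apply: measurable_funM; last exact: ah_mv0 H.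
by apply: measurable_funD => //; exact: measurableT_comp.
Qed.

Lemma moment_ge0 y : (0 <= ((1 + `|y|) * v0 y)%:E)%E.
Proof. by rewrite lee_fin mulr_ge0 ?(ah_v0_ge0 H) ?addr_ge0. Qed.

Lemma moment_v0 : (\int[mu]_y ((1 + `|y|) * v0 y)%:E <= M1%:E)%E.
Proof.
have m : measurable_fun setT (fun y : R => (expR (- (4^-1 * `|y|)))%:E).
  apply/measurable_EFinP; apply: measurableT_comp => //.
  by apply: measurableT_comp => //; apply: measurable_funM => //; exact: measurableT_comp.
apply: (@le_trans _ _ (\int[mu]_y ((expR (3 * `|L|))%:E * (expR (- (4^-1 * `|y|)))%:E))%E).
  apply: ge0_le_integral => //.
  - by move=> y _; exact: moment_ge0.
  - exact: measurable_moment.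
  - exact: measurable_funeM.
  - by move=> y _; rewrite -EFinM lee_fin (v0_decay H).
rewrite ge0_integralZl_EFin ?expR_ge0// /M1 EFinM fineK//.
by rewrite ge0_fin_numE ?integral_expR_abs ?invr_gt0// integral_ge0.
Qed.

(* Reflection at -K: the mass escaping below -K is at most t e^(-sqrt 2 K),
   while the surviving heat flow is of order (z + K) K / t^(3/2). *)
Lemma ah_reflection_bound t z K : 0 < t -> 0 <= K -> - K <= z ->
  v t z <= (1 + t) * expR (- (r2 * K)) + (z + K) * (1 + K) * M1 / (t * Num.sqrt t).
Proof.
move=> t0 K0 zK.
have st : 0 < Num.sqrt t by rewrite sqrtr_gt0.
pose z' := - (2 * K) - z.
have r20 : 0 < r2 by rewrite sqrtr_gt0.
pose B := (z + K) * (1 + K) / (t * Num.sqrt t).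
have B0 : 0 <= B by apply: mulr_ge0; [apply: mulr_ge0; lra|rewrite invr_ge0; pos].
pose e := expR (- (r2 * K)).
have e0 : 0 <= e by exact: expR_ge0.
(* For y >= - K the kernels at z and at its mirror image z' differ by the killed kernel; for y < - K
   the mirror image is the closer of the two and the difference is nonpositive. *)
have Pb : (\int[mu]_y (hk t (z - y) * v0 y)%:E <=
    \int[mu]_y (hk t (z' - y) * v0 y)%:E + (B * M1)%:E)%E.
  apply: (@le_trans _ _ (\int[mu]_y ((hk t (z' - y) * v0 y)%:E +
      B%:E * ((1 + `|y|) * v0 y)%:E))%E).
    apply: ge0_le_integral => //.
    - by move=> y _; exact: hk_v0_ge0 H _ _ _.
    - exact: measurable_hk_v0 H _ _.
    - apply: emeasurable_funD; first exact: measurable_hk_v0 H _ _.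
      by apply: measurable_funeM; exact: measurable_moment.
    - move=> y _; rewrite -EFinM -EFinD lee_fin mulrA -mulrDl ler_wpM2r ?(ah_v0_ge0 H)//.
      have [yK|yK] := leP (- K) y.
        have zK0 : 0 <= z + K by lra.
        have yK0 : 0 <= y + K by lra.
        have := hk_sub_le t0 zK0 yK0.
        have -> : z + K - (y + K) = z - y by lra.
        rewrite -(hkN t (_ + _ + _)) (_ : - (_ + _) = z' - y) ?/z'; last by lra.
        rewrite lerBlDl => /le_trans; apply; rewrite lerD2l.
        have -> : B * (1 + `|y|) = (z + K) / (t * Num.sqrt t) * ((1 + K) * (1 + `|y|)).
          by rewrite /B; ring.
        rewrite mulrAC ler_wpM2l//; first by rewrite mulr_ge0// invr_ge0; pos.
        by have := ler_norm y; have := normr_ge0 y; nra.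
      rewrite (@le_trans _ _ (hk t (z' - y)))//; first by apply: hk_lt; rewrite /z'; nra.
      by rewrite lerDl mulr_ge0// addr_ge0.
  rewrite ge0_integralD//; last 4 first.
  - by move=> y _; exact: hk_v0_ge0 H _ _ _.
  - exact: measurable_hk_v0 H _ _.
  - by move=> y _; rewrite mule_ge0 ?moment_ge0.
  - by apply: measurable_funeM; exact: measurable_moment.
  rewrite leeD2l// ge0_integralZl_EFin//.
  - by rewrite [(B * M1)%:E]EFinM; apply: lee_wpmul2l; rewrite ?lee_fin// moment_v0.
  - by move=> y _; exact: moment_ge0.
  - exact: measurable_moment.
(* For the absorption the comparison goes the other way: z' sees more of it only through y < - K,
   where kap <= e^(- sqrt 2 K); the kernel has mass 1 and times range over ]0, t[. *)
have Ib : (\int[mu]_s \int[mu]_y (hk (t - s) (z' - y) * kap s y)%:E <=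
    \int[mu]_s \int[mu]_y (hk (t - s) (z - y) * kap s y)%:E + (t * e)%:E)%E.
  have I0 x s : (0 <= \int[mu]_y (hk (t - s) (x - y) * kap s y)%:E)%E.
    by apply: integral_ge0 => y _; exact: hk_kap_ge0 H _ _ _ _.
  apply: (@le_trans _ _ (\int[mu]_s (\int[mu]_y (hk (t - s) (z - y) * kap s y)%:E +
     (e * \1_(`]0, t[ : set R) s)%:E))%E).
    apply: ge0_le_integral => //.
    - exact: measurable_hk_kap1 H _ _.
    - apply: emeasurable_funD; first exact: measurable_hk_kap1 H _ _.
      by apply/measurable_EFinP; apply: measurable_funM.
    - move=> s _.
      have [s0|s0] := leP s 0.
        under eq_integral do rewrite (ah_kap0 H) // mulr0.
        by rewrite integral0 adde_ge0// lee_fin mulr_ge0.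
      have [st'|st'] := leP t s.
        under eq_integral do rewrite hk_le0 ?subr_le0// mul0r.
        by rewrite integral0 adde_ge0// lee_fin mulr_ge0.
      have -> : (\1_(`]0, t[ : set R) : R -> R) s = 1.
        by rewrite indicE mem_set//= in_itv/= s0.
      rewrite mulr1.
      have ts : 0 < t - s by rewrite subr_gt0.
      apply: (@le_trans _ _ (\int[mu]_y ((hk (t - s) (z - y) * kap s y)%:E +
          e%:E * (hk (t - s) (z' - y))%:E))%E).
        apply: ge0_le_integral => //.
        + by move=> y _; exact: hk_kap_ge0 H _ _ _ _.
        + exact: measurable_hk_kap2 H _ _ _.
        + apply: emeasurable_funD; first exact: measurable_hk_kap2 H _ _ _.
          apply: measurable_funeM; apply/measurable_EFinP.
          by apply: measurable_hk2 => //; exact: measurable_funB.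
        + move=> y _; rewrite -EFinM -EFinD lee_fin.
          have [yK|yK] := leP (- K) y.
            apply: (@le_trans _ _ (hk (t - s) (z - y) * kap s y)).
              rewrite ler_wpM2r ?(ah_kap_ge0 H)//.
              by apply: hk_lt; rewrite /z'; nra.
            by rewrite lerDl mulr_ge0 ?hk_ge0.
          apply: (@le_trans _ _ (e * hk (t - s) (z' - y))).
            rewrite mulrC ler_wpM2r ?hk_ge0//.
            apply: (le_trans (ah_kap_v H y s0)); apply: (le_trans (ah_v_le H y s0)).
            by rewrite ler_expR; nra.
          by rewrite lerDr mulr_ge0 ?hk_ge0 ?(ah_kap_ge0 H).
      rewrite ge0_integralD//; last 4 first.
      + by move=> y _; exact: hk_kap_ge0 H _ _ _ _.
      + exact: measurable_hk_kap2 H _ _ _.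
      + by move=> y _; rewrite mule_ge0// lee_fin hk_ge0.
      + apply: measurable_funeM; apply/measurable_EFinP.
        by apply: measurable_hk2 => //; exact: measurable_funB.
      rewrite leeD2l// ge0_integralZl_EFin ?integral_hk ?mule1//.
      + by move=> y _; rewrite lee_fin hk_ge0.
      + apply/measurable_EFinP.
        by apply: measurable_hk2 => //; exact: measurable_funB.
  rewrite ge0_integralD//; last 3 first.
  - exact: measurable_hk_kap1 H _ _.
  - by move=> s _; rewrite lee_fin mulr_ge0.
  - by apply/measurable_EFinP; apply: measurable_funM.
  rewrite leeD2l//.
  under eq_integral do rewrite EFinM.
  rewrite ge0_integralZl_EFin//; last by apply/measurable_EFinP; exact: measurable_indic.
  by rewrite (integral_indic_oo (ltW t0)) -EFinM mulrC lexx.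
have vz' : v t z' <= e.
  by apply: (le_trans (ah_v_le H z' t0)); rewrite ler_expR /z'; nra.
have := ah_duhamel H z t0; have := ah_duhamel H z' t0.
move: Pb Ib.
set Pz := (\int[mu]_s _)%E; set Pz' := (\int[mu]_y _)%E.
set Iz' := (\int[mu]_s _)%E; set Iz := (\int[mu]_y _)%E.
move=> Pb Ib Ez' Ez.
have I0 : (0 <= Iz)%E.
  apply: integral_ge0 => s _; apply: integral_ge0 => y _; exact: hk_kap_ge0 H _ _ _ _.
(* Finite because the heat flow of a bounded datum is; this allows the cancellation, which takes
   place in the extended reals. *)
have Ifin : Iz \is a fin_num.
  rewrite ge0_fin_numE//; apply: (@le_lt_trans _ _ Pz).
    by rewrite -Ez leeDr// lee_fin (ah_v_ge0 H).
  apply: (@le_lt_trans _ _ (\int[mu]_y ((expR (3 / 2 * `|L|))%:E * (hk t (z - y))%:E))%E).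
    apply: ge0_le_integral => //.
    - by move=> y _; exact: hk_v0_ge0 H _ _ _.
    - exact: measurable_hk_v0 H _ _.
    - apply: measurable_funeM; apply/measurable_EFinP.
      by apply: measurable_hk2 => //; exact: measurable_funB.
    - by move=> y _; rewrite -EFinM lee_fin mulrC ler_wpM2r ?hk_ge0// (v0_le_L H).
  rewrite ge0_integralZl_EFin// ?integral_hk ?mule1 ?ltry//.
  - by move=> y _; rewrite lee_fin hk_ge0.
  - by apply/measurable_EFinP; apply: measurable_hk2 => //; exact: measurable_funB.
suff : ((v t z)%:E + Iz <= ((1 + t) * e + B * M1)%:E + Iz)%E.
  rewrite leeD2rE// lee_fin /B => /le_trans; apply.
  by rewrite lerD2l le_eqVlt; apply/orP; left; apply/eqP; ring.
rewrite Ez; apply: (le_trans Pb); rewrite -Ez' [leRHS]addeC EFinD addeA leeD2r//.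
apply: (@le_trans _ _ (e%:E + (Iz + (t * e)%:E))%E); first by apply: leeD.
by rewrite addeCA leeD2l// -EFinD lee_fin mulrDl mul1r.
Qed.

Lemma v_le_L s y : 0 < s -> v s y <= expR (3 / 2 * `|L|).
Proof. by apply: ah_v_le_sup H _ _ _ _ => z; exact: v0_le_L H _. Qed.

(** The 33 comes from 1 + 4 l <= 33 e^(l / 8), which absorbs the logarithms of the reflection level;
    the first 2 comes from (1 + s) s^(-4) <= 2 s^(-3). *)
Definition K2 : R := 2 + 33 ^+ 2 * M1.

Lemma K2_ge2 : 2 <= K2.
Proof. by rewrite lerDl mulr_ge0// M1_ge0. Qed.

(** Reflection at K = 4 ln s: deep enough for the escaping mass (1 + s) e^(- sqrt 2 K) to be
    negligible, shallow enough for the surviving term to be s^(-3/2) up to logarithms, absorbed by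
    lowering the exponent to 5/4. Left of - K the bound e^(sqrt 2 z) is already small enough. *)
Lemma ah_bound s z : 1 <= s ->
  v s z <= K2 * (1 + Num.max z 0) * expR (- (5 / 4 * ln s)).
Proof.
move=> s1; have s0 : 0 < s by exact: lt_le_trans s1.
have := M1_ge0; have /andP[r21 r22] := r2_bounds; rewrite /K2.
set l := ln s; set M := M1 => M0.
have l0 : 0 <= l by exact: ln_ge0.
have sE : s = expR l by rewrite lnK ?posrE.
have sqE : Num.sqrt s = expR (l / 2).
  by rewrite -powR12_sqrt ?ltW// /powR gt_eqF// -/l mulrC.
pose z1 := Num.max z 0.
have z10 : 0 <= z1 by rewrite le_max lexx orbT.
have zz1 : z <= z1 by rewrite le_max lexx.
rewrite -/z1; have e0 := expR_ge0 (- (5 / 4 * l)).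
have K0 : 0 <= 4 * l by rewrite mulr_ge0.
have eK : expR (- (r2 * (4 * l))) <= expR (- (4 * l)) by rewrite ler_expR; nra.
have [zK|zK] := leP (- (4 * l)) z.
  apply: (le_trans (ah_reflection_bound s0 K0 zK)).
  apply: (@le_trans _ _ (2 * expR (- (5 / 4 * l)) +
     (1 + z1) * (33 ^+ 2 * M) * expR (- (5 / 4 * l)))); last first.
    by set E := expR _ in e0 *; have := mulr_ge0 e0 z10; nra.
  apply: lerD.
    apply: (@le_trans _ _ ((2 * s) * expR (- (4 * l)))).
      by apply: ler_pM => //; lra.
    by rewrite sE -mulrA -expRD ler_wpM2l// ler_expR; lra.
  have -> : (s * Num.sqrt s)^-1 = expR (- (5 / 4 * l)) / (expR (l / 8) * expR (l / 8)).
    by rewrite sqE {1}sE -!expRD -!expRN -expRD; congr expR; lra.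
  rewrite mulrA -[leRHS]mulrA [33 ^+ 2 * M * _]mulrAC.
  have E1 : 1 + 4 * l <= 33 * expR (l / 8).
    by have := expR_ge1Dx (l / 8); lra.
  have E2 : 0 < expR (l / 8) by exact: expR_gt0.
  rewrite ler_pdivrMr ?mulr_gt0//.
  have h : (z + 4 * l) * (1 + 4 * l) <= (1 + z1) * (33 ^+ 2 * (expR (l / 8) * expR (l / 8))).
    apply: (@le_trans _ _ ((1 + z1) * ((1 + 4 * l) * (1 + 4 * l)))); first by nra.
    by rewrite ler_wpM2l ?addr_ge0//; nra.
  have := ler_wpM2r M0 h; move=> /(ler_wpM2r e0) /le_trans; apply.
  by rewrite le_eqVlt; apply/orP; left; apply/eqP; ring.
apply: (le_trans (ah_v_le H z s0)).
apply: (@le_trans _ _ (1 * 1 * expR (- (5 / 4 * l)))).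
  by rewrite !mul1r ler_expR; nra.
by rewrite ler_wpM2r// ler_pM//; nra.
Qed.

Lemma onesub_le (y : R) : 0 <= y -> 1 + y <= 2 * expR (y / 2).
Proof. by move=> y0; have := expR_ge1Dx (y / 2); lra. Qed.

Definition K3 : R := expR (3 / 2 * `|L|) + 2 * K2.

(** In kap <= C e^(- sqrt 2 y) v^2 the weight is split as sqrt 2 >= 3/4 + 1/2 between the two
    factors v. This is the factor that carries the decay, in space and in time. *)
Lemma ah_v_decay s y : 0 < s -> 0 <= y ->
  expR (- (3 / 4 * y)) * v s y <= K3 * (expR (- (`|y| / 16)) * theta s).
Proof.
move=> s0 y0; have /andP[r21 r22] := r2_bounds; have K22 := K2_ge2.
have v0s := ah_v_ge0 H y s0; rewrite (ger0_norm y0) /K3.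
have L0 := expR_ge0 (3 / 2 * `|L|).
have [s1|s1] := leP s 1.
  rewrite (theta1 s0 s1) mulr1 mulrC.
  apply: ler_pM => //.
    by apply: (le_trans (v_le_L y s0)); rewrite lerDl; lra.
  by rewrite ler_expR; nra.
rewrite (thetaE s1); have l0 : 0 <= ln s by exact/ln_ge0/ltW.
apply: (@le_trans _ _ (expR (- (3 / 4 * y)) *
   (K2 * (2 * expR (y / 2)) * expR (- (5 / 4 * ln s))))).
  rewrite ler_wpM2l//; apply: (le_trans (ah_bound y (ltW s1))).
  rewrite (max_idPl y0) ler_wpM2r// ler_wpM2l ?onesub_le//; lra.
have -> : expR (- (3 / 4 * y)) * (K2 * (2 * expR (y / 2)) * expR (- (5 / 4 * ln s)))
  = 2 * K2 * expR (y / 2 - 3 / 4 * y - 5 / 4 * ln s).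
  by rewrite !expRD; ring.
rewrite -expRD; apply: ler_pM => //; [lra|lra|].
by rewrite ler_expR; nra.
Qed.

(** The other factor v, with the remaining weight: here boundedness is enough. *)
Lemma ah_v_growth s y : 0 < s -> 0 <= y -> expR (- (1 / 2 * y)) * v s y <= 2 * K3.
Proof.
move=> s0 y0; have K22 := K2_ge2; have L0 := expR_ge0 (3 / 2 * `|L|).
have vy0 := ah_v_ge0 H y s0.
have [s1|s1] := leP s 1.
  apply: (@le_trans _ _ (1 * expR (3 / 2 * `|L|))).
    apply: ler_pM => //; rewrite ?v_le_L//.
    by rewrite -[leRHS]expR0 ler_expR; nra.
  by rewrite mul1r /K3; lra.
have l0 : 0 <= ln s by exact/ln_ge0/ltW.
apply: (@le_trans _ _ (expR (- (1 / 2 * y)) * (K2 * (2 * expR (y / 2))))).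
  rewrite ler_wpM2l//; apply: (le_trans (ah_bound y (ltW s1))).
  rewrite (max_idPl y0); apply: (@le_trans _ _ (K2 * (2 * expR (y / 2)) * 1)).
    apply: ler_pM; rewrite ?mulr_ge0//; try lra.
      by rewrite ler_wpM2l ?onesub_le//; lra.
    by rewrite -[leRHS]expR0 ler_expR; lra.
  by rewrite mulr1.
have -> : expR (- (1 / 2 * y)) * (K2 * (2 * expR (y / 2))) =
  2 * K2 * (expR (- (1 / 2 * y)) * expR (y / 2)) by ring.
by rewrite -expRD (_ : - _ + _ = 0) ?expR0 /K3; lra.
Qed.

(** Keeps one factor v as its bound M. For data of size lam this leaves a majorant proportional to
    lam, which can be divided by lam before taking limits. *)
Lemma ah_kap_le_mul M s y : 0 < s -> 0 <= y -> v s y <= M ->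
  kap s y <= C * M * K3 * (expR (- (`|y| / 16)) * theta s).
Proof.
move=> s0 y0 vM; have v0s := ah_v_ge0 H y s0.
have /andP[r21 r22] := r2_bounds.
have h := ah_v_decay s0 y0.
apply: (le_trans (ah_kap_sq H y s0)); rewrite -!mulrA ler_wpM2l//.
have -> : expR (- (r2 * y)) * v s y ^+ 2 = v s y * (expR (- (r2 * y)) * v s y) by ring.
apply: ler_pM => //; first by rewrite mulr_ge0.
apply: le_trans h; rewrite ler_wpM2r// ler_expR; nra.
Qed.

Definition K4 : R := 1 + K2 + C * K3 * (2 * K3).

(** For y >= 0 the quadratic bound is distributed over the two preceding estimates. For y < 0 the
    absorption is at most v, hence at most both e^(sqrt 2 y) and a multiple of s^(-5/4): comparing y
    with ln s, the one retained has both decays. *)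
Lemma ah_kap_decay s y : kap s y <= K4 * (expR (- (`|y| / 16)) * theta s).
Proof.
have K22 := K2_ge2; have L0 := expR_ge0 (3 / 2 * `|L|).
have K30 : 0 <= K3 by rewrite /K3; lra.
have K40 : 0 <= C * K3 * (2 * K3) by rewrite !mulr_ge0.
have D0 : 0 <= expR (- (`|y| / 16)) * theta s by rewrite mulr_ge0 ?theta_ge0.
have [s0|s0] := leP s 0.
  by rewrite (ah_kap0 H)// mulr_ge0// /K4; lra.
have vy0 := ah_v_ge0 H y s0.
have /andP[r21 r22] := r2_bounds.
have [y0|y0] := leP 0 y.
  apply: (le_trans (ah_kap_sq H y s0)).
  apply: (@le_trans _ _ (C * (expR (- (3 / 4 * y)) * v s y) * (expR (- (1 / 2 * y)) * v s y))).
    have -> : C * (expR (- (3 / 4 * y)) * v s y) * (expR (- (1 / 2 * y)) * v s y) =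
       C * (expR (- (3 / 4 * y)) * expR (- (1 / 2 * y))) * v s y ^+ 2 by ring.
    by rewrite ler_wpM2r ?sqr_ge0// ler_wpM2l// -expRD ler_expR; nra.
  apply: (@le_trans _ _ (C * (K3 * (expR (- (`|y| / 16)) * theta s)) * (2 * K3))).
    apply: ler_pM; rewrite ?mulr_ge0 ?expR_ge0//; last exact: ah_v_growth.
    by rewrite ler_wpM2l// ah_v_decay.
  have -> : C * (K3 * (expR (- (`|y| / 16)) * theta s)) * (2 * K3) =
    C * K3 * (2 * K3) * (expR (- (`|y| / 16)) * theta s) by ring.
  by rewrite ler_wpM2r// /K4; lra.
rewrite (le_trans (ah_kap_v H y s0))// (ltr0_norm y0).
have [s1|s1] := leP s 1.
  rewrite (theta1 s0 s1) mulr1 (le_trans (ah_v_le H y s0))//.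
  rewrite -[leLHS]mul1r ler_pM//; first by rewrite /K4; lra.
  by rewrite ler_expR; nra.
have l0 : 0 <= ln s by exact/ln_ge0/ltW.
rewrite (thetaE s1) -expRD.
have b1 := ah_v_le H y s0; have b2 := ah_bound y (ltW s1).
rewrite (max_idPr (ltW y0)) addr0 mulr1 in b2.
have [AB|AB] := leP (r2 * y) (- (5 / 4 * ln s)).
  rewrite (le_trans b1)// -[leLHS]mul1r ler_pM//; first by rewrite /K4; lra.
  by rewrite ler_expR; nra.
by rewrite (le_trans b2)// ler_pM//; [lra|rewrite /K4; lra|rewrite ler_expR; nra].
Qed.

End bound.
End absorbed_heat.

(** * Dominated convergence for real-valued integrals *)

Section dct.
Context d (T : measurableType d) {R : realType} (nu : {measure set T -> \bar R}).

Lemma Rintegral_dominated_cvg (f_ : nat -> T -> R) (f g : T -> R) :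
  (forall n, measurable_fun setT (f_ n)) -> measurable_fun setT f ->
  (forall x, f_ ^~ x @ \oo --> f x) -> nu.-integrable setT (EFin \o g) ->
  (forall n x, `|f_ n x| <= g x) ->
  (\int[nu]_x f_ n x)%R @[n --> \oo] --> (\int[nu]_x f x)%R.
Proof.
move=> mf_ mf f_f ig f_g.
have [] := @dominated_convergence _ T R nu setT measurableT
  (fun n => EFin \o f_ n) (EFin \o f) (EFin \o g).
- by move=> n; exact/measurable_EFinP.
- exact/measurable_EFinP.
- by apply: aeW => x _; apply: cvg_EFin; [exact: nearW|exact: f_f].
- exact: ig.
- by apply: aeW => x n _ /=; rewrite lee_fin.
move=> i_f _ c; apply: fine_cvg.
by rewrite fineK //; exact: integrable_fin_num.
Qed.

Lemma Rintegral_norm_le (f : T -> R) (g : T -> R) M :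
  measurable_fun setT f -> measurable_fun setT g -> 
  (forall x, `|f x| <= g x) -> (\int[nu]_x (g x)%:E <= M%:E)%E ->
  `|\int[nu]_x f x| <= M.
Proof.
move=> mf mg fg gM.
have h : (\int[nu]_x `|(EFin \o f) x| <= M%:E)%E.
  apply: le_trans gM; apply: ge0_le_integral => //.
  - by apply/measurable_EFinP; exact: measurableT_comp.
  - exact/measurable_EFinP.
  - by move=> x _; rewrite lee_fin fg.
have i_f : nu.-integrable setT (EFin \o f).
  apply/integrableP; split; first exact/measurable_EFinP.
  by rewrite (le_lt_trans h)// ltry.
rewrite /Rintegral -lee_fin -abse_EFin fineK ?integrable_fin_num//.
apply: le_trans h; apply: le_abse_integral => //; exact/measurable_EFinP.
Qed.

End dct.

(** * Asymptotics of v at distance of order sqrt t *)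

Section mass.
Context {R : realType}.
Local Notation mu := (@lebesgue_measure R).
Local Notation r2 := (Num.sqrt 2 : R).
Variables (L C : R).
Hypothesis C0 : 0 <= C.

Definition heat_mass (v0 : R -> R) (kap : R -> R -> R) : R :=
  (\int[mu]_y (y * v0 y))%R - (\int[(mu \x mu)%E]_p (p.2 * kap p.1 p.2))%R.

Lemma theta_le1 (s : R) : theta s <= 1.
Proof.
have [s1|s1] := leP s 1; first by rewrite /theta s1; case: ifP.
by rewrite thetaE// -[leRHS]expR0 ler_expR oppr_le0 mulr_ge0// ln_ge0// ltW.
Qed.

(** Equals -2 times the derivative at a of the standard normal density, as befits a difference of
    two Gaussian densities centred at y and - y and rescaled by sqrt t. *)
Definition clim (a : R) : R := 2 * (Num.sqrt (2 * pi))^-1 * a * expR (- (a ^+ 2 / 2)).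

Lemma clim_gt0 a : 0 < a -> 0 < clim a.
Proof.
by move=> a0; rewrite !mulr_gt0 ?expR_gt0// invr_gt0 sqrtr_gt0 mulr_gt0 ?pi_gt0.
Qed.

Lemma abs_expR_le (x : R) : 0 <= x -> x * expR (- (x / 16)) <= 32 * expR (- (x / 32)).
Proof.
move=> x0.
have -> : expR (- (x / 16)) = expR (- (x / 32)) * expR (- (x / 32)).
  by rewrite -expRD; congr expR; lra.
rewrite mulrA ler_wpM2r// expRN ler_pdivrMr ?expR_gt0//.
by have := expR_ge1Dx (x / 32); lra.
Qed.

Lemma K4_ge0 : 0 <= K4 L C.
Proof.
have := K2_ge2 L; have L0 := expR_ge0 (3 / 2 * `|L|) => K22.
have K30 : 0 <= K3 L by rewrite /K3; lra.
by rewrite /K4 addr_ge0 ?mulr_ge0//; lra.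
Qed.

Section limit.
Variables (v0 : R -> R) (v kap : R -> R -> R).
Hypothesis H : absorbed_heat L C v0 v kap.

Lemma fin_hk_v0 t z : 0 < t ->
  (\int[mu]_y (hk t (z - y) * v0 y)%:E < +oo)%E.
Proof.
move=> t0; have hkm x : measurable_fun setT (fun y : R => (hk t (x - y))%:E).
  by apply/measurable_EFinP; apply: measurable_hk2 => //; exact: measurable_funB.
apply: (@le_lt_trans _ _ (\int[mu]_y ((expR (3 / 2 * `|L|))%:E * (hk t (z - y))%:E))%E).
  apply: ge0_le_integral => //.
  - by move=> y _; exact: hk_v0_ge0 H _ _ _.
  - exact: measurable_hk_v0 H _ _.
  - by apply: measurable_funeM; exact: hkm.
  - by move=> y _; rewrite -EFinM lee_fin mulrC ler_wpM2r ?hk_ge0// (v0_le_L H).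
rewrite ge0_integralZl_EFin// ?integral_hk ?mule1 ?ltry//.
- by move=> y _; rewrite lee_fin hk_ge0.
- exact: hkm.
Qed.

Lemma integrable_hk_v0 t z : 0 < t ->
  mu.-integrable setT (EFin \o (fun y => hk t (z - y) * v0 y)).
Proof.
move=> t0; apply/integrableP; split; first exact: measurable_hk_v0 H _ _.
under eq_integral do rewrite gee0_abs ?(hk_v0_ge0 H)//.
exact: fin_hk_v0.
Qed.

Lemma integrable_hk_kap t z : 0 < t ->
  (mu \x mu)%E.-integrable setT (EFin \o (fun p => hk (t - p.1) (z - p.2) * kap p.1 p.2)).
Proof.
move=> t0; apply/integrable12ltyP; first exact: measurable_hk_kap H _ _.
apply: (@le_lt_trans _ _ (\int[mu]_s \int[mu]_y (hk (t - s) (z - y) * kap s y)%:E)%E).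
  rewrite le_eqVlt; apply/orP; left; apply/eqP.
  apply: eq_integral => s _; apply: eq_integral => y _.
  by rewrite gee0_abs ?(hk_kap_ge0 H).
apply: le_lt_trans (fin_hk_v0 z t0).
by rewrite -(ah_duhamel H z t0) leeDr// lee_fin (ah_v_ge0 H).
Qed.

(** Twice the odd part in z of the kernel; it vanishes at y = 0, so that the leading order is linear
    in y. *)
Definition hkq (t z y : R) : R := hk t (z - y) - hk t (z + y).

Lemma measurable_hkq d (S : measurableType d) (f g h : S -> R) :
  measurable_fun setT f -> measurable_fun setT g -> measurable_fun setT h ->
  measurable_fun setT (fun s => hkq (f s) (g s) (h s)).
Proof.
move=> mf mg mh; apply: measurable_funB.
  by apply: measurable_hk2 => //; exact: measurable_funB.
by apply: measurable_hk2 => //; exact: measurable_funD.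
Qed.

Lemma hk_reflectE (t z y : R) : hk t (- z - y) = hk t (z + y).
Proof. by rewrite -hkN; congr hk; ring. Qed.

(** Difference of the Duhamel formulas at z and - z. Since v(t, - z) <= e^(- sqrt 2 z) is
    negligible, v(t, z) is governed by the odd kernel. *)
Lemma ah_odd_repr t z : 0 < t ->
  v t z = v t (- z) + (\int[mu]_y (hkq t z y * v0 y))%R -
    (\int[(mu \x mu)%E]_p (hkq (t - p.1) z p.2 * kap p.1 p.2))%R.
Proof.
move=> t0.
have E x : v t x = (\int[mu]_y (hk t (x - y) * v0 y))%R -
    (\int[(mu \x mu)%E]_p (hk (t - p.1) (x - p.2) * kap p.1 p.2))%R.
  have := ah_duhamel H x t0; rewrite /Rintegral.
  have -> : (\int[mu]_s \int[mu]_y (hk (t - s) (x - y) * kap s y)%:E)%E =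
    (\int[(mu \x mu)%E]_p (hk (t - p.1) (x - p.2) * kap p.1 p.2)%:E)%E.
    rewrite fubini_tonelli1//; first exact: measurable_hk_kap H _ _.
    by move=> p; exact: hk_kap_ge0 H _ _ _ _.
  move=> <-; rewrite fineD//; last exact: (integrable_fin_num measurableT (integrable_hk_kap x t0)).
  by rewrite /= addrK.
rewrite E (E (- z)).
have -> : (\int[mu]_y (hkq t z y * v0 y))%R =
   (\int[mu]_y (hk t (z - y) * v0 y))%R - (\int[mu]_y (hk t (- z - y) * v0 y))%R.
  rewrite -RintegralB//; [|exact: integrable_hk_v0|exact: integrable_hk_v0].
  by apply: eq_Rintegral => y _; rewrite hk_reflectE -mulrBl.
have -> : (\int[(mu \x mu)%E]_p (hkq (t - p.1) z p.2 * kap p.1 p.2))%R =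
   (\int[(mu \x mu)%E]_p (hk (t - p.1) (z - p.2) * kap p.1 p.2))%R -
   (\int[(mu \x mu)%E]_p (hk (t - p.1) (- z - p.2) * kap p.1 p.2))%R.
  rewrite -RintegralB//; [|exact: integrable_hk_kap|exact: integrable_hk_kap].
  by apply: eq_Rintegral => y _; rewrite hk_reflectE -mulrBl.
do ?[move: (Rintegral _ _ _) => ?]; ring.
Qed.

Variables (a b : R) (t_ : nat -> R).
Hypotheses (a0 : 0 < a) (ty : t_ @ \oo --> +oo).
Let z_ n : R := a * Num.sqrt (t_ n) - b.
Hypotheses (t1 : forall n, 1 <= t_ n) (zt : forall n, a / 2 * Num.sqrt (t_ n) <= z_ n).

Let tgt0 n : 0 < t_ n. Proof. exact: lt_le_trans (t1 n). Qed.
Let st_gt0 n : 0 < Num.sqrt (t_ n). Proof. by rewrite sqrtr_gt0. Qed.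
Let zgt0 n : 0 < z_ n.
Proof. by apply: lt_le_trans (zt n); rewrite mulr_gt0// divr_gt0. Qed.

(** Squeeze between the two sides of [hk_sub_bounds], each written as a continuous function of (t -
    s)^(-1/2) and evaluated at 0. *)
Lemma hkq_lim s y : t_ n * hkq (t_ n - s) (z_ n) y @[n --> \oo] --> clim a * y.
Proof.
pose ep n : R := (Num.sqrt (t_ n - s))^-1.
have ep0 : ep n @[n --> \oo] --> (0 : R).
  apply/cvgr0Pnorm_le => e e0; near=> n.
  have h : s + e^-1 ^+ 2 <= t_ n by near: n; move/cvgryPge : ty; apply.
  rewrite /ep normfV ger0_norm ?sqrtr_ge0// invf_ple ?posrE ?sqrtr_gt0//.
    rewrite -[leLHS]ger0_norm ?invr_ge0 ?(ltW e0)// -sqrtr_sqr ler_wsqrtr//; lra.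
  have : 0 < e^-1 ^+ 2 by rewrite exprn_gt0// invr_gt0.
  lra.
(* At e = (t - s)^(-1/2) these are sqrt (t / (t - s)) and z / sqrt (t - s); in g the sign 1 gives
   the lower bound and -1 the upper one. *)
pose r e : R := Num.sqrt (1 + s * e ^+ 2).
pose w e : R := a * r e - b * e.
pose g (sg : R) e : R := 2 * (Num.sqrt (2 * pi))^-1 * y * (1 + s * e ^+ 2) * w e *
  expR (- ((w e + sg * y * e) ^+ 2 / 2)).
have gc sg : g sg (ep n) @[n --> \oo] --> clim a * y.
  have -> : clim a * y = g sg 0.
    rewrite /g /w /r /clim !expr0n/= !(mulr0n, mulr0, addr0, subr0) sqrtr1 !mulr1.
    by set E := expR _; ring.
  have cr : {for 0, continuous r}.
    apply: continuous_comp; last exact: sqrt_continuous.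
    apply: cvgD; first exact: cvg_cst.
    by apply: cvgM; [exact: cvg_cst|exact: exprn_continuous].
  have cw : {for 0, continuous w}.
    by apply: cvgB; apply: cvgM => //; exact: cvg_cst.
  apply: (cvg_comp _ _ ep0).
  apply: cvgM.
    apply: cvgM => //; apply: cvgM; first exact: cvg_cst.
    apply: cvgD; first exact: cvg_cst.
    by apply: cvgM; [exact: cvg_cst|exact: exprn_continuous].
  apply: continuous_comp; last exact: continuous_expR.
  apply: cvgN; apply: cvgM; last exact: cvg_cst.
  apply: (@continuous_comp _ _ _ (fun e => w e + sg * y * e) (fun x => x ^+ 2)); last exact: exprn_continuous.
  by apply: cvgD => //; apply: cvgM; [exact: cvg_cst|].
apply: (@squeeze_cvgr _ _ _ _ (fun n => g 1 (ep n)) (fun n => g (-1) (ep n))) => //.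
near=> n.
have tau0 : 0 < t_ n - s.
  rewrite subr_gt0; near: n; move/cvgryPgt : ty; apply.
have q0 : 0 < Num.sqrt (t_ n - s) by rewrite sqrtr_gt0.
have := hk_sub_bounds (z_ n) y tau0.
set tau := t_ n - s in tau0 q0 *.
have e2 : ep n ^+ 2 = tau^-1 by rewrite /ep exprVn sqr_sqrtr// ltW.
have tE : 1 + s * ep n ^+ 2 = t_ n / tau.
  by rewrite e2 /tau; field; rewrite gt_eqF.
have rE : r (ep n) = Num.sqrt (t_ n) * ep n.
  by rewrite /r tE sqrtrM ?(ltW (tgt0 n))// sqrtrV// ltW.
have wE : w (ep n) = z_ n * ep n by rewrite /w rE /z_; ring.
have pE : (Num.sqrt (2 * pi * tau))^-1 = (Num.sqrt (2 * pi))^-1 * ep n.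
  by rewrite sqrtrM ?mulr_ge0 ?pi_ge0// invfM.
have gE sg : g sg (ep n) = t_ n * ((Num.sqrt (2 * pi * tau))^-1 * (2 * z_ n * y / tau) *
    expR (- ((z_ n + sg * y) ^+ 2 / (2 * tau)))).
  rewrite /g wE tE pE -mulrDl exprMn e2 -mulrA invfM.
  by rewrite [2^-1 * tau^-1]mulrC -[X in expR (- X)]mulrA; set E := expR _; ring.
rewrite !gE mulN1r mul1r !mulNr => /andP[h1 h2].
have t0' := ltW (tgt0 n).
by apply/andP; split; apply: ler_wpM2l.
Unshelve. all: by end_near. Qed.


Let t_le_z2 n : t_ n <= 4 / a ^+ 2 * z_ n ^+ 2.
Proof.
have h := zt n; have s0 := ltW (st_gt0 n).
have : t_ n = Num.sqrt (t_ n) ^+ 2 by rewrite sqr_sqrtr// ltW.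
move: h s0; set x := Num.sqrt _; set z := z_ n => h s0 ->.
have -> : 4 / a ^+ 2 * z ^+ 2 = (z / (a / 2)) ^+ 2 by field; rewrite gt_eqF.
rewrite ler_sqr ?nnegrE//; first by rewrite ler_pdivlMr ?divr_gt0// mulrC.
apply: divr_ge0; last by rewrite divr_ge0// ltW.
by apply: le_trans h; rewrite mulr_ge0// divr_ge0// ltW.
Qed.

(** Since z is of order sqrt t, the factor t is paid for by 1 / z^2: t <= 4 z^2 / a^2, and 1024 = 4
    * 256. *)
Lemma hkq_near_le n s y : 0 <= s -> s < t_ n -> `|y| <= z_ n / 2 ->
  `|t_ n * hkq (t_ n - s) (z_ n) y| <= 1024 / a ^+ 2 * `|y|.
Proof.
move=> s0 st yz; rewrite normrM (gtr0_norm (tgt0 n)).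
have tau0 : 0 < t_ n - s by rewrite subr_gt0.
have := hk_sub_abs_le tau0 (zgt0 n) yz; rewrite -/(hkq _ _ _) => h.
apply: (le_trans (ler_wpM2l (ltW (tgt0 n)) h)).
have z2 : 0 < z_ n ^+ 2 by rewrite exprn_gt0.
apply: (@le_trans _ _ (4 / a ^+ 2 * z_ n ^+ 2 * (256 * `|y| / z_ n ^+ 2))).
  apply: ler_wpM2r; last exact: t_le_z2.
  by apply: divr_ge0; [exact: mulr_ge0|exact: sqr_ge0].
rewrite le_eqVlt; apply/orP; left; apply/eqP.
by field; rewrite !gt_eqF.
Qed.

Lemma hk_le_invsqrt (t x : R) : 0 < t -> hk t x <= (Num.sqrt t)^-1.
Proof.
move=> t0; apply: (@le_trans _ _ (2^-1 * (Num.sqrt t)^-1 * 1)).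
  apply: ler_pM; rewrite ?invr_ge0 ?sqrtr_ge0 ?expR_ge0 ?sqrt_pi_inv_le//.
  by rewrite -[leRHS]expR0 ler_expR mulNr oppr_le0 divr_ge0 ?sqr_ge0// mulr_ge0// ltW.
have : 0 <= (Num.sqrt t)^-1 by rewrite invr_ge0 sqrtr_ge0.
by set u := (_)^-1; lra.
Qed.

Let c1024_ge0 : 0 <= 1024 / a ^+ 2.
Proof. by apply: divr_ge0; [exact: ler0n|exact: sqr_ge0]. Qed.

Lemma cvg_initial_mass :
  t_ n * (\int[mu]_y (hkq (t_ n) (z_ n) y * v0 y))%R @[n --> \oo] -->
  clim a * (\int[mu]_y (y * v0 y))%R.
Proof.
have mv0 := ah_mv0 H.
pose D := 1024 / a ^+ 2 + 8 / a.
have i1 : mu.-integrable setT (EFin \o (fun y => (1 + `|y|) * v0 y)).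
  apply/integrableP; split; first exact: measurable_moment H.
  under eq_integral do rewrite gee0_abs ?(moment_ge0 H)//.
  by apply: le_lt_trans (moment_v0 H) _; rewrite ltry.
have i2 : mu.-integrable setT (EFin \o (fun y : R => y * v0 y)).
  apply: le_integrable i1 => //.
    by apply/measurable_EFinP; exact: measurable_funM.
  move=> y _ /=; rewrite !normrM (ger0_norm (ah_v0_ge0 H y)) lee_fin ler_wpM2r ?(ah_v0_ge0 H)//.
  by rewrite [leRHS]ger0_norm ?addr_ge0// lerDr.
have -> : clim a * (\int[mu]_y (y * v0 y))%R = (\int[mu]_y (clim a * (y * v0 y)))%R.
  by rewrite RintegralZl.
have E n : t_ n * (\int[mu]_y (hkq (t_ n) (z_ n) y * v0 y))%R =
    (\int[mu]_y (t_ n * (hkq (t_ n) (z_ n) y * v0 y)))%R.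
  rewrite RintegralZl//.
  have := integrableB measurableT (integrable_hk_v0 (z_ n) (tgt0 n)) (integrable_hk_v0 (- z_ n) (tgt0 n)).
  by apply: eq_integrable => // y _ /=; rewrite hk_reflectE -EFinB -mulrBl.
rewrite (_ : (fun n => _) = (fun n => (\int[mu]_y (t_ n * (hkq (t_ n) (z_ n) y * v0 y)))%R)); last first.
  by apply/funext => n; exact: E.
apply: (@Rintegral_dominated_cvg _ _ R mu (fun n y => t_ n * (hkq (t_ n) (z_ n) y * v0 y))
  (fun y => clim a * (y * v0 y)) (fun y => D * ((1 + `|y|) * v0 y))).
- move=> n; apply: measurable_funM => //; apply: measurable_funM => //.
  exact: measurable_hkq.
- by apply: measurable_funM => //; exact: measurable_funM.
- move=> y.
  have h := @hkq_lim 0 y.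
  rewrite mulrA (_ : (fun n => _) = (fun n => t_ n * hkq (t_ n - 0) (z_ n) y * v0 y)).
    exact: cvgMr_tmp.
  by apply/funext => n; rewrite subr0 mulrA.
- have := @integrableZl _ _ _ mu setT measurableT D _ i1.
  by apply: eq_integrable.
- move=> n y; rewrite mulrA normrM (ger0_norm (ah_v0_ge0 H y)) mulrA ler_wpM2r ?(ah_v0_ge0 H)//.
  have a20 := c1024_ge0.
  have a10 : 0 <= 8 / a by rewrite divr_ge0 ?ltW.
  have y0 := normr_ge0 y.
  have [yz|yz] := leP `|y| (z_ n / 2).
    have := hkq_near_le (lexx 0) (tgt0 n) yz; rewrite subr0 => /le_trans; apply.
    by rewrite /D; move: a20 a10; set A := _ / a ^+ 2; set B := 8 / a => A0 B0; nra.
  (* Far out, the crude kernel bound 1 / sqrt t suffices, because sqrt t <= 2 z / a < 4 |y| / a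
     there. *)
  rewrite normrM (gtr0_norm (tgt0 n)).
  have h1 := hk_le_invsqrt (z_ n - y) (tgt0 n).
  have h2 := hk_le_invsqrt (z_ n + y) (tgt0 n).
  have h3 := hk_ge0 (t_ n) (z_ n - y).
  have h4 := hk_ge0 (t_ n) (z_ n + y).
  have q : `|hkq (t_ n) (z_ n) y| <= (Num.sqrt (t_ n))^-1.
    by rewrite /hkq ler_norml; apply/andP; split; lra.
  apply: (@le_trans _ _ (Num.sqrt (t_ n))).
    apply: (le_trans (ler_wpM2l (ltW (tgt0 n)) q)).
    by rewrite ler_pdivrMr// -expr2 sqr_sqrtr// ltW.
  apply: (@le_trans _ _ (4 / a * `|y|)).
    have -> : 4 / a * `|y| = 4 * `|y| / a by ring.
    by rewrite ler_pdivlMr//; have := zt n; lra.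
  rewrite /D; move: a20 a10; have -> : 4 / a = 8 / a / 2 by lra.
  by set A := _ / a ^+ 2; set B := 8 / a => A0 B0; nra.
Qed.

Lemma moment_kap_le (p : R * R) : `|p.2| * kap p.1 p.2 <= 32 * K4 L C * dom p.
Proof.
apply: (@le_trans _ _ (`|p.2| * (K4 L C * (expR (- (`|p.2| / 16)) * theta p.1)))).
  by rewrite ler_wpM2l// (ah_kap_decay C0 H).
have h := abs_expR_le (normr_ge0 p.2).
have th0 : 0 <= K4 L C * theta p.1 by rewrite mulr_ge0 ?K4_ge0 ?theta_ge0.
have := ler_wpM2r th0 h; rewrite /dom.
by set A := expR _; set B := expR _; set D := theta _; set E := K4 _ _; nra.
Qed.

Lemma integrable_moment_kap : (mu \x mu)%E.-integrable setT (EFin \o (fun p => p.2 * kap p.1 p.2)).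
Proof.
have := @integrableZl _ _ _ (mu \x mu)%E setT measurableT (32 * K4 L C) _ (@integrable_dom R).
apply: le_integrable => //.
  apply/measurable_EFinP; apply: measurable_funM => //; exact: ah_mkap H.
move=> p _ /=; rewrite lee_fin normrM (ger0_norm (ah_kap_ge0 H _ _)).
rewrite [leRHS]ger0_norm; last first.
  by rewrite mulr_ge0 ?dom_ge0// mulr_ge0// K4_ge0.
exact: moment_kap_le.
Qed.


(** The absorption is split at |y| = z / 2. Inside, the kernel bound is uniform up to s = t and
    dominated convergence applies; outside, the spatial decay of kap beats every power of t. *)
Let nearb (n : nat) (y : R) : R := (`|y| <= z_ n / 2)%R%:R.

Let measurable_nearb n : measurable_fun setT (nearb n).
Proof.
rewrite (_ : nearb n = fun y => if `|y| <= z_ n / 2 then 1 else 0); last first.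
  by apply/funext => y; rewrite /nearb; case: ifP.
apply: measurable_fun_ifT => //.
by apply: measurable_fun_ler => //; exact: measurableT_comp.
Qed.

Let measurable_hkq_kap n : measurable_fun setT
  (fun p : R * R => hkq (t_ n - p.1) (z_ n) p.2 * kap p.1 p.2).
Proof.
apply: measurable_funM; last exact: ah_mkap H.
by apply: measurable_hkq => //; exact: measurable_funB.
Qed.

Let measurable_near n : measurable_fun setT
  (fun p : R * R => t_ n * (nearb n p.2 * (hkq (t_ n - p.1) (z_ n) p.2 * kap p.1 p.2))).
Proof.
apply: measurable_funM => //; apply: measurable_funM; last exact: measurable_hkq_kap.
exact: (measurableT_comp (measurable_nearb n)).
Qed.

Let measurable_far n : measurable_fun setT
  (fun p : R * R => t_ n * ((1 - nearb n p.2) * (hkq (t_ n - p.1) (z_ n) p.2 * kap p.1 p.2))).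
Proof.
apply: measurable_funM => //; apply: measurable_funM; last exact: measurable_hkq_kap.
by apply: measurable_funB => //; exact: (measurableT_comp (measurable_nearb n)).
Qed.

Lemma hkq_le0 t z y : t <= 0 -> hkq t z y = 0.
Proof. by move=> t0; rewrite /hkq !hk_le0 ?subrr. Qed.

Lemma cvg_near_absorption :
  (\int[(mu \x mu)%E]_p (t_ n * (nearb n p.2 * (hkq (t_ n - p.1) (z_ n) p.2 * kap p.1 p.2))))%R
    @[n --> \oo] -->
  (\int[(mu \x mu)%E]_p (clim a * (p.2 * kap p.1 p.2)))%R.
Proof.
have mk := ah_mkap H.
apply: (@Rintegral_dominated_cvg _ _ R (mu \x mu)%E
  (fun n p => t_ n * (nearb n p.2 * (hkq (t_ n - p.1) (z_ n) p.2 * kap p.1 p.2)))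
  (fun p => clim a * (p.2 * kap p.1 p.2))
  (fun p => 1024 / a ^+ 2 * (32 * K4 L C * dom p))).
- exact: measurable_near.
- by apply: measurable_funM => //; exact: measurable_funM.
- move=> p; have h := @hkq_lim p.1 p.2.
  rewrite mulrA.
  have hk' : t_ n * hkq (t_ n - p.1) (z_ n) p.2 * kap p.1 p.2 @[n --> \oo] -->
      clim a * p.2 * kap p.1 p.2 by exact: cvgMr_tmp.
  apply: cvg_trans hk'; apply: near_eq_cvg; near=> n.
  rewrite /nearb (_ : _ <= _) ?mul1r ?mulrA//.
  have : (4 * `|p.2| / a) ^+ 2 <= t_ n by near: n; move/cvgryPge : ty; apply.
  move=> /ler_wsqrtr; rewrite sqrtr_sqr ger0_norm; last first.
    by rewrite divr_ge0 ?mulr_ge0// ltW.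
  rewrite ler_pdivrMr// => h1; have := zt n; lra.
- have := @integrableZl _ _ _ (mu \x mu)%E setT measurableT (1024 / a ^+ 2 * (32 * K4 L C)) _ (@integrable_dom R).
  by apply: eq_integrable => // p _ /=; rewrite -EFinM -!mulrA.
- move=> n p; have kp0 := ah_kap_ge0 H p.1 p.2.
  have rhs0 : 0 <= 1024 / a ^+ 2 * (32 * K4 L C * dom p).
    apply: mulr_ge0; first exact: c1024_ge0.
    by apply: mulr_ge0; [apply: mulr_ge0; [exact: ler0n|exact: K4_ge0]|exact: dom_ge0].
  have [s0|s0] := leP p.1 0; first by rewrite (ah_kap0 H)// !mulr0 normr0.
  have [st|st] := leP (t_ n) p.1.
    by rewrite hkq_le0 ?subr_le0// mul0r !mulr0 normr0.
  rewrite /nearb; have [yz|yz] := leP `|p.2| (z_ n / 2); last by rewrite mul0r mulr0 normr0.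
  rewrite mul1r mulrA normrM (ger0_norm kp0).
  apply: (@le_trans _ _ (1024 / a ^+ 2 * `|p.2| * kap p.1 p.2)).
    by rewrite ler_wpM2r// hkq_near_le// ltW.
  by rewrite -mulrA; apply: ler_wpM2l; [exact: c1024_ge0|exact: moment_kap_le].
Unshelve. all: by end_near. Qed.

(** Where |y| > z / 2, kap is at most K4 e^(- z / 32). The kernels centred at z and - z each have
    mass 1, and times range over ]0, t[; together with the prefactor t this makes 2 t^2. *)
Lemma far_absorption_le n :
  `|(\int[(mu \x mu)%E]_p (t_ n * ((1 - nearb n p.2) * (hkq (t_ n - p.1) (z_ n) p.2 * kap p.1 p.2))))%R|
  <= 2 * K4 L C * t_ n ^+ 2 * expR (- (z_ n / 32)).
Proof.
pose e := K4 L C * expR (- (z_ n / 32)).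
have e0 : 0 <= e by rewrite mulr_ge0 ?K4_ge0.
pose ind (s : R) : R := \1_(`]0, t_ n[ : set R) s.
have mind : measurable_fun setT ind by exact: measurable_indic.
have ind0 s : 0 <= ind s by rewrite /ind indicE.
pose G (p : R * R) := t_ n * e * ind p.1 * (hk (t_ n - p.1) (z_ n - p.2) + hk (t_ n - p.1) (- z_ n - p.2)).
have mh x : measurable_fun setT (fun p : R * R => hk (t_ n - p.1) (x - p.2)).
  by apply: measurable_hk2; exact: measurable_funB.
have mG : measurable_fun setT G.
  apply: measurable_funM; last by apply: measurable_funD; exact: mh.
  apply: measurable_funM => //; exact: (measurableT_comp mind).
have G0 p : 0 <= G p.
  apply: mulr_ge0; last by rewrite addr_ge0 ?hk_ge0.
  by apply: mulr_ge0 => //; apply: mulr_ge0 => //; exact: ltW.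
apply: (@Rintegral_norm_le _ _ R (mu \x mu)%E _ G) => //.
- exact: measurable_far.
- move=> p; have kp0 := ah_kap_ge0 H p.1 p.2.
  have [s0|s0] := leP p.1 0; first by rewrite (ah_kap0 H)// !mulr0 normr0.
  have [st|st] := leP (t_ n) p.1.
    by rewrite hkq_le0 ?subr_le0// mul0r !mulr0 normr0.
  rewrite /nearb; have [yz|yz] := leP `|p.2| (z_ n / 2).
    by rewrite subrr mul0r mulr0 normr0.
  rewrite subr0 mul1r normrM (gtr0_norm (tgt0 n)) normrM (ger0_norm kp0).
  have i1 : ind p.1 = 1 by rewrite /ind indicE mem_set//= in_itv/= s0.
  rewrite /G i1 mulr1 -mulrA ler_wpM2l ?(ltW (tgt0 n))// mulrC.
  apply: ler_pM => //.
    apply: (le_trans (ah_kap_decay C0 H p.1 p.2)); rewrite /e ler_wpM2l ?K4_ge0//.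
    rewrite -[leRHS]mulr1; apply: ler_pM; rewrite ?theta_ge0 ?theta_le1//.
    by rewrite ler_expR; lra.
  rewrite /hkq hk_reflectE; have h1 := hk_ge0 (t_ n - p.1) (z_ n - p.2).
  have h2 := hk_ge0 (t_ n - p.1) (z_ n + p.2).
  by rewrite ler_norml; apply/andP; split; lra.
rewrite fubini_tonelli1//; last exact/measurable_EFinP.
have E s : (\int[mu]_y (G (s, y))%:E = (2 * (t_ n * e) * ind s)%:E)%E.
  rewrite /G/=; have [ts|ts] := leP (t_ n) s.
    have -> : ind s = 0.
      rewrite /ind indicE memNset//= in_itv/= => /andP[_].
      by rewrite ltNge ts.
    by rewrite !mulr0; under eq_integral do rewrite mul0r; rewrite integral0.
  have tau0 : 0 < t_ n - s by rewrite subr_gt0.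
  have mhk x : measurable_fun setT (fun y : R => (hk (t_ n - s) (x - y))%:E).
    by apply/measurable_EFinP; apply: measurable_hk2 => //; exact: measurable_funB.
  under eq_integral do rewrite EFinM EFinD.
  have c0 : 0 <= t_ n * e * ind s.
    by apply: mulr_ge0 => //; apply: mulr_ge0 => //; exact: ltW.
  rewrite ge0_integralZl_EFin//; last 2 first.
  - by move=> y _; rewrite adde_ge0// lee_fin hk_ge0.
  - by apply: emeasurable_funD; exact: mhk.
  rewrite ge0_integralD//; last 4 first.
  - by move=> y _; rewrite lee_fin hk_ge0.
  - exact: mhk.
  - by move=> y _; rewrite lee_fin hk_ge0.
  - exact: mhk.
  by rewrite !integral_hk// -EFinD -EFinM; congr EFin; ring.
under eq_integral do rewrite /fubini_F E EFinM.
rewrite ge0_integralZl_EFin//; last 3 first.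
- by move=> s _; rewrite lee_fin.
- exact/measurable_EFinP.
- by apply: mulr_ge0 => //; apply: mulr_ge0 => //; exact: ltW.
rewrite (integral_indic_oo (ltW (tgt0 n))) -EFinM lee_fin /e.
by rewrite le_eqVlt; apply/orP; left; apply/eqP; ring.
Qed.

Lemma cvg_far : 2 * K4 L C * t_ n ^+ 2 * expR (- (z_ n / 32)) @[n --> \oo] --> (0 : R).
Proof.
have zy : z_ @ \oo --> +oo.
  apply/cvgryPge => A; near=> n; apply: le_trans (zt n).
  have h : (2 * `|A| / a) ^+ 2 <= t_ n by near: n; move/cvgryPge : ty; apply.
  move: h => /ler_wsqrtr; rewrite sqrtr_sqr ger0_norm; last first.
    by rewrite divr_ge0 ?mulr_ge0// ltW.
  rewrite ler_pdivrMr// => h; have := ler_norm A; lra.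
pose M := 2 * K4 L C * (4 / a ^+ 2) ^+ 2.
have M0 : 0 <= M by rewrite mulr_ge0 ?sqr_ge0// mulr_ge0// K4_ge0.
have Kp := K4_ge0.
apply/cvgr0Pnorm_le => e e0; near=> n.
have z1 : 1 <= z_ n by near: n; move/cvgryPge : zy; apply.
have z2 : M * (160 ^+ 5) / e <= z_ n by near: n; move/cvgryPge : zy; apply.
rewrite ger0_norm; last first.
  by apply: mulr_ge0 => //; apply: mulr_ge0; [exact: mulr_ge0|exact: sqr_ge0].
have tz := t_le_z2 n.
(* From z e^(- z / 160) <= 160. As t^2 is of order z^4 only, the fifth power leaves a factor 1 / z
   tending to 0. *)
have z5 : (z_ n) ^+ 5 * expR (- (z_ n / 32)) <= 160 ^+ 5.
  have -> : expR (- (z_ n / 32)) = expR (- (z_ n / 160)) ^+ 5.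
    by rewrite -expRM_natl; congr expR; lra.
  rewrite -exprMn; apply: lerXn2r.
  - by rewrite nnegrE mulr_ge0 ?expR_ge0// (le_trans ler01).
  - by rewrite nnegrE ler0n.
  rewrite expRN ler_pdivrMr ?expR_gt0//.
  by have := expR_ge1Dx (z_ n / 160); lra.
apply: (@le_trans _ _ (M * z_ n ^+ 4 * expR (- (z_ n / 32)))).
  rewrite ler_wpM2r// /M -[leRHS]mulrA ler_wpM2l ?mulr_ge0//.
  rewrite (_ : z_ n ^+ 4 = (z_ n ^+ 2) ^+ 2); last by rewrite -exprM.
  rewrite -exprMn; apply: lerXn2r => //; rewrite nnegrE; first exact: ltW.
  by rewrite mulr_ge0 ?sqr_ge0// divr_ge0 ?sqr_ge0.
have zp := zgt0 n.
have : M * z_ n ^+ 4 * expR (- (z_ n / 32)) * z_ n <= e * z_ n.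
  rewrite (_ : _ * z_ n = M * (z_ n ^+ 5 * expR (- (z_ n / 32)))); last by ring.
  apply: (@le_trans _ _ (M * 160 ^+ 5)); first by rewrite ler_wpM2l.
  by move: z2; rewrite ler_pdivrMr// [z_ n * e]mulrC.
by rewrite ler_pM2r.
Unshelve. all: by end_near. Qed.

Lemma cvg_reflected : t_ n * v (t_ n) (- z_ n) @[n --> \oo] --> (0 : R).
Proof.
have /andP[r21 r22] := @r2_bounds R.
apply: norm_cvg0.
apply: (@squeeze_cvgr _ _ _ _ (cst 0) (fun n => 2 * K4 L C * t_ n ^+ 2 * expR (- (z_ n / 32)))).
- apply: nearW => n; rewrite normr_ge0/=.
  have vz := ah_v_le H (- z_ n) (tgt0 n); have vz0 := ah_v_ge0 H (- z_ n) (tgt0 n).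
  have K41 : 1 <= 2 * K4 L C.
    have := K2_ge2 L; have L0 := expR_ge0 (3 / 2 * `|L|) => K22.
    have K30 : 0 <= K3 L by rewrite /K3; lra.
    have : 0 <= C * K3 L * (2 * K3 L) by rewrite !mulr_ge0.
    by rewrite /K4; lra.
  have t0' := ltW (tgt0 n); have t1' := t1 n.
  rewrite ger0_norm ?mulr_ge0//; apply: ler_pM => //.
    apply: (@le_trans _ _ (1 * (t_ n ^+ 2))); last by rewrite ler_wpM2r ?sqr_ge0.
    by rewrite mul1r expr2 ler_peMr.
  apply: (le_trans vz); rewrite ler_expR; have := zgt0 n; nra.
- exact: cvg_cst.
- exact: cvg_far.
Qed.

Lemma ah_limit_seq : t_ n * v (t_ n) (z_ n) @[n --> \oo] --> clim a * heat_mass v0 kap.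
Proof.
have mk := ah_mkap H.
have iq n : (mu \x mu)%E.-integrable setT
    (EFin \o (fun p => hkq (t_ n - p.1) (z_ n) p.2 * kap p.1 p.2)).
  have := integrableB measurableT (integrable_hk_kap (z_ n) (tgt0 n)) (integrable_hk_kap (- z_ n) (tgt0 n)).
  by apply: eq_integrable => // y _ /=; rewrite hk_reflectE -EFinB -mulrBl.
have inear n : (mu \x mu)%E.-integrable setT
    (EFin \o (fun p => t_ n * (nearb n p.2 * (hkq (t_ n - p.1) (z_ n) p.2 * kap p.1 p.2)))).
  have := @integrableZl _ _ _ (mu \x mu)%E setT measurableT (t_ n) _ (iq n).
  apply: le_integrable => //.
    by apply/measurable_EFinP; exact: measurable_near.
  move=> p _ /=; rewrite lee_fin !normrM ler_wpM2l// ler_piMl ?mulr_ge0//.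
  by rewrite /nearb; case: (`|p.2| <= _); rewrite ?normr1 ?normr0.
have ifar n : (mu \x mu)%E.-integrable setT
    (EFin \o (fun p => t_ n * ((1 - nearb n p.2) * (hkq (t_ n - p.1) (z_ n) p.2 * kap p.1 p.2)))).
  have := @integrableZl _ _ _ (mu \x mu)%E setT measurableT (t_ n) _ (iq n).
  apply: le_integrable => //.
    by apply/measurable_EFinP; exact: measurable_far.
  move=> p _ /=; rewrite lee_fin !normrM ler_wpM2l// ler_piMl ?mulr_ge0//.
  by rewrite /nearb; case: (`|p.2| <= _); rewrite ?subrr ?subr0 ?normr1 ?normr0.
have E n : t_ n * v (t_ n) (z_ n) = t_ n * v (t_ n) (- z_ n) +
   t_ n * (\int[mu]_y (hkq (t_ n) (z_ n) y * v0 y))%R -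
   ((\int[(mu \x mu)%E]_p (t_ n * (nearb n p.2 * (hkq (t_ n - p.1) (z_ n) p.2 * kap p.1 p.2))))%R +
    (\int[(mu \x mu)%E]_p (t_ n * ((1 - nearb n p.2) * (hkq (t_ n - p.1) (z_ n) p.2 * kap p.1 p.2))))%R).
  rewrite (ah_odd_repr (z_ n) (tgt0 n)) mulrBr mulrDr; congr (_ - _).
  rewrite -RintegralD// -RintegralZl//.
  by apply: eq_Rintegral => p _; ring.
under eq_cvg do rewrite E.
have -> : clim a * heat_mass v0 kap = 0 + clim a * (\int[mu]_y (y * v0 y))%R -
   ((\int[(mu \x mu)%E]_p (clim a * (p.2 * kap p.1 p.2)))%R + 0).
  rewrite RintegralZl//; last exact: integrable_moment_kap.
  by rewrite /heat_mass; ring.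
apply: cvgB; first by apply: cvgD; [exact: cvg_reflected|exact: cvg_initial_mass].
apply: cvgD; first exact: cvg_near_absorption.
apply: norm_cvg0.
apply: (@squeeze_cvgr _ _ _ _ (cst 0) (fun n => 2 * K4 L C * t_ n ^+ 2 * expR (- (z_ n / 32)))).
- by apply: nearW => n; rewrite normr_ge0/= far_absorption_le.
- exact: cvg_cst.
- exact: cvg_far.
Qed.

End limit.

Section limit_pinfty.
Variables (v0 : R -> R) (v kap : R -> R -> R).
Hypothesis H : absorbed_heat L C v0 v kap.

(** Dominated convergence being sequential, the limit is taken along arbitrary sequences of times,
    shifted to a rank from which z >= (a / 2) sqrt t and t >= 1. *)
Lemma ah_limit (a b : R) : 0 < a ->
  t * v t (a * Num.sqrt t - b) @[t --> +oo] --> clim a * heat_mass v0 kap.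
Proof.
move=> a0; apply/cvg_pinftyP => u uy.
have [N _ hN] : \forall n \near \oo, 1 <= u n /\ 2 * `|b| / a <= Num.sqrt (u n).
  near=> n.
  have h1 : 1 <= u n by near: n; move/cvgryPge : uy; apply.
  split => //.
  have h2 : (2 * `|b| / a) ^+ 2 <= u n by near: n; move/cvgryPge : uy; apply.
  move/ler_wsqrtr : h2; rewrite sqrtr_sqr ger0_norm// divr_ge0 ?mulr_ge0//.
  exact: ltW.
rewrite -(cvg_shiftn N).
have uy' : u (n + N)%N @[n --> \oo] --> +oo by rewrite cvg_shiftn.
have h n : 1 <= u (n + N)%N /\ 2 * `|b| / a <= Num.sqrt (u (n + N)%N).
  by apply: hN => /=; rewrite leq_addl.
apply: (ah_limit_seq H (t_ := fun n => u (n + N)%N)) => // n; first by have [] := h n.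
have [_] := h n; rewrite ler_pdivrMr// => hb; have := ler_norm b; lra.
Unshelve. all: by end_near. Qed.

End limit_pinfty.

(** * Masses of small initial data *)

Section families.
Variables (v0_ : nat -> R -> R) (v_ kap_ : nat -> R -> R -> R) (lam : nat -> R) (M : R).
Hypothesis H : forall n, absorbed_heat L C (v0_ n) (v_ n) (kap_ n).
Hypothesis lam0 : lam @ \oo --> (0 : R).
Hypothesis v0_le : forall n y, v0_ n y <= lam n * M.

Let cvg0M : lam n * M @[n --> \oo] --> (0 : R).
Proof. by rewrite -(mul0r M); exact: cvgMr_tmp. Qed.

(** The majorants depend on L and C only, hence serve all n at once; pointwise both integrands are
    bounded by multiples of lam n. *)
Lemma cvg_heat_mass0 : heat_mass (v0_ n) (kap_ n) @[n --> \oo] --> (0 : R).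
Proof.
have E0 : 0 = (\int[mu]_y cst (0 : R) y)%R - (\int[(mu \x mu)%E]_p cst (0 : R) p)%R :> R.
  by rewrite !Rintegral_cst// !mul0r subr0.
rewrite [X in _ --> X]E0; apply: cvgB.
  apply: (@Rintegral_dominated_cvg _ _ R mu (fun n y => y * v0_ n y) (cst 0)
     (fun y => expR (3 * `|L|) * expR (- (4^-1 * `|y|)))).
  - by move=> n; apply: measurable_funM => //; exact: ah_mv0 (H n).
  - by [].
  - move=> y; rewrite -[X in _ --> X](mulr0 y); apply: cvgMl_tmp.
    apply: (@squeeze_cvgr _ _ _ _ (cst 0) (fun n => lam n * M)) => //; last exact: cvg_cst.
    by apply: nearW => n; rewrite (ah_v0_ge0 (H n))/= v0_le.
  - have i : mu.-integrable setT (fun y : R => (expR (- (4^-1 * `|y|)))%:E).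
      apply/integrableP; split.
        apply/measurable_EFinP; apply: measurableT_comp => //.
        by apply: measurableT_comp => //; apply: measurable_funM => //; exact: measurableT_comp.
      under eq_integral do rewrite gee0_abs//.
      by apply: integral_expR_abs; rewrite invr_gt0.
    exact: (@integrableZl _ _ _ mu setT measurableT (expR (3 * `|L|)) _ i).
  - move=> n y; rewrite normrM (ger0_norm (ah_v0_ge0 (H n) y)).
    apply: le_trans (v0_decay (H n) y); rewrite ler_wpM2r ?(ah_v0_ge0 (H n))//.
    by rewrite lerDr.
apply: (@Rintegral_dominated_cvg _ _ R (mu \x mu)%E (fun n p => p.2 * kap_ n p.1 p.2) (cst 0)
    (fun p => 32 * K4 L C * dom p)).
- by move=> n; apply: measurable_funM => //; exact: ah_mkap (H n).
- by [].
- move=> p; rewrite -[X in _ --> X](mulr0 p.2); apply: cvgMl_tmp.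
  have [s0|s0] := leP p.1 0.
    by under eq_cvg do rewrite (ah_kap0 (H _))//; exact: cvg_cst.
  apply: (@squeeze_cvgr _ _ _ _ (cst 0) (fun n => lam n * M)) => //; last exact: cvg_cst.
  apply: nearW => n; rewrite (ah_kap_ge0 (H n))/=.
  by rewrite (le_trans (ah_kap_v (H n) p.2 s0))// (ah_v_le_sup (H n))//.
- exact: (@integrableZl _ _ _ (mu \x mu)%E setT measurableT (32 * K4 L C) _ (@integrable_dom R)).
- move=> n p; rewrite normrM (ger0_norm (ah_kap_ge0 (H n) _ _)).
  exact: moment_kap_le (H n) _.
Qed.

(** The initial moment is linear in lam and the absorption quadratic, so that the absorption divided
    by lam tends to 0 and the initial moment wins for some n. *)
Lemma heat_mass_pos (v0 : R -> R) : 0 <= M -> (forall n, 0 < lam n) ->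
  (forall n y, v0_ n y = lam n * v0 y) -> 0 < (\int[mu]_y (y * v0 y))%R ->
  mu.-integrable setT (EFin \o (fun y => y * v0 y)) ->
  exists n, 0 < heat_mass (v0_ n) (kap_ n).
Proof.
move=> M0 lamp v0E I0 iv0.
have K30 : 0 <= K3 L.
  have := K2_ge2 L; have L0 := expR_ge0 (3 / 2 * `|L|) => K22; rewrite /K3; lra.
have vM n s y : 0 < s -> v_ n s y <= lam n * M by move=> s0; exact: (ah_v_le_sup (H n)).
(* Absorption at y < 0 only increases the mass and is discarded; the division by lam turns the claim
   into convergence of an integral to 0. *)
pose W n (p : R * R) := Num.max p.2 0 * kap_ n p.1 p.2 / lam n.
have mW n : measurable_fun setT (W n).
  apply: measurable_funM => //; apply: measurable_funM; last exact: ah_mkap (H n).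
  exact: measurable_maxr.
have domW n p : `|W n p| <= 32 * (C * M * K3 L) * dom p.
  have k0 := ah_kap_ge0 (H n) p.1 p.2; have d0 := dom_ge0 p.
  have CMK : 0 <= C * M * K3 L by rewrite !mulr_ge0.
  have rhs0 : 0 <= 32 * (C * M * K3 L) * dom p by do 2 apply: mulr_ge0 => //.
  rewrite /W; have [y0|y0] := leP p.2 0; first by rewrite !mul0r normr0.
  have [s0|s0] := leP p.1 0; first by rewrite (ah_kap0 (H n))// mulr0 mul0r normr0.
  have p20 := ltW y0; have lp := lamp n.
  rewrite ger0_norm ?divr_ge0 ?mulr_ge0 ?(ltW lp)//.
  have h := ah_kap_le_mul C0 (H n) s0 p20 (vM n p.1 p.2 s0).
  have h2 := abs_expR_le (normr_ge0 p.2); rewrite (ger0_norm p20) in h h2.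
  rewrite ler_pdivrMr// /dom (ger0_norm p20).
  apply: (le_trans (ler_wpM2l p20 h)).
  have th0 := theta_ge0 p.1.
  have q0 : 0 <= C * M * K3 L * theta p.1 * lam n by rewrite !mulr_ge0 ?(ltW lp).
  have := ler_wpM2l q0 h2.
  set A := expR _; set B := expR _; set D := theta _; set E := K3 _ => hh.
  rewrite (_ : p.2 * _ = C * M * E * D * lam n * (p.2 * A)); last by ring.
  by apply: (le_trans hh); rewrite le_eqVlt; apply/orP; left; apply/eqP; ring.
have iW n : (mu \x mu)%E.-integrable setT (EFin \o W n).
  apply: (@le_integrable _ _ _ (mu \x mu)%E setT measurableT _ (fun p => (32 * (C * M * K3 L))%:E * (EFin \o dom) p)%E).
  - by apply/measurable_EFinP; exact: mW.
  - move=> p _ /=; rewrite lee_fin; apply: (le_trans (domW n p)); exact: ler_norm.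
  - exact: (@integrableZl _ _ _ (mu \x mu)%E setT measurableT _ _ (@integrable_dom R)).
have WC : (\int[(mu \x mu)%E]_p W n p)%R @[n --> \oo] --> (\int[(mu \x mu)%E]_p cst (0 : R) p)%R.
  apply: (@Rintegral_dominated_cvg _ _ R (mu \x mu)%E W (cst 0)
    (fun p => 32 * (C * M * K3 L) * dom p)) => //.
  - move=> p; rewrite /W.
    have [s0|s0] := leP p.1 0.
      by under eq_cvg do rewrite (ah_kap0 (H _))// mulr0 mul0r; exact: cvg_cst.
    pose D := Num.max p.2 0 * (C * expR (- (r2 * p.2)) * M).
    apply: (@squeeze_cvgr _ _ _ _ (cst 0) (fun n => D * (lam n * M))).
    + apply: nearW => n; have k0 := ah_kap_ge0 (H n) p.1 p.2; have lp := lamp n.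
      have mx0 : 0 <= Num.max p.2 0 by rewrite le_max lexx orbT.
      rewrite /= divr_ge0 ?mulr_ge0 ?(ltW lp)//=.
      rewrite ler_pdivrMr// /D -!mulrA ler_wpM2l//.
      apply: (le_trans (ah_kap_sq (H n) p.2 s0)).
      rewrite -mulrA ler_wpM2l// ler_wpM2l//.
      have v0' := ah_v_ge0 (H n) p.2 s0.
      rewrite (_ : M * _ = (lam n * M) ^+ 2); last by ring.
      by apply: lerXn2r; rewrite ?nnegrE ?vM// mulr_ge0// ltW.
    + exact: cvg_cst.
    + by rewrite -(mulr0 D); exact: cvgMl_tmp.
  - exact: (@integrableZl _ _ _ (mu \x mu)%E setT measurableT (32 * (C * M * K3 L)) _ (@integrable_dom R)).
rewrite Rintegral_cst// mul0r in WC.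
have [N _ hN] : \forall n \near \oo, (\int[(mu \x mu)%E]_p W n p)%R < (\int[mu]_y (y * v0 y))%R.
  by near=> n; near: n; exact: (cvgr_lt 0).
exists N; have lp := lamp N; have {hN} := hN N (leqnn N).
rewrite /heat_mass.
have -> : (\int[mu]_y (y * v0_ N y))%R = lam N * (\int[mu]_y (y * v0 y))%R.
  by rewrite -RintegralZl//; apply: eq_Rintegral => y _; rewrite v0E mulrCA.
move=> WI.
have : (\int[(mu \x mu)%E]_p (p.2 * kap_ N p.1 p.2))%R <= lam N * (\int[(mu \x mu)%E]_p W N p)%R.
  rewrite -RintegralZl//; apply: le_Rintegral => //.
  - exact: integrable_moment_kap (H N).
  - by have := @integrableZl _ _ _ (mu \x mu)%E setT measurableT (lam N) _ (iW N).
  - move=> p _; rewrite /W mulrCA divff ?gt_eqF// mulr1.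
    by rewrite ler_wpM2r ?(ah_kap_ge0 (H N))// le_max lexx.
by move=> h; rewrite subr_gt0 (le_lt_trans h)// ltr_pM2l.
Unshelve. all: by end_near. Qed.

End families.
End mass.

(** * Independence *)

Section independence.
Context d (T : measurableType d) {R : realType} (P : probability T R).
Local Open Scope ereal_scope.

Definition indep_sys (G1 G2 : set (set T)) : Prop :=
  forall A B, <<s G1 >> A -> <<s G2 >> B -> P (A `&` B) = P A * P B.

Lemma big_setIP (I : eqType) (s : seq I) (A : I -> set T) w :
  (\big[setI/setT]_(i <- s) A i) w <-> forall i, i \in s -> A i w.
Proof.
elim: s => [|i s IH]; first by rewrite big_nil.
rewrite big_cons; split=> [[Ai /IH h] k|h].
  by rewrite inE => /predU1P[->|/h].
split; first by apply: h; rewrite mem_head.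
by apply/IH => k ks; apply: h; rewrite inE ks orbT.
Qed.

Lemma big_setI_sub (I : eqType) (s1 s : seq I) (A : I -> set T) : {subset s1 <= s} ->
  \big[setI/setT]_(i <- s) (if i \in s1 then A i else setT) =
  \big[setI/setT]_(i <- s1) A i.
Proof.
move=> s1s; apply/seteqP; split=> w /big_setIP h; apply/big_setIP => i si.
  by have := h i (s1s _ si); rewrite si.
by case: ifPn => // /h.
Qed.

(** Uniqueness of measures on a pi-system, used once for each side: with one event fixed, both
    members of the product formula are finite measures in the other. *)
Lemma indep_pi_sys (G1 G2 : set (set T)) :
  setI_closed G1 -> setI_closed G2 -> G1 setT -> G2 setT ->
  G1 `<=` measurable -> G2 `<=` measurable ->
  (forall A B, G1 A -> G2 B -> P (A `&` B) = P A * P B) -> indep_sys G1 G2.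
Proof.
move=> I1 I2 T1 T2 m1 m2 h.
have sm1 : <<s G1 >> `<=` measurable by apply: smallest_sub => //; exact: sigma_algebra_measurable.
have sm2 : <<s G2 >> `<=` measurable by apply: smallest_sub => //; exact: sigma_algebra_measurable.
have k0 B : (0 <= fine (P B))%R by rewrite fine_ge0.
have kE B : measurable B -> P B = (fine (P B))%:E.
  by move=> mB; rewrite fineK// fin_num_measure.
have half A B : <<s G1 >> A -> G2 B -> P (A `&` B) = P A * P B.
  move=> sA GB; have mB := m2 _ GB.
  have := @g_sigma_algebra_measure_unique _ R T G1 m1 (fun=> setT) (fun=> T1) _
    (mrestr P mB) (mscale (NngNum (k0 B)) P) I1 _ _ A sA.
  rewrite /= /mrestr /mscale/= -kE// => ->; first by rewrite muleC.
  - by rewrite bigcup_const//; exists 0%N.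
  - by move=> C GC; rewrite /= h// muleC.
  - by move=> _; rewrite /mrestr setTI (le_lt_trans (probability_le1 P mB))// ltry.
move=> A B sA sB; have mA := sm1 _ sA.
have := @g_sigma_algebra_measure_unique _ R T G2 m2 (fun=> setT) (fun=> T2) _
    (mrestr P mA) (mscale (NngNum (k0 A)) P) I2 _ _ B sB.
rewrite /= /mrestr /mscale/= -kE// (setIC A B) => ->//.
- by rewrite bigcup_const//; exists 0%N.
- by move=> C GC; rewrite /= setIC half.
- by move=> _; rewrite /mrestr setTI (le_lt_trans (probability_le1 P mA))// ltry.
Qed.

Section groups.
Variables (I : eqType) (F : I -> set (set T)).
Hypothesis FT : forall i, F i setT.
Hypothesis FI : forall i, setI_closed (F i).
Hypothesis Fm : forall i, F i `<=` measurable.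
Hypothesis indepF : mutual_indep P F.

(** The union of the F i is not stable under intersection. Finite intersections of events over
    distinct indices are, and their probabilities factorise. *)
Let cyl (J : set I) : set (set T) := [set A | exists s A_, [/\ uniq s,
  forall i, i \in s -> J i, forall i, i \in s -> F i (A_ i) &
  A = \big[setI/setT]_(i <- s) A_ i]].

Let cylT J : cyl J setT.
Proof. by exists [::], (fun=> setT); split => //; rewrite big_nil. Qed.

Let cylI J : setI_closed (cyl J).
Proof.
move=> A B [s1 [A1 [u1 J1 F1 ->]]] [s2 [A2 [u2 J2 F2 ->]]].
pose s := undup (s1 ++ s2).
exists s, (fun i => (if i \in s1 then A1 i else setT) `&` (if i \in s2 then A2 i else setT)).
split.
- exact: undup_uniq.
- by move=> i; rewrite mem_undup mem_cat => /orP[/J1|/J2].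
- by move=> i _; apply: FI; case: ifP => // h; [exact: F1|exact: F2].
- rewrite big_split/= !big_setI_sub// => i h.
    by rewrite mem_undup mem_cat h orbT.
  by rewrite mem_undup mem_cat h.
Qed.

Let cylm J : cyl J `<=` measurable.
Proof.
move=> A [s [A_ [_ _ FA ->]]]; rewrite big_seq.
apply: (big_ind measurable) => //; first by move=> *; exact: measurableI.
by move=> i /FA; exact: Fm.
Qed.

Lemma indep_groups (J1 J2 : set I) : (forall i, J1 i -> J2 i -> False) ->
  indep_sys (\bigcup_(i in J1) F i) (\bigcup_(i in J2) F i).
Proof.
move=> J12.
have sub J : <<s \bigcup_(i in J) F i >> `<=` <<s cyl J >>.
  apply: smallest_sub; first exact: smallest_sigma_algebra.
  move=> A [i Ji FA]; apply: sub_sigma_algebra.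
  exists [:: i], (fun=> A); split => //; last by rewrite big_seq1.
    by move=> k; rewrite inE => /eqP ->.
  by move=> k; rewrite inE => /eqP ->.
have h : indep_sys (cyl J1) (cyl J2).
  apply: indep_pi_sys; [exact: cylI|exact: cylI|exact: cylT|exact: cylT|exact: cylm|exact: cylm|].
  move=> A B [s1 [A1 [u1 K1 F1 ->]]] [s2 [A2 [u2 K2 F2 ->]]].
  pose A_ i := if i \in s1 then A1 i else A2 i.
  have ns i : i \in s2 -> (i \in s1) = false.
    by move=> i2; apply/negP => i1; exact: (J12 i (K1 _ i1) (K2 _ i2)).
  have E1 : \big[setI/setT]_(i <- s1) A1 i = \big[setI/setT]_(i <- s1) A_ i.
    by apply: eq_big_seq => i i1; rewrite /A_ i1.
  have E2 : \big[setI/setT]_(i <- s2) A2 i = \big[setI/setT]_(i <- s2) A_ i.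
    by apply: eq_big_seq => i i2; rewrite /A_ ns.
  have FA1 i : i \in s1 -> F i (A_ i) by move=> i1; rewrite /A_ i1; exact: F1.
  have FA2 i : i \in s2 -> F i (A_ i) by move=> i2; rewrite /A_ ns//; exact: F2.
  rewrite E1 E2 -big_cat/= !indepF//; first by rewrite big_cat.
  - rewrite cat_uniq u1 u2 andbT/=; apply/hasPn => i i2; exact: negbT (ns i i2).
  - by move=> i; rewrite mem_cat => /orP[/FA1|/FA2].
by move=> A B /sub sA /sub sB; exact: h.
Qed.

End groups.

Lemma mutual_indep_inj (I I' : eqType) (F : I -> set (set T)) (f : I' -> I) :
  injective f -> mutual_indep P F -> mutual_indep P (F \o f).
Proof.
move=> fi indF [|i0 s'] A us FA; first by rewrite !big_nil probability_setT.
set s := i0 :: s' in us FA *.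
(* Carries the events over to the index type I, through the position of i in the image list; i0 only
   serves as a default for [nth]. *)
pose A' i := A (nth i0 s (index i (map f s))).
have AE k : k \in s -> A' (f k) = A k.
  by move=> ks; rewrite /A' index_map// nth_index.
have := indF (map f s) A'; rewrite map_inj_uniq// => /(_ us).
rewrite !big_map.
have -> : \big[setI/setT]_(i <- s) A' (f i) = \big[setI/setT]_(i <- s) A i.
  by apply: eq_big_seq => k ks; rewrite AE.
have -> : \prod_(i <- s) P (A' (f i)) = \prod_(i <- s) P (A i).
  by apply: eq_big_seq => k ks; rewrite AE.
by apply=> _ /mapP[k ks ->]; rewrite AE//; exact: FA.
Qed.

(* Independence as freezing: xi sees only <<s G1 >>, the second argument of
   Psi only <<s G2 >>. *)
Lemma indep_freeze (G1 G2 : set (set T)) d' (E : measurableType d') (xi : T -> E)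
    (Psi : E * T -> \bar R) :
  G1 `<=` measurable -> G2 `<=` measurable -> indep_sys G1 G2 ->
  measurable_fun (setT : set (g_sigma_algebraType G1)) (xi : g_sigma_algebraType G1 -> E) ->
  measurable_fun setT (Psi : E * g_sigma_algebraType G2 -> \bar R) ->
  (forall p, 0 <= Psi p) ->
  \int[P]_w Psi (xi w, w) = \int[P]_w \int[P]_w' Psi (xi w, w').
Proof.
move=> m1 m2 ind mxi mPsi Psi0.
have sm1 : <<s G1 >> `<=` measurable by apply: smallest_sub => //; exact: sigma_algebra_measurable.
have sm2 : <<s G2 >> `<=` measurable by apply: smallest_sub => //; exact: sigma_algebra_measurable.
have mxi' : measurable_fun (setT : set T) xi.
  by move=> _ Y mY; rewrite setTI; apply: sm1; have := mxi measurableT Y mY; rewrite setTI.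
pose T2 := g_sigma_algebraType G2.
have mid : measurable_fun (setT : set T) (id : T -> T2).
  by move=> _ Y mY; rewrite setTI; apply: sm2.
pose Xi : {mfun T >-> E} := HB.pack xi (isMeasurableFun.Build _ _ _ _ _ mxi').
(* The identity, as a random element of T with the coarser sigma-algebra: Psi has to be measurable
   in its second argument for [<<s G2 >>] only. *)
pose Id : {mfun T >-> T2} := HB.pack (id : T -> T2) (isMeasurableFun.Build _ _ _ _ _ mid).
have mpair : measurable_fun setT (fun w : T => (xi w, w : T2)).
  exact: measurable_fun_pair.
pose Pair : {mfun T >-> (E * T2)%type} := HB.pack (fun w : T => (xi w, w : T2))
  (isMeasurableFun.Build _ _ _ _ _ mpair).
(* Independence says that the law of the pair is the product law, since this holds on rectangles;
   Tonelli then separates the two variables. *)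
have eqm (X : set (E * T2)) : measurable X ->
   (distribution P Xi \x distribution P Id) X = distribution P Pair X.
  apply: product_measure_unique => A B mA mB /=.
  rewrite /distribution /pushforward /=.
  have -> : (fun w : T => (xi w, w : T2)) @^-1` (A `*` B) = (xi @^-1` A) `&` B by [].
  rewrite ind//; have := mxi measurableT A mA; by rewrite setTI.
transitivity (\int[distribution P Pair]_p Psi p).
  by rewrite ge0_integral_distribution.
rewrite (eq_measure_integral (distribution P Xi \x distribution P Id)%E); last first.
  by move=> A mA _; exact/esym/eqm.
rewrite fubini_tonelli1//.
have mF := measurable_fun_fubini_tonelli_F (m2 := distribution P Id) Psi mPsi Psi0.
rewrite ge0_integral_distribution//; last first.
  by move=> e; apply: integral_ge0.
apply: eq_integral => w _ /=; rewrite /fubini_F.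
rewrite ge0_integral_distribution//.
have := measurableT_comp mPsi (@pair1_measurable _ _ E T2 (xi w)).
by apply.
Qed.

End independence.

(** * The branching recursion *)

Section measurability.
Context {R : realType}.

Lemma measurable_fun_nat_case d d' (S : measurableType d) (E : measurableType d')
    (K : S -> nat) (f : nat -> S -> E) :
  measurable_fun setT K -> (forall k, measurable_fun setT (f k)) ->
  measurable_fun setT (fun p => f (K p) p).
Proof.
move=> mK mf _ Y mY; rewrite setTI.
rewrite (_ : _ @^-1` Y = \bigcup_k (K @^-1` [set k] `&` f k @^-1` Y)); last first.
  apply/seteqP; split=> [p /= fp|p [k _ [/= <- //]]].
  by exists (K p) => //; split.
apply: bigcup_measurable => k _; apply: measurableI.
  by rewrite -[X in measurable X]setTI; exact: mK.
by rewrite -[X in measurable X]setTI; exact: mf.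
Qed.

Lemma measurable_truncn d (S : measurableType d) (f : S -> R) :
  measurable_fun setT f -> (forall p, 0 <= f p) ->
  measurable_fun setT (fun p => Num.truncn (f p)).
Proof.
move=> mf f0 _ Y mY; rewrite setTI.
rewrite (_ : _ @^-1` Y = \bigcup_(k in Y) (f @^-1` `[k%:R, k.+1%:R[%classic)); last first.
  apply/seteqP; split=> [p /= Yp|p [k Yk /=]]; last first.
    by rewrite in_itv/= => h; rewrite (truncn_def h).
  by exists (Num.truncn (f p)) => //=; rewrite in_itv/= truncn_itv.
apply: bigcup_measurable => k _.
by rewrite -[X in measurable X]setTI; exact: mf.
Qed.

Lemma cvg_truncn_div (s : R) : 0 <= s ->
  (Num.truncn (n.+1%:R * s))%:R / n.+1%:R @[n --> \oo] --> s.
Proof.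
move=> s0; apply/cvgrPdist_le => e e0; near=> n.
have n0 : 0 < n.+1%:R :> R by rewrite ltr0n.
have /truncn_itv/andP[h1 h2] : 0 <= n.+1%:R * s by rewrite mulr_ge0.
set k := Num.truncn _ in h1 h2 *.
have {}h2 : n.+1%:R * s < k%:R + 1 by rewrite natr1.
have -> : s - k%:R / n.+1%:R = (n.+1%:R * s - k%:R) / n.+1%:R.
  by rewrite mulrBl mulrAC mulfV ?mul1r ?gt_eqF.
rewrite ger0_norm ?divr_ge0 ?subr_ge0 ?ler0n//.
rewrite ler_pdivrMr// (@le_trans _ _ 1)//; first by rewrite lerBlDl ltW.
rewrite mulrC -ler_pdivrMr// mul1r.
have : (e^-1 <= n%:R :> R) by near: n; exact: nbhs_infty_ger.
by move/le_trans; apply; rewrite ler_nat.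
Unshelve. all: by end_near. Qed.

(** What [is_bbm] says without reference to the probability. It can therefore also be stated for a
    sub-sigma-algebra, to track which labels a quantity depends on. *)
Record bbm_measurable d (T : measurableType d) (X : bbm_data R T) : Prop := {
  bmm_lifetime : forall u, measurable_fun setT (lifetime X u);
  bmm_offspring : forall u, measurable_fun setT (offspring X u);
  bmm_motion : forall u s, 0 <= s -> measurable_fun setT (motion X u s);
  bmm_continuous : forall u w,
    {within `[0, +oo[%classic, continuous (fun s => motion X u s w)};
  bmm_lifetime_ge0 : forall u w, 0 <= lifetime X u w
}.

(** Times below 0 carry no information in [motion]; clamping them makes the path jointly measurable
    on the whole line. *)
Definition mot (T : Type) (X : bbm_data R T) (u : label) (s : R) (w : T) : R :=
  motion X u (Num.max s 0) w.

Lemma mot_ge0 (T : Type) (X : bbm_data R T) u s w : 0 <= s -> mot X u s w = motion X u s w.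
Proof. by move=> s0; rewrite /mot max_l. Qed.

(** Continuous paths are limits of their discretisations in time, which are jointly measurable. At
    time 0, where continuity is one-sided, the discretisation is exact. *)
Lemma measurable_mot d (T : measurableType d) (X : bbm_data R T) u :
  (forall s, 0 <= s -> measurable_fun setT (motion X u s)) ->
  (forall w, {within `[0, +oo[%classic, continuous (fun s => motion X u s w)}) ->
  measurable_fun setT (fun p : R * T => mot X u p.1 p.2).
Proof.
move=> mB cB.
pose m (p : R * T) := Num.max p.1 0.
have m0 p : 0 <= m p by rewrite le_max lexx orbT.
have mm : measurable_fun setT m by apply: measurable_maxr.
pose h n (p : R * T) := motion X u ((Num.truncn (n.+1%:R * m p))%:R / n.+1%:R) p.2.
apply: (@measurable_fun_cvg _ _ _ setT h) => [n|p _].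
  pose f k (p : R * T) := motion X u (k%:R / n.+1%:R) p.2.
  apply: (@measurable_fun_nat_case _ _ _ _ (fun p => Num.truncn (n.+1%:R * m p)) f).
    by apply: measurable_truncn => [|p]; [exact: measurable_funM|rewrite mulr_ge0].
  move=> k; apply: (measurableT_comp (f := motion X u (k%:R / n.+1%:R))) => //.
  by apply: mB; rewrite divr_ge0.
have sc : (fun n => (Num.truncn (n.+1%:R * m p))%:R / n.+1%:R) @ \oo --> m p.
  exact: cvg_truncn_div.
have /continuous_within_itvcyP[c1 c2] := cB p.2.
rewrite /mot -/(m p); move: (m0 p); rewrite le_eqVlt => /orP[/eqP mp|mp]; last first.
  have cm : motion X u y p.2 @[y --> m p] --> motion X u (m p) p.2.
    by apply: c1; rewrite in_itv/= mp.
  exact: (cvg_comp _ _ sc cm).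
rewrite /h -mp.
have -> : (fun n => motion X u ((Num.truncn (n.+1%:R * 0 : R))%:R / n.+1%:R) p.2) =
  (fun=> motion X u 0 p.2).
  by apply/funext => n; rewrite mulr0 truncn0 mul0r.
exact: cvg_cst.
Qed.

Lemma measurable_mot2 d d' (T : measurableType d) (S : measurableType d') (X : bbm_data R T) u
   (f : S -> R) (g : S -> T) :
  (forall s, 0 <= s -> measurable_fun setT (motion X u s)) ->
  (forall w, {within `[0, +oo[%classic, continuous (fun s => motion X u s w)}) ->
  measurable_fun setT f -> measurable_fun setT g ->
  measurable_fun setT (fun p => mot X u (f p) (g p)).
Proof.
move=> mB cB mf mg.
apply: (measurableT_comp (g := fun p => (f p, g p)) (measurable_mot mB cB)).
exact: measurable_fun_pair.
Qed.

(** Labels list the youngest generation first, so the descendants of the j-th child of the root are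
    the labels ending in j. *)
Definition sub_bbm (T : Type) (X : bbm_data R T) (j : nat) : bbm_data R T :=
  BBMData (fun v => lifetime X (rcons v j)) (fun v => offspring X (rcons v j))
    (fun v => motion X (rcons v j)).

Lemma sub_bbm_measurable d (T : measurableType d) (X : bbm_data R T) j :
  bbm_measurable X -> bbm_measurable (sub_bbm X j).
Proof.
move=> mX; split => /=.
- by move=> u; exact: (bmm_lifetime mX).
- by move=> u; exact: (bmm_offspring mX).
- by move=> u; exact: (bmm_motion mX).
- by move=> u; exact: (bmm_continuous mX).
- by move=> u; exact: (bmm_lifetime_ge0 mX).
Qed.

(* The product of F over the positions at time t of the particles of the
   first n generations, started from x. *)
Fixpoint trunc_prod (T : Type) (n : nat) (X : bbm_data R T) (F : R -> R) (t x : R) (w : T) : R :=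
  if n is m.+1 then
    let tau := lifetime X [::] w in
    if t < tau then F (x + mot X [::] t w) else
    \prod_(j <- iota 0 (offspring X [::] w))
      trunc_prod m (sub_bbm X j) F (t - tau) (x + mot X [::] tau w) w
  else 1.

Lemma trunc_prodS (T : Type) n (X : bbm_data R T) (F : R -> R) t x w :
  trunc_prod n.+1 X F t x w =
  if t < lifetime X [::] w then F (x + mot X [::] t w) else
  \prod_(j <- iota 0 (offspring X [::] w)) trunc_prod n (sub_bbm X j) F
     (t - lifetime X [::] w) (x + mot X [::] (lifetime X [::] w) w) w.
Proof. by []. Qed.

Lemma measurable_trunc_prod d (T : measurableType d) n (X : bbm_data R T) (F : R -> R) :
  bbm_measurable X -> measurable_fun setT F ->
  measurable_fun setT (fun p : (R * R) * T => trunc_prod n X F p.1.1 p.1.2 p.2).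
Proof.
move=> + mF; elim: n X => [|n IH] X mX; first exact: measurable_cst.
have m11 : measurable_fun setT (fun p : (R * R) * T => p.1.1) by exact: measurableT_comp.
have m12 : measurable_fun setT (fun p : (R * R) * T => p.1.2) by exact: measurableT_comp.
have mtau : measurable_fun setT (fun p : (R * R) * T => lifetime X [::] p.2).
  by apply: measurableT_comp; [exact: bmm_lifetime|exact: measurable_snd].
apply: measurable_fun_ifT.
- exact: measurable_fun_ltr.
- apply: measurableT_comp => //; apply: measurable_funD => //.
  apply: measurable_mot2 => //; [exact: bmm_motion|exact: bmm_continuous].
- pose f k (p : (R * R) * T) := \prod_(j <- iota 0 k)
    trunc_prod n (sub_bbm X j) F (p.1.1 - lifetime X [::] p.2)
      (p.1.2 + mot X [::] (lifetime X [::] p.2) p.2) p.2.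
  apply: (@measurable_fun_nat_case _ _ _ _ (fun p => offspring X [::] p.2) f).
    by apply: measurableT_comp; [exact: bmm_offspring|exact: measurable_snd].
  move=> k; apply: measurable_prod => j _.
  pose h (p : (R * R) * T) := ((p.1.1 - lifetime X [::] p.2,
      p.1.2 + mot X [::] (lifetime X [::] p.2) p.2), p.2).
  apply: (measurableT_comp (g := h) (IH (sub_bbm X j) (sub_bbm_measurable j mX))).
  apply: measurable_fun_pair; last exact: measurable_snd.
  apply: measurable_fun_pair; first exact: measurable_funB.
  apply: measurable_funD => //.
  apply: measurable_mot2 => //; [exact: bmm_motion|exact: bmm_continuous].
Qed.

Lemma measurable_trunc_prod2 d d' (T : measurableType d) (S : measurableType d') n
    (X : bbm_data R T) (F : R -> R) (f g : S -> R) (h : S -> T) :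
  bbm_measurable X -> measurable_fun setT F ->
  measurable_fun setT f -> measurable_fun setT g -> measurable_fun setT h ->
  measurable_fun setT (fun p => trunc_prod n X F (f p) (g p) (h p)).
Proof.
move=> mX mF mf mg mh.
apply: (measurableT_comp (g := fun p => ((f p, g p), h p)) (measurable_trunc_prod n mX mF)).
by apply: measurable_fun_pair => //; exact: measurable_fun_pair.
Qed.

Lemma prod_01 (I : Type) (s : seq I) (f : I -> R) : (forall i, 0 <= f i <= 1) ->
  0 <= \prod_(i <- s) f i <= 1.
Proof.
move=> f01; elim: s => [|i s /andP[IH1 IH2]]; first by rewrite big_nil ler01 lexx.
rewrite big_cons; have /andP[h1 h2] := f01 i.
by rewrite mulr_ge0//= mulr_ile1.
Qed.

Lemma trunc_prod_01 (T : Type) n (X : bbm_data R T) (F : R -> R) t x w :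
  (forall y, 0 <= F y <= 1) -> 0 <= trunc_prod n X F t x w <= 1.
Proof.
move=> F01; elim: n X t x => [|n IH] X t x /=; first by rewrite ler01 lexx.
by case: ifP => // _; exact: prod_01.
Qed.

Lemma trunc_prod_le (T : Type) n (X : bbm_data R T) (F : R -> R) t x w :
  (forall y, 0 <= F y <= 1) -> trunc_prod n.+1 X F t x w <= trunc_prod n X F t x w.
Proof.
move=> F01; elim: n X t x => [|n IH] X t x.
  by have /andP[] := trunc_prod_01 1 X t x w F01.
rewrite trunc_prodS [leRHS]trunc_prodS; case: ifP => // _.
by apply: ler_prod => j _; rewrite IH andbT; have /andP[] := trunc_prod_01 n.+1 (sub_bbm X j)
  (t - lifetime X [::] w) (x + mot X [::] (lifetime X [::] w) w) w F01.
Qed.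

End measurability.

Section laws.
Context {R : realType}.
Local Notation mu := (@lebesgue_measure R).

(** Layer cake: f is the integral over r of the indicator of 0 < r < f, so that the identity on sets
    extends to functions by Tonelli. *)
Lemma integral_density (m : probability (measurableTypeR R) R) (f h : R -> R) :
  measurable_fun setT f -> measurable_fun setT h -> (forall x, 0 <= f x) -> (forall x, 0 <= h x) ->
  (forall A, measurable A -> m A = \int[mu]_(x in A) (h x)%:E)%E ->
  (\int[m]_x (f x)%:E = \int[mu]_x (f x * h x)%:E)%E.
Proof.
move=> mf mh f0 h0 mE.
pose k (p : R * R) : R := ((0 < p.2) && (p.2 < f p.1))%R%:R.
have mk : measurable_fun setT k.
  apply: (measurableT_comp (f := fun b : bool => b%:R : R)) => //.
  apply: measurable_and; apply: measurable_fun_ltr => //.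
  exact: measurableT_comp.
have fE x : ((f x)%:E = \int[mu]_r (k (x, r))%:E)%E.
  rewrite -[LHS](integral_indic_oo (f0 x)).
  by apply: eq_integral => r _; rewrite /k indicE mem_setE in_itv.
transitivity (\int[m]_x \int[mu]_r (k (x, r))%:E)%E.
  by apply: eq_integral => x _; rewrite -fE.
rewrite (@fubini_tonelli _ _ _ _ _ m mu (fun p => (k p)%:E)); last 2 first.
- exact/measurable_EFinP.
- by move=> p; rewrite lee_fin ler0n.
transitivity (\int[mu]_r \int[mu]_x (k (x, r) * h x)%:E)%E.
  apply: eq_integral => r _.
  have mA : measurable [set x | 0 < r < f x].
    rewrite -[X in measurable X]setTI.
    apply: (measurable_and (f := fun=> 0 < r) (g := fun x => r < f x)) => //.
    exact: measurable_fun_ltr.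
  transitivity (\int[m]_x (\1_[set x | 0 < r < f x] x)%:E)%E.
    by apply: eq_integral => x _; rewrite /k/= indicE mem_setE.
  transitivity (m [set x | 0 < r < f x]); first by rewrite integral_indic// setIT.
  transitivity (\int[mu]_(x in [set x | (0 < r < f x)%R]) (h x)%:E)%E; first exact: mE.
  rewrite integral_mkcond.
  apply: eq_integral => x _; rewrite patchE /k/=.
  have [rx|rx] := boolP (0 < r < f x)%R; first by rewrite mem_set// mul1r.
  by rewrite memNset ?mul0r//; exact/negP.
rewrite -(@fubini_tonelli _ _ _ _ _ mu mu (fun p => (k p * h p.1)%:E)); last 2 first.
- by apply/measurable_EFinP; apply: measurable_funM => //; exact: measurableT_comp.
- by move=> p; rewrite lee_fin mulr_ge0 ?ler0n.
apply: eq_integral => x _.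
under eq_integral do rewrite /= EFinM muleC.
rewrite ge0_integralZl ?lee_fin//; last 2 first.
- apply/measurable_EFinP; apply: (measurableT_comp mk).
  exact: pair1_measurable.
- by move=> r _; rewrite lee_fin ler0n.
by rewrite -fE muleC.
Qed.

End laws.

Lemma measurable_fun_gen d (T : measurableType d) (G : set (set T)) d' (E : measurableType d')
    (f : T -> E) : sigma_rv f `<=` <<s G >> ->
  measurable_fun (setT : set (g_sigma_algebraType G)) (f : g_sigma_algebraType G -> E).
Proof.
by move=> h _ Y mY; rewrite setTI; apply: h; exists Y => //; rewrite setTI.
Qed.

Lemma bigcupB (R : eqType) T (F : R -> set (set T)) (J : set R) i : J i ->
  F i `<=` <<s \bigcup_(k in J) F k >>.
Proof. by move=> Ji A FA; apply: sub_sigma_algebra; exists i. Qed.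

Section laws2.
Context d (T : measurableType d) {R : realType} (P : probability T R).
Local Notation mu := (@lebesgue_measure R).

Lemma integral_law_density (X : T -> R) (f h : R -> R) :
  measurable_fun setT X ->
  measurable_fun setT f -> measurable_fun setT h -> (forall x, 0 <= f x) -> (forall x, 0 <= h x) ->
  (forall A, measurable A -> P (X @^-1` A) = \int[mu]_(x in A) (h x)%:E)%E ->
  (\int[P]_w (f (X w))%:E = \int[mu]_x (f x * h x)%:E)%E.
Proof.
move=> mX mf mh f0 h0 XE.
have mX' : measurable_fun setT (X : T -> measurableTypeR R).
  by move=> _ Y mY; exact: (mX measurableT Y mY).
pose X' : {RV P >-> measurableTypeR R} := HB.pack (X : T -> measurableTypeR R)
  (@isMeasurableFun.Build _ _ T (measurableTypeR R) _ mX').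
rewrite -(@integral_density R (distribution P X') f h)//.
by rewrite (@ge0_integral_distribution _ _ _ _ _ _ X' (EFin \o f))//; exact/measurable_EFinP.
Qed.

Lemma integral_nat_law (K : T -> nat) (f : nat -> R) :
  measurable_fun setT K -> (forall k, 0 <= f k) ->
  (\int[P]_w (f (K w))%:E = \sum_(0 <= k <oo) (f k)%:E * P (K @^-1` [set k]))%E.
Proof.
move=> mK f0.
have mKk k : measurable (K @^-1` [set k]).
  by rewrite -[X in measurable X]setTI; exact: mK.
have <- : \bigcup_k (K @^-1` [set k]) = setT.
  by apply/seteqP; split=> // w _; exists (K w).
rewrite ge0_integral_bigcup//; last 3 first.
- apply: measurable_funTS; apply/measurable_EFinP.
  exact: (measurableT_comp (f := f)).
- by move=> w _; rewrite lee_fin.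
- by move=> i j _ _ [w [/= <- <-]].
apply: eq_eseriesr => k _; rewrite -integral_cst//.
by apply: eq_integral => w; rewrite inE /= => ->.
Qed.

Lemma integral_exponential_law (X : T -> R) (f : R -> R) :
  measurable_fun setT X ->
  (forall A, measurable A -> P (X @^-1` A) = exponential_prob 1 A) ->
  measurable_fun setT f -> (forall x, 0 <= f x) ->
  (\int[P]_w (f (X w))%:E = \int[mu]_x (f x * exponential_pdf 1 x)%:E)%E.
Proof.
move=> mX XE mf f0; apply: integral_law_density => //.
- exact: measurable_exponential_pdf.
- by move=> x; exact: exponential_pdf_ge0.
Qed.

Lemma integral_brownian (B : R -> T -> R) s (f : R -> R) x : brownian_motion P B -> 0 < s ->
  measurable_fun setT f -> (forall x, 0 <= f x) ->
  (\int[P]_w (f (x + B s w))%:E = \int[mu]_y (hk s (x - y) * f y)%:E)%E.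
Proof.
move=> bB s0 mf f0.
transitivity (\int[mu]_z (f (x + z)%R * normal_pdf 0 (Num.sqrt s) z)%:E)%E.
  apply: (@integral_law_density (B s) (fun z => f (x + z))) => //.
  - by apply: (bm_measurable bB); exact: ltW.
  - apply: (measurableT_comp mf); exact: measurable_funD.
  - exact: measurable_normal_pdf.
  - by move=> y; exact: normal_pdf_ge0.
  - move=> A mA; have := bm_increments bB (lexx 0) s0 mA.
    rewrite subr0 /normal_prob => <-.
    have -> // : (fun w => B s w - B 0 w) = B s.
    by apply/funext => w /=; rewrite (bm_start bB) subr0.
rewrite -(@integral_shift R (fun y => (hk s (x - y)%R * f y)%:E) x); last 2 first.
- apply/measurable_EFinP; apply: measurable_funM => //.
  by apply: measurable_hk2 => //; exact: measurable_funB.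
- by move=> y; rewrite lee_fin mulr_ge0// hk_ge0.
apply: eq_integral => z _; rewrite addrC mulrC -hk_normal//.
by rewrite (_ : x - (z + x) = - z) ?hkN// (addrC z); ring.
Qed.

End laws2.

(** With K the offspring number, 1 - E[(1 - u)^K]: the value of 1 - E[prod F] at a split when it is
    u for each child. *)
Definition bpgf {R : realType} (p : nat -> R) (u : R) : R :=
  fine (\sum_(0 <= k <oo) ((1 - (1 - u) ^+ k)%:E * (p k)%:E))%E.

(** * Decomposition at the first splitting time *)

Section branching.
Context d (T : measurableType d) {R : realType} (P : probability T R) (p : nat -> R).
Local Notation mu := (@lebesgue_measure R).

Definition fam (X : bbm_data R T) (i : label + label + label) : set (set T) :=
  match i with
  | inl (inl u) => sigma_rv (lifetime X u)
  | inl (inr u) => sigma_rv (offspring X u)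
  | inr u => sigma_process (motion X u)
  end.

Definition lab (i : label + label + label) : label :=
  match i with inl (inl u) => u | inl (inr u) => u | inr u => u end.

Lemma bbm_is_measurable X : is_bbm P p X -> bbm_measurable X.
Proof.
move=> bX; split.
- exact: lifetime_measurable bX.
- exact: offspring_measurable bX.
- by move=> u; exact: (bm_measurable (motion_brownian bX u)).
- by move=> u; exact: (bm_continuous (motion_brownian bX u)).
- exact: lifetime_ge0 bX.
Qed.

Lemma sigma_rv_setT d' (E : measurableType d') (f : T -> E) : sigma_rv f setT.
Proof. by exists setT => //; rewrite setTI. Qed.

Lemma sigma_rv_setI d' (E : measurableType d') (f : T -> E) : setI_closed (sigma_rv f).
Proof.
move=> _ _ [A mA <-] [B mB <-]; exists (A `&` B); first exact: measurableI.
by rewrite !setTI.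
Qed.

Lemma sigma_rv_meas d' (E : measurableType d') (f : T -> E) : measurable_fun setT f ->
  sigma_rv f `<=` measurable.
Proof. by move=> mf _ [A mA <-]; exact: mf. Qed.

Lemma fam_setT X i : fam X i setT.
Proof.
case: i => [[u|u]|u]; [exact: sigma_rv_setT|exact: sigma_rv_setT|].
exact: (@measurableT _ (g_sigma_algebraType _)).
Qed.

Lemma fam_setI X i : setI_closed (fam X i).
Proof.
case: i => [[u|u]|u]; [exact: sigma_rv_setI|exact: sigma_rv_setI|].
by move=> A B; exact: (@measurableI _ (g_sigma_algebraType _)).
Qed.

Lemma fam_meas X i : bbm_measurable X -> fam X i `<=` measurable.
Proof.
move=> mX; case: i => [[u|u]|u].
- by apply: sigma_rv_meas; exact: bmm_lifetime.
- by apply: sigma_rv_meas; exact: bmm_offspring.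
- apply: smallest_sub; first exact: sigma_algebra_measurable.
  by move=> A [t t0]; apply: sigma_rv_meas; exact: bmm_motion.
Qed.

Lemma famJ_meas X J : bbm_measurable X -> \bigcup_(i in J) fam X i `<=` measurable.
Proof. by move=> mX A [i _]; exact: fam_meas. Qed.

Section gen.
Variables (X : bbm_data R T) (J : set (label + label + label)).
Hypothesis mX : bbm_measurable X.
Let TJ := g_sigma_algebraType (\bigcup_(i in J) fam X i).

Lemma gen_lifetime u : J (inl (inl u)) ->
  measurable_fun (setT : set TJ) (lifetime X u : TJ -> R).
Proof. by move=> Ju; apply: measurable_fun_gen; exact: (bigcupB (i := inl (inl u))). Qed.

Lemma gen_offspring u : J (inl (inr u)) ->
  measurable_fun (setT : set TJ) (offspring X u : TJ -> nat).
Proof. by move=> Ju; apply: measurable_fun_gen; exact: (bigcupB (i := inl (inr u))). Qed.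

Lemma gen_motion u : J (inr u) ->
  forall s, 0 <= s -> measurable_fun (setT : set TJ) (motion X u s : TJ -> R).
Proof.
move=> Ju s s0; apply: measurable_fun_gen.
apply: (subset_trans _ (bigcupB (i := inr u) Ju)).
by move=> A sA; apply: sub_sigma_algebra; exists s.
Qed.

Lemma gen_sub j : (forall i v, lab i = rcons v j -> J i) ->
  bbm_measurable (sub_bbm X j : bbm_data R TJ).
Proof.
move=> h; split => /=.
- by move=> u; apply: gen_lifetime; exact: (h (inl (inl (rcons u j))) u).
- by move=> u; apply: gen_offspring; exact: (h (inl (inr (rcons u j))) u).
- by move=> u; apply: gen_motion; exact: (h (inr (rcons u j)) u).
- by move=> u; exact: (bmm_continuous mX).
- by move=> u; exact: (bmm_lifetime_ge0 mX).
Qed.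

End gen.

Lemma sub_is_bbm X j : is_bbm P p X -> is_bbm P p (sub_bbm X j).
Proof.
move=> bX; split => /=.
- by move=> u; exact: lifetime_measurable bX _.
- by move=> u; exact: lifetime_ge0 bX _.
- by move=> u; exact: lifetime_law bX _.
- by move=> u; exact: offspring_measurable bX _.
- by move=> u; exact: offspring_lawE bX _.
- by move=> u; exact: motion_brownian bX _.
- pose f (i : label + label + label) : label + label + label :=
    match i with inl (inl u) => inl (inl (rcons u j)) | inl (inr u) => inl (inr (rcons u j))
    | inr u => inr (rcons u j) end.
  have fi : injective f.
    by move=> [[u|u]|u] [[v|v]|v] //= [/rcons_inj[->]].
  have := mutual_indep_inj fi (bbm_indep bX).
  by congr (mutual_indep P _); apply/funext => -[[u|u]|u].
Qed.

Lemma fam_indep X J1 J2 : is_bbm P p X -> (forall i, J1 i -> J2 i -> False) ->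
  indep_sys P (\bigcup_(i in J1) fam X i) (\bigcup_(i in J2) fam X i).
Proof.
move=> bX J12; apply: indep_groups => //.
- exact: fam_setT.
- exact: fam_setI.
- by move=> i; apply: fam_meas; exact: bbm_is_measurable.
- exact: bbm_indep bX.
Qed.

Definition children (Q : set nat) : set (label + label + label) :=
  [set i | exists v j, Q j /\ lab i = rcons v j].

(** Induction on k: the first k subtrees involve labels disjoint from those of the next one, so that
    they can be frozen while the next one is averaged. *)
Lemma expectation_siblings X n (F : R -> R) t x (c : R) k : is_bbm P p X ->
  measurable_fun setT F -> (forall y, 0 <= F y <= 1) ->
  (forall j, \int[P]_w (trunc_prod n (sub_bbm X j) F t x w)%:E = c%:E)%E ->
  (\int[P]_w (\prod_(j <- iota 0 k) trunc_prod n (sub_bbm X j) F t x w)%:E = (c ^+ k)%:E)%E.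
Proof.
move=> bX mF F01 cE; elim: k => [|k IH].
  under eq_integral do rewrite big_nil.
  by rewrite integral_cst//= probability_setT mule1 expr0.
have mX := bbm_is_measurable bX.
have tp0 j w : 0 <= trunc_prod n (sub_bbm X j) F t x w.
  by have /andP[] := trunc_prod_01 n (sub_bbm X j) t x w F01.
pose J1 := children [set j | (j < k)%N]; pose J2 := children [set k].
pose G1 := \bigcup_(i in J1) fam X i; pose G2 := \bigcup_(i in J2) fam X i.
have ind : indep_sys P G1 G2.
  apply: fam_indep => // i [v [j [/= jk iE]]] [v' [_ [/= ->]]].
  rewrite iE => /rcons_inj[_ jE]; by rewrite jE ltnn in jk.
pose xi w := \prod_(j <- iota 0 k) trunc_prod n (sub_bbm X j) F t x w.
have xi0 w : 0 <= xi w by apply: prodr_ge0.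
have mxi : measurable_fun (setT : set (g_sigma_algebraType G1)) (xi : g_sigma_algebraType G1 -> R).
  apply: measurable_prod => j; rewrite mem_iota add0n => /andP[_ jk].
  apply: (@measurable_trunc_prod2 _ _ _ (g_sigma_algebraType G1) (g_sigma_algebraType G1)
    n (sub_bbm X j) F _ _ id) => //.
  by apply: (@gen_sub X J1 mX) => // i v iE; exists v, j.
have mxi' : measurable_fun setT xi.
  by apply: measurable_prod => j _; apply: measurable_trunc_prod2 => //; exact: sub_bbm_measurable.
(* The maximum with 0 makes Psi nonnegative everywhere and changes nothing on the values of xi. *)
pose Psi (e : R * T) := (Num.max e.1 0 * trunc_prod n (sub_bbm X k) F t x e.2)%:E.
have mPsi : measurable_fun setT (Psi : R * g_sigma_algebraType G2 -> \bar R).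
  apply/measurable_EFinP; apply: measurable_funM => //; first exact: measurable_maxr.
  apply: (@measurable_trunc_prod2 _ _ _ (g_sigma_algebraType G2) (R * g_sigma_algebraType G2)%type
    n (sub_bbm X k) F _ _ snd) => //.
  by apply: (@gen_sub X J2 mX) => // i v iE; exists v, k.
have Psi0 e : (0 <= Psi e)%E by rewrite lee_fin mulr_ge0// le_max lexx orbT.
have := indep_freeze (famJ_meas mX) (famJ_meas mX) ind mxi mPsi Psi0.
rewrite /Psi /= => h.
transitivity (\int[P]_w (Num.max (xi w) 0 * trunc_prod n (sub_bbm X k) F t x w)%:E)%E.
  apply: eq_integral => w _; rewrite max_l// /xi.
  rewrite [_ :: _](_ : _ = rcons (iota 0 k) k) ?big_rcons//.
  by rewrite -[LHS]/(iota 0 k.+1) -addn1 iotaD cats1.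
rewrite h exprSr EFinM -IH -ge0_integralZr ?lee_fin//; last 3 first.
- exact/measurable_EFinP.
- by move=> w _; rewrite lee_fin; exact: xi0.
- by rewrite -lee_fin -(cE k); apply: integral_ge0 => w _; rewrite lee_fin.
apply: eq_integral => w _.
rewrite max_l//; under eq_integral do rewrite EFinM.
rewrite ge0_integralZl ?lee_fin ?cE//; last first.
  by move=> w' _; rewrite lee_fin.
apply/measurable_EFinP; apply: measurable_trunc_prod2 => //; exact: sub_bbm_measurable.
Qed.

Lemma fam_freeze X J1 J2 d' (E : measurableType d') (xi : T -> E) (Psi : E * T -> R) :
  is_bbm P p X -> (forall i, J1 i -> J2 i -> False) ->
  let T1 := g_sigma_algebraType (\bigcup_(i in J1) fam X i) in
  let T2 := g_sigma_algebraType (\bigcup_(i in J2) fam X i) in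
  measurable_fun (setT : set T1) (xi : T1 -> E) ->
  measurable_fun setT (Psi : E * T2 -> R) -> (forall q, 0 <= Psi q) ->
  (\int[P]_w (Psi (xi w, w))%:E = \int[P]_w \int[P]_w' (Psi (xi w, w'))%:E)%E.
Proof.
move=> bX J12 T1 T2 mxi mPsi Psi0; have mX := bbm_is_measurable bX.
have mPsi' : measurable_fun setT (EFin \o Psi : E * T2 -> \bar R) by exact/measurable_EFinP.
have Psi0' q : (0 <= (EFin \o Psi) q)%E by rewrite lee_fin.
exact: (indep_freeze (famJ_meas mX) (famJ_meas mX) (fam_indep bX J12) mxi mPsi' Psi0').
Qed.

Lemma expectation_compl (f : T -> R) (c : R) : measurable_fun setT f -> (forall w, 0 <= f w <= 1) ->
  (\int[P]_w (f w)%:E = c%:E -> \int[P]_w (1 - f w)%:E = (1 - c)%:E)%E.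
Proof.
move=> mf f01 fE.
have : (\int[P]_w (1 - f w)%:E + \int[P]_w (f w)%:E = 1)%E.
  rewrite -ge0_integralD//; last 4 first.
  - by move=> w _; rewrite lee_fin subr_ge0; case/andP: (f01 w).
  - by apply/measurable_EFinP; exact: measurable_funB.
  - by move=> w _; rewrite lee_fin; case/andP: (f01 w).
  - exact/measurable_EFinP.
  under eq_integral do rewrite -EFinD subrK.
  by rewrite integral_cst//= probability_setT mul1e.
rewrite fE => h; rewrite EFinB -h -addeA subee// ?adde0//.
Qed.

Lemma expectation_01 (f : T -> R) : measurable_fun setT f -> (forall w, 0 <= f w <= 1) ->
  (0 <= \int[P]_w (f w)%:E <= 1)%E.
Proof.
move=> mf f01; apply/andP; split.
  by apply: integral_ge0 => w _; rewrite lee_fin; case/andP: (f01 w).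
apply: (@le_trans _ _ (\int[P]_w (cst 1%E) w)%E).
  apply: ge0_le_integral => //.
  - by move=> w _; rewrite lee_fin; case/andP: (f01 w).
  - exact/measurable_EFinP.
  - by move=> w _; rewrite lee_fin; case/andP: (f01 w).
by rewrite integral_cst//= probability_setT mul1e.
Qed.

Lemma fin_num_01 (e : \bar R) : (0 <= e <= 1)%E -> e \is a fin_num.
Proof. by move=> /andP[e0 e1]; rewrite ge0_fin_numE// (le_lt_trans e1)// ltry. Qed.

Lemma fine_01 (e : \bar R) : (0 <= e <= 1)%E -> 0 <= fine e <= 1.
Proof.
by move=> h; have /andP[e0 e1] := h; rewrite fine_ge0//= -lee_fin fineK// fin_num_01.
Qed.

Lemma expr_01 (u : R) k : 0 <= u <= 1 -> 0 <= (1 - u) ^+ k <= 1.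
Proof. by move=> /andP[u0 u1]; rewrite exprn_ge0 ?exprn_ile1//; lra. Qed.

Lemma compl_01 (u : R) : 0 <= u <= 1 -> 0 <= 1 - u <= 1.
Proof. by move=> /andP[u0 u1]; apply/andP; split; lra. Qed.

Lemma expectation_offspring X v (u : R) : is_bbm P p X -> 0 <= u <= 1 ->
  (\int[P]_w (1 - (1 - u) ^+ offspring X v w)%:E = (bpgf p u)%:E)%E.
Proof.
move=> bX u01.
have h k : 0 <= 1 - (1 - u) ^+ k <= 1 by exact/compl_01/expr_01.
have E : (\int[P]_w (1 - (1 - u) ^+ offspring X v w)%:E =
   \sum_(0 <= k <oo) (1 - (1 - u) ^+ k)%:E * (p k)%:E)%E.
  rewrite (@integral_nat_law _ _ _ P _ (fun k => 1 - (1 - u) ^+ k)).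
  - by apply: eq_eseriesr => k _; rewrite (offspring_lawE bX).
  - exact: offspring_measurable bX v.
  - by move=> k; case/andP: (h k).
rewrite /bpgf -E fineK// fin_num_01// expectation_01//.
apply: (measurableT_comp (f := fun k : nat => 1 - (1 - u) ^+ k)) => //.
exact: offspring_measurable bX v.
Qed.

Lemma bpgf_01 X u : is_bbm P p X -> 0 <= u <= 1 -> 0 <= bpgf p u <= 1.
Proof.
move=> bX u01; rewrite -!lee_fin -(expectation_offspring [::] bX u01).
apply: expectation_01 => [|w]; last exact/compl_01/expr_01.
apply: (measurableT_comp (f := fun k : nat => 1 - (1 - u) ^+ k)) => //.
exact: offspring_measurable bX _.
Qed.

Lemma measurable_compl_expr d' (S : measurableType d') (f : S -> R) (K : S -> nat) :
  measurable_fun setT f -> measurable_fun setT K ->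
  measurable_fun setT (fun s => 1 - (1 - f s) ^+ K s).
Proof.
move=> mf mK; apply: (@measurable_fun_nat_case _ _ _ _ K (fun k s => 1 - (1 - f s) ^+ k)) => // k.
apply: measurable_funB => //; apply: measurable_funX; exact: measurable_funB.
Qed.

Lemma measurable_bpgf d' (S : measurableType d') (f : S -> R) X : is_bbm P p X ->
  measurable_fun setT f -> (forall s, 0 <= f s <= 1) ->
  measurable_fun setT (fun s => bpgf p (f s)).
Proof.
move=> bX mf f01.
pose h (q : S * T) := (1 - (1 - f q.1) ^+ offspring X [::] q.2)%:E.
have mh : measurable_fun setT h.
  apply/measurable_EFinP; apply: measurable_compl_expr; first exact: measurableT_comp.
  by apply: measurableT_comp => //; exact: offspring_measurable bX _.
have h0 q : (0 <= h q)%E.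
  by rewrite lee_fin; case/andP: (compl_01 (expr_01 (offspring X [::] q.2) (f01 q.1))).
have mF := measurable_fun_fubini_tonelli_F (m2 := P) h mh h0.
have -> : (fun s => bpgf p (f s)) = (fun s => fine (fubini_F P h s)).
  by apply/funext => s; rewrite /fubini_F /h/= (expectation_offspring [::] bX).
exact: measurableT_comp.
Qed.

(** The heat semigroup, with its value at time 0 given separately because [hk] vanishes there. *)
Definition heat (s : R) (f : R -> R) (x : R) : R :=
  if 0 < s then fine (\int[mu]_y (hk s (x - y) * f y)%:E)%E else f x.

Lemma expectation_heat X u (s : R) (f : R -> R) (x : R) : is_bbm P p X -> 0 <= s -> measurable_fun setT f ->
  (forall y, 0 <= f y <= 1) ->
  (\int[P]_w (f (x + mot X u s w))%:E = (heat s f x)%:E)%E.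
Proof.
move=> bX s0 mf f01; have bB := motion_brownian bX u.
have E01 : (0 <= \int[P]_w (f (x + mot X u s w)%R)%:E <= 1)%E.
  apply: expectation_01 => //; apply: (measurableT_comp mf); apply: measurable_funD => //.
  by apply: measurable_mot2 => //; [exact: (bm_measurable bB)|exact: (bm_continuous bB)].
rewrite /heat; case: ifPn => [s1|].
  rewrite -(integral_brownian x bB s1 mf); last by move=> y; case/andP: (f01 y).
  have E : (fun w => mot X u s w) = motion X u s by apply/funext => w; rewrite mot_ge0.
  by rewrite -E fineK// fin_num_01.
rewrite -leNgt => s2; have {s2}-> : s = 0 by apply/eqP; rewrite eq_le s0 s2.
rewrite (_ : (fun w => _) = cst (f x)%:E).
  by rewrite integral_cst//= probability_setT mule1.
by apply/funext => w; rewrite mot_ge0// (bm_start bB) addr0.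
Qed.

Section recursion.
Variables (X : bbm_data R T) (bX : is_bbm P p X) (n : nat) (F : R -> R).
Hypotheses (mF : measurable_fun setT F) (F01 : forall y, 0 <= F y <= 1).
Variable V : R -> R -> R.
Hypotheses (mV : measurable_fun setT (fun q : R * R => V q.1 q.2))
  (V01 : forall s y, 0 <= V s y <= 1)
  (VE : forall j t x, 0 <= t ->
     (\int[P]_w (trunc_prod n (sub_bbm X j) F t x w)%:E = (1 - V t x)%:E)%E).
Let mX : bbm_measurable X := bbm_is_measurable bX.
Let tau := lifetime X [::].
Let K := offspring X [::].
Let B := mot X [::].

Let mVc d' (S : measurableType d') (f g : S -> R) : measurable_fun setT f ->
  measurable_fun setT g -> measurable_fun setT (fun s => V (f s) (g s)).
Proof.
move=> mf mg; apply: (measurableT_comp (g := fun s => (f s, g s)) mV).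
exact: measurable_fun_pair.
Qed.

Let mFc d' (S : measurableType d') (f : S -> R) : measurable_fun setT f ->
  measurable_fun setT (fun s => 1 - F (f s)).
Proof. by move=> mf; apply: measurable_funB => //; exact: measurableT_comp. Qed.

(** First of three averagings: over the subtrees, with the lifetime, offspring number and motion of
    the root frozen. The next two are over the offspring number and over the motion. *)
Lemma freeze_descendants t x : 0 <= t ->
  (\int[P]_w (1 - trunc_prod n.+1 X F t x w)%:E =
   \int[P]_w (if t < tau w then 1 - F (x + B t w)
              else 1 - (1 - V (t - tau w) (x + B (tau w) w)) ^+ K w)%R%:E)%E.
Proof.
move=> t0.
pose J1 : set (label + label + label) := [set i | lab i = [::]].
pose J2 : set (label + label + label) := [set i | lab i != [::]].
pose T1 := g_sigma_algebraType (\bigcup_(i in J1) fam X i).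
pose T2 := g_sigma_algebraType (\bigcup_(i in J2) fam X i).
pose xi w := ((tau w, K w), (B t w, B (tau w) w)).
have mtau1 : measurable_fun (setT : set T1) (tau : T1 -> R) by exact: gen_lifetime.
have mxi : measurable_fun (setT : set T1) (xi : T1 -> (R * nat) * (R * R)).
  have mB1 s (s0 : 0 <= s) : measurable_fun (setT : set T1) (motion X [::] s : T1 -> R).
    by apply: gen_motion.
  apply: measurable_fun_pair.
    by apply: measurable_fun_pair => //; exact: gen_offspring.
  apply: measurable_fun_pair.
    by apply: (@measurable_mot2 _ _ _ T1 T1 X [::] (fun=> t) id) => //; exact: bmm_continuous mX _.
  by apply: (@measurable_mot2 _ _ _ T1 T1 X [::] tau id) => //; exact: bmm_continuous mX _.
pose Psi (q : (R * nat) * (R * R) * T) : R :=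
  if t < q.1.1.1 then 1 - F (x + q.1.2.1) else
  1 - \prod_(j <- iota 0 q.1.1.2) trunc_prod n (sub_bbm X j) F (t - q.1.1.1) (x + q.1.2.2) q.2.
have m111 : measurable_fun setT (fun q : (R * nat) * (R * R) * T2 => q.1.1.1).
  by do 2! apply: measurableT_comp => //.
have m112 : measurable_fun setT (fun q : (R * nat) * (R * R) * T2 => q.1.1.2).
  by do 2! apply: measurableT_comp => //.
have m121 : measurable_fun setT (fun q : (R * nat) * (R * R) * T2 => q.1.2.1).
  by do 2! apply: measurableT_comp => //.
have m122 : measurable_fun setT (fun q : (R * nat) * (R * R) * T2 => q.1.2.2).
  by do 2! apply: measurableT_comp => //.
have mPsi : measurable_fun setT (Psi : (R * nat) * (R * R) * T2 -> R).
  apply: measurable_fun_ifT; first exact: measurable_fun_ltr.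
    by apply: mFc; exact: measurable_funD.
  apply: measurable_funB => //.
  apply: (@measurable_fun_nat_case _ _ _ _ (fun q : (R * nat) * (R * R) * T2 => q.1.1.2)
     (fun k q => \prod_(j <- iota 0 k)
        trunc_prod n (sub_bbm X j) F (t - q.1.1.1) (x + q.1.2.2) q.2)) => // k.
  apply: measurable_prod => j _.
  apply: (@measurable_trunc_prod2 _ _ _ T2 _ n (sub_bbm X j) F _ _ snd) => //.
  - by apply: (@gen_sub X J2 mX) => i v iE; rewrite /J2 /= iE; case: v iE.
  - exact: measurable_funB.
  - exact: measurable_funD.
have Psi0 q : 0 <= Psi q.
  rewrite /Psi; case: ifP => _; first by case/andP: (compl_01 (F01 (x + q.1.2.1))).
  have h : 0 <= \prod_(j <- iota 0 q.1.1.2) trunc_prod n (sub_bbm X j) F (t - q.1.1.1)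
    (x + q.1.2.2) q.2 <= 1 by apply: prod_01 => j; exact: trunc_prod_01.
  by case/andP: (compl_01 h).
have J12 i : J1 i -> J2 i -> False by rewrite /J1/J2/= => ->.
transitivity (\int[P]_w (Psi (xi w, w))%:E)%E.
  by apply: eq_integral => w _; rewrite trunc_prodS /Psi /=; case: ifP.
rewrite (fam_freeze bX J12 mxi mPsi Psi0); apply: eq_integral => w _.
rewrite /Psi /=; case: ifPn => [_|]; first by rewrite integral_cst//= probability_setT mule1.
rewrite -leNgt => tt; apply: expectation_compl.
- by apply: measurable_prod => j _; apply: measurable_trunc_prod2 => //; exact: sub_bbm_measurable.
- by move=> w'; apply: prod_01 => j; exact: trunc_prod_01.
- by apply: expectation_siblings => // j; apply: VE; rewrite subr_ge0.
Qed.

Lemma freeze_offspring t x : 0 <= t ->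
  (\int[P]_w (if t < tau w then 1 - F (x + B t w)
              else 1 - (1 - V (t - tau w) (x + B (tau w) w)) ^+ K w)%R%:E =
   \int[P]_w (if t < tau w then 1 - F (x + B t w)
              else bpgf p (V (t - tau w) (x + B (tau w) w)))%R%:E)%E.
Proof.
move=> t0.
pose J1 : set (label + label + label) := [set i | i = inl (inl [::]) \/ i = inr [::]].
pose J2 : set (label + label + label) := [set i | i = inl (inr [::])].
pose T1 := g_sigma_algebraType (\bigcup_(i in J1) fam X i).
pose T2 := g_sigma_algebraType (\bigcup_(i in J2) fam X i).
pose xi w := (tau w, (B t w, B (tau w) w)).
have mtau1 : measurable_fun (setT : set T1) (tau : T1 -> R) by apply: gen_lifetime; left.
have mxi : measurable_fun (setT : set T1) (xi : T1 -> R * (R * R)).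
  have mB1 s (s0 : 0 <= s) : measurable_fun (setT : set T1) (motion X [::] s : T1 -> R).
    by apply: gen_motion => //; right.
  apply: measurable_fun_pair => //.
  apply: measurable_fun_pair.
    by apply: (@measurable_mot2 _ _ _ T1 T1 X [::] (fun=> t) id) => //; exact: bmm_continuous mX _.
  by apply: (@measurable_mot2 _ _ _ T1 T1 X [::] tau id) => //; exact: bmm_continuous mX _.
pose Psi (q : R * (R * R) * T) : R :=
  if t < q.1.1 then 1 - F (x + q.1.2.1) else
  1 - (1 - V (t - q.1.1) (x + q.1.2.2)) ^+ K q.2.
have m11 : measurable_fun setT (fun q : R * (R * R) * T2 => q.1.1).
  by apply: measurableT_comp => //.
have m121 : measurable_fun setT (fun q : R * (R * R) * T2 => q.1.2.1).
  by do 2! apply: measurableT_comp => //.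
have m122 : measurable_fun setT (fun q : R * (R * R) * T2 => q.1.2.2).
  by do 2! apply: measurableT_comp => //.
have mPsi : measurable_fun setT (Psi : R * (R * R) * T2 -> R).
  apply: measurable_fun_ifT; first exact: measurable_fun_ltr.
    by apply: mFc; exact: measurable_funD.
  apply: measurable_compl_expr.
    by apply: mVc; [exact: measurable_funB|exact: measurable_funD].
  by apply: (measurableT_comp (f := K : T2 -> nat)) => //; exact: gen_offspring.
have Psi0 q : 0 <= Psi q.
  rewrite /Psi; case: ifP => _; first by case/andP: (compl_01 (F01 (x + q.1.2.1))).
  by case/andP: (compl_01 (expr_01 (K q.2) (V01 (t - q.1.1) (x + q.1.2.2)))).
have J12 i : J1 i -> J2 i -> False by move=> [->|->].
rewrite [LHS](_ : _ = (\int[P]_w (Psi (xi w, w))%:E)%E); last by [].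
rewrite (fam_freeze bX J12 mxi mPsi Psi0); apply: eq_integral => w _.
rewrite /Psi /=; case: ifPn => [_|_]; first by rewrite integral_cst//= probability_setT mule1.
exact: expectation_offspring.
Qed.

(** Value of 1 - E[prod F] given that the root splits at time s, with V standing for the
    subtrees. *)
Definition branch_step t x s : R :=
  if t < s then heat t (fun y => 1 - F y) x else heat s (fun y => bpgf p (V (t - s) y)) x.

(** Once the lifetime is frozen, the motion is evaluated at a deterministic time, where it is
    Gaussian; the exponential density then accounts for the lifetime. *)
Lemma freeze_lifetime t x : 0 <= t ->
  (\int[P]_w (if t < tau w then 1 - F (x + B t w)
              else bpgf p (V (t - tau w) (x + B (tau w) w)))%R%:E =
   \int[mu]_s (branch_step t x s * exponential_pdf 1 s)%:E)%E.
Proof.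
move=> t0.
pose J1 : set (label + label + label) := [set i | i = inl (inl [::])].
pose J2 : set (label + label + label) := [set i | i = inr [::]].
pose T1 := g_sigma_algebraType (\bigcup_(i in J1) fam X i).
pose T2 := g_sigma_algebraType (\bigcup_(i in J2) fam X i).
have mtau1 : measurable_fun (setT : set T1) (tau : T1 -> R) by exact: gen_lifetime.
pose Psi (q : R * T) : R :=
  if t < q.1 then 1 - F (x + B t q.2) else bpgf p (V (t - q.1) (x + B q.1 q.2)).
have mPsi_ d' (S : measurableType d') (f : R * S -> T) :
  measurable_fun setT (fun q : R * S => B t (f q)) ->
  measurable_fun setT (fun q : R * S => B q.1 (f q)) ->
  measurable_fun setT (fun q : R * S => Psi (q.1, f q)).
  move=> mBt mBs; have m1 : measurable_fun setT (fun q : R * S => q.1) by exact: measurable_fst.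
  apply: measurable_fun_ifT.
    by apply: measurable_fun_ltr => //; exact: measurable_cst.
    by apply: mFc; exact: measurable_funD.
  apply: (@measurable_bpgf _ _ _ X bX) => //.
  by apply: mVc; [exact: measurable_funB|exact: measurable_funD].
have mB1 s (s0 : 0 <= s) : measurable_fun (setT : set T2) (motion X [::] s : T2 -> R).
  by apply: gen_motion.
have mPsi : measurable_fun setT (Psi : R * T2 -> R).
  rewrite [Psi](_ : _ = (fun q : R * T2 => Psi (q.1, q.2))); last by apply/funext => -[].
  apply: mPsi_.
    apply: (@measurable_mot2 _ _ _ T2 _ X [::] (fun=> t) snd) => //; exact: bmm_continuous mX _.
  by apply: (@measurable_mot2 _ _ _ T2 _ X [::] fst snd) => //; exact: bmm_continuous mX _.
have mPsi2 : measurable_fun setT Psi.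
  rewrite [Psi](_ : _ = (fun q : R * T => Psi (q.1, q.2))); last by apply/funext => -[].
  apply: mPsi_; apply: measurable_mot2 => //; do ?[exact: bmm_continuous mX _|exact: bmm_motion mX _].
have Psi01 q : 0 <= Psi q <= 1.
  rewrite /Psi; case: ifP => _; first exact/compl_01.
  exact: (bpgf_01 bX).
have Psi0 q : 0 <= Psi q by case/andP: (Psi01 q).
have J12 i : J1 i -> J2 i -> False by move=> ->.
rewrite [LHS](_ : _ = (\int[P]_w (Psi (tau w, w))%:E)%E); last by [].
rewrite (fam_freeze bX J12 mtau1 mPsi Psi0).
have PE s : 0 <= s -> (\int[P]_w' (Psi (s, w'))%:E = (branch_step t x s)%:E)%E.
  move=> s0; rewrite /branch_step /Psi/=; case: ifP => _.
    apply: (@expectation_heat X [::] t (fun y => 1 - F y) x) => //; first exact: mFc.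
    by move=> y; exact: compl_01.
  apply: (@expectation_heat X [::] s (fun y => bpgf p (V (t - s) y)) x) => //.
    by apply: (@measurable_bpgf _ _ _ X bX) => //; exact: mVc.
  by move=> y; exact: (bpgf_01 bX).
pose f s := fine (\int[P]_w' (Psi (s, w'))%:E)%E.
have mf : measurable_fun setT f.
  apply: (measurableT_comp (f := fine)) => //.
  have mPsi' : measurable_fun setT (EFin \o Psi) by exact/measurable_EFinP.
  have Psi0' q : (0 <= (EFin \o Psi) q)%E by rewrite lee_fin.
  exact: (measurable_fun_fubini_tonelli_F (m2 := P) (EFin \o Psi) mPsi' Psi0').
have f0 s : 0 <= f s by apply: fine_ge0; apply: integral_ge0 => w _; rewrite lee_fin.
transitivity (\int[P]_w (f (tau w))%:E)%E.
  by apply: eq_integral => w _; rewrite /f PE//; exact: lifetime_ge0 bX _ _.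
rewrite (integral_exponential_law (lifetime_measurable bX [::]) (lifetime_law bX [::]) mf f0).
apply: eq_integral => s _; have [s0|s0] := leP 0 s; first by rewrite /f PE.
by rewrite lt0_exponential_pdf// !mulr0.
Qed.

Lemma branching_recursion t x : 0 <= t ->
  (\int[P]_w (1 - trunc_prod n.+1 X F t x w)%:E =
   \int[mu]_s (branch_step t x s * exponential_pdf 1 s)%:E)%E.
Proof. by move=> t0; rewrite freeze_descendants// freeze_offspring// freeze_lifetime. Qed.

End recursion.

End branching.

(** * Bounds on the offspring nonlinearity *)

Section offspring_moments.
Context d (T : measurableType d) {R : realType} (P : probability T R) (p : nat -> R).
Hypotheses (hp : offspring_law p).
Variables (X : bbm_data R T) (bX : is_bbm P p X).

Lemma compl_expr_le (u v : R) k : 0 <= u -> u <= v -> v <= 1 ->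
  (1 - u) ^+ k - (1 - v) ^+ k <= k%:R * (v - u).
Proof.
move=> u0 uv v1; elim: k => [|k IH]; first by rewrite !expr0 subrr mul0r.
have a1 : 0 <= (1 - u) ^+ k <= 1 by apply: expr_01; rewrite u0 (le_trans uv).
have b1 : 0 <= (1 - v) ^+ k <= 1 by apply: expr_01; rewrite v1 (le_trans u0).
have a2 : (1 - v) ^+ k <= (1 - u) ^+ k by rewrite lerXn2r// ?nnegrE; lra.
rewrite !exprS -natr1; move: a1 b1 a2 IH; set a := (1 - u) ^+ k; set b := (1 - v) ^+ k.
move=> /andP[a0 a1] /andP[b0 b1] ba; set c := k%:R * _ => IH.
have -> : (k%:R + 1) * (v - u) = c + (v - u) by rewrite /c; ring.
have : (1 - u) * (a - b) <= a - b by rewrite ler_piMl//; lra.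
have : (v - u) * b <= v - u by rewrite ler_piMr//; lra.
lra.
Qed.

(** Bonferroni inequality with k (k - 1) in place of its half, the form that matches the second
    moment of the offspring law. *)
Lemma compl_expr_ge (u : R) k : 0 <= u <= 1 ->
  k%:R * u - (1 - (1 - u) ^+ k) <= (k * k.-1)%:R * u ^+ 2.
Proof.
move=> u01; have /andP[u0 u1] := u01; elim: k => [|k IH].
  by rewrite expr0 mul0r subrr subr0 mul0n mul0r.
have h := compl_expr_le k (lexx 0) u0 u1.
rewrite subr0 expr1n in h.
have hk2 : u * (1 - (1 - u) ^+ k) <= u * (k%:R * u) by apply: ler_wpM2l => //; lra.
have e : (k.+1 * k.+1.-1)%:R * u ^+ 2 = (k * k.-1)%:R * u ^+ 2 + 2 * (k%:R * u ^+ 2) :> R.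
  case: k {IH h hk2} => [|k] /=; first by rewrite !mul0n muln0 !mul0r mulr0 addr0.
  rewrite !natrM -!natr1; ring.
rewrite e exprS -natr1; move: IH hk2; set a := (1 - u) ^+ k; set c := (k * _)%:R * _.
have : 0 <= k%:R * u ^+ 2 by rewrite mulr_ge0// sqr_ge0.
rewrite expr2; set k' := k%:R; nra.
Qed.

Lemma expectation_offspring_f (f : nat -> R) : (forall k, 0 <= f k) -> f 0%N = 0 ->
  (\int[P]_w (f (offspring X [::] w))%:E = \sum_(1 <= k <oo) (f k * p k)%:E)%E.
Proof.
move=> f0 f00; rewrite (@integral_nat_law _ _ _ P _ f)//; last exact: offspring_measurable bX _.
have E k : ((f k)%:E * P (offspring X [::] @^-1` [set k]) = (f k * p k)%:E)%E.
  by rewrite (offspring_lawE bX).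
under eq_eseriesr do rewrite E.
rewrite nneseries_recl//; last by move=> k _; rewrite lee_fin mulr_ge0// (offspring_ge0 hp).
rewrite f00 mul0r add0e.
rewrite -(@nneseries_addn _ (fun k => (f k * p k)%:E) 1)//.
by move=> k; rewrite lee_fin mulr_ge0// (offspring_ge0 hp).
Qed.

Lemma measurable_offspring_f (f : nat -> R) : measurable_fun setT (fun w => f (offspring X [::] w)).
Proof. by apply: (measurableT_comp (f := f)) => //; exact: offspring_measurable bX _. Qed.

Lemma expectation_offspring_mean : (\int[P]_w ((offspring X [::] w)%:R)%:E = 2%:E)%E.
Proof. by rewrite (@expectation_offspring_f (fun k => k%:R))// (offspring_mean hp). Qed.

Lemma bpgf0 : bpgf p 0 = 0.
Proof.
rewrite /bpgf eseries0//= => k _ _; by rewrite subr0 expr1n subrr mul0e.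
Qed.

Lemma bpgf_lip (u v : R) : 0 <= u -> u <= v -> v <= 1 ->
  bpgf p u <= bpgf p v <= bpgf p u + 2 * (v - u).
Proof.
move=> u0 uv v1.
have u01 : 0 <= u <= 1 by rewrite u0 (le_trans uv).
have v01 : 0 <= v <= 1 by rewrite v1 (le_trans u0).
have h (a : R) w : 0 <= a <= 1 -> (0 <= (1 - (1 - a) ^+ offspring X [::] w)%:E)%E.
  by move=> a01; rewrite lee_fin; case/andP: (compl_01 (expr_01 (offspring X [::] w) a01)).
have m (a : R) : measurable_fun setT (fun w => (1 - (1 - a) ^+ offspring X [::] w)%:E).
  by apply/measurable_EFinP; exact: (measurable_offspring_f (fun k => 1 - (1 - a) ^+ k)).
have mK : measurable_fun setT (fun w => ((offspring X [::] w)%:R)%:E : \bar R).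
  by apply/measurable_EFinP; exact: (measurable_offspring_f (fun k => k%:R)).
apply/andP; split; rewrite -lee_fin.
  rewrite -!(expectation_offspring [::] bX)//; apply: ge0_le_integral => //.
  - by move=> w _; exact: h.
  - by move=> w _; rewrite lee_fin lerD2l lerN2 lerXn2r// ?nnegrE; lra.
rewrite EFinD EFinM -!(expectation_offspring [::] bX)// -expectation_offspring_mean.
rewrite -ge0_integralZr ?lee_fin ?subr_ge0//.
have mKv : measurable_fun setT
  (fun w => ((offspring X [::] w)%:R%:E * (v - u)%:E : \bar R)%E) by exact: emeasurable_funM.
have Kv0 w : (0 <= (offspring X [::] w)%:R%:E * (v - u)%:E :> \bar R)%E.
  by rewrite lee_fin mulr_ge0// subr_ge0.
rewrite -ge0_integralD//; last by move=> w _; exact: h.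
apply: ge0_le_integral => //.
- by move=> w _; exact: h.
- exact: emeasurable_funD.
- move=> w _; rewrite -EFinM -EFinD lee_fin.
  have := compl_expr_le (offspring X [::] w) u0 uv v1; lra.
Qed.

(** Becomes the constant C of the quadratic bound on the absorption. *)
Definition offspring_C : R := fine (\sum_(1 <= k <oo) ((k * k.-1)%:R * p k)%:E)%E.

Lemma offspring_C_ge0 : 0 <= offspring_C.
Proof.
apply: fine_ge0; apply: nneseries_ge0 => k _ _; rewrite lee_fin mulr_ge0// (offspring_ge0 hp)//.
Qed.

Lemma offspring_CE : (\int[P]_w ((offspring X [::] w * (offspring X [::] w).-1)%:R)%:E = offspring_C%:E)%E.
Proof.
rewrite (@expectation_offspring_f (fun k => (k * k.-1)%:R))// /offspring_C fineK//.
rewrite ge0_fin_numE ?(offspring_moment2 hp)//.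
by apply: nneseries_ge0 => k _ _; rewrite lee_fin mulr_ge0// (offspring_ge0 hp).
Qed.

(** The absorption will be 2 u - [bpgf p u], where 2 is the mean offspring number. The three bounds
    become kap <= v, kap >= 0 and kap <= C e^(- sqrt 2 z) v^2; the first rests on p_0 = 0. *)
Lemma bpgf_bounds (u : R) : 0 <= u <= 1 ->
  [/\ u <= bpgf p u, bpgf p u <= 2 * u & 2 * u - bpgf p u <= offspring_C * u ^+ 2].
Proof.
move=> u01; have /andP[u0 u1] := u01.
have h w : (0 <= (1 - (1 - u) ^+ offspring X [::] w)%:E)%E.
  by rewrite lee_fin; case/andP: (compl_01 (expr_01 (offspring X [::] w) u01)).
have m : measurable_fun setT (fun w => (1 - (1 - u) ^+ offspring X [::] w)%:E).
  by apply/measurable_EFinP; exact: (measurable_offspring_f (fun k => 1 - (1 - u) ^+ k)).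
split.
- rewrite -lee_fin -(expectation_offspring [::] bX u01).
  have <- : (\int[P]_w (u *+ (0 < offspring X [::] w)%N)%:E = u%:E)%E.
    rewrite (@expectation_offspring_f (fun k => u *+ (0 < k)%N))//; last first.
      by move=> k; rewrite mulrn_wge0.
    transitivity (u%:E * \sum_(1 <= k <oo) (p k)%:E)%E.
      rewrite -nneseriesZl; last by move=> k _; rewrite lee_fin (offspring_ge0 hp).
      by apply: eq_eseriesr => -[|k] kp //=; rewrite (offspring_none hp) !mulr0 mule0.
    by rewrite (offspring_total hp) mule1.
  apply: ge0_le_integral => //.
  + by move=> w _; rewrite lee_fin mulrn_wge0.
  + by apply/measurable_EFinP; exact: (measurable_offspring_f (fun k => u *+ (0 < k)%N)).
  + move=> w _; rewrite lee_fin; case: offspring => [|k]; first by rewrite mulr0n expr0 subrr.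
    rewrite mulr1n exprS.
    have /andP[e0 e1] := expr_01 k u01.
    have : (1 - u) * (1 - u) ^+ k <= 1 - u by rewrite ler_piMr//; lra.
    lra.
- by have /andP[_] := bpgf_lip (lexx 0) u0 u1; rewrite bpgf0 subr0 add0r.
- rewrite lerBlDr -lee_fin EFinD (EFinM 2) (EFinM offspring_C) -(expectation_offspring [::] bX u01) -offspring_CE.
  rewrite -expectation_offspring_mean.
  have m2 : measurable_fun setT (fun w => ((offspring X [::] w)%:R%:E : \bar R)).
    by apply/measurable_EFinP; exact: (measurable_offspring_f (fun k => k%:R)).
  have m3 : measurable_fun setT
    (fun w => ((offspring X [::] w * (offspring X [::] w).-1)%:R%:E : \bar R)).
    by apply/measurable_EFinP; exact: (measurable_offspring_f (fun k => (k * k.-1)%:R)).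
  rewrite -!ge0_integralZr ?lee_fin ?sqr_ge0//.
  have m1 : measurable_fun setT (fun w => ((offspring X [::] w * (offspring X [::] w).-1)%:R%:E * (u ^+ 2)%:E : \bar R)%E).
    exact: emeasurable_funM.
  rewrite -ge0_integralD//; last by move=> w _; rewrite lee_fin mulr_ge0// sqr_ge0.
  apply: ge0_le_integral => //.
  + by move=> w _; rewrite lee_fin mulr_ge0.
  + exact: emeasurable_funM.
  + exact: emeasurable_funD.
  + move=> w _; rewrite -!EFinM -EFinD lee_fin.
    by have := compl_expr_ge (offspring X [::] w) u01; lra.
Qed.

End offspring_moments.

(** * The mild equation with killing at the first split *)

Section mild_form.
Context d (T : measurableType d) {R : realType} (P : probability T R) (p : nat -> R).
Hypotheses (hp : offspring_law p).
Local Notation mu := (@lebesgue_measure R).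

Lemma integral_flip (k : R -> \bar R) (t : R) : measurable_fun setT k -> (forall s, 0 <= k s)%E ->
  (\int[mu]_s k (t - s)%R = \int[mu]_s k s)%E.
Proof.
move=> mk k0; rewrite -(integral_reflect mk k0).
have mk' : measurable_fun setT (fun s : R => k (- s)) by exact: measurableT_comp.
have k0' (s : R) : (0 <= k (- s)%R)%E by [].
rewrite -(@integral_shift R (fun s : R => k (- s)) (- t) mk' k0').
by apply: eq_integral => s _; rewrite (_ : - (s + - t) = t - s)//; ring.
Qed.

(** For identities between integrands that may fail at the two ends of the time interval. The
    measurability of f is inherited from g, f being g modified at two points. *)
Lemma integral_eq_off (f g : R -> \bar R) (a b : R) : measurable_fun setT g ->
  (forall s, s != a -> s != b -> f s = g s) -> (\int[mu]_s f s = \int[mu]_s g s)%E.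
Proof.
move=> mg fg.
pose h s := if s == a then f a else if s == b then f b else g s.
have mh : measurable_fun setT h.
  apply: measurable_fun_ifT; first exact: measurable_fun_eqr.
    exact: measurable_cst.
  apply: measurable_fun_ifT => //; first exact: measurable_fun_eqr.
have -> : f = h.
  apply/funext => s; rewrite /h; case: eqVneq => [->//|sa].
  by case: eqVneq => [->//|sb]; exact: fg.
apply: ae_eq_integral => //.
exists ([set a] `|` [set b]); split.
- by apply: measurableU; exact: measurable_set1.
- apply/eqP; rewrite eq_le measure_ge0 andbT.
  rewrite (le_trans (measureU2 _ _ _))//; try exact: measurable_set1.
  have e : (mu [set a] + mu [set b] = 0)%E by rewrite !lebesgue_measure_set1 adde0.
  by rewrite [leLHS]e.
- move=> s /= hs; apply: contrapT => /not_orP[/eqP sa /eqP sb].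
  by apply: hs => _; rewrite /h (negbTE sa) (negbTE sb).
Qed.

Definition ext (X : bbm_data R T) (F : R -> R) (n : nat) (t x : R) : R :=
  fine (\int[P]_w (1 - trunc_prod n X F t x w)%:E)%E.

(** Set to 0 at nonpositive times; as [hk] vanishes there too, integrals over 0 < s < t can be
    written over the whole line. *)
Definition bpos (V : R -> R -> R) (s y : R) : R := if 0 < s then bpgf p (V s y) else 0.

Section fixed_F.
Variables (F : R -> R) (mF : measurable_fun setT F) (F01 : forall y, 0 <= F y <= 1).

Lemma compl_trunc_prod_01 X n t x (w : T) : 0 <= 1 - trunc_prod n X F t x w <= 1.
Proof. by apply: compl_01; exact: trunc_prod_01. Qed.

Lemma measurable_compl_trunc_prod X n t x : bbm_measurable X ->
  measurable_fun setT (fun w : T => 1 - trunc_prod n X F t x w).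
Proof. by move=> mX; apply: measurable_funB => //; exact: measurable_trunc_prod2. Qed.

Lemma extE X n t x : bbm_measurable X ->
  (\int[P]_w (1 - trunc_prod n X F t x w)%:E = (ext X F n t x)%:E)%E.
Proof.
move=> mX; rewrite /ext fineK// fin_num_01// expectation_01//.
  exact: measurable_compl_trunc_prod.
by move=> w; exact: compl_trunc_prod_01.
Qed.

Lemma ext_01 X n t x : bbm_measurable X -> 0 <= ext X F n t x <= 1.
Proof.
move=> mX; apply: fine_01; apply: expectation_01; first exact: measurable_compl_trunc_prod.
by move=> w; exact: compl_trunc_prod_01.
Qed.

Lemma extC X n t x : bbm_measurable X ->
  (\int[P]_w (trunc_prod n X F t x w)%:E = (1 - ext X F n t x)%:E)%E.
Proof.
move=> mX.
under eq_integral do rewrite -[trunc_prod _ _ _ _ _ _](subKr 1).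
apply: expectation_compl.
- exact: measurable_compl_trunc_prod.
- by move=> w; exact: compl_trunc_prod_01.
- exact: extE.
Qed.

Lemma measurable_ext X n : bbm_measurable X ->
  measurable_fun setT (fun q : R * R => ext X F n q.1 q.2).
Proof.
move=> mX; apply: (measurableT_comp (f := fine)) => //.
pose h (q : (R * R) * T) := (1 - trunc_prod n X F q.1.1 q.1.2 q.2)%:E.
have mh : measurable_fun setT h.
  apply/measurable_EFinP; apply: measurable_funB => //; exact: measurable_trunc_prod.
have h0 q : (0 <= h q)%E.
  by rewrite lee_fin; case/andP: (compl_trunc_prod_01 X n q.1.1 q.1.2 q.2).
exact: (measurable_fun_fubini_tonelli_F (m2 := P) h mh h0).
Qed.

Lemma ext_recursion X (V : R -> R -> R) n (t x : R) : is_bbm P p X -> 0 <= t ->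
  measurable_fun setT (fun q : R * R => V q.1 q.2) -> (forall s y, 0 <= V s y <= 1) ->
  (forall j t x, 0 <= t -> ext (sub_bbm X j) F n t x = V t x) ->
  ((ext X F n.+1 t x)%:E = \int[mu]_s (branch_step p F V t x s * exponential_pdf 1 s)%:E)%E.
Proof.
move=> bX t0 mV V01 VE; have mX := bbm_is_measurable bX.
rewrite -extE// (branching_recursion bX mF F01 mV V01)//.
by move=> j t' x' t'0; rewrite extC ?VE//; exact: sub_bbm_measurable.
Qed.

(** By induction through the recursion, the expectation depends on the law only. This identifies the
    subtrees with the whole process and closes the equation. *)
Lemma ext_indep X X' n t x : is_bbm P p X -> is_bbm P p X' -> 0 <= t ->
  ext X F n t x = ext X' F n t x.
Proof.
move=> + + t0; elim: n X X' t t0 x => [|n IH] X X' t t0 x bX bX' //.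
have mX := bbm_is_measurable bX.
have h Y : is_bbm P p Y -> ((ext Y F n.+1 t x)%:E =
    \int[mu]_s (branch_step p F (ext X F n) t x s * exponential_pdf 1 s)%:E)%E.
  move=> bY; apply: ext_recursion => //.
  - exact: measurable_ext.
  - by move=> s y; exact: ext_01.
  - by move=> j t' x' t'0; apply: IH => //; exact: sub_is_bbm.
by apply: EFin_inj; rewrite (h X)// (h X').
Qed.

Lemma measurable_bpos X (V : R -> R -> R) : is_bbm P p X -> measurable_fun setT (fun q : R * R => V q.1 q.2) ->
  (forall s y, 0 <= V s y <= 1) ->
  measurable_fun setT (fun q : R * R => bpos V q.1 q.2).
Proof.
move=> bX mV V01; apply: measurable_fun_ifT => //; first exact: measurable_fun_ltr.
exact: (measurable_bpgf bX).
Qed.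

Lemma bpos_01 X (V : R -> R -> R) s y : is_bbm P p X -> (forall s y, 0 <= V s y <= 1) -> 0 <= bpos V s y <= 1.
Proof.
by move=> bX V01; rewrite /bpos; case: ifP => _; [exact: (bpgf_01 bX)|rewrite lexx ler01].
Qed.

Lemma exponential_pdf_shift (t s : R) : 0 <= t ->
  (if t <= s + t then exponential_pdf 1 (s + t) else 0) = expR (- t) * exponential_pdf 1 s :> R.
Proof.
move=> t0; case: ifPn => ts.
  have s0 : 0 <= s by lra.
  by rewrite !exponential_pdfE ?addr_ge0// !mul1r -expRD; congr expR; ring.
by rewrite lt0_exponential_pdf ?mulr0//; rewrite -ltNge in ts; lra.
Qed.

(** Contribution of the event that the root has not split by time t, A being its value there. *)
Definition exp_tail (A t s : R) : R := if t <= s then A * exponential_pdf 1 s else 0.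

Lemma measurable_exp_tail A t : measurable_fun setT (exp_tail A t).
Proof.
apply: measurable_fun_ifT; last exact: measurable_cst.
  by apply: measurable_fun_ler; [exact: measurable_cst|exact: measurable_id].
by apply: measurable_funM; [exact: measurable_cst|exact: measurable_exponential_pdf].
Qed.

Lemma exp_tail_ge0 A t s : 0 <= A -> (0 <= (exp_tail A t s)%:E)%E.
Proof.
by move=> A0; rewrite lee_fin /exp_tail; case: ifP => // _; rewrite mulr_ge0 ?exponential_pdf_ge0.
Qed.

Lemma exponential_tail (A t : R) : 0 <= t -> 0 <= A ->
  (\int[mu]_s (exp_tail A t s)%:E = (expR (- t))%:E * A%:E)%E.
Proof.
move=> t0 A0; pose a s := (exp_tail A t s)%:E.
have ma : measurable_fun setT a by apply/measurable_EFinP; exact: measurable_exp_tail.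
have a0 s : (0 <= a s)%E by exact: exp_tail_ge0.
rewrite -(@integral_shift R a t ma a0).
transitivity (\int[mu]_s ((expR (- t) * A)%:E * (exponential_pdf 1 s)%:E))%E.
  apply: eq_integral => s _; rewrite /a /exp_tail -EFinM; congr EFin.
  rewrite -mulrA mulrCA -exponential_pdf_shift//.
  by case: ifP; rewrite ?mulr0.
rewrite ge0_integralZl ?lee_fin ?mulr_ge0 ?expR_ge0//; last 2 first.
- by apply/measurable_EFinP; exact: measurable_exponential_pdf.
- by move=> s _; rewrite lee_fin exponential_pdf_ge0.
by rewrite integral_exponential_pdf// mule1 EFinM.
Qed.

Lemma exp_tail_add (A t : R) (k : R -> \bar R) : 0 <= t -> 0 <= A ->
  measurable_fun setT k -> (forall s, 0 <= k s)%E ->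
  ((expR (- t))%:E * A%:E + \int[mu]_s k s =
    \int[mu]_s ((exp_tail A t s)%:E + k (t - s)%R))%E /\
  measurable_fun setT (fun s => (exp_tail A t s)%:E + k (t - s)%R)%E.
Proof.
move=> t0 A0 mk k0.
have me : measurable_fun setT (fun s => (exp_tail A t s)%:E).
  by apply/measurable_EFinP; exact: measurable_exp_tail.
have mkt : measurable_fun setT (fun s : R => k (t - s)).
  by apply: (measurableT_comp mk); exact: measurable_funB.
split; last exact: emeasurable_funD.
rewrite -(exponential_tail t0 A0) -(@integral_flip k t mk k0) -ge0_integralD//.
by move=> s _; exact: exp_tail_ge0.
Qed.

Lemma heat_fin (s x : R) (f : R -> R) : 0 < s -> measurable_fun setT f -> (forall y, 0 <= f y <= 1) ->
  (\int[mu]_y (hk s (x - y) * f y)%:E = (heat s f x)%:E)%E.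
Proof.
move=> s0 mf f01; rewrite /heat s0 fineK// fin_num_01//; apply/andP; split.
  by apply: integral_ge0 => y _; rewrite lee_fin mulr_ge0 ?hk_ge0//; case/andP: (f01 y).
rewrite -(integral_hk x s0); apply: ge0_le_integral => //.
- by move=> y _; rewrite lee_fin mulr_ge0 ?hk_ge0//; case/andP: (f01 y).
- apply/measurable_EFinP; apply: measurable_funM => //.
  by apply: measurable_hk2 => //; exact: measurable_funB.
- by apply/measurable_EFinP; apply: measurable_hk2 => //; exact: measurable_funB.
- by move=> y _; rewrite lee_fin ler_piMr ?hk_ge0//; case/andP: (f01 y).
Qed.

Lemma measurable_mild_kernel X (V : R -> R -> R) (t x : R) : is_bbm P p X ->
  measurable_fun setT (fun q : R * R => V q.1 q.2) ->
  (forall s y, 0 <= V s y <= 1) ->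
  measurable_fun setT (fun q : R * R =>
    (expR (- (t - q.1)) * (hk (t - q.1) (x - q.2) * bpos V q.1 q.2))%:E).
Proof.
move=> bX mV V01; apply/measurable_EFinP; apply: measurable_funM.
  apply: measurableT_comp; first exact: measurable_expR.
  by apply: measurableT_comp => //; exact: measurable_funB.
apply: measurable_funM; last exact: (measurable_bpos bX).
by apply: measurable_hk2; exact: measurable_funB.
Qed.

Lemma mild_kernel_ge0 X (V : R -> R -> R) (t x s y : R) : is_bbm P p X -> (forall s y, 0 <= V s y <= 1) ->
  (0 <= (expR (- (t - s)) * (hk (t - s) (x - y) * bpos V s y))%:E)%E.
Proof.
move=> bX V01; rewrite lee_fin mulr_ge0 ?expR_ge0// mulr_ge0 ?hk_ge0//.
by case/andP: (bpos_01 s y bX V01).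
Qed.

Lemma branch_step_mild X (V : R -> R -> R) (t x : R) : is_bbm P p X -> 0 < t ->
  measurable_fun setT (fun q : R * R => V q.1 q.2) -> (forall s y, 0 <= V s y <= 1) ->
  (\int[mu]_s (branch_step p F V t x s * exponential_pdf 1 s)%:E =
   (expR (- t))%:E * \int[mu]_y (hk t (x - y) * (1 - F y))%:E +
   \int[mu]_s \int[mu]_y (expR (- (t - s)) * (hk (t - s) (x - y) * bpos V s y))%:E)%E.
Proof.
move=> bX t0 mV V01.
have mCF : measurable_fun setT (fun y => 1 - F y) by exact: measurable_funB.
have CF01 y : 0 <= 1 - F y <= 1 by exact: compl_01.
rewrite heat_fin//; set A := heat t _ x.
have A0 : 0 <= A.
  rewrite -lee_fin -heat_fin//; apply: integral_ge0 => y _.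
  by rewrite lee_fin mulr_ge0 ?hk_ge0//; case/andP: (CF01 y).
pose k s := (\int[mu]_y (expR (- (t - s)) * (hk (t - s) (x - y) * bpos V s y))%:E)%E.
have mk : measurable_fun setT k.
  exact: (measurable_fun_fubini_tonelli_F (m2 := mu) _ (measurable_mild_kernel t x bX mV V01)
    (fun q => mild_kernel_ge0 t x q.1 q.2 bX V01)).
have k0 s : (0 <= k s)%E by apply: integral_ge0 => y _; exact: (mild_kernel_ge0 _ _ _ _ bX).
have [-> mg] := exp_tail_add (ltW t0) A0 mk k0.
(* The reversal s -> t - s replaces the splitting time by the time left after it; the ends 0 and t
   are set aside. *)
apply: (integral_eq_off (a := 0) (b := t)); first exact: mg.
move=> s s0 st; rewrite /exp_tail /branch_step /k.
rewrite (_ : t - (t - s) = s); last by ring.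
have [ts|ts] := ltP t s.
  rewrite (ltW ts) (_ : (\int[mu]_y _)%E = 0%E); first by rewrite adde0.
  by apply: integral0_eq => y _; rewrite /bpos subr_gt0 ltNge (ltW ts) !mulr0.
rewrite leNgt lt_neqAle st ts add0e.
have {}ts : s < t by rewrite lt_neqAle st ts.
have [s1|s1] := ltP 0 s; last first.
  have {}s1 : s < 0 by rewrite lt_neqAle s0.
  rewrite lt0_exponential_pdf// mulr0; apply/esym; apply: integral0_eq => y _.
  by rewrite hk_le0 ?(ltW s1)// mul0r mulr0.
rewrite exponential_pdfE ?(ltW s1)// mul1r mulN1r EFinM.
have mb : measurable_fun setT (fun y => bpgf p (V (t - s) y)).
  apply: (measurable_bpgf bX) => //.
  by apply: (measurableT_comp mV (g := fun y => (t - s, y))); exact: measurable_fun_pair.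
have b01 y : 0 <= bpgf p (V (t - s) y) <= 1 by exact: (bpgf_01 bX).
rewrite -heat_fin// muleC -ge0_integralZl ?lee_fin ?expR_ge0//; last 2 first.
- apply/measurable_EFinP; apply: measurable_funM => //.
  by apply: measurable_hk2 => //; exact: measurable_funB.
- by move=> y _; rewrite lee_fin mulr_ge0 ?hk_ge0//; case/andP: (b01 y).
by apply: eq_integral => y _; rewrite /bpos subr_gt0 ts -EFinM.
Qed.

Lemma ext_mild X n t x : is_bbm P p X -> 0 < t ->
  ((ext X F n.+1 t x)%:E =
   (expR (- t))%:E * \int[mu]_y (hk t (x - y) * (1 - F y))%:E +
   \int[mu]_s \int[mu]_y
     (expR (- (t - s)) * (hk (t - s) (x - y) * bpos (ext X F n) s y))%:E)%E.
Proof.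
move=> bX t0; have mX := bbm_is_measurable bX.
have mV := measurable_ext n mX; have V01 s y := ext_01 n s y mX.
rewrite -(branch_step_mild x bX t0 mV V01); apply: ext_recursion => //; first exact: ltW.
by move=> j t' x' t'0; apply: ext_indep => //; exact: sub_is_bbm.
Qed.

Lemma ext_nd X t x : bbm_measurable X -> nondecreasing_seq (fun n => ext X F n t x).
Proof.
move=> mX; apply/nondecreasing_seqP => n; rewrite -lee_fin -!extE//.
apply: ge0_le_integral => //.
- by move=> w _; rewrite lee_fin; case/andP: (compl_trunc_prod_01 X n t x w).
- by apply/measurable_EFinP; exact: measurable_compl_trunc_prod.
- by apply/measurable_EFinP; exact: measurable_compl_trunc_prod.
- by move=> w _; rewrite lee_fin lerD2l lerN2; exact: trunc_prod_le.
Qed.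

(* 1 - E[prod of F over the population], by monotone limit over generations. *)
Definition extinction_compl (X : bbm_data R T) (t x : R) : R := limn (fun n => ext X F n t x).
Local Notation U := extinction_compl.

Lemma cvg_ext X t x : bbm_measurable X -> ext X F n t x @[n --> \oo] --> U X t x.
Proof.
move=> mX; apply: nondecreasing_is_cvgn; first exact: ext_nd.
by exists 1 => _ [n _ <-]; case/andP: (ext_01 n t x mX).
Qed.

Lemma U_01 X t x : bbm_measurable X -> 0 <= U X t x <= 1.
Proof.
move=> mX; have c := cvg_ext (t := t) (x := x) mX; apply/andP; split.
  apply: (limr_ge (cvgP _ c)); near=> n; by case/andP: (ext_01 n t x mX).
apply: (limr_le (cvgP _ c)); near=> n; by case/andP: (ext_01 n t x mX).
Unshelve. all: by end_near. Qed.

Lemma measurable_U X : bbm_measurable X -> measurable_fun setT (fun q : R * R => U X q.1 q.2).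
Proof.
move=> mX; apply: (@measurable_fun_cvg _ _ _ setT (fun n (q : R * R) => ext X F n q.1 q.2)).
  by move=> n; exact: measurable_ext.
by move=> q _; exact: cvg_ext.
Qed.

Lemma ext_le_U X n t x : bbm_measurable X -> ext X F n t x <= U X t x.
Proof. by move=> mX; apply: nondecreasing_cvgn_le; [exact: ext_nd|exact: cvgP (cvg_ext mX)]. Qed.

Lemma cvg_bpos_ext X s y : is_bbm P p X -> bpos (ext X F n) s y @[n --> \oo] --> bpos (U X) s y.
Proof.
move=> bX; have mX := bbm_is_measurable bX.
rewrite /bpos; case: ifP => _; last exact: cvg_cst.
apply/cvgrPdist_le => e e0.
have e2 : 0 < e / 2 by rewrite divr_gt0.
have /cvgrPdist_le/(_ _ e2) := cvg_ext (t := s) (x := y) mX.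
apply: filterS => n.
have /andP[u0 _] := ext_01 n s y mX; have /andP[_ v1] := U_01 s y mX.
have uv := ext_le_U n s y mX.
have /andP[h1 h2] := bpgf_lip hp bX u0 uv v1.
rewrite !ger0_norm ?subr_ge0//; lra.
Qed.

Lemma U_mild X t x : is_bbm P p X -> 0 < t ->
  ((U X t x)%:E =
   (expR (- t))%:E * \int[mu]_y (hk t (x - y) * (1 - F y))%:E +
   \int[mu]_s \int[mu]_y
     (expR (- (t - s)) * (hk (t - s) (x - y) * bpos (U X) s y))%:E)%E.
Proof.
move=> bX t0; have mX := bbm_is_measurable bX.
pose k V (q : R * R) := (expR (- (t - q.1)) * (hk (t - q.1) (x - q.2) * bpos V q.1 q.2))%:E.
have V01 n s y := ext_01 n s y mX; have mV n := measurable_ext n mX.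
have fub (V : R -> R -> R) : measurable_fun setT (fun q : R * R => V q.1 q.2) -> (forall s y, 0 <= V s y <= 1) ->
    (\int[mu]_s \int[mu]_y
     (expR (- (t - s)) * (hk (t - s) (x - y) * bpos V s y))%:E = \int[(mu \x mu)%E]_q k V q)%E.
  move=> mV' V01'; rewrite fubini_tonelli1//; first exact: (measurable_mild_kernel _ _ bX).
  by move=> q; exact: (mild_kernel_ge0 _ _ _ _ bX).
rewrite fub; [|exact: measurable_U|by move=> *; exact: U_01].
have mono : (\int[(mu \x mu)%E]_q k (ext X F n) q @[n --> \oo] -->
    \int[(mu \x mu)%E]_q k (U X) q)%E.
  have -> : k (U X) = fun q => limn (fun n => k (ext X F n) q).
    apply/funext => q; apply/esym/cvg_lim => //; apply: cvg_EFin; first by near=> n.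
    have h : expR (- (t - q.1)) * (hk (t - q.1) (x - q.2) * bpos (ext X F n) q.1 q.2)
        @[n --> \oo] --> expR (- (t - q.1)) * (hk (t - q.1) (x - q.2) * bpos (U X) q.1 q.2).
      by apply: cvgM; [exact: cvg_cst|apply: cvgM; [exact: cvg_cst|exact: cvg_bpos_ext]].
    exact: h.
  apply: cvg_monotone_convergence => //.
  - by move=> n; exact: (measurable_mild_kernel _ _ bX).
  - by move=> n q _; exact: (mild_kernel_ge0 _ _ _ _ bX).
  - move=> q _; apply/nondecreasing_seqP => n; rewrite lee_fin.
    apply: ler_wpM2l; first exact: expR_ge0.
    apply: ler_wpM2l; first exact: hk_ge0.
    rewrite /bpos; case: ifP => _; last by [].
    have /andP[u0 _] := V01 n q.1 q.2; have /andP[_ v1] := V01 n.+1 q.1 q.2.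
    have uv := ext_nd q.1 q.2 mX (leqnSn n).
    by case/andP: (bpgf_lip hp bX u0 uv v1).
have c1 : ((ext X F n.+1 t x)%:E @[n --> \oo] --> (U X t x)%:E)%E.
  apply: cvg_EFin; first by near=> n.
  have c := cvg_ext (t := t) (x := x) mX.
  by rewrite -(@cvg_shiftS _ (fun n => ext X F n t x)) in c.
pose A := ((expR (- t))%:E * \int[mu]_y (hk t (x - y) * (1 - F y))%:E)%E.
suff c2 : ((ext X F n.+1 t x)%:E @[n --> \oo] --> A + \int[(mu \x mu)%E]_q k (U X) q)%E.
  exact: (cvg_unique _ c1 c2).
have -> : (fun n => (ext X F n.+1 t x)%:E) =
    fun n => (A + \int[(mu \x mu)%E]_q k (ext X F n) q)%E.
  by apply/funext => n; rewrite ext_mild// fub.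
apply: cvgeD => //; last exact: cvg_cst.
have hE : (\int[mu]_y (hk t (x - y) * (1 - F y))%:E = (heat t (fun y => 1 - F y) x)%:E)%E.
  by apply: heat_fin => // [|y]; [exact: measurable_funB|exact: compl_01].
by rewrite /A hE -EFinM fin_num_adde_defr.
Unshelve. all: by end_near. Qed.

End fixed_F.

End mild_form.

(** * The Duhamel formula *)

Section duhamel.
Context {R : realType}.
Local Notation mu := (@lebesgue_measure R).
Local Notation M := (mu \x mu)%E.

Lemma lebesgue2_sigma_finite : sigma_finite setT (mu \x mu)%E.
Proof.
have /sigma_finiteP[F [TF ndF Foo]] := sigma_finiteT mu.
exists (fun n => F n `*` F n).
  rewrite -setXTT {1 2}TF predeqE => -[x y]; split.
    move=> [/= [n _ Fnx] [k _ Fky]]; exists (maxn n k) => //; split.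
    - by move: x Fnx; exact/subsetPset/ndF/leq_maxl.
    - by move: y Fky; exact/subsetPset/ndF/leq_maxr.
  by move=> [n _ []/= ? ?]; split; exists n.
move=> k; have [? ?] := Foo k.
split; first exact: measurableX.
by rewrite product_measure1E// lte_mul_pinfty// ge0_fin_numE.
Qed.

Definition lebesgue2 : {sigma_finite_measure set _ -> \bar R} :=
  HB.pack (mu \x mu)%E (Measure_isSigmaFinite.Build _ _ _ _ lebesgue2_sigma_finite).

(** [Sk] is the heat kernel weighted by the expected population e^t and [Tk] the one killed at the
    first split; [Wk], half their difference, turns out to be their space-time convolution. *)
Definition Sk (t x : R) : R := expR t * hk t x.
Definition Tk (t x : R) : R := expR (- t) * hk t x.
Definition Wk (t x : R) : R := (expR t - expR (- t)) / 2 * hk t x.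

Lemma Sk_ge0 t x : 0 <= Sk t x.
Proof. by rewrite mulr_ge0 ?expR_ge0 ?hk_ge0. Qed.

Lemma Tk_ge0 t x : 0 <= Tk t x.
Proof. by rewrite mulr_ge0 ?expR_ge0 ?hk_ge0. Qed.

Lemma WkE t x : 2 * Wk t x + Tk t x = Sk t x.
Proof. by rewrite /Wk /Tk /Sk; field. Qed.

Lemma Wk_ge0 t x : 0 <= Wk t x.
Proof.
rewrite /Wk; have [t0|t0] := leP t 0; first by rewrite hk_le0// mulr0.
rewrite mulr_ge0 ?hk_ge0// divr_ge0// subr_ge0 ler_expR; lra.
Qed.

Lemma measurable_Sk d (S : measurableType d) (f g : S -> R) :
  measurable_fun setT f -> measurable_fun setT g ->
  measurable_fun setT (fun s => Sk (f s) (g s)).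
Proof.
move=> mf mg; apply: measurable_funM; last exact: measurable_hk2.
by apply: measurableT_comp => //; exact: measurable_expR.
Qed.

Lemma measurable_Tk d (S : measurableType d) (f g : S -> R) :
  measurable_fun setT f -> measurable_fun setT g ->
  measurable_fun setT (fun s => Tk (f s) (g s)).
Proof.
move=> mf mg; apply: measurable_funM; last exact: measurable_hk2.
apply: measurableT_comp; first exact: measurable_expR.
exact: measurableT_comp.
Qed.

Lemma measurable_Wk d (S : measurableType d) (f g : S -> R) :
  measurable_fun setT f -> measurable_fun setT g ->
  measurable_fun setT (fun s => Wk (f s) (g s)).
Proof.
move=> mf mg; apply: measurable_funM; last exact: measurable_hk2.
apply: measurable_funM => //; apply: measurable_funB.
  by apply: measurableT_comp => //; exact: measurable_expR.
apply: measurableT_comp; first exact: measurable_expR.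
exact: measurableT_comp.
Qed.

(** The time part of that convolution: after the shift by r the integrand is e^(t - r) / 2 times the
    exponential density of parameter 2. *)
Lemma integral_exp_window (r t : R) : r < t ->
  (\int[mu]_s (if (r < s < t)%R then expR (t + r - 2 * s) else 0%R)%:E =
   ((expR (t - r) - expR (- (t - r))) / 2)%:E)%E.
Proof.
move=> rt; have x0 : 0 < t - r by rewrite subr_gt0.
have ind (a b : R) : measurable_fun setT (fun s : R => (a < s) && (s < b)).
  by apply: measurable_and; apply: measurable_fun_ltr.
have mf : measurable_fun setT (fun s : R => (if (r < s < t)%R then expR (t + r - 2 * s) else 0%R)%:E).
  apply/measurable_EFinP; apply: measurable_fun_ifT => //.
  apply: measurableT_comp; first exact: measurable_expR.
  by apply: measurable_funB => //; exact: measurable_funM.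
have f0 s : (0 <= (if (r < s < t)%R then expR (t + r - 2 * s) else 0%R)%:E)%E.
  by rewrite lee_fin; case: ifP => // _; exact: expR_ge0.
rewrite -(integral_shift r mf f0).
have h := @exponential_prob_itv0c R 2 _ x0.
transitivity (\int[mu]_s ((expR (t - r) / 2)%:E * (if (0 <= s <= t - r)%R then exponential_pdf 2 s else 0%R)%:E))%E.
  apply: (@integral_eq_off _ _ _ 0 (t - r)).
    apply: emeasurable_funM => //; apply/measurable_EFinP; apply: measurable_fun_ifT => //.
      by apply: measurable_and; apply: measurable_fun_ler.
    exact: measurable_exponential_pdf.
  move=> s s0 st; rewrite -EFinM.
  have -> : (r < s + r < t) = (0 <= s <= t - r).
    rewrite (le_eqVlt 0 s) (le_eqVlt s) (negbTE st) (eq_sym 0) (negbTE s0)/=.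
    by apply/idP/idP => /andP[h1 h2]; apply/andP; split; lra.
  case: ifP => [/andP[h1 h2]|_]; last by rewrite mulr0.
  rewrite exponential_pdfE// mulrA mulfVK// -expRD; congr (expR _)%:E; ring.
rewrite ge0_integralZl ?lee_fin ?divr_ge0 ?expR_ge0//; last 2 first.
- apply/measurable_EFinP; apply: measurable_fun_ifT => //.
    by apply: measurable_and; apply: measurable_fun_ler.
  exact: measurable_exponential_pdf.
- by move=> s _; rewrite lee_fin; case: ifP => // _; exact: exponential_pdf_ge0.
have -> : (\int[mu]_s (if (0 <= s <= t - r)%R then exponential_pdf 2 s else 0%R)%:E =
    exponential_prob 2 `[0%R, (t - r)%R])%E.
  rewrite /exponential_prob [RHS]integral_mkcond; apply: eq_integral => s _.
  by rewrite patchE mem_setE in_itv/=; case: ifP.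
rewrite h -EFinB -EFinM; congr EFin.
rewrite mulrBr mulr1 mulrAC -expRD mulrBl; congr (_ - expR _ / 2); ring.
Qed.

Lemma kernel_compose (a c : R * R) :
  (\int[M]_q (Sk (a.1 - q.1) (a.2 - q.2) * Tk (q.1 - c.1) (q.2 - c.2))%:E =
   (Wk (a.1 - c.1) (a.2 - c.2))%:E)%E.
Proof.
rewrite fubini_tonelli1; last 2 first.
- apply/measurable_EFinP; apply: measurable_funM.
    by apply: measurable_Sk; exact: measurable_funB.
  by apply: measurable_Tk; exact: measurable_funB.
- by move=> q; rewrite lee_fin mulr_ge0 ?Sk_ge0 ?Tk_ge0.
rewrite /fubini_F /=.
transitivity (\int[mu]_s ((hk (a.1 - c.1) (a.2 - c.2))%:E *
    (if (c.1 < s < a.1)%R then expR (a.1 + c.1 - 2 * s) else 0%R)%:E))%E.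
  apply: eq_integral => s _; rewrite -EFinM.
  case: ifPn => [/andP[cs sa]|]; last first.
    rewrite negb_and -!leNgt mulr0 => h; apply: integral0_eq => y _.
    rewrite /Sk /Tk; case/orP: h => h.
      by rewrite (hk_le0 (y - c.2)) ?subr_le0// !mulr0.
    by rewrite hk_le0 ?subr_le0// mulr0 mul0r.
  under eq_integral do rewrite /Sk /Tk mulrACA EFinM.
  rewrite ge0_integralZl ?lee_fin ?mulr_ge0 ?expR_ge0//; last 2 first.
  - apply/measurable_EFinP; apply: measurable_funM; apply: measurable_hk2 => //; exact: measurable_funB.
  - by move=> y _; rewrite lee_fin mulr_ge0 ?hk_ge0.
  rewrite hk_semigroup ?subr_gt0// -EFinM mulrC -expRD.
  by congr (hk _ _ * expR _)%:E; ring.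
rewrite ge0_integralZl ?lee_fin ?hk_ge0//; last 2 first.
- apply/measurable_EFinP; apply: measurable_fun_ifT => //.
    by apply: measurable_and; apply: measurable_fun_ltr.
  apply: measurableT_comp; first exact: measurable_expR.
  by apply: measurable_funB => //; exact: measurable_funM.
- by move=> s _; rewrite lee_fin; case: ifP => // _; exact: expR_ge0.
have [ca|ca] := ltP c.1 a.1; last by rewrite /Wk hk_le0 ?subr_le0// mul0e mulr0.
by rewrite integral_exp_window// -EFinM mulrC.
Qed.

Section compose.
Context d' (E : measurableType d') (m : {sigma_finite_measure set E -> \bar R}).
Variables (th : E -> R * R) (f : E -> R).
Hypotheses (mth : measurable_fun setT th) (mf : measurable_fun setT f) (f0 : forall e, 0 <= f e).

Let mth1 : measurable_fun setT (fun e => (th e).1). Proof. exact: measurableT_comp. Qed.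
Let mth2 : measurable_fun setT (fun e => (th e).2). Proof. exact: measurableT_comp. Qed.

Let k (w : (R * R) * E) := Tk (w.1.1 - (th w.2).1) (w.1.2 - (th w.2).2) * f w.2.

Let mk : measurable_fun setT k.
Proof.
have m11 : measurable_fun setT (fun w : (R * R) * E => w.1.1) by exact: measurableT_comp.
have m12 : measurable_fun setT (fun w : (R * R) * E => w.1.2) by exact: measurableT_comp.
have m21 : measurable_fun setT (fun w : (R * R) * E => (th w.2).1) by exact: (measurableT_comp mth1).
have m22 : measurable_fun setT (fun w : (R * R) * E => (th w.2).2) by exact: (measurableT_comp mth2).
apply: measurable_funM; last exact: measurableT_comp.
by apply: measurable_Tk => //; exact: measurable_funB.
Qed.

Lemma measurable_Tint : measurable_fun setT (fun q : R * R =>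
  (\int[m]_e (Tk (q.1 - (th e).1) (q.2 - (th e).2) * f e)%:E)%E).
Proof.
have mk' : measurable_fun setT (EFin \o k) by exact/measurable_EFinP.
have k0 w : (0 <= (EFin \o k) w)%E by rewrite lee_fin mulr_ge0 ?Tk_ge0.
exact: (measurable_fun_fubini_tonelli_F (m2 := m) _ mk' k0).
Qed.

(** The sources sit at the points th e of space-time, with weights f. This covers both the initial
    datum, at th z = (0, z), and the source over the plane, with th the identity. *)
Lemma compose_Tint (a : R * R) :
  (\int[M]_q ((Sk (a.1 - q.1) (a.2 - q.2))%:E *
     \int[m]_e (Tk (q.1 - (th e).1) (q.2 - (th e).2) * f e)%:E) =
   \int[m]_e (Wk (a.1 - (th e).1) (a.2 - (th e).2) * f e)%:E)%E.
Proof.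
have mS : measurable_fun setT (fun q : R * R => Sk (a.1 - q.1) (a.2 - q.2)).
  by apply: measurable_Sk; exact: measurable_funB.
have mSk_ : measurable_fun setT (fun w : (R * R) * E => (Sk (a.1 - w.1.1) (a.2 - w.1.2) * k w)%:E).
  by apply/measurable_EFinP; apply: measurable_funM => //; exact: (measurableT_comp (g := fst) mS).
have Sk0 w : (0 <= (Sk (a.1 - w.1.1) (a.2 - w.1.2) * k w)%:E)%E.
  by rewrite lee_fin mulr_ge0 ?Sk_ge0// mulr_ge0 ?Tk_ge0.
transitivity (\int[M]_q \int[m]_e (Sk (a.1 - q.1) (a.2 - q.2) * k (q, e))%:E)%E.
  apply: eq_integral => q _; rewrite -ge0_integralZl ?lee_fin ?Sk_ge0//; last 2 first.
  - apply/measurable_EFinP; apply: measurable_funM => //.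
    by apply: measurable_Tk; exact: measurable_funB.
  - by move=> e _; rewrite lee_fin mulr_ge0 ?Tk_ge0.
have := @fubini_tonelli _ _ _ _ _ lebesgue2 m _ mSk_ Sk0; rewrite /= => ->.
apply: eq_integral => e _.
transitivity (\int[M]_q ((f e)%:E * (Sk (a.1 - q.1) (a.2 - q.2) *
    Tk (q.1 - (th e).1) (q.2 - (th e).2))%:E))%E.
  by apply: eq_integral => q _; rewrite -EFinM /k/=; congr EFin; ring.
rewrite ge0_integralZl ?lee_fin//; last 2 first.
- apply/measurable_EFinP; apply: measurable_funM => //.
  by apply: measurable_Tk; exact: measurable_funB.
- by move=> q _; rewrite lee_fin mulr_ge0 ?Sk_ge0 ?Tk_ge0.
by rewrite kernel_compose -EFinM mulrC.
Qed.

End compose.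

Section S_form.
Variables (u b : R * R -> R) (g : R -> R).
Hypotheses (mu_ : measurable_fun setT u) (mb : measurable_fun setT b) (mg : measurable_fun setT g).
Hypotheses (u0 : forall q, 0 <= u q) (b01 : forall q, 0 <= b q <= 1) (g0 : forall y, 0 <= g y).
Hypothesis us : forall q, q.1 <= 0 -> u q = 0.
Hypothesis bs : forall q, q.1 <= 0 -> b q = 0.
Hypothesis bu : forall q, b q <= 2 * u q.
Hypothesis hT : forall q, 0 < q.1 -> ((u q)%:E =
  \int[mu]_z (Tk q.1 (q.2 - z) * g z)%:E +
  \int[M]_c (Tk (q.1 - c.1) (q.2 - c.2) * b c)%:E)%E.

Let b0 q : 0 <= b q. Proof. by case/andP: (b01 q). Qed.

Let hT' q : ((u q)%:E =
  \int[mu]_z (Tk q.1 (q.2 - z) * g z)%:E +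
  \int[M]_c (Tk (q.1 - c.1) (q.2 - c.2) * b c)%:E)%E.
Proof.
have [q0|q0] := ltP 0 q.1; first exact: hT.
rewrite us// !integral0_eq ?adde0//.
- move=> c _; have [c0|c0] := leP c.1 0; first by rewrite bs// mulr0.
  by rewrite /Tk hk_le0 ?mulr0 ?mul0r//; lra.
- by move=> z _; rewrite /Tk hk_le0// mulr0 mul0r.
Qed.

Let mSk (a : R * R) : measurable_fun setT (fun q : R * R => Sk (a.1 - q.1) (a.2 - q.2)).
Proof. by apply: measurable_Sk; exact: measurable_funB. Qed.

(** Finiteness is for cancelling this term in the extended reals: b <= 1 lives on positive times, so
    the integral is at most a.1 e^(a.1). *)
Lemma finite_Sb a : (\int[M]_q (Sk (a.1 - q.1) (a.2 - q.2) * b q)%:E < +oo)%E.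
Proof.
have mSb : measurable_fun setT (fun q : R * R => (Sk (a.1 - q.1) (a.2 - q.2) * b q)%:E).
  by apply/measurable_EFinP; apply: measurable_funM => //; exact: mSk.
rewrite fubini_tonelli1//; last first.
  by move=> q; rewrite lee_fin mulr_ge0 ?Sk_ge0.
have [a0|a0] := leP a.1 0.
  rewrite integral0_eq ?ltry// => s _; apply: integral0_eq => y _ /=.
  have [s0|s0] := leP s 0; first by rewrite bs// mulr0.
  by rewrite /Sk hk_le0 ?mulr0 ?mul0r//; lra.
have mh (s : R) : measurable_fun setT (fun y : R => (hk (a.1 - s) (a.2 - y))%:E).
  by apply/measurable_EFinP; apply: measurable_hk2 => //; exact: measurable_funB.
apply: (@le_lt_trans _ _ (\int[mu]_s ((expR a.1)%:E * (\1_(`]0%R, a.1[ : set R) s)%:E))%E); last first.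
  rewrite ge0_integralZl ?lee_fin ?expR_ge0//; last by apply/measurable_EFinP; exact: measurable_indic.
  by rewrite integral_indic_oo ?(ltW a0)// -EFinM ltry.
apply: ge0_le_integral => //.
- by move=> s _; apply: integral_ge0 => y _; rewrite lee_fin mulr_ge0 ?Sk_ge0.
- apply: measurable_fun_fubini_tonelli_F => //.
  by move=> q; rewrite lee_fin mulr_ge0 ?Sk_ge0.
- by apply: emeasurable_funM => //; apply/measurable_EFinP; exact: measurable_indic.
- move=> s _; rewrite /fubini_F/= indicE mem_setE in_itv/= -EFinM.
  have [s0|s0] := leP s 0.
    rewrite integral0_eq ?mulr0// => y _; by rewrite bs// mulr0.
  have [sa|sa] := ltP s a.1; last first.
    by rewrite integral0_eq ?mulr0// => y _; rewrite /Sk hk_le0 ?mulr0 ?mul0r//; lra.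
  rewrite mulr1; apply: (@le_trans _ _ (\int[mu]_y ((expR a.1)%:E * (hk (a.1 - s) (a.2 - y))%:E))%E).
    apply: ge0_le_integral => //.
    + by move=> y _; rewrite lee_fin mulr_ge0 ?Sk_ge0.
    + apply: (measurableT_comp (g := fun y : R => (s, y)) mSb); exact: measurable_fun_pair.
    + by apply: emeasurable_funM; [exact: measurable_cst|exact: mh].
    + move=> y _; rewrite -EFinM lee_fin /Sk mulrAC ler_wpM2r ?hk_ge0//.
      case/andP: (b01 (s, y)) => q0 q1.
      apply: (@le_trans _ _ (expR (a.1 - s))); first by rewrite ler_piMr// expR_ge0.
      by rewrite ler_expR; lra.
  rewrite ge0_integralZl ?lee_fin ?expR_ge0//; last by move=> y _; rewrite lee_fin hk_ge0.
  by rewrite integral_hk ?mule1 ?lexx// subr_gt0.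
exact: mh.
Qed.

(* Applying the semigroup kernel Sk to the T-form and using Sk * Tk = (Sk - Tk) / 2
   turns e^(-t) into e^t. *)
Lemma duhamel_S (a : R * R) : 0 < a.1 ->
  ((u a)%:E + \int[M]_q (Sk (a.1 - q.1) (a.2 - q.2) * (2 * u q - b q))%:E =
   \int[mu]_z (Sk a.1 (a.2 - z) * g z)%:E)%E.
Proof.
move=> a0.
pose Su := (\int[M]_q (Sk (a.1 - q.1) (a.2 - q.2) * u q)%:E)%E.
pose Sb := (\int[M]_q (Sk (a.1 - q.1) (a.2 - q.2) * b q)%:E)%E.
pose K := (\int[M]_q (Sk (a.1 - q.1) (a.2 - q.2) * (2 * u q - b q))%:E)%E.
pose Wg := (\int[mu]_z (Wk a.1 (a.2 - z) * g z)%:E)%E.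
pose Wb := (\int[M]_c (Wk (a.1 - c.1) (a.2 - c.2) * b c)%:E)%E.
pose Tg := (\int[mu]_z (Tk a.1 (a.2 - z) * g z)%:E)%E.
pose Tb := (\int[M]_c (Tk (a.1 - c.1) (a.2 - c.2) * b c)%:E)%E.
pose Sg := (\int[mu]_z (Sk a.1 (a.2 - z) * g z)%:E)%E.
have mSb : measurable_fun setT (fun q : R * R => (Sk (a.1 - q.1) (a.2 - q.2) * b q)%:E).
  by apply/measurable_EFinP; by apply: measurable_funM => //; exact: mSk.
have mSu : measurable_fun setT (fun q : R * R => (Sk (a.1 - q.1) (a.2 - q.2) * u q)%:E).
  by apply/measurable_EFinP; exact: measurable_funM.
have mWb : measurable_fun setT (fun q : R * R => (Wk (a.1 - q.1) (a.2 - q.2) * b q)%:E).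
  apply/measurable_EFinP; apply: measurable_funM => //.
  by apply: measurable_Wk; exact: measurable_funB.
have mTb : measurable_fun setT (fun q : R * R => (Tk (a.1 - q.1) (a.2 - q.2) * b q)%:E).
  apply/measurable_EFinP; apply: measurable_funM => //.
  by apply: measurable_Tk; exact: measurable_funB.
have mWg : measurable_fun setT (fun z : R => (Wk a.1 (a.2 - z) * g z)%:E).
  apply/measurable_EFinP; apply: measurable_funM => //.
  by apply: measurable_Wk => //; exact: measurable_funB.
have mTg : measurable_fun setT (fun z : R => (Tk a.1 (a.2 - z) * g z)%:E).
  apply/measurable_EFinP; apply: measurable_funM => //.
  by apply: measurable_Tk => //; exact: measurable_funB.
have two : (2%:E = 1 + 1 :> \bar R)%E by rewrite -EFinD.
have e1 : (2%:E * Su = Sb + K)%E.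
  rewrite /Su /Sb /K -ge0_integralZl ?lee_fin//; last by move=> q _; rewrite lee_fin mulr_ge0 ?Sk_ge0.
  rewrite -ge0_integralD//; last 3 first.
  - by move=> q _; rewrite lee_fin mulr_ge0 ?Sk_ge0.
  - by move=> q _; rewrite lee_fin mulr_ge0 ?Sk_ge0// subr_ge0.
  - apply/measurable_EFinP; apply: measurable_funM; first exact: mSk.
    by apply: measurable_funB; [exact: measurable_funM|].
  by apply: eq_integral => q _; rewrite -EFinM -EFinD; congr EFin; ring.
have mth : measurable_fun setT (fun z : R => (0 : R, z)) by exact: measurable_fun_pair.
have mid : measurable_fun setT (fun q : R * R => q) by exact: measurable_id.
(* The equation with killing, convolved with [Sk]. *)
have e2 : Su = (Wg + Wb)%E.
  transitivity (\int[M]_q ((Sk (a.1 - q.1) (a.2 - q.2))%:E *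
      \int[mu]_z (Tk (q.1 - 0)%R (q.2 - z) * g z)%:E + (Sk (a.1 - q.1) (a.2 - q.2))%:E *
      \int[M]_c (Tk (q.1 - c.1) (q.2 - c.2) * b c)%:E))%E.
    apply: eq_integral => q _; rewrite EFinM hT' subr0 muleDr//.
    rewrite ge0_adde_def// inE; apply: integral_ge0 => z _; rewrite lee_fin mulr_ge0 ?Tk_ge0//.
  rewrite ge0_integralD//; last 4 first.
  - move=> q _; rewrite mule_ge0 ?lee_fin ?Sk_ge0//.
    by apply: integral_ge0 => z _; rewrite lee_fin mulr_ge0 ?Tk_ge0.
  - apply: emeasurable_funM; first by apply/measurable_EFinP; exact: mSk.
    exact: (measurable_Tint mu mth mg g0).
  - move=> q _; rewrite mule_ge0 ?lee_fin ?Sk_ge0//.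
    by apply: integral_ge0 => z _; rewrite lee_fin mulr_ge0 ?Tk_ge0.
  - apply: emeasurable_funM; first by apply/measurable_EFinP; exact: mSk.
    exact: (measurable_Tint lebesgue2 mid mb b0).
  rewrite (compose_Tint mu mth mg g0) (compose_Tint lebesgue2 mid mb b0).
  by rewrite /Wg; under eq_integral do rewrite /= subr0.
(* Adds the equation itself to twice its convolution, using 2 Wk + Tk = Sk on both terms. *)
have e3 : (2%:E * Su + (u a)%:E = Sg + Sb)%E.
  have hu : ((u a)%:E = Tg + Tb)%E by exact: hT'.
  have Wg0 : (0 <= Wg)%E by apply: integral_ge0 => z _; rewrite lee_fin mulr_ge0 ?Wk_ge0.
  have Wb0 : (0 <= Wb)%E by apply: integral_ge0 => z _; rewrite lee_fin mulr_ge0 ?Wk_ge0.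
  rewrite hu e2 (muleDr _ (ge0_adde_def _ _)) ?inE; [|by []|by []|by []].
  rewrite addeACA; congr (_ + _)%E.
    rewrite /Wg /Tg -ge0_integralZl ?lee_fin//; last by move=> z _; rewrite lee_fin mulr_ge0 ?Wk_ge0.
    rewrite -ge0_integralD//; last 3 first.
    + move=> z _; apply: mule_ge0; first by rewrite lee_fin.
    by rewrite lee_fin mulr_ge0 ?Wk_ge0.
    + exact: emeasurable_funM.
    + by move=> z _; rewrite lee_fin mulr_ge0 ?Tk_ge0.
    by apply: eq_integral => z _; rewrite -EFinM -EFinD -WkE; congr EFin; ring.
  rewrite /Wb /Tb -ge0_integralZl ?lee_fin//; last by move=> z _; rewrite lee_fin mulr_ge0 ?Wk_ge0.
  rewrite -ge0_integralD//; last 3 first.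
  + move=> z _; apply: mule_ge0; first by rewrite lee_fin.
    by rewrite lee_fin mulr_ge0 ?Wk_ge0.
  + exact: emeasurable_funM.
  + by move=> z _; rewrite lee_fin mulr_ge0 ?Tk_ge0.
  by apply: eq_integral => z _; rewrite -EFinM -EFinD -WkE; congr EFin; ring.
have Sbfin : Sb \is a fin_num.
  rewrite ge0_fin_numE; first exact: finite_Sb.
  by apply: integral_ge0 => q _; rewrite lee_fin mulr_ge0 ?Sk_ge0.
(* From 2 Su = Sb + K and 2 Su + u = Sg + Sb, cancelling Sb. *)
rewrite e1 in e3.
rewrite -[LHS](addeK _ Sbfin) -[RHS](addeK _ Sbfin); congr (_ - _)%E.
rewrite -[RHS]e3; by rewrite -[in RHS]addeA [RHS]addeC (addeC K).
Qed.

End S_form.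

End duhamel.

(** * From branching Brownian motion to the absorbed heat equation *)

Section absorbed_heat_bbm.
Context d (T : measurableType d) {R : realType} (P : probability T R) (p : nat -> R).
Hypotheses (hp : offspring_law p).
Variables (X : bbm_data R T) (bX : is_bbm P p X).
Local Notation mu := (@lebesgue_measure R).
Local Notation M := (mu \x mu)%E.
Local Notation r2 := (Num.sqrt 2 : R).

Lemma integral_flipZl (k : R -> \bar R) (t c : R) : measurable_fun setT k ->
  (forall s, 0 <= k s)%E -> 0 <= c ->
  (c%:E * \int[mu]_s k s = \int[mu]_s (c%:E * k (t - s)%R))%E.
Proof.
move=> mk k0 c0; rewrite -(@integral_flip _ _ t mk k0) ge0_integralZl ?lee_fin//.
by apply: (measurableT_comp mk); exact: measurable_funB.
Qed.

(** Cameron-Martin tilt: as (sqrt 2)^2 / 2 = 1, the weight e^(sqrt 2 z) in the frame of speed sqrt 2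
    exactly cancels the growth e^t. *)
Lemma drift_Sk (t z y : R) :
  expR (r2 * z) * Sk t (- (z - y) - r2 * t) = hk t (z - y) * expR (r2 * y).
Proof.
have [t0|t0] := leP t 0; first by rewrite /Sk !hk_le0// !(mulr0, mul0r).
rewrite /Sk /hk; set c := (_)^-1.
transitivity (c * expR (- (z - y) ^+ 2 / (2 * t) + r2 * y)); last by rewrite expRD mulrA.
rewrite [LHS](_ : _ = c * (expR (r2 * z) * expR t * expR (- (- (z - y) - r2 * t) ^+ 2 / (2 * t)))).
  rewrite -!expRD; congr (_ * expR _).
  have h : r2 ^+ 2 = 2 by rewrite sqr_sqrtr.
  have -> : (- (z - y) - r2 * t) ^+ 2 = (z - y) ^+ 2 + 2 * r2 * (z - y) * t + r2 ^+ 2 * t ^+ 2.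
    by ring.
  by rewrite h; field; rewrite gt_eqF.
by ring.
Qed.

Variables (F : R -> R).
Hypotheses (mF : measurable_fun setT F) (F01 : forall y, 0 <= F y <= 1).
Let U := extinction_compl P F X.
Let mX := bbm_is_measurable bX.

(** Space is reflected, z being minus the position in the moving frame: the starting point - a sqrt
    t + b - sqrt 2 t corresponds to z = a sqrt t - b. *)
Definition bbm_v (t z : R) : R := expR (r2 * z) * U t (- z - r2 * t).
Definition bbm_kap (s y : R) : R := if 0 < s then
  expR (r2 * y) * (2 * U s (- y - r2 * s) - bpgf p (U s (- y - r2 * s))) else 0.
Definition bbm_v0 (y : R) : R := expR (r2 * y) * (1 - F (- y)).

Let U01 s y : 0 <= U s y <= 1. Proof. exact: U_01. Qed.

Let mUc d' (S : measurableType d') (f g : S -> R) : measurable_fun setT f ->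
  measurable_fun setT g -> measurable_fun setT (fun s => U (f s) (g s)).
Proof.
move=> mf mg; apply: (measurableT_comp (g := fun s => (f s, g s)) (measurable_U P mF F01 mX)).
exact: measurable_fun_pair.
Qed.

Let u (q : R * R) : R := if 0 < q.1 then U q.1 q.2 else 0.
Let b (q : R * R) : R := bpos p U q.1 q.2.

Let mu_ : measurable_fun setT u.
Proof. by apply: measurable_fun_ifT => //; [exact: measurable_fun_ltr|exact: mUc]. Qed.

Let mb : measurable_fun setT b.
Proof. by apply: (measurable_bpos bX) => //; exact: mUc. Qed.

Let u0 q : 0 <= u q.
Proof. by rewrite /u; case: ifP => // _; case/andP: (U01 q.1 q.2). Qed.

Let bu q : b q <= 2 * u q.
Proof.
rewrite /b /u /bpos; case: ifP => _; last by rewrite mulr0.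
by case: (bpgf_bounds hp bX (U01 q.1 q.2)).
Qed.

Let CF01 y : 0 <= 1 - F y <= 1. Proof. exact: compl_01. Qed.

Lemma bbm_duhamel (t x : R) : 0 < t ->
  ((U t x)%:E + \int[M]_q (Sk (t - q.1) (x - q.2) * (2 * u q - b q))%:E =
   \int[mu]_z (Sk t (x - z) * (1 - F z))%:E)%E.
Proof.
move=> t0.
have mg : measurable_fun setT (fun y => 1 - F y) by exact: measurable_funB.
have b01 q : 0 <= b q <= 1 by exact: (bpos_01 _ _ bX).
have g0 y : 0 <= 1 - F y by case/andP: (CF01 y).
have us q : q.1 <= 0 -> u q = 0 by move=> q0; rewrite /u ltNge q0.
have bs q : q.1 <= 0 -> b q = 0 by move=> q0; rewrite /b /bpos ltNge q0.
have hT q : 0 < q.1 -> ((u q)%:E = \int[mu]_z (Tk q.1 (q.2 - z) * (1 - F z))%:E +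
    \int[M]_c (Tk (q.1 - c.1) (q.2 - c.2) * b c)%:E)%E.
  move=> q0; rewrite /u q0 (U_mild hp mF F01 q.2 bX q0); congr (_ + _)%E.
    rewrite -ge0_integralZl ?lee_fin ?expR_ge0//.
    + by apply: eq_integral => y _; rewrite -EFinM mulrA.
    + apply/measurable_EFinP; apply: measurable_funM => //.
      by apply: measurable_hk2 => //; exact: measurable_funB.
    + by move=> y _; rewrite lee_fin mulr_ge0 ?hk_ge0.
  rewrite fubini_tonelli1.
  + by apply: eq_integral => s _; apply: eq_integral => y _; rewrite /Tk/= mulrA.
  + apply/measurable_EFinP; apply: measurable_funM => //.
    by apply: measurable_Tk; exact: measurable_funB.
  + by move=> c; rewrite lee_fin mulr_ge0 ?Tk_ge0//; case/andP: (b01 c).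
have := duhamel_S mu_ mb mg u0 b01 g0 us bs bu hT (a := (t, x)) t0.
by rewrite /= {1}/u/= t0.
Qed.

(** First moment bound, e^t being the expected population: the absorption in the Duhamel formula is
    dropped. *)
Lemma U_le_exp (lam t x : R) : 0 < t -> (forall y, 1 - F y <= lam) -> U t x <= expR t * lam.
Proof.
move=> t0 gl.
have lam0 : 0 <= lam by apply: le_trans (gl 0); case/andP: (CF01 0).
have mh : measurable_fun setT (fun z : R => (hk t (x - z))%:E).
  by apply/measurable_EFinP; apply: measurable_hk2 => //; exact: measurable_funB.
have h := bbm_duhamel x t0; rewrite -lee_fin.
apply: (@le_trans _ _ (\int[mu]_z (Sk t (x - z) * (1 - F z))%:E)%E).
  rewrite -h leeDl//; apply: integral_ge0 => q _.
  by rewrite lee_fin mulr_ge0 ?Sk_ge0// subr_ge0.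
apply: (@le_trans _ _ (\int[mu]_z ((expR t * lam)%:E * (hk t (x - z))%:E))%E).
  apply: ge0_le_integral => //.
  - by move=> z _; rewrite lee_fin mulr_ge0 ?Sk_ge0//; case/andP: (CF01 z).
  - apply/measurable_EFinP; apply: measurable_funM; last exact: measurable_funB.
    by apply: measurable_Sk => //; exact: measurable_funB.
  - exact: emeasurable_funM.
  - move=> z _; rewrite -EFinM lee_fin /Sk [leRHS]mulrAC.
    by apply: ler_wpM2l; rewrite ?mulr_ge0 ?expR_ge0 ?hk_ge0.
rewrite ge0_integralZl ?lee_fin ?mulr_ge0 ?expR_ge0//; last first.
  by move=> z _; rewrite lee_fin hk_ge0.
by rewrite integral_hk// mule1.
Qed.

Lemma absorbed_heat_bbm (L : R) : (forall y, y < - L -> F y = 1) ->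
  absorbed_heat L (offspring_C p) bbm_v0 bbm_v bbm_kap.
Proof.
move=> FL.
have me d' (S : measurableType d') (f : S -> R) : measurable_fun setT f ->
    measurable_fun setT (fun s => expR (r2 * f s)).
  move=> mf; apply: measurableT_comp; first exact: measurable_expR.
  exact: measurable_funM.
have g0 y : 0 <= 1 - F y by case/andP: (CF01 y).
have mg : measurable_fun setT (fun y => 1 - F y) by exact: measurable_funB.
have e0 y : 0 <= expR (r2 * y) by exact: expR_ge0.
split.
- apply: measurable_funM; first exact: me.
  by apply: measurable_funB => //; apply: measurableT_comp.
- by move=> y; rewrite /bbm_v0 mulr_ge0//; case/andP: (CF01 (- y)).
- by move=> y; rewrite /bbm_v0 ler_piMr//; case/andP: (CF01 (- y)).
- by move=> y Ly; rewrite /bbm_v0 FL ?subrr ?mulr0// ltrN2.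
- apply: measurable_fun_ifT => //; first exact: measurable_fun_ltr.
  have mU : measurable_fun setT (fun q : R * R => U q.1 (- q.2 - r2 * q.1)).
    apply: mUc => //; apply: measurable_funB; first exact: measurableT_comp.
    exact: measurable_funM.
  apply: measurable_funM; first exact: me.
  apply: measurable_funB; first exact: measurable_funM.
  exact: (measurable_bpgf bX).
- move=> s y; rewrite /bbm_kap; case: ifP => // _; rewrite mulr_ge0// subr_ge0.
  by case: (bpgf_bounds hp bX (U01 s (- y - r2 * s))).
- by move=> s y s0; rewrite /bbm_kap ltNge s0.
- move=> s y s0; rewrite /bbm_kap s0 ler_wpM2l//.
  by case: (bpgf_bounds hp bX (U01 s (- y - r2 * s))) => h _ _; lra.
- by move=> s y _; rewrite /bbm_v ler_piMr//; case/andP: (U01 s (- y - r2 * s)).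
- move=> s y s0; rewrite /bbm_kap s0 /bbm_v exprMn expRN.
  rewrite -mulrA [X in _ <= _ * X]mulrA expr2 (mulrA (_)^-1) mulVf ?gt_eqF ?expR_gt0// mul1r.
  rewrite mulrCA ler_wpM2l//.
  by case: (bpgf_bounds hp bX (U01 s (- y - r2 * s))).
- move=> t z t0.
  (* The Duhamel formula at x = - z - sqrt 2 t, times e^(sqrt 2 z). The space variable is then
     changed to - y in the initial term and to - sqrt 2 s - y in the absorption. *)
  have := bbm_duhamel (- z - r2 * t) t0; move=> /(congr1 (fun e => (expR (r2 * z))%:E * e)%E).
  pose k (q : R * R) := (Sk (t - q.1) (- z - r2 * t - q.2) * (2 * u q - b q))%:E.
  have k0 q : (0 <= k q)%E by rewrite lee_fin mulr_ge0 ?Sk_ge0// subr_ge0.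
  have mk : measurable_fun setT k.
    apply/measurable_EFinP; apply: measurable_funM.
      by apply: measurable_Sk; exact: measurable_funB.
    by apply: measurable_funB => //; exact: measurable_funM.
  rewrite muleDr ?ge0_adde_def ?inE ?lee_fin//; last 2 first.
  - by case/andP: (U01 t (- z - r2 * t)).
  - by apply: integral_ge0 => q _; exact: k0.
  rewrite -EFinM -/(bbm_v t z).
  have mk1 s : measurable_fun setT (fun y : R => k (s, y)).
    by apply: (measurableT_comp mk); exact: pair1_measurable.
  have -> : ((expR (r2 * z))%:E *
      \int[mu]_y (Sk t (- z - r2 * t - y) * (1 - F y))%:E =
      \int[mu]_y (hk t (z - y) * bbm_v0 y)%:E)%E.
    have mS : measurable_fun setT (fun y : R => (Sk t (- z - r2 * t - y) * (1 - F y))%:E).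
      apply/measurable_EFinP; apply: measurable_funM => //.
      by apply: measurable_Sk => //; exact: measurable_funB.
    have S0 y : (0 <= (Sk t (- z - r2 * t - y) * (1 - F y))%:E)%E.
      by rewrite lee_fin mulr_ge0 ?Sk_ge0.
    rewrite (integral_flipZl 0 mS S0 (e0 z)).
    apply: eq_integral => y _; rewrite -EFinM sub0r mulrA opprK.
    rewrite (_ : - z - r2 * t + y = - (z - y) - r2 * t); last by ring.
    by rewrite drift_Sk -mulrA.
  move=> <-; congr (_ + _)%E; apply/esym.
  rewrite [X in (_ * X)%E](_ : _ = \int[mu]_s \int[mu]_y k (s, y))%E; last exact: fubini_tonelli1.
  rewrite -ge0_integralZl ?lee_fin//; last 2 first.
  - exact: (measurable_fun_fubini_tonelli_F (m2 := mu) _ mk k0).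
  - by move=> s _; apply: integral_ge0.
  apply: eq_integral => s _.
  rewrite (integral_flipZl (- (r2 * s)) (mk1 s) (fun y => k0 (s, y)) (e0 z)).
  apply: eq_integral => y _; rewrite /k/= -EFinM mulrA.
  rewrite (_ : - z - r2 * t - (- (r2 * s) - y) = - (z - y) - r2 * (t - s)); last by ring.
  rewrite drift_Sk -mulrA /bbm_kap /u /b /bpos/=.
  case: ifP => _; last by rewrite mulr0 subrr !mulr0.
  by rewrite (_ : - (r2 * s) - y = - y - r2 * s)//; ring.
Qed.

End absorbed_heat_bbm.

(** * Asymptotic mass *)

Lemma cvg_ratio {R : realType} (h f g : R -> R) (c A B : R) : (forall t, 0 < t -> 0 < h t) ->
  0 < c -> 0 < B -> h t * f t @[t --> +oo] --> c * A -> h t * g t @[t --> +oo] --> c * B ->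
  f t / g t @[t --> +oo] --> A / B.
Proof.
move=> h0 c0 B0 hf hg.
have cB : c * B != 0 by rewrite mulf_neq0 ?gt_eqF.
have <- : (c * A) * (c * B)^-1 = A / B by rewrite invfM mulrACA mulfV ?gt_eqF// mul1r.
apply: cvg_trans (cvgM hf (cvgV cB hg)); apply: near_eq_cvg; near=> t.
have t0 : 0 < t by near: t; exact: nbhs_pinfty_gt.
by rewrite /= invfM mulrACA mulfV ?mul1r// gt_eqF// h0.
Unshelve. all: by end_near. Qed.

Section mass.
Context d (T : measurableType d) {R : realType} (P : probability T R) (p : nat -> R).
Hypotheses (hp : offspring_law p).
Variables (X : bbm_data R T) (bX : is_bbm P p X).
Local Notation mu := (@lebesgue_measure R).
Local Notation r2 := (Num.sqrt 2 : R).
Let mX := bbm_is_measurable bX.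

Record cutoff (L : R) (F : R -> R) : Prop := {
  cut_m : measurable_fun setT F;
  cut_01 : forall y, 0 <= F y <= 1;
  cut_1 : forall y, y < - L -> F y = 1
}.

Local Notation U := (extinction_compl P).

Definition mass (F : R -> R) : R := heat_mass (bbm_v0 F) (bbm_kap P p X F).

Lemma cutoff_heat L F : cutoff L F ->
  absorbed_heat L (offspring_C p) (bbm_v0 F) (bbm_v P X F) (bbm_kap P p X F).
Proof. by move=> [mF F01 FL]; exact: absorbed_heat_bbm. Qed.

Lemma cvg_mass L F a b : cutoff L F -> 0 < a ->
  t * expR (r2 * (a * Num.sqrt t - b)) * U F X t (- a * Num.sqrt t + b - r2 * t)
    @[t --> +oo] --> clim a * mass F.
Proof.
move=> cF a0; have := ah_limit (offspring_C_ge0 hp) (cutoff_heat cF) b a0.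
apply: cvg_trans; apply: near_eq_cvg; apply: nearW => t.
by rewrite /bbm_v mulrA; congr (_ * U F X t _); ring.
Qed.

Lemma trunc_prod_mono n (Y : bbm_data R T) (F1 F2 : R -> R) t x w : (forall y, 0 <= F1 y <= F2 y) ->
  0 <= trunc_prod n Y F1 t x w <= trunc_prod n Y F2 t x w.
Proof.
move=> F12; elim: n Y t x => [|n IH] Y t x; first by rewrite /= lexx ler01.
rewrite !trunc_prodS; case: ifP => // _.
have h j := IH (sub_bbm Y j) (t - lifetime Y [::] w) (x + mot Y [::] (lifetime Y [::] w) w).
apply/andP; split; last by apply: ler_prod.
by apply: prodr_ge0 => j _; case/andP: (h j).
Qed.

Lemma trunc_prod_shift n (Y : bbm_data R T) (F : R -> R) c t x w :
  trunc_prod n Y (fun y => F (y + c)) t x w = trunc_prod n Y F t (x + c) w.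
Proof.
elim: n Y t x => [//|n IH] Y t x; rewrite !trunc_prodS.
case: ifP => _; first by rewrite addrAC.
by apply: eq_bigr => j _; rewrite IH addrAC.
Qed.

Lemma U_mono L1 L2 F1 F2 t x : cutoff L1 F1 -> cutoff L2 F2 -> (forall y, F1 y <= F2 y) ->
  U F2 X t x <= U F1 X t x.
Proof.
move=> c1 c2 F12.
have c1' := @cvg_ext _ _ _ P _ (cut_m c1) (cut_01 c1) X t x mX.
have c2' := @cvg_ext _ _ _ P _ (cut_m c2) (cut_01 c2) X t x mX.
apply: (ler_lim (cvgP _ c2') (cvgP _ c1')); near=> n.
rewrite -lee_fin -!extE//; do ?[exact: cut_m c1|exact: cut_m c2|exact: cut_01 c1|exact: cut_01 c2].
have m1 : measurable_fun setT (fun w => (1 - trunc_prod n X F1 t x w)%:E).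
  by apply/measurable_EFinP; apply: measurable_compl_trunc_prod => //; exact: cut_m c1.
have m2 : measurable_fun setT (fun w => (1 - trunc_prod n X F2 t x w)%:E).
  by apply/measurable_EFinP; apply: measurable_compl_trunc_prod => //; exact: cut_m c2.
apply: ge0_le_integral => //.
- by move=> w _; rewrite lee_fin; case/andP: (compl_trunc_prod_01 (cut_01 c2) X n t x w).
- move=> w _; rewrite lee_fin lerD2l lerN2.
  have F12' y : 0 <= F1 y <= F2 y by rewrite F12 andbT; case/andP: (cut_01 c1 y).
  by case/andP: (trunc_prod_mono n X t x w F12').
Unshelve. all: by end_near. Qed.

Lemma U_shift F c t x : U (fun y => F (y + c)) X t x = U F X t (x + c).
Proof.
rewrite /extinction_compl; congr (limn _); apply/funext => n.
by rewrite /ext; congr fine; apply: eq_integral => w _; rewrite trunc_prod_shift.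
Qed.

(** Not visible on the formula for the mass: inherited from U through the limit, taken at a = 1 and
    b = 0. *)
Lemma mass_mono L1 L2 F1 F2 : cutoff L1 F1 -> cutoff L2 F2 -> (forall y, F1 y <= F2 y) ->
  mass F2 <= mass F1.
Proof.
move=> c1 c2 F12; rewrite -(ler_pM2l (clim_gt0 (@ltr01 R))).
have h1 := cvg_mass 0 c1 (@ltr01 R); have h2 := cvg_mass 0 c2 (@ltr01 R).
apply: (ler_cvg_to h2 h1); near=> t.
have t0 : 0 < t by near: t; exact: nbhs_pinfty_gt.
by apply: ler_wpM2l; [rewrite mulr_ge0 ?expR_ge0// ltW|exact: U_mono c1 c2 F12].
Unshelve. all: by end_near. Qed.

Lemma cutoff_shift L F c : cutoff L F -> cutoff (L + c) (fun y => F (y + c)).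
Proof.
move=> [mF F01 FL]; split => //.
  by apply: (measurableT_comp mF); exact: measurable_funD.
by move=> y yL; apply: FL; lra.
Qed.

(** Shifting F moves the starting point, that is, replaces b = 0 by c. The limit does not see b, but
    the normalisation contains e^(- sqrt 2 b), whence the factor. *)
Lemma mass_shift L F c : cutoff L F -> mass (fun y => F (y + c)) = expR (r2 * c) * mass F.
Proof.
move=> cF; apply: (mulfI (lt0r_neq0 (clim_gt0 (@ltr01 R)))).
have h1 := cvg_mass 0 (cutoff_shift c cF) (@ltr01 R).
have h2 := cvg_mass c cF (@ltr01 R).
apply: (@cvg_unique _ _ _ _ _ _ h1); first exact: Rhausdorff.
rewrite mulrCA; have h3 : expR (r2 * c) * (t * expR (r2 * (1 * Num.sqrt t - c)) *
    U F X t (- 1 * Num.sqrt t + c - r2 * t)) @[t --> +oo] --> expR (r2 * c) * (clim 1 * mass F).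
  by apply: cvgM => //; exact: cvg_cst.
change (t * expR (r2 * (1 * Num.sqrt t - 0)) *
    U (fun y => F (y + c)) X t (- 1 * Num.sqrt t + 0 - r2 * t) @[t --> +oo] --> expR (r2 * c) * (clim 1 * mass F)).
apply: cvg_trans h3; apply: near_eq_cvg; apply: nearW => t.
rewrite U_shift mulrA [_ * (t * _)]mulrCA -expRD.
by congr (t * expR _ * U F X t _); ring.
Qed.

Definition nonpos (y : R) : R := (y <= 0)%R%:R.

Lemma bool_01 (b : bool) : 0 <= (b%:R : R) <= 1.
Proof. by case: b; rewrite ?lexx ?ler01. Qed.

Lemma cutoff_nonpos : cutoff 0 nonpos.
Proof.
split.
- apply: (measurableT_comp (f := fun b : bool => b%:R : R)) => //.
  exact: measurable_fun_ler.
- by move=> y; exact: bool_01.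
- by move=> y; rewrite oppr0 /nonpos => /ltW ->.
Qed.

Lemma cutoff_thin (L lam : R) (b : R -> bool) : 0 <= lam <= 1 -> measurable_fun setT b ->
  (forall y, y < - L -> b y = false) -> cutoff L (fun y => 1 - lam * (b y)%:R).
Proof.
move=> /andP[l0 l1] mb bL; split.
- apply: measurable_funB => //; apply: measurable_funM => //.
  exact: (measurableT_comp (f := fun b : bool => b%:R : R)).
- by move=> y; case: (b y); apply/andP; split; rewrite ?mulr1 ?mulr0; lra.
- by move=> y /bL ->; rewrite mulr0 subr0.
Qed.

Lemma inv_succ_01 n : 0 <= (n.+1%:R^-1 : R) <= 1.
Proof. by rewrite invr_ge0 ler0n/= invf_le1// ler1n. Qed.

Lemma bbm_v0_thin (lam : R) (b : R -> bool) y :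
  bbm_v0 (fun y => 1 - lam * (b y)%:R) y = lam * (expR (r2 * y) * (b (- y))%:R).
Proof. by rewrite /bbm_v0 opprB addrC subrK mulrCA. Qed.

(** Data of size 1 / (n + 1) with a common cutoff; the source of the tightness of the counts. *)
Lemma cvg_mass0 (L : R) : mass (fun y => 1 - n.+1%:R^-1 * (- L < y)%R%:R) @[n --> \oo] --> (0 : R).
Proof.
pose b (y : R) := - L < y.
have mb : measurable_fun setT b by exact: measurable_fun_ltr.
have cF n : cutoff L (fun y => 1 - n.+1%:R^-1 * (b y)%:R).
  by apply: cutoff_thin => //; [exact: inv_succ_01|move=> y yL; rewrite /b ltNge (ltW yL)].
have := @cvg_heat_mass0 R L (offspring_C p) (offspring_C_ge0 hp) _ _ _ (fun n => n.+1%:R^-1)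
  (expR (r2 * L)) (fun n => cutoff_heat (cF n)).
apply; first exact: cvg_harmonic.
move=> n y; rewrite bbm_v0_thin ler_wpM2l//.
rewrite /b ltrN2; case: ltP => yL; last by rewrite mulr0 expR_ge0.
by rewrite mulr1 ler_expR ler_wpM2l// ltW.
Qed.

(** The sign is accessible for small data only. A thin bump on ]-2,
    -1[ has its reflected datum on ]1, 2[, with positive first moment, so its mass is positive for a
    small amplitude; it is compared with [nonpos] shifted by 2, and the shift only multiplies the
    mass. *)
Lemma mass_nonpos_gt0 : 0 < mass nonpos.
Proof.
pose b (y : R) := (-2 < y) && (y < -1).
have mb : measurable_fun setT b by apply: measurable_and; exact: measurable_fun_ltr.
have cF n : cutoff 2 (fun y => 1 - n.+1%:R^-1 * (b y)%:R).
  apply: cutoff_thin => //; first exact: inv_succ_01.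
  by move=> y yL; rewrite /b ltNge (ltW yL).
pose v0 y := expR (r2 * y) * (b (- y))%:R.
have mv0 : measurable_fun setT v0.
  apply: measurable_funM.
    apply: measurableT_comp; first exact: measurable_expR.
    exact: measurable_funM.
  apply: (measurableT_comp (f := fun b : bool => b%:R : R)) => //.
  exact: measurableT_comp.
have v0E y : v0 y = expR (r2 * y) * \1_(`]1, 2[ : set R) y.
  by rewrite /v0 /b indicE mem_setE in_itv/= ltrN2 ltrNl opprK andbC.
have i12 : mu.-integrable setT (EFin \o (\1_(`]1, 2[ : set R))).
  apply/integrableP; split; first by apply/measurable_EFinP; exact: measurable_indic.
  under eq_integral do rewrite gee0_abs ?lee_fin//.
  rewrite integral_indic//= setIT lebesgue_measure_itv/= lte_fin ltr1n/= -EFinB.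
  exact: ltry.
have iv0 : mu.-integrable setT (EFin \o (fun y => y * v0 y)).
  have i2 := @integrableZl _ _ _ mu setT measurableT (2 * expR (r2 * 2)) _ i12.
  apply: (le_integrable measurableT _ _ i2).
  - by apply/measurable_EFinP; exact: measurable_funM.
  - move=> y _ /=; rewrite lee_fin v0E indicE mem_setE in_itv/=.
    have [/andP[y1 y2]|_] := boolP (1 < y < 2); last by rewrite !mulr0 normr0.
    have y0 : 0 <= y by rewrite ltW// (lt_trans _ y1).
    rewrite !mulr1 ger0_norm ?mulr_ge0 ?expR_ge0// ger0_norm ?mulr_ge0 ?expR_ge0//.
    by rewrite ler_pM ?expR_ge0 ?(ltW y2)// ler_expR ler_wpM2l// ltW.
have I0 : 0 < (\int[mu]_y (y * v0 y))%R.
  apply: (@lt_le_trans _ _ (\int[mu]_y (\1_(`]1, 2[ : set R) y))%R).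
    rewrite /Rintegral integral_indic//= setIT lebesgue_measure_itv/= lte_fin ltr1n/=.
    lra.
  apply: le_Rintegral => // y _; rewrite v0E indicE mem_setE in_itv/=.
  have [/andP[y1 y2]|_] := boolP (1 < y < 2); last by rewrite !mulr0.
  rewrite !mulr1 -[leLHS]mulr1 ler_pM ?ler01 ?(ltW y1)//.
  by rewrite -expR0 ler_expR mulr_ge0// ltW// (lt_trans _ y1).
have vle n y : bbm_v0 (fun y => 1 - n.+1%:R^-1 * (b y)%:R) y <= n.+1%:R^-1 * expR (r2 * 2).
  rewrite bbm_v0_thin ler_wpM2l//.
  have [by_|by_] := boolP (b (- y)); last by rewrite mulr0 expR_ge0.
  rewrite mulr1 ler_expR ler_wpM2l//.
  by move: by_ => /andP[h1 h2]; lra.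
have lp n : 0 < (n.+1%:R^-1 : R) by rewrite invr_gt0.
have [n n0] := @heat_mass_pos R 2 (offspring_C p) (offspring_C_ge0 hp) _ _ _ (fun n => n.+1%:R^-1)
  (expR (r2 * 2)) (fun n => cutoff_heat (cF n)) (@cvg_harmonic R)
  vle v0 (expR_ge0 _) lp
  (fun n y => bbm_v0_thin _ b y) I0 iv0.
have c2 := cutoff_shift 2 cutoff_nonpos.
have : mass (fun y => 1 - n.+1%:R^-1 * (b y)%:R) <= mass (fun y => nonpos (y + 2)).
  apply: mass_mono c2 (cF n) _ => y; rewrite /nonpos.
  have [y2|y2] := leP (y + 2) 0; first by rewrite /b (_ : -2 < y = false) ?mulr0 ?subr0//; apply/negP; lra.
  by case/andP: (cut_01 (cF n) y).
rewrite (mass_shift _ cutoff_nonpos) => /(lt_le_trans n0).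
by rewrite pmulr_rgt0 ?expR_gt0.
Qed.

Lemma cvg_U_ratio L F (a b : R) : cutoff L F -> 0 < a ->
  U F X t (- a * Num.sqrt t + b - r2 * t) / U nonpos X t (- a * Num.sqrt t + b - r2 * t)
    @[t --> +oo] --> mass F / mass nonpos.
Proof.
move=> cF a0.
apply: (cvg_ratio (h := fun t => t * expR (r2 * (a * Num.sqrt t - b))) _ (clim_gt0 a0) mass_nonpos_gt0).
- by move=> t t0; rewrite mulr_gt0 ?expR_gt0.
- exact: (cvg_mass b cF).
- exact: (cvg_mass b cutoff_nonpos).
Qed.

End mass.

(** * Particles alive at a given time *)

Section alive_lists.
Context {R : realType} (T : Type).
Implicit Types (X : bbm_data R T) (w : T) (u v : label).

Lemma realized_rcons X v j w :
  realized X (rcons v j) w <-> (j < offspring X [::] w)%N /\ realized (sub_bbm X j) v w.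
Proof.
elim: v => [|i v IH] /=; first by split=> -[].
by rewrite IH; split=> [[[h1 h2] h3]|[h1 [h2 h3]]].
Qed.

Lemma birth_time_rcons X v j w :
  birth_time X (rcons v j) w = lifetime X [::] w + birth_time (sub_bbm X j) v w.
Proof. by elim: v => [|i v IH] /=; [rewrite add0r addr0|rewrite IH addrA]. Qed.

Lemma birth_place_rcons X v j w : birth_place X (rcons v j) w =
  motion X [::] (lifetime X [::] w) w + birth_place (sub_bbm X j) v w.
Proof. by elim: v => [|i v IH] /=; [rewrite add0r addr0|rewrite IH addrA]. Qed.

Lemma position_rcons X v j t w : position X (rcons v j) t w =
  motion X [::] (lifetime X [::] w) w + position (sub_bbm X j) v (t - lifetime X [::] w) w.
Proof. by rewrite /position birth_place_rcons birth_time_rcons /= opprD !addrA. Qed.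

Lemma birth_time_ge0 X u w : (forall u w, 0 <= lifetime X u w) -> 0 <= birth_time X u w.
Proof. by move=> l0; elim: u => //= _ u IH; rewrite addr_ge0. Qed.

Lemma alive_rcons X v j t w : alive X t w (rcons v j) <->
  (j < offspring X [::] w)%N /\ alive (sub_bbm X j) (t - lifetime X [::] w) w v.
Proof.
rewrite /alive realized_rcons birth_time_rcons /= -addrA lerBrDl ltrBlDl.
by split=> [[[h1 h2] h3]|[h1 [h2 h3]]].
Qed.

(** Follows the recursion of [trunc_prod], which makes the truncated product a product over this
    list. *)
Fixpoint alive_list (n : nat) X (t : R) (w : T) : seq label :=
  if n is m.+1 then
    let tau := lifetime X [::] w in
    if t < tau then [:: [::]] else
    [seq rcons u j | j <- iota 0 (offspring X [::] w), u <- alive_list m (sub_bbm X j) (t - tau) w]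
  else [::].

Lemma alive_listP n X t w u : (forall u w, 0 <= lifetime X u w) -> 0 <= t ->
  u \in alive_list n X t w <-> (size u < n)%N /\ alive X t w u.
Proof.
elim: n X t u => [|n IH] X t u l0 t0 /=; first by split=> [//|[]].
have ls j v w' : 0 <= lifetime (sub_bbm X j) v w' by exact: l0.
case: ifPn => tt.
  rewrite mem_seq1; split=> [/eqP ->|]; first by split=> //; split=> //=; rewrite add0r t0.
  case/lastP: u => // v j [_ /alive_rcons[_ [_ /andP[h _]]]].
  have := le_trans (birth_time_ge0 v w (ls j)) h; rewrite subr_ge0 leNgt; by rewrite tt.
rewrite -leNgt in tt.
split.
- move=> /allpairsPdep[j [v [+ + ->]]]; rewrite mem_iota/= add0n => jK.
  rewrite (IH _ _ v (ls j)) ?subr_ge0// size_rcons ltnS => -[h1 h2]; split => //.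
  by apply/alive_rcons.
- case/lastP: u => [|v j] [].
    by move=> _ [_] /=; rewrite add0r ltNge tt andbF.
  rewrite size_rcons ltnS => vn /alive_rcons[jK av].
  apply/allpairsPdep; exists j, v; rewrite mem_iota/= add0n jK; split => //.
  by apply/IH => //; rewrite subr_ge0.
Qed.

Lemma uniq_alive_list n X t w : uniq (alive_list n X t w).
Proof.
elim: n X t => [//|n IH] X t /=; case: ifP => // _.
apply: allpairs_uniq_dep; first exact: iota_uniq.
  by move=> j _; exact: IH.
by move=> [j u] [j' u'] /= _ _ /rcons_inj[-> ->].
Qed.

Lemma trunc_prod_alive n X (F : R -> R) t x w : (forall u w, 0 <= lifetime X u w) -> 0 <= t ->
  trunc_prod n X F t x w = \prod_(u <- alive_list n X t w) F (x + position X u t w).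
Proof.
elim: n X t x => [|n IH] X t x l0 t0; first by rewrite big_nil.
rewrite trunc_prodS /=; case: ifPn => tt.
  by rewrite big_seq1 /position /= subr0 add0r mot_ge0.
rewrite big_allpairs_dep; apply: eq_bigr => j _.
have ls v w' : 0 <= lifetime (sub_bbm X j) v w' by exact: l0.
rewrite IH ?subr_ge0 1?leNgt//; apply: eq_bigr => u _.
by rewrite position_rcons (mot_ge0 _ _ _ (l0 _ _)) !addrA.
Qed.

Lemma alive_list_sub n m X t w : (forall u w, 0 <= lifetime X u w) -> 0 <= t -> (n <= m)%N ->
  {subset alive_list n X t w <= alive_list m X t w}.
Proof.
move=> l0 t0 nm u h; have [h1 h2] := (alive_listP _ _ _ l0 t0).1 h; apply/alive_listP => //.
by split=> //; exact: leq_trans nm.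
Qed.

Lemma size_alive_list n m X t w : (forall u w, 0 <= lifetime X u w) -> 0 <= t -> (n <= m)%N ->
  (size (alive_list n X t w) <= size (alive_list m X t w))%N.
Proof.
by move=> l0 t0 nm; apply: uniq_leq_size; [exact: uniq_alive_list|exact: alive_list_sub].
Qed.

(** As the lists increase with n, unbounded size is the only obstruction to their being eventually
    constant. *)
Definition explosive X (t : R) : set T :=
  [set w | forall m, exists n, (m <= size (alive_list n X t w))%N].

Definition stable X t w (s : seq label) := exists n0, forall n, (n0 <= n)%N ->
  perm_eq (alive_list n X t w) s.

Lemma stable_exists X t w : (forall u w, 0 <= lifetime X u w) -> 0 <= t ->
  ~ explosive X t w -> exists s, stable X t w s.
Proof.
move=> l0 t0 /existsNP[m /forallNP hm].
have hm' n : (size (alive_list n X t w) <= m)%N.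
  by have /negP := hm n; rewrite -ltnNge => /ltnW.
have ex : exists k, `[< exists n, size (alive_list n X t w) = k >].
  by exists (size (alive_list 0 X t w)); apply/asboolP; exists 0%N.
have ub k : `[< exists n, size (alive_list n X t w) = k >] -> (k <= m)%N.
  by move=> /asboolP[n <-]; exact: hm'.
(* A generation of maximal size: the later lists contain its list and cannot be longer. *)
case: (ex_maxnP ex ub) => k /asboolP[n0 n0k] kmax.
exists (alive_list n0 X t w), n0 => n nn0.
rewrite perm_sym; apply: uniq_perm; [exact: uniq_alive_list|exact: uniq_alive_list|].
have [|_ h] := uniq_min_size (uniq_alive_list n0 X t w) (alive_list_sub (w := w) l0 t0 nn0).
  by rewrite n0k; apply: kmax; apply/asboolP; exists n.
by [].
Qed.

(** Empty in the explosive case, a default that makes the counts 0 there. *)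
Definition alist X (t : R) (w : T) : seq label :=
  if pselect (exists s, stable X t w s) is left h then projT1 (cid h) else [::].

Section good.
Variables (X : bbm_data R T) (t : R) (w : T).
Hypotheses (l0 : forall u w, 0 <= lifetime X u w) (t0 : 0 <= t) (good : ~ explosive X t w).

Lemma alist_stable : stable X t w (alist X t w).
Proof.
rewrite /alist; case: pselect => [h|]; first by case: cid.
by case; exact: stable_exists.
Qed.

Lemma alistP u : u \in alist X t w <-> alive X t w u.
Proof.
have [n0 hn] := alist_stable.
rewrite -(perm_mem (hn (maxn n0 (size u).+1) (leq_maxl _ _))).
split=> [h|au]; first by have [] := (alive_listP _ _ _ l0 t0).1 h.
by apply/alive_listP => //; rewrite leq_maxr.
Qed.

Lemma uniq_alist : uniq (alist X t w).
Proof. by have [n0 hn] := alist_stable; rewrite -(perm_uniq (hn n0 (leqnn _))) uniq_alive_list. Qed.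

Lemma trunc_prod_alist (F : R -> R) x : \forall n \near \oo,
  trunc_prod n X F t x w = \prod_(u <- alist X t w) F (x + position X u t w).
Proof.
have [n0 hn] := alist_stable; exists n0 => // n nn0.
by rewrite trunc_prod_alive// (perm_big _ (hn n nn0)).
Qed.

End good.

End alive_lists.

(** * Almost sure finiteness of the population *)

Section population.
Context d (T : measurableType d) {R : realType} (P : probability T R) (p : nat -> R).
Hypotheses (hp : offspring_law p).
Variables (X : bbm_data R T) (bX : is_bbm P p X).
Let mX : bbm_measurable X := bbm_is_measurable bX.
Let l0 : forall u w, 0 <= lifetime X u w := lifetime_ge0 bX.

Definition pprod (F : R -> R) (t x : R) (w : T) : R := limn (fun n => trunc_prod n X F t x w).

Section fixed_F.
Variables (F : R -> R) (mF : measurable_fun setT F) (F01 : forall y, 0 <= F y <= 1).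

Lemma cvg_trunc_prod t x w : trunc_prod n X F t x w @[n --> \oo] --> pprod F t x w.
Proof.
apply: nonincreasing_is_cvgn.
  by apply/nonincreasing_seqP => n; exact: trunc_prod_le.
by exists 0 => _ [n _ <-]; case/andP: (trunc_prod_01 n X t x w F01).
Qed.

Lemma pprod_01 t x w : 0 <= pprod F t x w <= 1.
Proof.
have c := @cvg_trunc_prod t x w; apply/andP; split.
  apply: (limr_ge (cvgP _ c)); near=> n; by case/andP: (trunc_prod_01 n X t x w F01).
apply: (limr_le (cvgP _ c)); near=> n; by case/andP: (trunc_prod_01 n X t x w F01).
Unshelve. all: by end_near. Qed.

Lemma measurable_pprod t x : measurable_fun setT (pprod F t x).
Proof.
apply: (@measurable_fun_cvg _ _ _ setT (fun n w => trunc_prod n X F t x w)).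
  by move=> n; exact: measurable_trunc_prod2.
by move=> w _; exact: cvg_trunc_prod.
Qed.

Lemma expectation_pprod t x :
  (\int[P]_w (1 - pprod F t x w)%:E = (extinction_compl P F X t x)%:E)%E.
Proof.
have mono : ((ext P X F n t x)%:E @[n --> \oo] --> \int[P]_w (1 - pprod F t x w)%:E)%E.
  have -> : (fun n => (ext P X F n t x)%:E) = (fun n => \int[P]_w (1 - trunc_prod n X F t x w)%:E)%E.
    by apply/funext => n; rewrite extE.
  have -> : (fun w => (1 - pprod F t x w)%:E) = (fun w => limn (fun n => (1 - trunc_prod n X F t x w)%:E)).
    apply/funext => w; apply/esym/cvg_lim => //; apply: cvg_EFin; first by near=> n.
    by apply: cvgB; [exact: cvg_cst|exact: cvg_trunc_prod].
  apply: cvg_monotone_convergence => //.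
  - by move=> n; apply/measurable_EFinP; exact: measurable_compl_trunc_prod.
  - by move=> n w _; rewrite lee_fin; case/andP: (compl_trunc_prod_01 F01 X n t x w).
  - move=> w _; apply/nondecreasing_seqP => n; rewrite lee_fin lerD2l lerN2.
    exact: trunc_prod_le.
apply: (cvg_unique _ mono) => //; apply: cvg_EFin; first by near=> n.
have c := @cvg_ext _ _ _ P _ mF F01 X t x mX; exact: c.
Unshelve. all: by end_near. Qed.

Lemma pprod_alist t x w : 0 <= t -> ~ explosive X t w ->
  pprod F t x w = \prod_(u <- alist X t w) F (x + position X u t w).
Proof.
move=> t0 good; apply: cvg_lim => //.
apply: cvg_near_cst; have := trunc_prod_alist l0 t0 good F x.
by apply: filterS => n ->.
Qed.

End fixed_F.

Let half : R := 2^-1.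

(** With F = 1/2 the product is 2 to the minus population size, so that events about the size
    inherit the measurability of [trunc_prod]. *)
Lemma size_alive_half n m t w : 0 <= t ->
  (m <= size (alive_list n X t w))%N = (trunc_prod n X (fun=> half) t 0 w <= half ^+ m).
Proof.
move=> t0; rewrite trunc_prod_alive// big_const_seq count_predT iter_mulr_1.
by rewrite ler_iXn2l// /half ?invr_gt0// invf_lt1// ltr1n.
Qed.

Let Bn t m n : set T := [set w | (m <= size (alive_list n X t w))%N].

Let mBn t m n : 0 <= t -> measurable (Bn t m n).
Proof.
move=> t0; rewrite /Bn (_ : [set _ | _] = [set w | trunc_prod n X (fun=> half) t 0 w <= half ^+ m]).
  rewrite -[X in measurable X]setTI.
  apply: (measurable_fun_ler (f := fun w => trunc_prod n X (fun=> half) t 0 w) (g := fun=> half ^+ m) _ _ measurableT (Y := [set true])) => //.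
  exact: measurable_trunc_prod2.
by apply/seteqP; split=> w /=; rewrite size_alive_half.
Qed.

Lemma measurable_explosive t : 0 <= t -> measurable (explosive X t).
Proof.
move=> t0; rewrite (_ : explosive X t = \bigcap_m \bigcup_n Bn t m n).
  by apply: bigcapT_measurable => m; apply: bigcupT_measurable => n; exact: mBn.
apply/seteqP; split=> w /= h m; first by move=> _; have [n hn] := h m; exists n.
by have [n _ hn] := h m I; exists n.
Qed.

(** With F = 1 - lam the product is (1 - lam) to the population size, at most 1/2 once the size
    reaches some m. Markov and the first moment bound give probability at most 2 e^t lam, uniformly
    in the number of generations; then lam tends to 0. *)
Lemma explosive_null t : 0 < t -> P (explosive X t) = 0.
Proof.
move=> t0; have t0' := ltW t0.
have Pe0 : (0 <= P (explosive X t))%E by [].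
have key lam : 0 < lam -> lam < 1 -> (P (explosive X t) <= (2 * (expR t * lam))%:E)%E.
  move=> lam0 lam1.
  have l01 : 0 < 1 - lam < 1 by apply/andP; split; lra.
  have [m hm] : exists m, (1 - lam) ^+ m <= 2^-1.
    have := @cvg_expr R (1 - lam); rewrite ger0_norm; last by case/andP: l01 => /ltW.
    case/andP: (l01) => _ h => /(_ h) /cvgrPdist_le/(_ 2^-1).
    rewrite invr_gt0 ltr0n => /(_ isT)[m _ /(_ m (leqnn m))].
    rewrite /= sub0r normrN ger0_norm ?exprn_ge0//; last by case/andP: l01 => /ltW.
    by exists m.
  pose Fl (y : R) : R := 1 - lam.
  have mFl : measurable_fun setT Fl by exact: measurable_cst.
  have Fl01 y : 0 <= Fl y <= 1 by rewrite /Fl; apply/andP; split; lra.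
  have PB n : (P (Bn t m n) <= (2 * (expR t * lam))%:E)%E.
    have Ul : (\int[P]_w (1 - trunc_prod n X Fl t 0 w)%:E <= (expR t * lam)%:E)%E.
      rewrite extE// lee_fin; apply: (le_trans (ext_le_U P mFl Fl01 n t 0 mX)).
      by apply: (U_le_exp hp bX mFl Fl01) => // y; rewrite /Fl; lra.
    apply: (@le_trans _ _ (2%:E * \int[P]_w (1 - trunc_prod n X Fl t 0 w)%:E)%E); last first.
      by rewrite EFinM lee_pmul2l.
    have m1 : measurable_fun setT (fun w => (1 - trunc_prod n X Fl t 0 w)%:E).
      by apply/measurable_EFinP; exact: measurable_compl_trunc_prod.
    have c0 w : (0 <= (1 - trunc_prod n X Fl t 0 w)%:E)%E.
      by rewrite lee_fin; case/andP: (compl_trunc_prod_01 Fl01 X n t 0 w).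
    rewrite -ge0_integralZl//.
    rewrite -(setIT (Bn t m n)) -integral_indic//; last exact: mBn.
    apply: ge0_le_integral => //.
    - by apply/measurable_EFinP; apply: measurable_indic; exact: mBn.
    - exact: emeasurable_funM.
    - move=> w _; rewrite indicE; case: (boolP (w \in _)) => [|_]; last by apply: mule_ge0.
      rewrite inE /Bn/= => ms.
      rewrite -EFinM lee_fin trunc_prod_alive// /Fl big_const_seq count_predT iter_mulr_1.
      have : (1 - lam) ^+ size (alive_list n X t w) <= (1 - lam) ^+ m.
        by rewrite ler_wiXn2l//; lra.
      rewrite /=; lra.
  apply: (@le_trans _ _ (P (\bigcup_n Bn t m n))).
    apply: le_measure; rewrite ?inE; [exact: measurable_explosive| |].
      by apply: bigcupT_measurable => n; exact: mBn.
    by move=> w hw; have [n hn] := hw m; exists n.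
  have nd : nondecreasing_seq (Bn t m).
    move=> n n' nn'; apply/subsetPset => w; rewrite /Bn/= => /leq_trans; apply.
    exact: size_alive_list.
  have := nondecreasing_cvg_mu (mu := P) (F := Bn t m) (fun n => mBn m n t0').
  have mU : measurable (\bigcup_n Bn t m n) by apply: bigcupT_measurable => n; exact: mBn.
  move=> /(_ mU nd) c.
  rewrite -(cvg_lim _ c)//; apply: lime_le; first exact: cvgP c.
  by apply: nearW => n; exact: PB.
apply/eqP; rewrite eq_le Pe0 andbT; apply/lee_addgt0Pr => e e0; rewrite add0e.
pose lam := Num.min (2^-1) (e / (2 * expR t)).
have lam0 : 0 < lam by rewrite lt_min invr_gt0 ltr0n divr_gt0// mulr_gt0 ?expR_gt0.
apply: (le_trans (key lam lam0 _)); first by rewrite gt_min invf_lt1// ltr1n.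
rewrite lee_fin mulrA mulrC -ler_pdivlMr ?mulr_gt0 ?expR_gt0//.
by rewrite ge_min lexx orbT.
Qed.

End population.

(** * Conditional expectations *)

Section approximation.
Context {R : realType} (I : Type) (FF : set_system I) {pF : ProperFilter FF}.

Lemma cvg_by_approx (a : I -> R) (l : R) :
  (forall e, 0 < e -> exists (b : I -> R) (l' : R), [/\ b i @[i --> FF] --> l',
     \forall i \near FF, `|a i - b i| <= e & `|l - l'| <= e]) ->
  a i @[i --> FF] --> l.
Proof.
move=> h; apply/cvgrPdist_le => e e0.
have e3 : 0 < e / 3 by rewrite divr_gt0.
have [b [l' [/cvgrPdist_le/(_ _ e3) bl ab ll]]] := h _ e3.
near=> i.
have h1 : `|a i - b i| <= e / 3 by near: i.
have h2 : `|l' - b i| <= e / 3 by near: i.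
have -> : l - a i = (l - l') + (l' - b i) - (a i - b i) by ring.
rewrite (le_trans (ler_normB _ _))// (le_trans (lerD (ler_normD _ _) (lexx _)))//.
lra.
Unshelve. all: by end_near. Qed.

Lemma cvg_by_approx_ex (a : I -> R) :
  (forall e, 0 < e -> exists b : I -> R, cvg (b i @[i --> FF]) /\
     \forall i \near FF, `|a i - b i| <= e) ->
  cvg (a i @[i --> FF]).
Proof.
move=> h; apply: cauchy_cvg; apply: cauchy_exP => e e0.
have e3 : 0 < e / 3 by rewrite divr_gt0.
have [b [cb ab]] := h _ e3.
exists (lim (b i @[i --> FF])).
move/cvgrPdist_le : cb => /(_ _ e3) cb.
suff : \forall i \near FF, ball (lim (b i @[i --> FF])) e (a i) by [].
apply: filterS2 ab cb => i h1 h2; rewrite -ball_normE /=.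
rewrite (_ : _ - a i = (lim (b i @[i --> FF]) - b i) - (a i - b i)); last by ring.
rewrite (le_lt_trans (ler_normB _ _))//; lra.
Qed.

End approximation.

Section conditional_expectation.
Context d (T : measurableType d) {R : realType} (P : probability T R).
Implicit Types (E : set T) (h : T -> R).

Definition cex E h : R := (\int[P]_(w in E) h w)%R / fine (P E).

Definition bfun h : Prop := measurable_fun setT h /\ exists B, forall w, `|h w| <= B.

Lemma bfun_cst c : bfun (fun=> c).
Proof. by split; [exact: measurable_cst|exists `|c|]. Qed.

Lemma bfunD h1 h2 : bfun h1 -> bfun h2 -> bfun (fun w => h1 w + h2 w).
Proof.
move=> [m1 [B1 b1]] [m2 [B2 b2]]; split; first exact: measurable_funD.
by exists (B1 + B2) => w; rewrite (le_trans (ler_normD _ _))// lerD.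
Qed.

Lemma bfunM h1 h2 : bfun h1 -> bfun h2 -> bfun (fun w => h1 w * h2 w).
Proof.
move=> [m1 [B1 b1]] [m2 [B2 b2]]; split; first exact: measurable_funM.
by exists (B1 * B2) => w; rewrite normrM ler_pM.
Qed.

Lemma bfunB h1 h2 : bfun h1 -> bfun h2 -> bfun (fun w => h1 w - h2 w).
Proof.
move=> [m1 [B1 b1]] [m2 [B2 b2]]; split; first exact: measurable_funB.
by exists (B1 + B2) => w; rewrite (le_trans (ler_normB _ _))// lerD.
Qed.

Lemma bfun_bool (b : T -> bool) : measurable_fun setT b -> bfun (fun w => (b w)%:R).
Proof.
move=> mb; split; first exact: (measurableT_comp (f := fun b : bool => b%:R : R)).
by exists 1 => w; case: (b w); rewrite ?normr1 ?normr0.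
Qed.

Lemma bfun_sum (J : eqType) (s : seq J) (h : J -> T -> R) : (forall j, j \in s -> bfun (h j)) ->
  bfun (fun w => \sum_(j <- s) h j w).
Proof.
elim: s => [|j s IH] hs.
  by rewrite (_ : (fun _ => _) = fun=> 0); [exact: bfun_cst|apply/funext => w; rewrite big_nil].
rewrite (_ : (fun _ => _) = fun w => h j w + \sum_(j <- s) h j w); last first.
  by apply/funext => w; rewrite big_cons.
apply: bfunD; first by apply: hs; rewrite mem_head.
by apply: IH => k ks; apply: hs; rewrite inE ks orbT.
Qed.

Lemma bfun_prod (J : eqType) (s : seq J) (h : J -> T -> R) : (forall j, j \in s -> bfun (h j)) ->
  bfun (fun w => \prod_(j <- s) h j w).
Proof.
elim: s => [|j s IH] hs.
  by rewrite (_ : (fun _ => _) = fun=> 1); [exact: bfun_cst|apply/funext => w; rewrite big_nil].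
rewrite (_ : (fun _ => _) = fun w => h j w * \prod_(j <- s) h j w); last first.
  by apply/funext => w; rewrite big_cons.
apply: bfunM; first by apply: hs; rewrite mem_head.
by apply: IH => k ks; apply: hs; rewrite inE ks orbT.
Qed.

Variables (E : set T).
Hypothesis mE : measurable E.

Lemma bfun_integrable h : bfun h -> P.-integrable E (EFin \o h).
Proof.
move=> [mh [B hB]]; apply: measurable_bounded_integrable => //.
- by rewrite (le_lt_trans (probability_le1 P mE))// ltry.
- exact: measurable_funTS.
- exists B; split; first exact: num_real.
  by move=> B' /ltW BB' w _; exact: le_trans BB'.
Qed.

Lemma cexD h1 h2 : bfun h1 -> bfun h2 -> cex E (fun w => h1 w + h2 w) = cex E h1 + cex E h2.
Proof. by move=> b1 b2; rewrite /cex RintegralD ?mulrDl//; exact: bfun_integrable. Qed.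

Lemma cexB h1 h2 : bfun h1 -> bfun h2 -> cex E (fun w => h1 w - h2 w) = cex E h1 - cex E h2.
Proof. by move=> b1 b2; rewrite /cex RintegralB ?mulrBl//; exact: bfun_integrable. Qed.

Lemma cexZ c h : bfun h -> cex E (fun w => c * h w) = c * cex E h.
Proof. by move=> b1; rewrite /cex RintegralZl ?mulrA//; exact: bfun_integrable. Qed.

Lemma cex_sum (J : eqType) (s : seq J) (h : J -> T -> R) : (forall j, j \in s -> bfun (h j)) ->
  cex E (fun w => \sum_(j <- s) h j w) = \sum_(j <- s) cex E (h j).
Proof.
elim: s => [|j s IH] hs.
  rewrite big_nil /cex (_ : (fun _ => _) = fun=> 0) ?Rintegral_cst// ?mul0r//.
  by apply/funext => w; rewrite big_nil.
have hs' k : k \in s -> bfun (h k) by move=> ks; apply: hs; rewrite inE ks orbT.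
rewrite big_cons -IH// -cexD//; last exact: bfun_sum.
  by congr cex; apply/funext => w; rewrite big_cons.
by apply: hs; rewrite mem_head.
Qed.

Lemma cex_le h1 h2 : bfun h1 -> bfun h2 -> (forall w, E w -> h1 w <= h2 w) -> cex E h1 <= cex E h2.
Proof.
move=> b1 b2 h12; rewrite /cex ler_wpM2r ?invr_ge0 ?fine_ge0//.
by apply: le_Rintegral => //; exact: bfun_integrable.
Qed.

Lemma cex_ge0 h : bfun h -> (forall w, E w -> 0 <= h w) -> 0 <= cex E h.
Proof.
move=> bh h0; rewrite (_ : 0 = cex E (fun=> 0)); first by apply: cex_le => //; exact: bfun_cst.
by rewrite /cex Rintegral_cst// !mul0r.
Qed.

Hypothesis PE : 0 < fine (P E).

Lemma cex_cst c : cex E (fun=> c) = c.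
Proof. by rewrite /cex Rintegral_cst// mulfK// gt_eqF. Qed.

Lemma cex_norm_le h c : bfun h -> (forall w, E w -> `|h w| <= c) -> `|cex E h| <= c.
Proof.
move=> bh hc; rewrite ler_norml; apply/andP; split.
  rewrite -[leLHS]cex_cst; apply: cex_le => //; first exact: bfun_cst.
  by move=> w /hc; rewrite ler_norml => /andP[].
rewrite -[leRHS]cex_cst; apply: cex_le => //; first exact: bfun_cst.
by move=> w /hc; rewrite ler_norml => /andP[].
Qed.

Lemma cex_bool_01 (b : T -> bool) : measurable_fun setT b -> 0 <= cex E (fun w => (b w)%:R) <= 1.
Proof.
move=> mb; apply/andP; split; first by apply: cex_ge0; [exact: bfun_bool|move=> w _; exact: ler0n].
rewrite -[leRHS]cex_cst; apply: cex_le; [exact: bfun_bool|exact: bfun_cst|].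
by move=> w _; case: (b w).
Qed.

End conditional_expectation.

(** Latest term first, so that extending a word by one letter is a [cons]. *)
Fixpoint prefix_of (x : nat -> nat) (k : nat) : seq nat :=
  if k is k'.+1 then x k' :: prefix_of x k' else [::].

Lemma size_prefix_of x k : size (prefix_of x k) = k.
Proof. by elim: k => //= k ->. Qed.

Fixpoint box (K k : nat) : seq (seq nat) :=
  if k is k'.+1 then [seq m :: c | m <- iota 0 K.+1, c <- box K k'] else [:: [::]].

Lemma boxS K k : box K k.+1 = [seq m :: c | m <- iota 0 K.+1, c <- box K k].
Proof. by []. Qed.

Lemma uniq_box K k : uniq (box K k).
Proof.
elim: k => // k IH; rewrite boxS; apply: (allpairs_uniq (iota_uniq 0 K.+1) IH).
by move=> [m c] [m' c'] _ _ [-> ->].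
Qed.

Lemma size_box K k c : c \in box K k -> size c = k.
Proof.
elim: k c => [|k IH] c; first by rewrite inE => /eqP ->.
rewrite boxS; by move=> /allpairsP[[m c'] [_ /IH h ->]]; rewrite /= h.
Qed.

Lemma prefix_box K x k : (prefix_of x k \in box K k) = all (fun j => (x j <= K)%N) (iota 0 k).
Proof.
elim: k => [|k IH] //; rewrite boxS [prefix_of _ _]/=.
have -> : iota 0 k.+1 = rcons (iota 0 k) k by rewrite -addn1 iotaD cats1.
rewrite all_rcons -IH; apply/allpairsP/andP => [[[m c] [+ h2 [-> ->]]]|[h1 h2]].
  by rewrite mem_iota/= ltnS.
by exists (x k, prefix_of x k); rewrite mem_iota/= ltnS.
Qed.

(** * Limits of integer-valued processes *)

Lemma measurable_fun_natE d (S : measurableType d) (f : S -> nat) :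
  (forall m, measurable (f @^-1` [set m])) -> measurable_fun setT f.
Proof.
move=> mf _ Y mY; rewrite setTI (_ : f @^-1` Y = \bigcup_(m in Y) f @^-1` [set m]).
  exact: bigcup_measurable.
by apply/seteqP; split=> [s Ys|s [m Ym /= fs]]; [exists (f s)|rewrite /= fs].
Qed.

Lemma measurable_bigcup_count d (S : measurableType d) (J : countType) (F : J -> set S) :
  (forall j, measurable (F j)) -> measurable (\bigcup_j F j).
Proof.
move=> mF.
rewrite (_ : \bigcup_j F j = \bigcup_n (if unpickle n is Some j then F j else set0)).
  by apply: bigcupT_measurable => n; case: unpickle.
apply/seteqP; split=> [s [j _ Fs]|s [n _]]; first by exists (pickle j) => //; rewrite pickleK.
by case: unpickle => // j Fs; exists j.
Qed.

(** * From generating functions to joint laws *)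

Section pgf.
Context d (T : measurableType d) {R : realType} (P : probability T R).
Context (I : Type) (FF : set_system I) {pF : ProperFilter FF}.
Variable E : I -> set T.
Hypothesis mE : forall i, measurable (E i).
Hypothesis PE : \forall i \near FF, 0 < fine (P (E i)).

Lemma ler_cvgT (f g : I -> R) (l l' : R) : f i @[i --> FF] --> l -> g i @[i --> FF] --> l' ->
  (\forall i \near FF, f i <= g i) -> l <= l'.
Proof.
move=> fl gl fg; rewrite -subr_ge0.
have h : g i - f i @[i --> FF] --> l' - l by exact: cvgB.
rewrite -(cvg_lim _ h)//; apply: limr_ge; first exact: cvgP h.
by apply: filterS fg => i; rewrite subr_ge0.
Qed.

Lemma cvg_bigsum (J : eqType) (s : seq J) (f : J -> I -> R) (l : J -> R) :
  (forall j, j \in s -> f j i @[i --> FF] --> l j) ->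
  \sum_(j <- s) f j i @[i --> FF] --> \sum_(j <- s) l j.
Proof.
elim: s => [|j s IH] h.
  by rewrite big_nil; under eq_cvg do rewrite big_nil; exact: cvg_cst.
rewrite big_cons; under eq_cvg do rewrite big_cons.
apply: cvgD; first by apply: h; rewrite mem_head.
by apply: IH => k ks; apply: h; rewrite inE ks orbT.
Qed.

Lemma measurable_fun_eqnat d' (S : measurableType d') (f : S -> nat) c : measurable_fun setT f ->
  measurable_fun setT (fun w => f w == c).
Proof. by move=> mf; exact: (measurableT_comp (f := fun n => n == c)). Qed.

Lemma bfun_expr (f : T -> nat) (s : R) : measurable_fun setT f -> 0 < s < 1 ->
  bfun (fun w => s ^+ f w).
Proof.
move=> mf /andP[s0 s1]; split; first exact: (measurableT_comp (f := fun n => s ^+ n)).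
exists 1 => w; rewrite ger0_norm ?exprn_ge0 ?(ltW s0)//.
by rewrite exprn_ile1 ?ltW.
Qed.

(** Strong induction on c: once the terms below c are removed from E[H s^C], division by s^c leaves
    E[H; C = c] up to an error at most s, and s is arbitrarily small. *)
Lemma pgf_pmf (H : I -> T -> R) (C : I -> T -> nat) :
  (forall i, bfun (H i)) -> (forall i w, 0 <= H i w <= 1) ->
  (forall i, measurable_fun setT (C i)) ->
  (forall s, 0 < s < 1 -> cvg (cex P (E i) (fun w => H i w * s ^+ C i w) @[i --> FF])) ->
  forall c, cvg (cex P (E i) (fun w => H i w * (C i w == c)%:R) @[i --> FF]).
Proof.
move=> bH H01 mC hs c; elim/ltn_ind: c => c IH.
apply: cvg_by_approx_ex => e e0.
pose s := Num.min e (2^-1).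
have s0 : 0 < s by rewrite lt_min e0 invr_gt0 ltr0n.
have s1 : s < 1 by rewrite gt_min invf_lt1 ?ltr1n ?orbT.
have s01 : 0 < s < 1 by rewrite s0.
have se : s <= e by rewrite ge_min lexx.
have sc0 : s ^+ c != 0 by rewrite expf_neq0// gt_eqF.
pose A j i := cex P (E i) (fun w => H i w * (C i w == j)%:R).
have bA j i : bfun (fun w => H i w * (C i w == j)%:R).
  by apply: bfunM => //; apply: bfun_bool; exact: measurable_fun_eqnat.
have bS i : bfun (fun w => H i w * s ^+ C i w) by apply: bfunM => //; exact: bfun_expr.
exists (fun i => (s ^+ c)^-1 * (cex P (E i) (fun w => H i w * s ^+ C i w) -
   \sum_(j <- iota 0 c) s ^+ j * A j i)); split.
  apply: is_cvgMl_tmp; apply: is_cvgB; first exact: hs.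
  apply: (@cvgP _ _ (\sum_(j <- iota 0 c) s ^+ j * lim (A j i @[i --> FF]))).
  apply: cvg_bigsum => j; rewrite mem_iota add0n => /andP[_ jc].
  by apply: cvgM; [exact: cvg_cst|exact: IH].
near=> i; have PEi : 0 < fine (P (E i)) by near: i.
have bZ j : bfun (fun w => s ^+ j * (H i w * (C i w == j)%:R)).
  by apply: bfunM => //; exact: bfun_cst.
have bsum : bfun (fun w => \sum_(j <- iota 0 c) s ^+ j * (H i w * (C i w == j)%:R)).
  exact: bfun_sum.
have -> : \sum_(j <- iota 0 c) s ^+ j * A j i =
    cex P (E i) (fun w => \sum_(j <- iota 0 c) s ^+ j * (H i w * (C i w == j)%:R)).
  by rewrite cex_sum//; apply: eq_bigr => j _; rewrite cexZ.
rewrite -cexB// -cexZ//; last exact: bfunB.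
rewrite -cexB//; last by apply: bfunM; [exact: bfun_cst|exact: bfunB].
apply: (le_trans _ se); apply: cex_norm_le => //.
  by apply: bfunB => //; apply: bfunM; [exact: bfun_cst|exact: bfunB].
move=> w _; have /andP[h0 h1] := H01 i w.
set n := C i w; set h := H i w in h0 h1 *.
have sumE : \sum_(j <- iota 0 c) s ^+ j * (h * (n == j)%:R) = if (n < c)%N then s ^+ n * h else 0.
  case: ifPn => nc.
    rewrite (bigD1_seq n) ?iota_uniq ?mem_iota//= eqxx mulr1 big1 ?addr0// => j jn.
    by rewrite eq_sym (negbTE jn) !mulr0.
  rewrite big1_seq// => j; rewrite mem_iota add0n => /andP[_ jc].
  by rewrite (_ : n == j = false) ?mulr0//; apply/eqP => nj; rewrite nj in nc; move: nc jc => /negP nc /andP[_ /nc].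
rewrite sumE; case: (ltngtP n c) => nc.
- by rewrite mulr0 sub0r (mulrC h) subrr mulr0 oppr0 normr0 ltW.
- rewrite mulr0 sub0r subr0 normrN -(subnK nc) exprD exprS.
  rewrite [X in `|X|](_ : _ = s * (s ^+ (n - c.+1) * h)); last first.
    by move: sc0; set z := s ^+ c => z0; field.
  have e1 : 0 <= s ^+ (n - c.+1) <= 1 by rewrite exprn_ge0 ?exprn_ile1 ?ltW.
  have e2 : 0 <= s ^+ (n - c.+1) * h <= 1 by case/andP: e1 => x0 x1; rewrite mulr_ge0//= mulr_ile1.
  case/andP: e2 => x0 x1.
  have s0' := ltW s0; rewrite ger0_norm; last by apply: mulr_ge0.
  exact: ler_piMr.
- by rewrite nc mulr1 subr0 (mulrC h) mulKf// subrr normr0 ltW.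
Unshelve. all: by end_near. Qed.

Variable X : I -> T -> nat -> nat.
Hypothesis mX : forall i j, measurable_fun setT (fun w => X i w j).

(** Mixed functionals: exact values for the coordinates already treated, powers for the others. *)
Let mono (l1 : seq (nat * nat)) (l2 : seq (nat * R)) i w : R :=
  \prod_(a <- l1) (X i w a.1 == a.2)%:R * \prod_(a <- l2) a.2 ^+ X i w a.1.

Let prod_01' (J : eqType) (s : seq J) (f : J -> R) : (forall j, j \in s -> 0 <= f j <= 1) ->
  0 <= \prod_(j <- s) f j <= 1.
Proof.
move=> f01; rewrite big_seq; apply: (big_ind (fun x => 0 <= x <= 1)) => //.
  by rewrite ler01 lexx.
by move=> x y /andP[x0 x1] /andP[y0 y1]; rewrite mulr_ge0//= mulr_ile1.
Qed.

Let mono_01 l1 l2 i w : all (fun a => 0 < a.2 < 1) l2 -> 0 <= mono l1 l2 i w <= 1.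
Proof.
move=> /allP h2; rewrite /mono.
have /andP[x0 x1] : 0 <= \prod_(a <- l1) ((X i w a.1 == a.2)%:R : R) <= 1.
  by apply: prod_01' => a _; case: eqP; rewrite ?ler01 lexx.
have /andP[y0 y1] : 0 <= \prod_(a <- l2) a.2 ^+ X i w a.1 <= 1.
  by apply: prod_01' => a /h2 /andP[a0 a1]; rewrite exprn_ge0 ?exprn_ile1 ?ltW.
by rewrite mulr_ge0//= mulr_ile1.
Qed.

Let bfun_mono l1 l2 i : all (fun a => 0 < a.2 < 1) l2 -> bfun (mono l1 l2 i).
Proof.
move=> /allP h2; apply: bfunM.
  by apply: bfun_prod => a _; apply: bfun_bool; exact: measurable_fun_eqnat.
by apply: bfun_prod => a /h2; exact: bfun_expr.
Qed.

Hypothesis hpgf : forall l2 : seq (nat * R), all (fun a => 0 < a.2 < 1) l2 ->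
  cvg (cex P (E i) (fun w => \prod_(a <- l2) a.2 ^+ X i w a.1) @[i --> FF]).

(** Coordinates pass from powers to exact values one at a time. The remaining powers are kept
    arbitrary, so that the induction hypothesis provides the generating function in the next
    coordinate. *)
Lemma joint_pmf l1 l2 : all (fun a => 0 < a.2 < 1) l2 -> cvg (cex P (E i) (mono l1 l2 i) @[i --> FF]).
Proof.
elim: l1 l2 => [|a l1 IH] l2 h2.
  have := hpgf h2; rewrite (_ : (fun i => cex P (E i) (fun w => _)) = fun i => cex P (E i) (mono [::] l2 i))//.
  by apply/funext => i; congr cex; apply/funext => w; rewrite /mono big_nil mul1r.
have := @pgf_pmf (mono l1 l2) (fun i w => X i w a.1) (fun i => bfun_mono l1 i h2)
  (fun i w => mono_01 l1 i w h2) (fun i => mX i a.1) _ a.2.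
rewrite (_ : (fun i => cex P (E i) (fun w => mono l1 l2 i w * (X i w a.1 == a.2)%:R)) =
    fun i => cex P (E i) (mono (a :: l1) l2 i)); last first.
  apply/funext => i; congr cex; apply/funext => w.
  by rewrite /mono big_cons mulrC mulrA.
apply=> s s01.
have := IH ((a.1, s) :: l2); rewrite /= s01 => /(_ h2).
rewrite (_ : (fun i => cex P (E i) (mono l1 ((a.1, s) :: l2) i)) =
    fun i => cex P (E i) (fun w => mono l1 l2 i w * s ^+ X i w a.1))//.
apply/funext => i; congr cex; apply/funext => w.
by rewrite /mono big_cons /= -!mulrA; congr (_ * _); rewrite mulrC.
Qed.

Let isp c i w : bool := prefix_of (X i w) (size c) == c.

Lemma measurable_prefix c i : measurable_fun setT (isp c i).
Proof.
elim: c => [|m c IH]; first exact: measurable_cst.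
have -> : isp (m :: c) i = fun w => (X i w (size c) == m) && isp c i w by [].
by apply: measurable_and => //; exact: measurable_fun_eqnat.
Qed.

Lemma bfun_prefix c i : bfun (fun w => (isp c i w)%:R : R).
Proof. by apply: bfun_bool; exact: measurable_prefix. Qed.

Definition kappa (c : seq nat) : R := lim (cex P (E i) (fun w => (isp c i w)%:R) @[i --> FF]).

Lemma cvg_kappa c : cex P (E i) (fun w => (isp c i w)%:R) @[i --> FF] --> kappa c.
Proof.
pose fix l1 (c : seq nat) : seq (nat * nat) := if c is m :: c' then (size c', m) :: l1 c' else [::].
have E1 i w : (isp c i w)%:R = mono (l1 c) [::] i w.
  rewrite /mono big_nil mulr1; elim: c => [|m c IH] /=; first by rewrite big_nil.
  by rewrite big_cons -IH /= -natrM mulnb.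
rewrite /kappa; have := @joint_pmf (l1 c) [::] isT.
rewrite (_ : (fun i => cex P (E i) (mono (l1 c) [::] i)) =
  fun i => cex P (E i) (fun w => (isp c i w)%:R))//.
by apply/funext => i; congr cex; apply/funext => w; rewrite E1.
Qed.

Hypothesis tight : forall j e, 0 < e -> exists K, \forall i \near FF,
  cex P (E i) (fun w => (K < X i w j)%N%:R) <= e.

Lemma kappa_ge0 c : 0 <= kappa c.
Proof.
apply: limr_ge; first exact: cvgP (@cvg_kappa c).
near=> i; have PEi : 0 < fine (P (E i)) by near: i.
by have /andP[] := cex_bool_01 (mE i) PEi (measurable_prefix c i).
Unshelve. all: by end_near. Qed.

Lemma kappa_nil : kappa [::] = 1.
Proof.
apply: cvg_lim => //; apply: cvg_near_cst; near=> i.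
have PEi : 0 < fine (P (E i)) by near: i.
exact: cex_cst.
Unshelve. all: by end_near. Qed.

Let isp_split c n i w : (isp c i w)%:R =
  \sum_(m <- iota 0 n) (isp (m :: c) i w)%:R + (isp c i w && (n <= X i w (size c))%N)%:R :> R.
Proof.
have E1 m : isp (m :: c) i w = (X i w (size c) == m) && isp c i w by [].
case: (boolP (isp c i w)) => h /=; last first.
  by rewrite big1 ?addr0// => m _; rewrite E1 (negbTE h) andbF.
have [nX|nX] := leqP n (X i w (size c)).
  rewrite big1_seq ?add0r// => m; rewrite mem_iota add0n => /andP[_ mn].
  by rewrite E1 h andbT gtn_eqF// (leq_trans mn).
rewrite addr0 (bigD1_seq (X i w (size c))) ?iota_uniq ?mem_iota//= E1 eqxx h.
by rewrite big1 ?addr0// => m mX'; rewrite E1 eq_sym (negbTE mX').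
Qed.

Let cex_split c n i : cex P (E i) (fun w => (isp c i w)%:R) =
  \sum_(m <- iota 0 n) cex P (E i) (fun w => (isp (m :: c) i w)%:R) +
  cex P (E i) (fun w => (isp c i w && (n <= X i w (size c))%N)%:R).
Proof.
have b2 : bfun (fun w => (isp c i w && (n <= X i w (size c))%N)%:R : R).
  apply: bfun_bool; apply: measurable_and; first exact: measurable_prefix.
  exact: (measurableT_comp (f := fun m => (n <= m)%N)).
rewrite -cex_sum//; last by move=> m _; exact: bfun_prefix.
rewrite -cexD//; last by apply: bfun_sum => m _; exact: bfun_prefix.
by congr cex; apply/funext => w; exact: isp_split.
Qed.

Let cvg_sum_kappa c n :
  \sum_(m <- iota 0 n) cex P (E i) (fun w => (isp (m :: c) i w)%:R) @[i --> FF] -->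
  \sum_(m <- iota 0 n) kappa (m :: c).
Proof. by apply: cvg_bigsum => m _; exact: cvg_kappa. Qed.

Lemma kappa_sum_le c n : \sum_(m <- iota 0 n) kappa (m :: c) <= kappa c.
Proof.
apply: (ler_cvgT (@cvg_sum_kappa c n) (@cvg_kappa c)); near=> i.
have PEi : 0 < fine (P (E i)) by near: i.
rewrite (cex_split c n i) lerDl; apply: cex_ge0 => //.
apply: bfun_bool; apply: measurable_and; first exact: measurable_prefix.
exact: (measurableT_comp (f := fun m => (n <= m)%N)).
Unshelve. all: by end_near. Qed.

(** Tightness of the next coordinate: no mass escapes to infinity, so with [kappa_sum_le] the
    limiting word probabilities are consistent. *)
Lemma kappa_sum_ge c e : 0 < e -> exists n, kappa c - e <= \sum_(m <- iota 0 n) kappa (m :: c).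
Proof.
move=> e0; have [K hK] := tight (size c) e0; exists K.+1; rewrite lerBlDr.
have h : \sum_(m <- iota 0 K.+1) cex P (E i) (fun w => (isp (m :: c) i w)%:R) + e @[i --> FF] -->
  \sum_(m <- iota 0 K.+1) kappa (m :: c) + e.
  by apply: cvgD; [exact: cvg_sum_kappa|exact: cvg_cst].
apply: (ler_cvgT (@cvg_kappa c) h); near=> i.
have PEi : 0 < fine (P (E i)) by near: i.
have mK : measurable_fun setT (fun w => (K < X i w (size c))%N).
  exact: (measurableT_comp (f := fun m => (K < m)%N)).
rewrite (cex_split c K.+1 i) lerD2l.
apply: (@le_trans _ _ (cex P (E i) (fun w => (K < X i w (size c))%N%:R))); last by near: i.
apply: cex_le => //; [|exact: bfun_bool|].
  by apply: bfun_bool; apply: measurable_and => //; exact: measurable_prefix.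
by move=> w _; rewrite ler_nat; case: (isp c i w).
Unshelve. all: by end_near. Qed.

End pgf.

(** * Realisation on the unit interval *)

Section realization.
Context {R : realType} (kap : seq nat -> R).
Hypothesis kap_ge0 : forall c, 0 <= kap c.
Hypothesis kap_nil : kap [::] = 1.
Hypothesis kap_le : forall c n, \sum_(m <- iota 0 n) kap (m :: c) <= kap c.
Hypothesis kap_ge : forall c e, 0 < e -> exists n, kap c - e <= \sum_(m <- iota 0 n) kap (m :: c).

Let S c n : R := \sum_(m <- iota 0 n) kap (m :: c).

Let S0 c : S c 0 = 0. Proof. by rewrite /S big_nil. Qed.

Let SS c n : S c n.+1 = S c n + kap (n :: c).
Proof. by rewrite /S -addn1 iotaD cats1 big_rcons /= addrC. Qed.

Let S_nd c n m : (n <= m)%N -> S c n <= S c m.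
Proof. by move=> nm; rewrite -(subnKC nm) /S iotaD big_cat/= lerDl sumr_ge0. Qed.

(* Each finite word c gets the interval [left_end c, left_end c + kap c[, those of the
   one-letter extensions of c being consecutive subintervals of that of c. *)
Fixpoint left_end (c : seq nat) : R :=
  if c is m :: c' then left_end c' + \sum_(j <- iota 0 m) kap (j :: c') else 0.

Definition next_letter (u : R) (c : seq nat) : nat :=
  if pselect (exists m, u < left_end c + \sum_(j <- iota 0 m.+1) kap (j :: c)) is left h
  then ex_minn h else 0%N.

Fixpoint word (u : R) (k : nat) : seq nat :=
  if k is k'.+1 then next_letter u (word u k') :: word u k' else [::].

Definition path_of (u : R) (k : nat) : nat :=
  if 0 <= u < 1 then next_letter u (word u k) else 0%N.

Lemma prefix_path u k : 0 <= u < 1 -> prefix_of (path_of u) k = word u k.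
Proof. by move=> u01; elim: k => //= k ->; rewrite /path_of u01. Qed.

Lemma next_letterP u c m : left_end c <= u < left_end c + kap c ->
  (next_letter u c == m) = (left_end c + S c m <= u < left_end c + S c m.+1).
Proof.
move=> /andP[lu ul]; rewrite /next_letter; case: pselect => [h|]; last first.
  case; have e0 : 0 < (left_end c + kap c - u) / 2 by rewrite divr_gt0// subr_gt0.
  have [n hn] := kap_ge c e0; exists n; rewrite -/(S c n.+1).
  have := S_nd c (leqnSn n); move: hn; rewrite -/(S c n); lra.
case: ex_minnP => n un nmin; rewrite -/(S c n.+1) in un.
apply/eqP/andP => [<-|[h1 h2]].
  split=> //; case: n nmin un => [|n] nmin un; first by rewrite S0 addr0.
  by rewrite leNgt; apply/negP => /nmin; rewrite ltnn.
apply/eqP; rewrite eqn_leq nmin//= leqNgt; apply/negP => nm.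
have := S_nd c nm; lra.
Qed.

Lemma wordP u c : 0 <= u < 1 -> (word u (size c) == c) = (left_end c <= u < left_end c + kap c).
Proof.
move=> u01; elim: c => [|m c IH]; first by rewrite /= eqxx kap_nil add0r.
rewrite [word _ _]/= eqseq_cons andbC.
have E : left_end (m :: c) + kap (m :: c) = left_end c + S c m.+1 by rewrite /= SS addrA.
rewrite E [left_end (m :: c)]/= -/(S c m).
have h1 : 0 <= S c m by rewrite -(S0 c) S_nd.
have h2 : S c m.+1 <= kap c by exact: kap_le.
case: (boolP (word u (size c) == c)) => [/eqP wE|wE].
  by rewrite wE next_letterP// -IH wE.
apply/esym/negP => /andP[h3 h4]; move/negP: wE; apply; rewrite IH; apply/andP; split; lra.
Qed.

Lemma left_end_ge0 c : 0 <= left_end c.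
Proof. by elim: c => //= m c IH; rewrite addr_ge0// sumr_ge0. Qed.

Lemma right_end_le1 c : left_end c + kap c <= 1.
Proof.
elim: c => [|m c IH]; first by rewrite /= add0r kap_nil.
have E : left_end (m :: c) + kap (m :: c) = left_end c + S c m.+1 by rewrite /= SS addrA.
rewrite E (le_trans _ IH)// lerD2l; exact: kap_le.
Qed.

(** Words being countable, this exhibits the fiber as a countable union of intervals, up to the
    default outside [0, 1[. *)
Lemma path_fiber j m : (path_of^~ j) @^-1` [set m] =
  (`[0, 1[%classic `&` \bigcup_c (if size c == j
     then `[left_end (m :: c), (left_end (m :: c) + kap (m :: c))%R[%classic else set0)) `|`
  (~` `[0, 1[%classic `&` (if m == 0%N then setT else set0)).
Proof.
apply/seteqP; split=> [u /= um|u].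
  case: (boolP (0 <= u < 1)) => u01.
    left; split; first by rewrite /= in_itv.
    exists (word u j) => //.
    have sw : size (word u j) = j by rewrite -prefix_path// size_prefix_of.
    rewrite sw eqxx /= in_itv/=; rewrite -[X in X && _]/(left_end (m :: word u j) <= u).
    have := @wordP u (m :: word u j) u01; rewrite /= sw => <-.
    by move: um; rewrite /path_of u01 => ->.
  right; split; first by rewrite /= in_itv/=; exact/negP.
  by move: um; rewrite /path_of (negbTE u01) => <-.
move=> [[/=]|[/=]]; rewrite in_itv/=.
  move=> u01 [c _]; case: ifP => // /eqP <-; rewrite /= in_itv/= => h.
  have := @wordP u (m :: c) u01; rewrite h /= eqseq_cons => /andP[/eqP + /eqP wc].
  by rewrite /path_of u01 wc.
by move=> /negP u01; rewrite /path_of (negbTE u01); case: ifP => [/eqP ->|].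
Qed.

Lemma measurable_path j : measurable_fun setT (path_of^~ j : measurableTypeR R -> nat).
Proof.
apply: measurable_fun_natE => m; rewrite path_fiber.
apply: measurableU; apply: measurableI.
- exact: measurable_itv.
- apply: measurable_bigcup_count => c; case: ifP => // _; exact: measurable_itv.
- by apply: measurableC; exact: measurable_itv.
- by case: ifP.
Qed.

Definition unif : probability (measurableTypeR R) R := uniform_prob (@ltr01 R).

Lemma path_law c : cex unif setT (fun u => (prefix_of (path_of u) (size c) == c)%:R) = kap c.
Proof.
have mp : measurable_fun setT (fun u : measurableTypeR R => prefix_of (path_of u) (size c) == c).
  elim: c => [|m c IH]; first exact: measurable_cst.
  have -> : (fun u => prefix_of (path_of u) (size (m :: c)) == m :: c) =
    fun u => (path_of u (size c) == m) && (prefix_of (path_of u) (size c) == c) by [].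
  apply: measurable_and => //; apply: measurable_fun_eqnat; exact: measurable_path.
rewrite /cex probability_setT divr1 /Rintegral integral_uniform; last 2 first.
- apply/measurable_EFinP; exact: (measurableT_comp (f := fun b : bool => b%:R : R)).
- by move=> u; rewrite lee_fin.
rewrite subr0 invr1 mul1e -integral_itv_bndo_bndc; last first.
  apply/measurable_funTS/measurable_EFinP.
  exact: (measurableT_comp (f := fun b : bool => b%:R : R)).
transitivity (fine (\int[lebesgue_measure]_(u in `[0%R, 1%R[)
  (\1_(`[left_end c, (left_end c + kap c)%R[ : set R) u)%:E)%E).
  congr fine; apply: eq_integral => u; rewrite inE/= in_itv/= => u01.
  by rewrite prefix_path// wordP// indicE mem_setE in_itv.
rewrite integral_indic//.
rewrite (setIidl _); last first.
  move=> u /=; rewrite !in_itv/= => /andP[h1 h2].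
  by rewrite (le_trans (left_end_ge0 c) h1) (lt_le_trans h2 (right_end_le1 c)).
transitivity (fine (lebesgue_measure (`[left_end c, (left_end c + kap c)%R[ : set R))) => //.
rewrite lebesgue_measure_itv/= lte_fin ltrDl; case: ltP => [_|k0].
  by rewrite -EFinB/= addrC addKr.
by apply/eqP; rewrite eq_le k0 andbT.
Qed.

End realization.

(** * Approximation by finitely many words *)

Section box_approximation.
Context d (T : measurableType d) {R : realType} (P : probability T R).
Variables (E : set T) (x : T -> nat -> nat).
Hypotheses (mE : measurable E) (PE : 0 < fine (P E)).
Hypothesis mx : forall j, measurable_fun setT (x^~ j).

Lemma measurable_fun_prefix k (f : seq nat -> R) : measurable_fun setT (fun w => f (prefix_of (x w) k)).
Proof.
have mp c : measurable [set w | prefix_of (x w) k = c].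
  have [sk|/eqP sk] := eqVneq (size c) k; last first.
    rewrite (_ : [set _ | _] = set0)//; apply/seteqP; split=> // w /= h.
    by apply: sk; rewrite -h size_prefix_of.
  rewrite -sk => {sk}; elim: c => [|m c IH]; first by rewrite (_ : [set _ | _] = setT)//; apply/seteqP.
  rewrite (_ : [set _ | _] = (x^~ (size c)) @^-1` [set m] `&` [set w | prefix_of (x w) (size c) = c]).
    by apply: measurableI => //; rewrite -[X in measurable X]setTI; exact: mx.
  by apply/seteqP; split=> w /= => [[-> ->]|[-> ->]].
move=> _ Y mY; rewrite setTI.
rewrite (_ : _ @^-1` Y = \bigcup_c (if `[< Y (f c) >] then [set w | prefix_of (x w) k = c] else set0)).
  by apply: measurable_bigcup_count => c; case: ifP.
apply/seteqP; split=> [w /= Yw|w [c _]].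
  by exists (prefix_of (x w) k) => //; rewrite ifT//; exact/asboolP.
by case: ifP => // /asboolP + /= wc; rewrite /= wc.
Qed.

Lemma measurable_prefix_eq k c : measurable_fun setT (fun w => prefix_of (x w) k == c).
Proof.
have m := measurable_fun_prefix k (fun c' => (c' == c)%:R).
have -> : (fun w => prefix_of (x w) k == c) = fun w => 0 < ((prefix_of (x w) k == c)%:R : R).
  by apply/funext => w; case: eqP; rewrite ?ltr01 ?ltxx.
exact: measurable_fun_ltr.
Qed.

Let sum_box K k w : \sum_(c <- box K k) ((prefix_of (x w) k == c)%:R : R) =
  (prefix_of (x w) k \in box K k)%:R.
Proof.
case: (boolP (_ \in _)) => h.
  rewrite (bigD1_seq (prefix_of (x w) k)) ?uniq_box//= eqxx big1 ?addr0// => c cn.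
  by rewrite eq_sym (negbTE cn).
rewrite big1_seq// => c /andP[_ cb]; case: eqP => // xc; by rewrite xc cb in h.
Qed.

(** Words with a letter above K are dropped, at a cost of B times their probability. *)
Lemma box_approx (f : seq nat -> R) B K k : (forall c, `|f c| <= B) ->
  `|cex P E (fun w => f (prefix_of (x w) k)) -
    \sum_(c <- box K k) f c * cex P E (fun w => (prefix_of (x w) k == c)%:R)| <=
  B * (1 - \sum_(c <- box K k) cex P E (fun w => (prefix_of (x w) k == c)%:R)).
Proof.
move=> fB.
have bb c : bfun (fun w => (prefix_of (x w) k == c)%:R : R).
  by apply: bfun_bool; exact: measurable_prefix_eq.
have bf : bfun (fun w => f (prefix_of (x w) k)).
  by split; [exact: measurable_fun_prefix|exists B => w].
have bfb c : bfun (fun w => f c * (prefix_of (x w) k == c)%:R) by apply: bfunM => //; exact: bfun_cst.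
have bs : bfun (fun w => \sum_(c <- box K k) ((prefix_of (x w) k == c)%:R : R)).
  by apply: bfun_sum => c _.
have bfs : bfun (fun w => \sum_(c <- box K k) f c * ((prefix_of (x w) k == c)%:R : R)).
  by apply: bfun_sum => c _.
have -> : \sum_(c <- box K k) f c * cex P E (fun w => (prefix_of (x w) k == c)%:R) =
    cex P E (fun w => \sum_(c <- box K k) f c * (prefix_of (x w) k == c)%:R).
  by rewrite cex_sum//; apply: eq_bigr => c _; rewrite cexZ.
rewrite -cexB// -cex_sum// -[X in B * (X - _)](cex_cst mE PE) -cexB//; last exact: bfun_cst.
have b1 : bfun (fun w => 1 - \sum_(c <- box K k) ((prefix_of (x w) k == c)%:R : R)).
  by apply: bfunB => //; exact: bfun_cst.
rewrite -cexZ//.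
have pt w : `|f (prefix_of (x w) k) - \sum_(c <- box K k) f c * (prefix_of (x w) k == c)%:R| <=
    B * (1 - \sum_(c <- box K k) (prefix_of (x w) k == c)%:R).
  rewrite sum_box; case: (boolP (_ \in _)) => h.
    rewrite (bigD1_seq (prefix_of (x w) k)) ?uniq_box//= eqxx big1 ?addr0 => [|c cn].
      by rewrite mulr1 !subrr normr0 mulr0.
    by rewrite eq_sym (negbTE cn) mulr0.
  rewrite subr0 mulr1 big1_seq ?subr0// => c /andP[_ cb].
  by case: eqP => [xc|]; rewrite ?mulr0//; rewrite xc cb in h.
have bB1 : bfun (fun w => B * (1 - \sum_(c <- box K k) ((prefix_of (x w) k == c)%:R : R))).
  by apply: bfunM => //; exact: bfun_cst.
rewrite ler_norml; apply/andP; split; last first.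
  by apply: cex_le => //; [exact: bfunB|move=> w _; rewrite (le_trans (ler_norm _))].
rewrite -mulN1r -cexZ//; apply: cex_le => //; [by apply: bfunM => //; exact: bfun_cst|exact: bfunB|].
by move=> w _; rewrite mulN1r; have := pt w; rewrite ler_norml => /andP[].
Qed.

Lemma out_of_box_le K k : 1 - \sum_(c <- box K k) cex P E (fun w => (prefix_of (x w) k == c)%:R) <=
  \sum_(j <- iota 0 k) cex P E (fun w => (K < x w j)%N%:R).
Proof.
have bb c : bfun (fun w => (prefix_of (x w) k == c)%:R : R).
  by apply: bfun_bool; exact: measurable_prefix_eq.
have bK j : bfun (fun w => (K < x w j)%N%:R : R).
  apply: bfun_bool; exact: (measurableT_comp (f := fun m => (K < m)%N)).
have bs : bfun (fun w => \sum_(c <- box K k) ((prefix_of (x w) k == c)%:R : R)).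
  by apply: bfun_sum => c _.
rewrite -[X in X - _](cex_cst mE PE) -!cex_sum// -cexB//; last exact: bfun_cst.
apply: cex_le => //; first by apply: bfunB => //; exact: bfun_cst.
  by apply: bfun_sum => j _.
move=> w _; rewrite sum_box prefix_box.
case: (boolP (all _ _)) => [_|/allPn[j js]]; first by rewrite subrr sumr_ge0.
rewrite -ltnNge => Kx; rewrite subr0 (bigD1_seq j) ?iota_uniq//= Kx lerDl sumr_ge0// => i _.
Qed.

End box_approximation.

Section discrete_limit.
Context d (T : measurableType d) {R : realType} (P : probability T R).
Context (I : Type) (FF : set_system I) {pF : ProperFilter FF}.
Variable E : I -> set T.
Hypothesis mE : forall i, measurable (E i).
Hypothesis PE : \forall i \near FF, 0 < fine (P (E i)).
Variable X : I -> T -> nat -> nat.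
Hypothesis mX : forall i j, measurable_fun setT (fun w => X i w j).
Hypothesis hpgf : forall l2 : seq (nat * R), all (fun a => 0 < a.2 < 1) l2 ->
  cvg (cex P (E i) (fun w => \prod_(a <- l2) a.2 ^+ X i w a.1) @[i --> FF]).
Hypothesis tight : forall j e, 0 < e -> exists K, \forall i \near FF,
  cex P (E i) (fun w => (K < X i w j)%N%:R) <= e.

(** Up to the tails, a functional of k coordinates is a finite combination of word probabilities.
    The same finite box serves before the limit and in it. *)
Lemma discrete_limit : exists Y : R -> nat -> nat,
  (forall j, measurable_fun setT (Y^~ j : measurableTypeR R -> nat)) /\
  forall k (f : seq nat -> R) (B : R), (forall c, `|f c| <= B) ->
    cex P (E i) (fun w => f (prefix_of (X i w) k)) @[i --> FF] -->
    cex (@unif R) setT (fun u => f (prefix_of (Y u) k)).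
Proof.
pose kap := kappa P FF E X.
have k0 : forall c, 0 <= kap c by exact: kappa_ge0.
have k1 : kap [::] = 1 by exact: kappa_nil.
have kle : forall c n, \sum_(m <- iota 0 n) kap (m :: c) <= kap c by exact: kappa_sum_le.
have kge : forall c e, 0 < e -> exists n, kap c - e <= \sum_(m <- iota 0 n) kap (m :: c).
  exact: kappa_sum_ge.
exists (path_of kap).
have mY j : measurable_fun setT ((path_of kap)^~ j : measurableTypeR R -> nat).
  exact: measurable_path.
split=> // k f B fB.
have B0 : 0 <= B by exact: le_trans (fB [::]).
have PQ : 0 < fine (@unif R setT) by rewrite probability_setT.
have ckap c : size c = k -> cex P (E i) (fun w => (prefix_of (X i w) k == c)%:R) @[i --> FF] --> kap c.
  by move=> <-; exact: cvg_kappa.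
apply: (@cvg_by_approx R I FF pF (fun i => cex P (E i) (fun w => f (prefix_of (X i w) k)))) => e e0.
(* B + 1 rather than B, which may be 0; the other factor shares the error among the k
   coordinates. *)
have e1 : 0 < e / ((B + 1) * k.+1%:R) by rewrite divr_gt0// mulr_gt0//; lra.
have /choice[K hK] : forall j, exists K, \forall i \near FF,
  cex P (E i) (fun w => (K < X i w j)%N%:R) <= e / ((B + 1) * k.+1%:R).
  by move=> j; exact: tight.
pose KK := \max_(j < k) K j.
have small : \forall i \near FF, 0 < fine (P (E i)) /\
    1 - \sum_(c <- box KK k) cex P (E i) (fun w => (prefix_of (X i w) k == c)%:R) <= e / (B + 1).
  have hall : \forall i \near FF, forall j : 'I_k,
      cex P (E i) (fun w => (K j < X i w j)%N%:R) <= e / ((B + 1) * k.+1%:R).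
    by apply: filter_forall => j; exact: hK.
  near=> i; have PEi : 0 < fine (P (E i)) by near: i.
  have hi : forall j : 'I_k, cex P (E i) (fun w => (K j < X i w j)%N%:R) <= e / ((B + 1) * k.+1%:R).
    by near: i.
  split=> //; apply: (le_trans (out_of_box_le (mE i) PEi (mX i) KK k)).
  have -> : iota 0 k = index_iota 0 k by rewrite /index_iota subn0.
  rewrite big_mkord.
  apply: (@le_trans _ _ (\sum_(j < k) e / ((B + 1) * k.+1%:R))).
    apply: ler_sum => j _; apply: le_trans (hi j); apply: cex_le => //.
    - apply: bfun_bool; exact: (measurableT_comp (f := fun m => (KK < m)%N)).
    - apply: bfun_bool; exact: (measurableT_comp (f := fun m => (K j < m)%N)).
    - move=> w _; rewrite ler_nat; case: (ltnP KK _) => // h.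
      by rewrite (leq_ltn_trans _ h)//; exact: leq_bigmax.
  rewrite sumr_const card_ord -[leLHS]mulr_natr invfM mulrA -mulrA.
  apply: ler_piMr; first by rewrite divr_ge0//; [exact: ltW|lra].
  by rewrite mulrC ler_pdivrMr// mul1r ler_nat.
pose b i := \sum_(c <- box KK k) f c * cex P (E i) (fun w => (prefix_of (X i w) k == c)%:R).
have eB : B * (e / (B + 1)) <= e.
  by rewrite mulrCA ler_piMr ?(ltW e0)// ler_pdivrMr; lra.
exists b, (\sum_(c <- box KK k) f c * kap c); split.
- apply: cvg_bigsum => c cb; apply: cvgM; first exact: cvg_cst.
  by apply: ckap; exact: size_box cb.
- near=> i; have [PEi hi] : 0 < fine (P (E i)) /\
    1 - \sum_(c <- box KK k) cex P (E i) (fun w => (prefix_of (X i w) k == c)%:R) <= e / (B + 1).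
    by near: i.
  apply: (le_trans (box_approx (mE i) PEi (mX i) KK k fB)).
  by apply: le_trans eB; rewrite ler_wpM2l.
- have law c : c \in box KK k -> cex (@unif R) setT (fun u => (prefix_of (path_of kap u) k == c)%:R) = kap c.
    by move=> /size_box <-; exact: path_law.
  have -> : \sum_(c <- box KK k) f c * kap c =
      \sum_(c <- box KK k) f c * cex (@unif R) setT (fun u => (prefix_of (path_of kap u) k == c)%:R).
    by apply: eq_big_seq => c /law ->.
  apply: (le_trans (box_approx (@measurableT _ (measurableTypeR R)) PQ mY KK k fB)).
  (* For the limit law, the mass of the box is bounded below by passing to the limit in the finite
     sum of word probabilities. *)
  apply: le_trans eB; rewrite ler_wpM2l// lerBlDl -lerBlDr.
  rewrite (eq_big_seq kap law).
  have h1 : (1 : R) - e / (B + 1) @[_ --> FF] --> 1 - e / (B + 1) by exact: cvg_cst.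
  have h2 : \sum_(c <- box KK k) cex P (E i) (fun w => (prefix_of (X i w) k == c)%:R) @[i --> FF]
     --> \sum_(c <- box KK k) kap c.
    by apply: cvg_bigsum => c /size_box; exact: ckap.
  apply: (ler_cvgT h1 h2); apply: filterS small => i [_]; lra.
Unshelve. all: by end_near. Qed.

End discrete_limit.

(** * Point measures *)

Section atoms.
Context d (Z : measurableType d) {R : realType}.

Definition atom (b : bool) (y : Z) : {measure set Z -> \bar R} :=
  if b then (dirac y : {measure set Z -> \bar R}) else mzero.

Lemma integral_atom b y (f : Z -> R) : measurable_fun setT f -> (forall x, 0 <= f x) ->
  (\int[atom b y]_x (f x)%:E = (b%:R * f y)%:E)%E.
Proof.
move=> mf f0; rewrite /atom; case: b; last by rewrite integral_measure_zero mul0r.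
rewrite integral_dirac//; last exact/measurable_EFinP.
by rewrite diracT mul1e mul1r.
Qed.

(** The flags allow empty slots: labels of particles that are not alive, or ranks beyond the number
    of atoms. *)
Definition atoms (b : nat -> bool) (y : nat -> Z) : {measure set Z -> \bar R} :=
  mseries (fun n => atom (b n) (y n)) 0.

Variables (b : nat -> bool) (y : nat -> Z).

Lemma atomsE (A : set Z) : measurable A -> atoms b y A = (\sum_(n <oo) (b n && (y n \in A))%:R%:E)%E.
Proof.
move=> mA; rewrite /atoms/= /mseries; apply: eq_eseriesr => n _; rewrite /atom.
by case: (b n) => //=; rewrite diracE.
Qed.

Lemma atoms_fin N0 (A : set Z) : measurable A -> (forall n, (N0 <= n)%N -> b n -> ~ A (y n)) ->
  (atoms b y A < +oo)%E.
Proof.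
move=> mA h; rewrite atomsE// (nneseries_split 0 N0)// add0n.
rewrite (eseries0 (P := xpredT)) ?adde0; first by rewrite sumEFin ltry.
move=> n Nn _; case: (boolP (b n)) => //= bn.
by rewrite memNset//; exact: h.
Qed.

Lemma integral_atoms (f : Z -> R) : measurable_fun setT f ->
  (\int[atoms b y]_x (f x)%:E = \sum_(n <oo) ((b n)%:R * Num.max (f (y n)) 0)%:E -
    \sum_(n <oo) ((b n)%:R * Num.max (- f (y n)) 0)%:E)%E.
Proof.
move=> mf; rewrite integralE; congr (_ - _)%E.
- rewrite (ge0_integral_measure_series (fun n => atom (b n) (y n)))//; last first.
    by apply/measurable_funepos/measurable_EFinP.
  apply: eq_eseriesr => n _; rewrite -(@integral_atom (b n) (y n) (fun x => Num.max (f x) 0)).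
  + by apply: eq_integral => x _; rewrite funeposE EFin_max.
  + by apply: measurable_maxr.
  + by move=> x; rewrite le_max lexx orbT.
- rewrite (ge0_integral_measure_series (fun n => atom (b n) (y n)))//; last first.
    by apply/measurable_funeneg/measurable_EFinP.
  apply: eq_eseriesr => n _; rewrite -(@integral_atom (b n) (y n) (fun x => Num.max (- f x) 0)).
  + by apply: eq_integral => x _; rewrite funenegE EFin_max.
  + by apply: measurable_maxr => //; exact: measurableT_comp.
  + by move=> x; rewrite le_max lexx orbT.
Qed.

Lemma Rintegral_atoms N0 (f : Z -> R) : measurable_fun setT f ->
  (forall n, (N0 <= n)%N -> b n -> f (y n) = 0) ->
  \int[atoms b y]_x f x = \sum_(n < N0) (b n)%:R * f (y n).
Proof.
move=> mf f0; rewrite /Rintegral integral_atoms//.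
have fin (g : R -> R) : g 0 = 0 ->
    (\sum_(n <oo) ((b n)%:R * Num.max (g (f (y n))) 0)%:E =
     (\sum_(n < N0) (b n)%:R * Num.max (g (f (y n))) 0)%:E)%E.
  move=> g0; rewrite (nneseries_split 0 N0) => [|n _]; last first.
    by rewrite lee_fin mulr_ge0// le_max lexx orbT.
  rewrite add0n (eseries0 (P := xpredT)) ?adde0 => [|n Nn _].
    by rewrite sumEFin big_mkord.
  case: (boolP (b n)) => [/(f0 _ Nn) ->|_]; last by rewrite mul0r.
  by rewrite g0 maxxx mulr0.
rewrite (fin id)// (fin -%R) ?oppr0// -EFinB/= -sumrB; apply: eq_bigr => n _.
rewrite -mulrBr; congr (_ * _).
by case: (ler0P (f (y n))) => h; rewrite /Num.max; do !case: ifPn; lra.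
Qed.

End atoms.

Lemma measurable_Rintegral_atoms d (T : measurableType d) d' (Z : measurableType d') {R : realType} (b : T -> nat -> bool)
    (y : T -> nat -> Z) (f : Z -> R) : measurable_fun setT f ->
  (forall n, measurable_fun setT (b ^~ n)) ->
  (forall n, measurable_fun setT (fun w => (b w n)%:R * f (y w n))) ->
  measurable_fun setT (fun w => \int[@atoms d' Z R (b w) (y w)]_x f x).
Proof.
move=> mf mb mbf; rewrite /Rintegral.
apply: (measurableT_comp (fine_measurable measurableT)).
rewrite (_ : (fun w => _) = fun w =>
  (\sum_(n <oo) (Num.max ((b w n)%:R * f (y w n)) 0)%:E -
    \sum_(n <oo) (Num.max (- ((b w n)%:R * f (y w n))) 0)%:E)%E).
  apply: emeasurable_funB.
  - apply: ge0_emeasurable_sum => [n w _ _|n _]; first by rewrite lee_fin le_max lexx orbT.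
    by apply/measurable_EFinP; apply: measurable_maxr.
  - apply: ge0_emeasurable_sum => [n w _ _|n _]; first by rewrite lee_fin le_max lexx orbT.
    by apply/measurable_EFinP; apply: measurable_maxr => //; exact: measurableT_comp.
apply/funext => w; rewrite integral_atoms//; congr (_ - _)%E; apply: eq_eseriesr => n _.
- by case: (b w n); rewrite ?mul1r// !mul0r maxxx.
- by case: (b w n); rewrite ?mul1r// !mul0r oppr0 maxxx.
Qed.

Lemma measurable_atoms d (T : measurableType d) d' (Z : measurableType d') {R : realType} (b : T -> nat -> bool)
    (y : T -> nat -> Z) (A : set Z) : measurable A ->
  (forall n, measurable_fun setT (b ^~ n)) -> (forall n, measurable_fun setT (y ^~ n)) ->
  measurable_fun setT (fun w => @atoms d' Z R (b w) (y w) A).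
Proof.
move=> mA mb my.
rewrite (_ : (fun w => _) = fun w => (\sum_(n <oo) (b w n && (y w n \in A))%:R%:E)%E); last first.
  by apply/funext => w; rewrite atomsE.
apply: ge0_emeasurable_sum => // n _; apply/measurable_EFinP.
apply: (measurableT_comp (f := fun b : bool => b%:R : R)) => //.
apply: measurable_and => //; apply: (measurable_fun_bool true).
rewrite setTI (_ : _ @^-1` _ = (y ^~ n) @^-1` A); last first.
  by apply/seteqP; split=> z /=; [move/set_mem|move/mem_set].
by rewrite -[X in measurable X]setTI; exact: my.
Qed.

(* [be n i] says whether the [n]th atom lies beyond the [i]th grid point. *)
Lemma grid_sum {R : realType} (N0 J : nat) (v : nat -> R) (ph : nat -> R) (be : nat -> nat -> bool) e :
  (forall n i, be n i.+1 -> be n i) ->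
  (forall n i, (i < J)%N -> be n i -> ~~ be n i.+1 -> `|v n - ph i| <= e) ->
  (forall n, ~~ be n 0%N -> v n = 0) -> (forall n, be n J -> v n = 0) -> 0 <= e ->
  `|\sum_(n < N0) v n - \sum_(i < J) ph i * (\sum_(n < N0) (be n i)%:R - \sum_(n < N0) (be n i.+1)%:R)|
    <= e * \sum_(n < N0) (be n 0%N)%:R.
Proof.
move=> mon hv v0 vJ e0.
have -> : \sum_(i < J) ph i * (\sum_(n < N0) (be n i)%:R - \sum_(n < N0) (be n i.+1)%:R) =
    \sum_(n < N0) \sum_(i < J) ph i * ((be n i)%:R - (be n i.+1)%:R).
  rewrite exchange_big/=; apply: eq_bigr => i _; rewrite -sumrB mulr_sumr.
  by apply: eq_bigr.
rewrite -sumrB (le_trans (ler_norm_sum _ _ _))// mulr_sumr; apply: ler_sum => n _.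
case: (boolP (be n 0%N)) => b0; last first.
  have bF i : be n i = false by apply/negbTE; apply: contra b0; elim: i => // i IH /mon.
  rewrite v0// big1 ?subrr ?normr0 ?mulr0// => i _; by rewrite !bF subrr mulr0.
have dn i k : be n i -> be n (i - k)%N.
  move=> bi; elim: k => [|k]; first by rewrite subn0.
  by rewrite subnS; case: (i - k)%N => //= m /mon.
case: (boolP (be n J)) => bJ.
  have bT i : (i <= J)%N -> be n i by move=> iJ; rewrite -(subKn iJ); exact: dn.
  rewrite vJ// big1 ?subrr ?normr0 ?mulr1// => i _.
  by rewrite !bT ?subrr ?mulr0//; exact: ltnW.
(* The last grid point that the atom is beyond; only the cell starting there contributes. *)
have [i0 [i0J bi0 nbi0]] : exists i0, [/\ (i0 < J)%N, be n i0 & ~~ be n i0.+1].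
  elim: {hv vJ} J bJ => [|J IH] bJ; first by rewrite b0 in bJ.
  case: (boolP (be n J)) => [bJ'|/IH[i0 [iJ bi nbi]]]; first by exists J.
  by exists i0; split => //; exact: ltnW.
have bT i : (i <= i0)%N -> be n i by move=> ii; rewrite -(subKn ii); exact: dn.
have bF i : (i0 < i)%N -> be n i = false.
  by move=> ii; apply/negbTE; apply: contra nbi0 => /(dn _ (i - i0.+1)%N); rewrite subKn.
rewrite (bigD1 (Ordinal i0J))//= bi0 (negbTE nbi0) subr0 !mulr1 big1 ?addr0; first exact: hv.
move=> i ii0; case: (ltngtP i i0) => h; last by rewrite -val_eqE /= h eqxx in ii0.
- by rewrite !bT ?subrr ?mulr0//; exact: ltnW.
- by rewrite !bF ?subrr ?mulr0//; exact: leqW.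
Qed.

Lemma measurable_fun_gt d (T : measurableType d) {R : realType} (f : T -> R) :
  (forall c, measurable [set w | c < f w]) -> measurable_fun setT f.
Proof.
move=> mf _; apply: (measurability _ (RGenOInfty.measurableE R)) => //.
move=> _ [_ [c ->] <-]; rewrite setTI (_ : _ @^-1` _ = [set w | c < f w])//.
by apply/seteqP; split => w /=; rewrite in_itv/= andbT.
Qed.

Lemma measurable_sup d (T : measurableType d) {R : realType} (J : countType) (A : J -> set T)
    (f : J -> T -> R) : (forall j, measurable (A j)) ->
  (forall j c, measurable (A j `&` [set w | c < f j w])) ->
  measurable_fun setT (fun w => sup [set f j w | j in [set j | A j w]]).
Proof.
move=> mA mf; apply: measurable_fun_gt => c.
pose ne : set T := \bigcup_j A j.
pose ub : set T := \bigcup_(n : nat) (\bigcap_(m : nat) if unpickle m is Some j then ~` (A j `&` [set w | n%:R < f j w]) else setT).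
have mne : measurable ne by exact: measurable_bigcup_count.
have mub : measurable ub.
  apply: bigcup_measurable => n _; apply: bigcap_measurableType => m _.
  by case: (unpickle m) => [j|]//; exact: measurableC.
have hs w : (ne `&` ub) w <-> has_sup [set f j w | j in [set j | A j w]].
  split=> [[[j _ Aj] [n _ hn]]|[[_ [j Aj _]] [y hy]]].
    split; first by exists (f j w), j.
    exists n%:R => _ [k Ak <-]; have := hn (pickle k) I; rewrite pickleK => h.
    by rewrite leNgt; apply/negP => nf; apply: h.
  split; first by exists j.
  exists (Num.truncn y).+1 => // m _; case: (unpickle m) => // k [Ak /= fk].
  have := hy _ (ex_intro2 _ _ k Ak erefl); rewrite leNgt => /negP; apply.
  by rewrite (lt_trans _ fk)// truncnS_gt.
(* Where the set is empty or unbounded the supremum is 0 by convention, which accounts for the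
   second piece. *)
rewrite (_ : mkset _ = ((ne `&` ub) `&` \bigcup_j (A j `&` [set w | c < f j w])) `|`
   (~` (ne `&` ub) `&` (if c < 0 then setT else set0))).
  apply: measurableU; apply: measurableI.
  - exact: measurableI.
  - by apply: measurable_bigcup_count => j; exact: mf.
  - by apply: measurableC; exact: measurableI.
  - by case: ifP.
apply/seteqP; split => w /=.
- move=> cs; have [h|h] := pselect ((ne `&` ub) w); [left|right]; split => //.
    have /hs hh := h; have e0 : 0 < sup [set f j w | j in [set j | A j w]] - c by rewrite subr_gt0.
    have [_ [j Aj <-] sj] := sup_adherent e0 hh; exists j => //; split=> //=.
    by move: sj; rewrite subKr.
  by move: cs; rewrite sup_out => [->//|/hs].
- case=> [[/hs h [j _ [Aj /= cf]]]|[/hs h]].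
    by rewrite (lt_le_trans cf)//; apply: ub_le_sup => //; [case: h|exists j].
  by rewrite sup_out//; case: ifP.
Qed.

(** * Measurability of positions and of the maximum *)

Section population_measurability.
Context d (T : measurableType d) {R : realType} (X : bbm_data R T).
Hypothesis mX : bbm_measurable X.

Lemma measurable_birth_time u : measurable_fun setT (birth_time X u).
Proof.
elim: u => [|j u IH]; first exact: measurable_cst.
apply: measurable_funD => //; exact: bmm_lifetime.
Qed.

Lemma measurable_birth_place u : measurable_fun setT (birth_place X u).
Proof.
elim: u => [|j u IH]; first exact: measurable_cst.
apply: measurable_funD => //.
rewrite (_ : (fun w => _) = fun w => mot X u (lifetime X u w) w).
  have h := measurable_mot2 (g := fun w => w) (bmm_motion mX u) (@bmm_continuous _ _ _ _ mX u)
    (bmm_lifetime mX u).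
  exact/h/measurable_id.
by apply/funext => w; rewrite mot_ge0//; exact: bmm_lifetime_ge0.
Qed.

Lemma measurable_realized u : measurable [set w | realized X u w].
Proof.
elim: u => [|j u IH]; first by rewrite (_ : mkset _ = setT)//; apply/seteqP; split.
apply: measurableI => //.
change (measurable (offspring X u @^-1` [set n | (j < n)%N])).
by rewrite -[X in measurable X]setTI; apply: bmm_offspring.
Qed.

Lemma measurable_alive t u : measurable [set w | alive X t w u].
Proof.
have mb := measurable_birth_time u; have ml := bmm_lifetime mX u.
apply: measurableI; first exact: measurable_realized.
have : measurable_fun setT (fun w => (birth_time X u w <= t) && (t < birth_time X u w + lifetime X u w)).
  apply: measurable_and; first exact: measurable_fun_ler.
  by apply: measurable_fun_ltr => //; exact: measurable_funD.
by move=> /(_ measurableT [set true] Logic.I); rewrite setTI.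
Qed.

(** Measurable substitute for [position], with the age clamped at 0; the two agree on living
    particles. *)
Definition posm u t w := birth_place X u w + mot X u (t - birth_time X u w) w.

Lemma posmE u t w : alive X t w u -> position X u t w = posm u t w.
Proof. by move=> [_ /andP[h _]]; rewrite /posm mot_ge0// subr_ge0. Qed.

Lemma measurable_posm u t : measurable_fun setT (posm u t).
Proof.
apply: measurable_funD; first exact: measurable_birth_place.
have mt : measurable_fun setT (fun w => t - birth_time X u w).
  by apply: measurable_funB => //; exact: measurable_birth_time.
have h := measurable_mot2 (g := fun w => w) (bmm_motion mX u) (@bmm_continuous _ _ _ _ mX u) mt.
exact/h/measurable_id.
Qed.

Lemma measurable_max_position t : measurable_fun setT (max_position X t).
Proof.
apply: (@measurable_sup _ _ R label (fun u => [set w | alive X t w u])).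
  by move=> u; exact: measurable_alive.
move=> u c.
rewrite (_ : _ `&` _ = [set w | alive X t w u] `&` [set w | c < posm u t w]).
  apply: measurableI; first exact: measurable_alive.
  have : measurable_fun setT (fun w => c < posm u t w).
    by apply: measurable_fun_ltr => //; exact: measurable_posm.
  by move=> /(_ measurableT [set true] Logic.I); rewrite setTI.
by apply/seteqP; split => w /= [aw]; rewrite posmE.
Qed.

End population_measurability.

(** * The population seen from its maximum *)

Lemma Rintegral_setT d (T : measurableType d) {R : realType} (P : probability T R) (E : set T)
    (h : T -> R) : (\int[P]_(w in E) h w)%R = (\int[P]_w ((w \in E)%:R * h w))%R.
Proof.
rewrite /Rintegral integral_mkcond; congr fine; apply: eq_integral => w _.
by rewrite patchE; case: ifP; rewrite ?mul1r ?mul0r.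
Qed.

Lemma Rintegral_null d (T : measurableType d) {R : realType} (P : probability T R) (N : set T)
    (h1 h2 : T -> R) : measurable N -> P N = 0 -> measurable_fun setT h1 -> measurable_fun setT h2 ->
  (forall w, ~ N w -> h1 w = h2 w) -> (\int[P]_w h1 w)%R = (\int[P]_w h2 w)%R.
Proof.
move=> mN PN m1 m2 h12; rewrite /Rintegral; congr fine; apply: ae_eq_integral => //.
- exact/measurable_EFinP.
- exact/measurable_EFinP.
- exists N; split=> // w /= nh; apply: contrapT => /h12 e.
  by apply: nh => _; rewrite /= e.
Qed.

Lemma cex_null d (T : measurableType d) {R : realType} (P : probability T R) (E N : set T)
    (h1 h2 : T -> R) : measurable E -> measurable N -> P N = 0 ->
  measurable_fun setT h1 -> measurable_fun setT h2 ->
  (forall w, ~ N w -> E w -> h1 w = h2 w) -> cex P E h1 = cex P E h2.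
Proof.
move=> mE mN PN m1 m2 h12; rewrite /cex (Rintegral_setT P E h1) (Rintegral_setT P E h2).
congr (_ / _).
have mI : measurable_fun setT (fun w => (w \in E)%:R : R).
  apply: (measurableT_comp (f := fun b : bool => b%:R : R)) => //.
  apply: (measurable_fun_bool true); rewrite setTI (_ : _ @^-1` _ = E)//.
  by apply/seteqP; split=> w /=; [move/set_mem|move/mem_set].
apply: (Rintegral_null mN PN); [exact: measurable_funM|exact: measurable_funM|].
by move=> w nN; case: (boolP (w \in E)) => [/set_mem Ew|_]; rewrite ?mul0r// h12.
Qed.

Lemma seq_ub {R : realType} (J : eqType) (s : seq J) (f : J -> R) :
  exists M, forall u, u \in s -> f u <= M.
Proof.
elim: s => [|v s [M hM]]; first by exists 0.
exists (Num.max (f v) M) => u; rewrite inE => /orP[/eqP ->|/hM h]; rewrite le_max ?lexx//.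
by rewrite h orbT.
Qed.

Section extremal.
Context d (T : measurableType d) {R : realType} (P : probability T R) (p : nat -> R).
Hypotheses (hp : offspring_law p).
Variables (X : bbm_data R T) (bX : is_bbm P p X).
Let mX : bbm_measurable X := bbm_is_measurable bX.
Let l0 : forall u w, 0 <= lifetime X u w := lifetime_ge0 bX.
Let mass := mass P p X.

(** The index i stands for (a, b, t). This is the translation applied to the particles, and equally
    the starting point in the asymptotics of U. *)
Definition drift (i : R * R * R) : R := - i.1.1 * Num.sqrt i.2 + i.1.2 - Num.sqrt 2 * i.2.

Definition smax (i : R * R * R) (w : T) : R :=
  - i.1.1 * Num.sqrt i.2 + i.1.2 + max_position X i.2 w - Num.sqrt 2 * i.2.

Definition Ev (i : R * R * R) : set T := [set w | 0 < smax i w].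

Definition pos (i : R * R * R) (w : T) (u : label) : R := drift i + position X u i.2 w.

Definition cnt (i : R * R * R) (c : R) (w : T) : nat :=
  count (fun u => c < pos i w u) (alist X i.2 w).

(* Triples (a, b, t) with t -> +oo for fixed a > 0 and b: convergence along this filter is
   convergence to a limit that does not depend on a and b. *)
Definition FF : set_system (R * R * R) :=
  [set A | forall a b, 0 < a -> \forall t \near +oo, A (a, b, t)].

Lemma FF_proper : ProperFilter FF.
Proof.
split.
  move=> /(_ 1 0 ltr01) /filter_ex [t []].
split=> [a b _|A B hA hB a b a0|A B AB hA a b a0]; first exact: filterE.
- by apply: filterS2 (hA a b a0) (hB a b a0).
- by apply: filterS (hA a b a0) => t; exact: AB.
Qed.
#[local] Existing Instance FF_proper.

Lemma cvg_FF (h : R * R * R -> R) (l : R) :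
  (h i @[i --> FF] --> l) <-> (forall a b, 0 < a -> h (a, b, t) @[t --> +oo] --> l).
Proof. by split=> [hl a b a0 A /hl|hl A /= hA a b a0]; [exact|exact: hl]. Qed.

Lemma measurable_smax i : measurable_fun setT (smax i).
Proof.
apply: measurable_funB => //; apply: measurable_funD => //.
exact: measurable_max_position.
Qed.

Lemma measurable_Ev i : measurable (Ev i).
Proof.
have : measurable_fun setT (fun w => 0 < smax i w).
  by apply: measurable_fun_ltr => //; exact: measurable_smax.
by move=> /(_ measurableT [set true] Logic.I); rewrite setTI.
Qed.

(** A negative drift neutralises the default 0 of the supremum: with no particle, the shifted
    maximum is the drift, and [Ev] does not occur. *)
Lemma near_drift : \forall i \near FF, 0 < i.2 /\ drift i < 0.
Proof.
move=> a b a0; near=> t.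
have bt : `|b| < t by near: t; apply: nbhs_pinfty_gt; rewrite num_real.
have t0 : 0 < t by exact: le_lt_trans bt.
split=> //; rewrite /drift/=.
have s2 : 1 <= Num.sqrt 2 :> R by rewrite -[leLHS]sqrtr1 ler_wsqrtr// ler1n.
have h1 : 0 <= a * Num.sqrt t by rewrite mulr_ge0 ?sqrtr_ge0// ltW.
have h2 : t <= Num.sqrt 2 * t by rewrite ler_peMl// ltW.
have h3 := ler_norm b; lra.
Unshelve. all: by end_near. Qed.

Lemma smax_gt i w c : 0 < i.2 -> drift i < 0 -> ~ explosive X i.2 w -> 0 <= c ->
  (c < smax i w) = has (fun u => c < pos i w u) (alist X i.2 w).
Proof.
move=> t0 s0 good c0.
have aP u := alistP l0 (ltW t0) good u.
have -> : smax i w = drift i + sup [set position X u i.2 w | u in alive X i.2 w].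
  by rewrite /smax /drift /max_position; ring.
apply/idP/hasP => [cs|[u ul cu]].
  case: (boolP (nilp (alist X i.2 w))) => [/nilP e|].
    move: cs; rewrite sup_out; first by rewrite addr0 ltNge (le_trans (ltW s0)).
    by case=> -[_ [u /aP + _]]; rewrite e.
  case el : (alist X i.2 w) => [//|u0 l] _; rewrite -el.
  have hs : has_sup [set position X u i.2 w | u in alive X i.2 w].
    split; first by exists (position X u0 i.2 w), u0 => //; apply/aP; rewrite el mem_head.
    have [M hM] := seq_ub (alist X i.2 w) (fun u => position X u i.2 w).
    by exists M => _ [u /aP ul <-]; exact: hM.
  have e0 : 0 < drift i + sup [set position X u i.2 w | u in alive X i.2 w] - c by rewrite subr_gt0.
  have [_ [u /aP ul <-] su] := sup_adherent e0 hs; exists u => //.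
  by rewrite /pos; lra.
apply: (lt_le_trans cu); rewrite lerD2l; apply: ub_le_sup; last by exists u => //; exact/aP.
have [M hM] := seq_ub (alist X i.2 w) (fun u => position X u i.2 w).
by exists M => _ [v /aP vl <-]; exact: hM.
Qed.

Lemma alist_explosive t w : 0 <= t -> explosive X t w -> alist X t w = [::].
Proof.
move=> t0 ex; rewrite /alist; case: pselect => // -[s [n0 hn]].
have [n hs] := ex (size s).+1.
have := @size_alive_list _ _ _ _ X t w l0 t0 (leq_maxr n0 n).
by rewrite (perm_size (hn _ (leq_maxl _ _))) leqNgt hs.
Qed.

Lemma pprod_pos (F : R -> R) (i : R * R * R) w : 0 < i.2 -> ~ explosive X i.2 w ->
  pprod X F i.2 (drift i) w = \prod_(u <- alist X i.2 w) F (pos i w u).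
Proof. by move=> t0 good; rewrite (pprod_alist bX)//; exact: ltW. Qed.

Lemma prod_if_pow (J : Type) (s : seq J) (b : J -> bool) (x : R) :
  \prod_(u <- s) (if b u then x else 1) = x ^+ count b s.
Proof. by rewrite -big_mkcond/= big_const_seq iter_mulr_1. Qed.

(** The count is read off the product with a factor 1/2 for each particle above c, which is
    injective in the count; the explosive event, where the count is 0, is treated apart. *)
Lemma measurable_cnt i c : 0 < i.2 -> measurable_fun setT (cnt i c).
Proof.
move=> t0.
pose F (y : R) : R := if c < y then 2^-1 else 1.
have mF : measurable_fun setT F.
  by apply: measurable_fun_ifT => //; exact: measurable_fun_ltr.
have F01 y : 0 <= F y <= 1 by rewrite /F; case: ifP => _; apply/andP; split; lra.
have cE w : ~ explosive X i.2 w -> pprod X F i.2 (drift i) w = 2^-1 ^+ cnt i c w.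
  by move=> good; rewrite pprod_pos// prod_if_pow.
have mN := measurable_explosive bX (ltW t0).
apply: measurable_fun_natE => m.
rewrite (_ : _ @^-1` _ = (explosive X i.2 `&` (if m == 0%N then setT else set0)) `|`
  (~` explosive X i.2 `&` pprod X F i.2 (drift i) @^-1` [set 2^-1 ^+ m])).
  apply: measurableU; apply: measurableI => //.
  - by case: ifP.
  - exact: measurableC.
  - by rewrite -[X in measurable X]setTI; apply: (measurable_pprod bX mF F01) => //.
apply/seteqP; split=> w /=.
- move=> <-; have [ex|ex] := pselect (explosive X i.2 w); [left|right]; split=> //.
    by rewrite /cnt (alist_explosive (ltW t0) ex).
  exact: cE.
- case=> [[ex]|[ex]].
    by rewrite /cnt (alist_explosive (ltW t0) ex)/=; case: eqP.
  rewrite cE// => /ieexprIn; apply; first by rewrite invr_gt0.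
  by rewrite invr_eq1; apply/eqP; lra.
Qed.

Let U F (i : R * R * R) : R := extinction_compl P F X i.2 (drift i).

Lemma bfun_pprod (F : R -> R) (t x : R) : measurable_fun setT F -> (forall y, 0 <= F y <= 1) ->
  bfun (pprod X F t x).
Proof.
move=> mF F01; split; first exact: (measurable_pprod bX mF F01).
by exists 1 => w; have /andP[h0 h1] := pprod_01 X F01 t x w; rewrite ger0_norm.
Qed.

Lemma Rintegral_pprod (F : R -> R) (i : R * R * R) : measurable_fun setT F ->
  (forall y, 0 <= F y <= 1) -> (\int[P]_w (1 - pprod X F i.2 (drift i) w))%R = U F i.
Proof. by move=> mF F01; rewrite /Rintegral (expectation_pprod bX mF F01). Qed.

Lemma cutoffM L (F : R -> R) : cutoff L F -> cutoff (Num.max L 0) (fun y => F y * nonpos y).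
Proof.
move=> [mF F01 F1]; have [mN N01 N1] := @cutoff_nonpos R; split.
- exact: measurable_funM.
- move=> y; have /andP[f0 f1] := F01 y; have /andP[n0 n1] := N01 y.
  by rewrite mulr_ge0//= mulr_ile1.
- move=> y yL; have h1 : L <= Num.max L 0 by rewrite le_max lexx.
  have h2 : 0 <= Num.max L 0 by rewrite le_max lexx orbT.
  by rewrite F1 ?N1 ?mulr1//; lra.
Qed.

Lemma pprod_Ev i w : 0 < i.2 -> drift i < 0 -> ~ explosive X i.2 w ->
  pprod X (@nonpos R) i.2 (drift i) w = (w \notin Ev i)%:R.
Proof.
move=> t0 s0 good; rewrite pprod_pos//.
have -> : (w \in Ev i) = (0 < smax i w) by apply/idP/idP => [/set_mem|h]; last exact/mem_set.
rewrite smax_gt//; elim: (alist X i.2 w) => [|u l IH]; first by rewrite big_nil.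
by rewrite big_cons IH /nonpos /= negb_or -leNgt; case: (_ <= 0); rewrite ?mul1r ?mul0r.
Qed.

Lemma prob_Ev i : 0 < i.2 -> drift i < 0 -> fine (P (Ev i)) = U (@nonpos R) i.
Proof.
move=> t0 s0; have [mN N01 N1] := @cutoff_nonpos R; have mE := measurable_Ev i.
rewrite -Rintegral_pprod//.
rewrite (_ : fine (P (Ev i)) = \int[P]_(w in Ev i) (1 : R))%R; last first.
  by rewrite Rintegral_cst// mul1r.
rewrite Rintegral_setT; apply: (Rintegral_null (measurable_explosive bX (ltW t0))).
- exact: (explosive_null hp bX t0).
- apply: measurable_funM => //; apply: (measurableT_comp (f := fun b : bool => b%:R : R)) => //.
  apply: (measurable_fun_bool true); rewrite setTI (_ : _ @^-1` _ = Ev i)//.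
  by apply/seteqP; split=> w /=; [move/set_mem|move/mem_set].
- by apply: measurable_funB => //; exact: (measurable_pprod bX mN N01).
- by move=> w good; rewrite pprod_Ev// mulr1; case: (_ \in _); rewrite ?subr0 ?subrr.
Qed.

(** Multiplying F by [nonpos] inserts the indicator of the complement of [Ev] into the product, so
    the restriction to [Ev] is a difference of two products. *)
Lemma cex_pprod L (F : R -> R) i : cutoff L F -> 0 < i.2 -> drift i < 0 ->
  cex P (Ev i) (pprod X F i.2 (drift i)) =
  (U (fun y => F y * nonpos y) i - U F i) / U (@nonpos R) i.
Proof.
move=> cF t0 s0; rewrite /cex prob_Ev//; congr (_ / _).
have [mF F01 F1] := cF; have [mG G01 G1] := cutoffM cF; have mE := measurable_Ev i.
have iF : forall (G : R -> R), measurable_fun setT G -> (forall y, 0 <= G y <= 1) ->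
    P.-integrable setT (EFin \o (fun w => 1 - pprod X G i.2 (drift i) w)).
  move=> G mG' G01'; apply: bfun_integrable => //; apply: bfunB; first exact: bfun_cst.
  exact: bfun_pprod.
rewrite -Rintegral_pprod// -Rintegral_pprod// -RintegralB//; [|exact: iF|exact: iF].
rewrite Rintegral_setT; apply: (Rintegral_null (measurable_explosive bX (ltW t0))).
- exact: (explosive_null hp bX t0).
- apply: measurable_funM; last exact: (measurable_pprod bX mF F01).
  apply: (measurableT_comp (f := fun b : bool => b%:R : R)) => //.
  apply: (measurable_fun_bool true); rewrite setTI (_ : _ @^-1` _ = Ev i)//.
  by apply/seteqP; split=> w /=; [move/set_mem|move/mem_set].
- apply: measurable_funB; apply: measurable_funB => //.
    exact: (measurable_pprod bX mG G01).
  exact: (measurable_pprod bX mF F01).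
- move=> w good; rewrite (pprod_pos (fun y => F y * nonpos y))// big_split/=.
  rewrite -!pprod_pos// pprod_Ev//.
  by case: (_ \in _); rewrite ?mulr1 ?mulr0 ?mul1r ?mul0r; ring.
Qed.

Lemma cvg_cex_pprod L (F : R -> R) : cutoff L F ->
  cex P (Ev i) (pprod X F i.2 (drift i)) @[i --> FF] -->
  (mass (fun y => F y * nonpos y) - mass F) / mass (@nonpos R).
Proof.
move=> cF; have near_eq : \forall i \near FF, (U (fun y => F y * nonpos y) i - U F i) / U (@nonpos R) i =
    cex P (Ev i) (pprod X F i.2 (drift i)).
  by apply: filterS near_drift => i [t0 s0]; rewrite (cex_pprod cF).
apply: cvg_trans; first exact: (near_eq_cvg near_eq).
apply/cvg_FF => a b a0; rewrite mulrBl.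
under eq_fun do rewrite mulrBl.
apply: cvgB; first exact: (cvg_U_ratio hp bX b (cutoffM cF) a0).
exact: (cvg_U_ratio hp bX b cF a0).
Qed.

(** The rescaled probability tends to [clim a] times the mass of [nonpos], which is positive;
    conditioning is thus eventually meaningful. *)
Lemma near_prob_Ev : \forall i \near FF, 0 < fine (P (Ev i)).
Proof.
have m0 := mass_nonpos_gt0 hp bX.
suff h : \forall i \near FF, 0 < U (@nonpos R) i.
  by apply: filterS2 near_drift h => i [t0 s0]; rewrite prob_Ev.
move=> a b a0; have c := cvg_mass hp bX b (@cutoff_nonpos R) a0.
have c0 : 0 < clim a * mass (@nonpos R) by rewrite mulr_gt0// clim_gt0.
near=> t.
have : 0 < t * expR (Num.sqrt 2 * (a * Num.sqrt t - b)) *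
   extinction_compl P (@nonpos R) X t (- a * Num.sqrt t + b - Num.sqrt 2 * t).
  by near: t; exact: (cvgr_gt _ c).
have t0 : 0 < t by near: t; exact: nbhs_pinfty_gt.
by rewrite pmulr_rgt0// mulr_gt0// expR_gt0.
Unshelve. all: by end_near. Qed.

Section counts.
Variable q : nat -> R.

(** The value 0 at nonpositive times makes the counts measurable for every index, not only
    eventually. *)
Definition cq (i : R * R * R) (w : T) (j : nat) : nat := if 0 < i.2 then cnt i (q j) w else 0%N.

Lemma measurable_cq i j : measurable_fun setT (fun w => cq i w j).
Proof.
rewrite /cq; have [t0|_] := boolP (0 < i.2); [exact: measurable_cnt|exact: measurable_cst].
Qed.

Lemma bfun_cq_pow i j (s : R) : 0 <= s <= 1 -> bfun (fun w => s ^+ cq i w j).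
Proof.
move=> /andP[s0 s1]; split.
  exact: (measurableT_comp (f := fun m => s ^+ m) _ (measurable_cq i j)).
by exists 1 => w; rewrite ger0_norm ?exprn_ge0// exprn_ile1.
Qed.

Lemma cvg_cq_pgf (l2 : seq (nat * R)) : all (fun a => 0 < a.2 < 1) l2 ->
  cvg (cex P (Ev i) (fun w => \prod_(a <- l2) a.2 ^+ cq i w a.1) @[i --> FF]).
Proof.
move=> /allP h2.
(* The product of this step function over the particles is the joint generating function of the
   counts; - M lies below all the levels. *)
pose F (y : R) : R := \prod_(a <- l2) (if q a.1 < y then a.2 else 1).
have [M hM] := seq_ub l2 (fun a => - q a.1).
have mF : measurable_fun setT F.
  apply: measurable_prod => a _; apply: measurable_fun_ifT => //; exact: measurable_fun_ltr.
have F01 y : 0 <= F y <= 1.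
  rewrite /F; elim: l2 h2 {hM mF F} => [|a l IH] h2; first by rewrite big_nil ler01 lexx.
  rewrite big_cons; have /IH/andP[i0 i1] : forall x, x \in l -> 0 < x.2 < 1.
    by move=> x xl; apply: h2; rewrite inE xl orbT.
  have /andP[a0 a1] := h2 a (mem_head _ _).
  case: ifP => _; last by rewrite mul1r i0.
  by rewrite mulr_ge0 ?(ltW a0)//= mulr_ile1// ltW.
have cF : cutoff M F.
  split=> // y yM; rewrite /F big1_seq// => a /andP[_ al]; case: ifPn => //.
  by have := hM a al; lra.
apply: (cvgP ((mass (fun y => F y * nonpos y) - mass F) / mass (@nonpos R))).
apply: cvg_trans (cvg_cex_pprod cF); apply: near_eq_cvg.
apply: filterS near_drift => i [t0 s0].
apply: (cex_null (measurable_Ev i) (measurable_explosive bX (ltW t0)) (explosive_null hp bX t0)).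
- exact: (measurable_pprod bX mF F01).
- have [//] : bfun (fun w => \prod_(a <- l2) a.2 ^+ cq i w a.1).
  apply: bfun_prod => a /h2 /andP[a0 a1]; apply: bfun_cq_pow; rewrite !ltW//.
- move=> w good _; rewrite pprod_pos// exchange_big/=; apply: eq_bigr => a _.
  by rewrite prod_if_pow /cq t0.
Qed.

(** Lowering F from 1 to 1 - lam above the level gives (1 - lam) to the count, at most 1/2 when the
    count exceeds K. For small lam the mass is small, so the conditional expectation is close to 1,
    and Markov bounds the probability of large counts. *)
Lemma cq_tight j (e : R) : 0 < e -> exists K, \forall i \near FF,
  cex P (Ev i) (fun w => (K < cq i w j)%N%:R) <= e.
Proof.
move=> e0.
have aux1 (z : R) : 1 - e / 2 < z -> 2 * (1 - z) <= e by lra.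
have aux2 (z : R) : z <= 1 -> 0 <= 2 * (1 - z) by lra.
have aux3 (z : R) : z <= 2^-1 -> 1 <= 2 * (1 - z) by lra.
have m0 := mass_nonpos_gt0 hp bX.
have [lam [lp l01 hn]] : exists lam : R, [/\ 0 < lam, 0 <= lam <= 1 &
    mass (fun y => 1 - lam * (- (- q j) < y)%R%:R) < mass (@nonpos R) * (e / 2)].
  have c := cvg_mass0 hp bX (- q j).
  have : \forall n \near \oo, mass (fun y => 1 - n.+1%:R^-1 * (- (- q j) < y)%R%:R) < mass (@nonpos R) * (e / 2).
    by apply: (cvgr_lt _ c); rewrite mulr_gt0// divr_gt0.
  by move=> /filter_ex[n hn]; exists n.+1%:R^-1; split; [rewrite invr_gt0|exact: inv_succ_01|].
have lam1 : 0 <= 1 - lam by case/andP: l01 => _; rewrite subr_ge0.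
have lam2 : 1 - lam < 1 by rewrite ltrBlDr ltrDl.
pose F (y : R) : R := 1 - lam * (- (- q j) < y)%R%:R.
have cF : cutoff (- q j) F.
  apply: (cutoff_thin (b := fun y => - (- q j) < y)) => //; first exact: measurable_fun_ltr.
  by move=> y /ltW yq; apply/negbTE; rewrite -leNgt.
have [mF F01 F1] := cF.
have [K hK] : exists K, (1 - lam) ^+ K <= 2^-1.
  have : (1 - lam) ^+ k @[k --> \oo] --> (0 : R).
    by apply: cvg_expr; rewrite ger0_norm.
  move=> /cvgr_lt/(_ 2^-1); rewrite invr_gt0 ltr0n => /(_ isT) /filter_ex[K hK].
  by exists K; exact: ltW.
exists K.
have lim : (mass (fun y => F y * nonpos y) - mass F) / mass (@nonpos R) > 1 - e / 2.
  rewrite ltr_pdivlMr//.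
  have : mass (@nonpos R) <= mass (fun y => F y * nonpos y).
    apply: (mass_mono hp bX (cutoffM cF) (@cutoff_nonpos R)) => y.
    by have /andP[f0 f1] := F01 y; rewrite ler_piMl// /nonpos.
  by move: hn; rewrite -/F; set A := mass F; set B := mass nonpos; clear; nra.
have near_h : \forall i \near FF, 1 - e / 2 < cex P (Ev i) (pprod X F i.2 (drift i)).
  by apply: (cvgr_gt _ (cvg_cex_pprod cF)).
near=> i.
have [t0 s0] : 0 < i.2 /\ drift i < 0 by near: i; exact: near_drift.
have PE : 0 < fine (P (Ev i)) by near: i; exact: near_prob_Ev.
have hh : 1 - e / 2 < cex P (Ev i) (pprod X F i.2 (drift i)) by near: i; exact: near_h.
have mE := measurable_Ev i.
pose h w := (1 - lam) ^+ cq i w j.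
have bh : bfun h by apply: bfun_cq_pow; rewrite lam1 ltW.
have eh : cex P (Ev i) (pprod X F i.2 (drift i)) = cex P (Ev i) h.
  apply: (cex_null mE (measurable_explosive bX (ltW t0)) (explosive_null hp bX t0)).
  - exact: (measurable_pprod bX mF F01).
  - by case: bh.
  - move=> w good _; rewrite pprod_pos// /h /cq t0 -prod_if_pow; apply: eq_bigr => u _.
    by rewrite /F opprK; case: ifP => _; rewrite ?mulr1// mulr0 subr0.
have bK : bfun (fun w => (K < cq i w j)%N%:R : R).
  by apply: bfun_bool; exact: (measurableT_comp (f := fun m => (K < m)%N) _ (measurable_cq i j)).
apply: (@le_trans _ _ (2 * (1 - cex P (Ev i) h))); last by rewrite -eh; exact: aux1.
rewrite -[X in _ * (X - _)](cex_cst mE PE) -cexB//; last exact: bfun_cst.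
rewrite -cexZ//; last by apply: bfunB => //; exact: bfun_cst.
apply: cex_le => //; first by apply: bfunM; [exact: bfun_cst|apply: bfunB => //; exact: bfun_cst].
move=> w _; have h0 : 0 <= h w by rewrite exprn_ge0.
have h1 : h w <= 1 by rewrite exprn_ile1// ltW.
case: (ltnP K _) => Kc; last exact: aux2.
apply: aux3.
apply: le_trans hK; apply: ler_wiXn2l => //; [exact: ltW|exact: ltnW].
Unshelve. all: by end_near. Qed.

End counts.

(** With F the indicator of ]-oo, c] and c >= 0, F [nonpos] = [nonpos]; the shift rule gives mass
    e^(- sqrt 2 c) relative to [nonpos]. *)
Lemma cvg_tail (c : R) : 0 <= c ->
  cex P (Ev i) (fun w => (c < smax i w)%R%:R) @[i --> FF] --> expR (- Num.sqrt 2 * c).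
Proof.
move=> c0; have m0 := mass_nonpos_gt0 hp bX.
pose F (y : R) : R := nonpos (y - c).
have cF : cutoff (0 - c) F by exact: (cutoff_shift (- c) (@cutoff_nonpos R)).
have [mF F01 F1] := cF.
have FN : (fun y => F y * nonpos y) = @nonpos R.
  apply/funext => y; rewrite /F /nonpos; case: (lerP y 0) => y0; last by rewrite mulr0.
  by rewrite (_ : y - c <= 0) ?mulr1//; lra.
have lim : expR (- Num.sqrt 2 * c) = 1 - (mass (fun y => F y * nonpos y) - mass F) / mass (@nonpos R).
  rewrite FN (_ : mass F = expR (Num.sqrt 2 * - c) * mass (@nonpos R)); last first.
    exact: (mass_shift hp bX (- c) (@cutoff_nonpos R)).
  by rewrite mulrN mulNr; field; exact: lt0r_neq0.
rewrite lim.
have h : 1 - cex P (Ev i) (pprod X F i.2 (drift i)) @[i --> FF] -->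
    1 - (mass (fun y => F y * nonpos y) - mass F) / mass (@nonpos R).
  by apply: cvgB; [exact: cvg_cst|exact: (cvg_cex_pprod cF)].
apply: cvg_trans h; apply: near_eq_cvg; near=> i.
have [t0 s0] : 0 < i.2 /\ drift i < 0 by near: i; exact: near_drift.
have PE : 0 < fine (P (Ev i)) by near: i; exact: near_prob_Ev.
have mE := measurable_Ev i.
have bp : bfun (pprod X F i.2 (drift i)) by exact: bfun_pprod.
rewrite -[X in X - _](cex_cst mE PE) -cexB//; last exact: bfun_cst.
apply: (cex_null mE (measurable_explosive bX (ltW t0)) (explosive_null hp bX t0)).
- by have [] : bfun (fun w => 1 - pprod X F i.2 (drift i) w) by apply: bfunB => //; exact: bfun_cst.
- apply: (measurableT_comp (f := fun b : bool => b%:R : R)) => //.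
  by apply: measurable_fun_ltr => //; exact: measurable_smax.
- move=> w good _; rewrite pprod_pos// smax_gt//.
  elim: (alist X i.2 w) => [|u l IH]; first by rewrite big_nil subrr.
  rewrite big_cons/= {1}/F /nonpos subr_le0 ltNge.
  by case: (_ <= c); rewrite /= ?mul1r// mul0r subr0.
Unshelve. all: by end_near. Qed.

End extremal.

(** * The exponential limit *)

(** Only x is confined to the interval; the nearby y may leave it, which spares a bound on the
    approximants. *)
Lemma uniform_modulus {R : realType} (g : R -> R) (A e : R) : continuous g -> 0 < e ->
  exists2 de, 0 < de & forall x y, `|x| <= A -> `|x - y| <= de -> `|g x - g y| <= e.
Proof.
move=> cg e0.
have /compact_near_coveringP cpt : compact [set` `[- A, A]] by exact: segment_compact.
have e2 : 0 < e / 2 by rewrite divr_gt0.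
have h : \forall de \near 0^'+, [set` `[- A, A]] `<=` [set x | forall y, `|x - y| <= de -> `|g x - g y| <= e].
  apply: cpt => x _.
  have /cvgrPdist_le/(_ _ e2)/nbhs_ballP[e1 /= e10 he] := cg x.
  exists (ball x (e1 / 2), [set de | de < e1 / 2]) => /=.
    split; first by apply: nbhsx_ballx; rewrite divr_gt0.
    by apply: nbhs_right_lt; rewrite divr_gt0.
  move=> [x' de] /= [bx hde] y xy.
  have hx : `|g x - g x'| <= e / 2 by apply: he; apply: le_ball bx; rewrite ler_pdivrMr//; lra.
  have hy : `|g x - g y| <= e / 2.
    apply: he; rewrite /ball/=; move: bx; rewrite /ball/= => bx.
    rewrite (_ : x - y = (x - x') + (x' - y)); last by ring.
    rewrite (le_lt_trans (ler_normD _ _))//; lra.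
  rewrite (_ : g x' - g y = (g x - g y) - (g x - g x')); last by ring.
  rewrite (le_trans (ler_normB _ _))//; lra.
have [de [de0 hd]] : exists de : R, 0 < de /\ [set` `[- A, A]] `<=` [set x | forall y, `|x - y| <= de -> `|g x - g y| <= e].
  have /filter_ex[de [h1 h2]] : \forall de \near (0:R)^'+, 0 < de /\
     [set` `[- A, A]] `<=` [set x | forall y, `|x - y| <= de -> `|g x - g y| <= e].
    by apply: filterS2 (nbhs_right_gt 0) h.
  by exists de.
by exists de => // x y xA; apply: hd; rewrite /= in_itv/= -ler_norml.
Qed.

Section step_functions.
Context d (T : measurableType d) {R : realType} (P : probability T R).
Variables (E : set T) (mE : measurable E) (PE : 0 < fine (P E)).
Variables (M : T -> R) (mM : measurable_fun setT M) (M0 : forall w, E w -> 0 < M w).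
Variables (g : R -> R) (mg : measurable_fun setT g) (Bd : R) (gB : forall y, `|g y| <= Bd).
Variables (r : nat -> R) (J : nat) (e : R).
Hypotheses (r0 : r 0%N = 0) (rmono : forall i, r i <= r i.+1) (e0 : 0 <= e).
Hypothesis gr : forall i y, (i < J)%N -> r i < y <= r i.+1 -> `|g y - g (r i)| <= e.

Let rle i k : (i <= k)%N -> r i <= r k.
Proof.
elim: k => [|k IH]; first by rewrite leqn0 => /eqP ->.
by rewrite leq_eqVlt ltnS => /orP[/eqP ->//|/IH h]; exact: le_trans h (rmono k).
Qed.

Lemma step_error :
  `|cex P E (fun w => g (M w)) - \sum_(i < J) g (r i) *
      (cex P E (fun w => (r i < M w)%R%:R) - cex P E (fun w => (r i.+1 < M w)%R%:R))|
  <= e + Bd * cex P E (fun w => (r J < M w)%R%:R).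
Proof.
have bi i : bfun (fun w => (r i < M w)%R%:R : R).
  by apply: bfun_bool; exact: measurable_fun_ltr.
have bg : bfun (fun w => g (M w)).
  by split; [exact: measurableT_comp|exists Bd => w].
have bc (c : R) : bfun (fun _ : T => c) by exact: bfun_cst.
have bt (i : 'I_J) : bfun (fun w => g (r i) * ((r i < M w)%R%:R - (r i.+1 < M w)%R%:R)).
  by apply: bfunM => //; exact: bfunB.
have bs : bfun (fun w => \sum_(i < J) g (r i) * ((r i < M w)%R%:R - (r i.+1 < M w)%R%:R)).
  by apply: bfun_sum => i _.
have -> : \sum_(i < J) g (r i) *
      (cex P E (fun w => (r i < M w)%R%:R) - cex P E (fun w => (r i.+1 < M w)%R%:R)) =
    cex P E (fun w => \sum_(i < J) g (r i) * ((r i < M w)%R%:R - (r i.+1 < M w)%R%:R)).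
  rewrite cex_sum//; apply: eq_bigr => i _; rewrite cexZ ?cexB//; exact: bfunB.
have bR : bfun (fun w => e + Bd * (r J < M w)%R%:R) by apply: bfunD => //; exact: bfunM.
have -> : e + Bd * cex P E (fun w => (r J < M w)%R%:R) = cex P E (fun w => e + Bd * (r J < M w)%R%:R).
  by rewrite cexD ?cexZ ?(cex_cst mE PE)//; exact: bfunM.
rewrite -cexB//.
have pt w : E w -> `|g (M w) - \sum_(i < J) g (r i) * ((r i < M w)%R%:R - (r i.+1 < M w)%R%:R)| <=
    e + Bd * (r J < M w)%R%:R.
  move=> Ew.
  (* [grid_sum] with a single atom at M w, cut off beyond the last grid point. *)
  pose v (_ : nat) := g (M w) * (M w <= r J)%R%:R.
  pose be (_ : nat) i := r i < M w.
  have := @grid_sum R 1 J v (fun i => g (r i)) be e.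
  rewrite big_ord1; under eq_bigr do rewrite !big_ord1.
  rewrite big_ord1 /v /be r0 (M0 Ew) mulr1 => h.
  have {h} h : `|g (M w) * (M w <= r J)%R%:R -
      \sum_(i < J) g (r i) * ((r i < M w)%R%:R - (r i.+1 < M w)%R%:R)| <= e.
    apply: h => //.
    - by move=> _ i; exact: le_lt_trans.
    - move=> _ i iJ ri; rewrite -leNgt => ri1.
      rewrite (_ : M w <= r J) ?mulr1; first by apply: gr => //; rewrite ri.
      by apply: (le_trans ri1); exact: rle.
    - by move=> _ rJ; rewrite leNgt rJ mulr0.
  case: (lerP (M w) (r J)) h => /= hM; rewrite ?mulr1 ?mulr0 ?addr0//.
  rewrite sub0r normrN => h; rewrite (le_trans (ler_normB _ _))// addrC lerD//.
rewrite ler_norml; apply/andP; split; last first.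
  by apply: cex_le => //; [exact: bfunB|move=> w Ew; rewrite (le_trans (ler_norm _))// pt].
rewrite -mulN1r -cexZ//; apply: cex_le => //; [exact: bfunM|exact: bfunB|].
by move=> w Ew; rewrite mulN1r; have := pt w Ew; rewrite ler_norml => /andP[].
Qed.

End step_functions.

Lemma exponential_prob_gt {R : realType} (la c : R) : 0 < la -> 0 <= c ->
  (exponential_prob la [set y | (c < y)%R] = (expR (- la * c))%:E)%E.
Proof.
move=> la0 c0; rewrite (_ : [set y | _] = `]c, +oo[%classic); last first.
  by apply/seteqP; split=> y /=; rewrite in_itv/= andbT.
have cexp : continuous (fun z : R^o => expR (- la * z)).
  move=> z; apply: continuous_comp; last exact: continuous_expR.
  by apply: continuousM => //; apply: (@continuousN _ R^o); exact: cst_continuous.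
rewrite /exponential_prob integral_itv_obnd_cbnd; last first.
  by apply/measurable_EFinP; apply: measurable_funTS; exact: measurable_exponential_pdf.
rewrite (@ge0_continuous_FTC2y _ _ (fun x => - expR (- la * x)) _ 0)//.
- by rewrite EFinN oppeK add0e.
- by move=> x _; apply: exponential_pdf_ge0; exact: ltW.
- apply: (@continuous_subspaceW R^o _ _ [set` `[0, +oo[%R]); last first.
    exact: within_continuous_exponential_pdf.
  by move=> x /=; rewrite !in_itv/= !andbT; exact: le_trans.
- rewrite -oppr0; apply: cvgN.
  rewrite (_ : (fun x => expR (- la * x)) = (fun z => expR (- z)) \o (fun z => la * z)); last first.
    by apply: eq_fun => x; rewrite mulNr.
  apply: (@cvg_comp _ _ _ _ _ _ (pinfty_nbhs R)); last exact: cvgr_expR.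
  exact: gt0_cvgMry.
- by apply: cvgN; apply/cvg_at_right_filter; exact: cexp.
- move=> x; rewrite in_itv/= andbT => cx; apply: derive1_exponential_pdf.
  by rewrite in_itv/= andbT (le_lt_trans c0).
Qed.

Section exponential_limit.
Context d (T : measurableType d) {R : realType} (P : probability T R).
Context (I : Type) (FF : set_system I) {pF : ProperFilter FF}.
Variables (E : I -> set T) (mE : forall i, measurable (E i)).
Hypothesis PE : \forall i \near FF, 0 < fine (P (E i)).
Variables (M : I -> T -> R) (mM : forall i, measurable_fun setT (M i)).
Hypothesis M0 : forall i w, E i w -> 0 < M i w.
Variable la : R.
Hypothesis la0 : 0 < la.
Hypothesis tails : forall c, 0 <= c ->
  cex P (E i) (fun w => (c < M i w)%R%:R) @[i --> FF] --> expR (- la * c).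

(** Tails determine the integrals of step functions. The same estimate is applied to M under P and
    to the identity under the exponential law, which charges the positive half-line only. *)
Lemma cvg_exponential (g : R -> R) : continuous g -> bounded_fun g ->
  cex P (E i) (fun w => g (M i w)) @[i --> FF] -->
  fine (\int[exponential_prob la]_y (g y)%:E)%E.
Proof.
move=> cg [B0 [_ gB0]].
have [Bd Bd0 gB] : exists2 Bd, 0 <= Bd & forall y, `|g y| <= Bd.
  exists (`|B0| + 1) => [|y]; first by rewrite addr_ge0.
  by apply: gB0 => //; rewrite (le_lt_trans (ler_norm _))// ltrDl.
have mg : measurable_fun setT g by exact: continuous_measurable_fun.
pose Q0 : probability (measurableTypeR R) R := exponential_prob la.
pose Q := Q0 la0.
pose E' : set (measurableTypeR R) := [set y | 0 < y].
have tQ (c : R) : 0 <= c -> Q [set y | c < y] = (expR (- la * c))%:E.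
  by move=> c0; exact: exponential_prob_gt.
have QE' : Q E' = 1%E by rewrite tQ// mulr0 expR0.
have mE' : measurable E'.
  rewrite (_ : E' = `]0, +oo[%classic); first exact: measurable_itv.
  by apply/seteqP; split=> y /=; rewrite in_itv/= andbT.
have PE' : 0 < fine (Q E') by rewrite QE'.
have tails' (c : R) : 0 <= c -> cex Q E' (fun w => (c < w)%R%:R) = expR (- la * c).
  move=> c0; rewrite /cex QE' divr1 Rintegral_setT /Rintegral.
  transitivity (fine (\int[Q]_w (\1_[set y | c < y] w)%:E)%E); last first.
    have mc : measurable ([set y | c < y] : set (measurableTypeR R)).
      rewrite (_ : mkset _ = `]c, +oo[%classic); first exact: measurable_itv.
      by apply/seteqP; split=> y /=; rewrite in_itv/= andbT.
    by rewrite integral_indic// setIT; exact: (congr1 fine (tQ c c0)).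
  congr fine; apply: eq_integral => w _; rewrite indicE; congr (_%:E).
  have -> : (w \in E') = (0 < w) by apply/idP/idP => [/set_mem|/mem_set].
  have -> : (w \in [set y | c < y]) = (c < w) by apply/idP/idP => [/set_mem|/mem_set].
  by case: (ltrP c w) => cw; rewrite ?mulr0// (le_lt_trans c0 cw) mulr1.
have -> : fine (\int[exponential_prob la]_y (g y)%:E)%E = cex Q E' g.
  rewrite /cex QE' divr1 Rintegral_setT; apply: (@Rintegral_null _ _ _ Q (~` E')).
  - exact: measurableC.
  - by rewrite probability_setC// QE' subee.
  - exact: mg.
  - apply: measurable_funM => //; apply: (measurableT_comp (f := fun b : bool => b%:R : R)) => //.
    apply: (measurable_fun_bool true); rewrite setTI (_ : _ @^-1` _ = E')//.
    by apply/seteqP; split=> w /=; [move/set_mem|move/mem_set].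
  - by move=> w /contrapT Ew; rewrite (mem_set Ew) mul1r.
apply: cvg_by_approx => e e0.
have e2 : 0 < e / 2 by rewrite divr_gt0.
have [K K0 hK] : exists2 K : R, 0 < K & Bd * expR (- la * K) < e / 2.
  (* From e^x >= 1 + x: with this K, (e / 2) (1 + la K) = e / 2 + Bd + 1 exceeds Bd. *)
  exists (2 * (Bd + 1) / (e * la)); first by rewrite divr_gt0// ?mulr_gt0// ltr_wpDl.
  rewrite mulNr expRN ltr_pdivrMr ?expR_gt0//.
  have h := expR_ge1Dx (la * (2 * (Bd + 1) / (e * la))).
  apply: lt_le_trans (ler_wpM2l (ltW e2) h).
  rewrite (_ : e / 2 * _ = e / 2 + Bd + 1); first lra.
  by field; rewrite !lt0r_neq0.
have [de de0 hde] := uniform_modulus K cg e2.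
pose J := (Num.truncn (K / de)).+1.
pose r (i : nat) : R := i%:R * (K / J%:R).
have KJ : 0 <= K / J%:R by rewrite divr_ge0// ltW.
have r0 : r 0%N = 0 by rewrite /r mul0r.
have rJ : r J = K by rewrite /r mulrC divfK ?pnatr_eq0.
have rS i : r i.+1 = r i + K / J%:R by rewrite /r -natr1 mulrDl mul1r.
have rge i : 0 <= r i by rewrite /r mulr_ge0.
have rmono i : r i <= r i.+1 by rewrite rS lerDl.
have gr i y : (i < J)%N -> r i < y <= r i.+1 -> `|g y - g (r i)| <= e / 2.
  move=> iJ /andP[ry yr].
  have h : K / J%:R <= de.
    by rewrite ler_pdivrMr// mulrC -ler_pdivrMr// ltW// truncnS_gt.
  rewrite distrC; apply: hde.
    rewrite ger0_norm// -rJ /r ler_wpM2r// ler_nat ltnW//.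
  by rewrite distrC ger0_norm; move: yr; rewrite rS; lra.
exists (fun i => \sum_(j < J) g (r j) * (cex P (E i) (fun w => (r j < M i w)%R%:R) -
    cex P (E i) (fun w => (r j.+1 < M i w)%R%:R))),
  (\sum_(j < J) g (r j) * (expR (- la * r j) - expR (- la * r j.+1))); split.
- apply: (cvg_bigsum (s := index_enum _)) => j _.
  by apply: cvgM; [exact: cvg_cst|apply: cvgB; exact: tails].
- have c : Bd * cex P (E i) (fun w => (K < M i w)%R%:R) @[i --> FF] --> Bd * expR (- la * K).
    by apply: cvgM; [exact: cvg_cst|apply: tails; exact: ltW].
  near=> i.
  have PEi : 0 < fine (P (E i)) by near: i.
  have h : Bd * cex P (E i) (fun w => (K < M i w)%R%:R) < e / 2 by near: i; exact: (cvgr_lt _ c).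
  have := step_error (mE i) PEi (mM i) (@M0 i) mg gB r0 rmono (ltW e2) gr.
  by move/le_trans; apply; rewrite rJ; lra.
- have := @step_error _ _ _ Q E' mE' PE' id (@measurable_id _ _ _) (fun _ h => h) g mg Bd gB r J (e / 2)
    r0 rmono (ltW e2) gr.
  rewrite rJ (tails' K (ltW K0)); under eq_bigr do rewrite !tails'//.
  by move/le_trans; apply; move: hK; lra.
Unshelve. all: by end_near. Qed.

End exponential_limit.

(** * The point process before the limit *)

(** Words list the latest letter first, hence the reversal. *)
Definition entry (c : seq nat) (j : nat) : nat := nth 0%N (rev c) j.

Lemma entry_prefix (x : nat -> nat) k j : (j < k)%N -> entry (prefix_of x k) j = x j.
Proof.
move=> jk; rewrite /entry (_ : rev (prefix_of x k) = map x (iota 0 k)).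
  by rewrite (nth_map 0%N) ?size_iota// nth_iota.
elim: k {jk} => [//|k IH].
by rewrite [prefix_of _ _]/= rev_cons IH -(addn1 k) iotaD map_cat cats1.
Qed.

Section truncation.
Context d (T : measurableType d) {R : realType} (P : probability T R).
Variables (E N : set T) (mE : measurable E) (PE : 0 < fine (P E)).
Hypotheses (mN : measurable N) (PN : P N = 0).
Variables (V S : T -> R) (C : T -> nat) (mV : measurable_fun setT V) (mS : measurable_fun setT S).
Hypothesis mC : measurable_fun setT C.
Variables (g : R -> R) (Bd Ph e' de e : R) (K : nat).
Hypotheses (mg : measurable_fun setT g) (gB : forall y, `|g y| <= Bd).
Hypotheses (VC : forall w, ~ N w -> `|V w| <= Ph * (C w)%:R)
  (VS : forall w, ~ N w -> `|V w - S w| <= e' * (C w)%:R).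
Hypotheses (Ph0 : 0 <= Ph) (e'0 : 0 <= e') (eK : e' * K%:R <= de) (e0 : 0 <= e).
Hypothesis gmod : forall x y, `|x| <= Ph * K%:R -> `|x - y| <= de -> `|g x - g y| <= e.

(** V is to be the integral of a test function, S its approximation on a grid and C the number of
    atoms above - L. Size and error are proportional to C; where C > K only the bound on g is used.
    Serves both before the limit and in it. *)
Lemma trunc_error :
  `|cex P E (fun w => g (V w)) - cex P E (fun w => g (S w) * (C w <= K)%N%:R)| <=
  e + Bd * cex P E (fun w => (K < C w)%N%:R).
Proof.
have Bd0 : 0 <= Bd by exact: le_trans (gB 0).
have bgV : bfun (fun w => g (V w)) by split; [exact: measurableT_comp|exists Bd => w].
have mCK : measurable_fun setT (fun w => (C w <= K)%N).
  exact: (measurableT_comp (f := fun m => (m <= K)%N)).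
have bCK : bfun (fun w => (C w <= K)%N%:R : R) by exact: bfun_bool.
have bKC : bfun (fun w => (K < C w)%N%:R : R).
  by apply: bfun_bool; exact: (measurableT_comp (f := fun m => (K < m)%N)).
have bgS : bfun (fun w => g (S w) * (C w <= K)%N%:R).
  by apply: bfunM => //; split; [exact: measurableT_comp|exists Bd => w].
have bc (c : R) : bfun (fun _ : T => c) by exact: bfun_cst.
have bR : bfun (fun w => e + Bd * (K < C w)%N%:R) by apply: bfunD => //; exact: bfunM.
have -> : e + Bd * cex P E (fun w => (K < C w)%N%:R) = cex P E (fun w => e + Bd * (K < C w)%N%:R).
  by rewrite cexD ?cexZ ?(cex_cst mE PE)//; exact: bfunM.
rewrite -cexB//.
(* The estimates hold off the null set N only, so the difference is set to 0 on it. *)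
pose D w : R := if `[< N w >] then 0 else g (V w) - g (S w) * (C w <= K)%N%:R.
have mNb : measurable_fun setT (fun w => `[< N w >]).
  apply: (measurable_fun_bool true); rewrite setTI (_ : _ @^-1` _ = N)//.
  by apply/seteqP; split=> w /=; [move/asboolP|move/asboolP].
have mD : measurable_fun setT D.
  by apply: measurable_fun_ifT => //; have [] := bfunB bgV bgS.
have -> : cex P E (fun w => g (V w) - g (S w) * (C w <= K)%N%:R) = cex P E D.
  apply: (cex_null mE mN PN) => //; first by have [] := bfunB bgV bgS.
  by move=> w nN _; rewrite /D; case: asboolP.
have pt w : `|D w| <= e + Bd * (K < C w)%N%:R.
  rewrite /D; case: asboolP => nN; first by rewrite normr0 addr_ge0// mulr_ge0.
  case: (leqP (C w) K) => CK; rewrite ?mulr1 ?mulr0 ?addr0 ?subr0; last first.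
    by rewrite (le_trans (gB _))// lerDr.
  have CK' : (C w)%:R <= K%:R :> R by rewrite ler_nat.
  apply: gmod; first by rewrite (le_trans (VC nN))// ler_wpM2l.
  by rewrite (le_trans (VS nN))// (le_trans _ eK)// ler_wpM2l.
have bD : bfun D.
  split=> //; exists (e + Bd) => w; rewrite (le_trans (pt w))// lerD2l.
  by case: (_ < _)%N; rewrite ?mulr1// mulr0.
rewrite ler_norml; apply/andP; split; last first.
  by apply: cex_le => // w _; rewrite (le_trans (ler_norm _)).
rewrite -mulN1r -cexZ//; apply: cex_le => //; first exact: bfunM.
by move=> w _; rewrite mulN1r; have := pt w; rewrite ler_norml => /andP[].
Qed.

End truncation.

Section prelimit_measure.
Context d (T : measurableType d) {R : realType} (P : probability T R) (p : nat -> R).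
Hypotheses (hp : offspring_law p).
Variables (X : bbm_data R T) (bX : is_bbm P p X).
Let mX : bbm_measurable X := bbm_is_measurable bX.
Let l0 : forall u w, 0 <= lifetime X u w := lifetime_ge0 bX.

Definition has_atom (i : R * R * R) (w : T) (n : nat) : bool :=
  if @pickle_inv label n is Some u then `[< alive X i.2 w u >] else false.

Definition atom_at (i : R * R * R) (w : T) (n : nat) : R :=
  if @pickle_inv label n is Some u then pos X i w u else 0.

Lemma bbm_atoms (a b t : R) w :
  bbm_point_process X t (fun y => - a * Num.sqrt t + b + y - Num.sqrt 2 * t) w =
  atoms (has_atom (a, b, t) w) (atom_at (a, b, t) w).
Proof.
rewrite /bbm_point_process /atoms; congr mseries; apply/funext => n.
rewrite /has_atom /atom_at /atom; case: (pickle_inv n) => // u.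
rewrite /particle_measure; case: asboolP => // _.
have -> // : - a * Num.sqrt t + b + position X u t w - Num.sqrt 2 * t = pos X (a, b, t) w u.
by rewrite /pos /drift/=; ring.
Qed.

Lemma sum_labels (i : R * R * R) w (h : label -> R) : 0 < i.2 -> ~ explosive X i.2 w ->
  forall N0, (forall u, u \in alist X i.2 w -> (pickle u < N0)%N) ->
  \sum_(n < N0) (if @pickle_inv label n is Some u then (`[< alive X i.2 w u >])%:R * h u else 0) =
  \sum_(u <- alist X i.2 w) h u.
Proof.
move=> t0 good N0 hN0; have aP u := alistP l0 (ltW t0) good u.
pose H n := if @pickle_inv label n is Some u then (`[< alive X i.2 w u >])%:R * h u else 0.
have -> : \sum_(u <- alist X i.2 w) h u = \sum_(n <- map pickle (alist X i.2 w)) H n.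
  rewrite big_map; apply: eq_big_seq => u /aP au; rewrite /H pickleK_inv.
  by case: asboolP => // _; rewrite mul1r.
transitivity (\sum_(n <- [seq n <- iota 0 N0 | has_atom i w n]) H n).
  rewrite big_filter [RHS]big_mkcond/=.
  rewrite (_ : iota 0 N0 = index_iota 0 N0); last by rewrite /index_iota subn0.
  rewrite big_mkord; apply: eq_bigr => n _; rewrite /H /has_atom.
  by case: (pickle_inv n) => // u; case: asboolP => //; rewrite mul0r.
apply: perm_big; apply: uniq_perm.
- by rewrite filter_uniq ?iota_uniq.
- by rewrite map_inj_uniq ?(uniq_alist l0 (ltW t0) good)//; exact: pcan_inj pickleK.
- move=> n; rewrite mem_filter mem_iota add0n /=; apply/andP/mapP => [[]|[u ul ->]].
    rewrite /has_atom; have := @pickle_invK label n.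
    by case: (pickle_inv n) => //= u <- /asboolP au _; exists u => //; exact/aP.
  rewrite hN0// /has_atom pickleK_inv; split=> //; exact/asboolP/aP.
Qed.

Lemma labels_bound (i : R * R * R) w : exists N0, forall u, u \in alist X i.2 w -> (pickle u < N0)%N.
Proof.
elim: (alist X i.2 w) => [|v s [N0 h]]; first by exists 0%N.
exists (maxn (pickle v).+1 N0) => u; rewrite inE => /orP[/eqP ->|/h uN]; first exact: leq_maxl.
by rewrite (leq_trans uN)// leq_maxr.
Qed.

Section integrals.
Variables (phi : R -> R) (L : R).
Hypotheses (mphi : measurable_fun setT phi) (phi0 : forall y, L <= `|y| -> phi y = 0).

Definition Vp (i : R * R * R) (w : T) : R := \int[atoms (has_atom i w) (atom_at i w)]_y phi y.

Lemma measurable_Vp i : measurable_fun setT (Vp i).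
Proof.
have mb n : measurable_fun setT (has_atom i ^~ n).
  rewrite /has_atom; case: (pickle_inv n) => [u|]; last exact: measurable_cst.
  apply: (measurable_fun_bool true); rewrite setTI (_ : _ @^-1` _ = [set w | alive X i.2 w u]).
    exact: measurable_alive.
  by apply/seteqP; split=> w /=; [move/asboolP|move/asboolP].
apply: measurable_Rintegral_atoms => // n.
rewrite (_ : (fun w => _) = fun w => (has_atom i w n)%:R *
    phi (if @pickle_inv label n is Some u then drift i + posm X u i.2 w else 0)).
  apply: measurable_funM.
    exact: (measurableT_comp (f := fun b : bool => b%:R : R)).
  case: (pickle_inv n) => [u|]; last exact: measurable_cst.
  by apply: (measurableT_comp mphi); apply: measurable_funD => //; exact: measurable_posm.
apply/funext => w; rewrite /has_atom /atom_at; case: (pickle_inv n) => // u.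
by case: asboolP => [au|]; rewrite ?mul0r// /pos posmE.
Qed.

Variables (r : nat -> R) (J : nat) (ph : nat -> R) (e : R).
Hypotheses (rmono : forall j, r j <= r j.+1) (r0 : r 0%N = - L) (rJ : r J = L) (e0 : 0 <= e).
Hypothesis ph_e : forall j y, (j < J)%N -> r j <= y <= r j.+1 -> `|phi y - ph j| <= e.

Lemma Vp_grid i w : 0 < i.2 -> ~ explosive X i.2 w ->
  `|Vp i w - \sum_(j < J) ph j * ((cnt X i (r j) w)%:R - (cnt X i (r j.+1) w)%:R)| <=
  e * (cnt X i (- L) w)%:R.
Proof.
move=> t0 good; have aP u := alistP l0 (ltW t0) good u.
have [N0 hN0] := labels_bound i w.
have VE : Vp i w = \sum_(n < N0) (has_atom i w n)%:R * phi (atom_at i w n).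
  apply: Rintegral_atoms => // n Nn; rewrite /has_atom.
  have := @pickle_invK label n; case: (pickle_inv n) => //= u un /asboolP au.
  by have := hN0 u ((aP u).2 au); rewrite un ltnNge Nn.
pose be n j := has_atom i w n && (r j < atom_at i w n).
have cE j : \sum_(n < N0) ((be n j)%:R : R) = (cnt X i (r j) w)%:R.
  transitivity (\sum_(u <- alist X i.2 w) ((r j < pos X i w u)%R%:R : R)); last first.
    rewrite /cnt -sum1_count natr_sum [RHS]big_mkcond/=; apply: eq_bigr => u _.
    by case: ifP.
  rewrite -(sum_labels (fun u => (r j < pos X i w u)%R%:R) t0 good hN0); apply: eq_bigr => n _.
  rewrite /be /has_atom /atom_at; case: (pickle_inv n) => // u.
  by case: asboolP => _; rewrite ?mul1r ?mul0r.
rewrite VE -r0 -(cE 0%N).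
under [in X in _ - X]eq_bigr do rewrite -!cE.
apply: (@grid_sum R N0 J (fun n => (has_atom i w n)%:R * phi (atom_at i w n)) ph be e) => //.
- by move=> n j /andP[b1 b2]; rewrite /be b1 (le_lt_trans (rmono j)).
- move=> n j jJ /andP[b1 b2]; rewrite /be b1/= -leNgt => b3.
  by rewrite mul1r; apply: ph_e => //; rewrite (ltW b2).
- move=> n; rewrite /be; case: (has_atom i w n); rewrite ?mul0r//= -leNgt r0 mul1r => h.
  by apply: phi0; rewrite ler_normr lerNr h orbT.
- move=> n /andP[_]; rewrite rJ => h; rewrite phi0 ?mulr0//.
  by rewrite ler_normr (ltW h).
Qed.

End integrals.

End prelimit_measure.

(** * The limit process *)

Section limit_process.
Context {R : realType}.
Variables (Y : R -> nat -> nat).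
Hypothesis mY : forall j, measurable_fun setT (Y ^~ j : measurableTypeR R -> nat).

Definition CY (u : R) (r : rat) : nat := Y u (pickle r).

(** The limiting counts are decreasing in the level only almost surely. The samples where this
    fails, or where points lie above every integer, are excluded and carry no atom. *)
Definition inversion (rr : rat * rat) : set (measurableTypeR R) :=
  [set u | (rr.1 <= rr.2) && (CY u rr.1 < CY u rr.2)%N].

Definition good : set (measurableTypeR R) :=
  ~` (\bigcup_rr inversion rr) `&` \bigcup_(n : nat) [set u | CY u n%:R = 0%N].

Definition occurs (u : R) (n : nat) : bool :=
  `[< good u >] && `[< exists r, (n < CY u r)%N >].

(** The n-th atom from the right, counted from 0: the supremum of the levels with more than n points
    above them. *)
Definition xi (u : R) (n : nat) : R := sup [set (ratr r : R) | r in [set r | (n < CY u r)%N]].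

Let mlt n r : measurable ([set u | (n < CY u r)%N] : set (measurableTypeR R)).
Proof.
have : measurable_fun setT ((fun u => (n < CY u r)%N) : measurableTypeR R -> bool).
  exact: (measurableT_comp (f := fun m => (n < m)%N) _ (mY (pickle r))).
by move=> /(_ measurableT [set true] Logic.I); rewrite setTI.
Qed.

Lemma measurable_inversion rr : measurable (inversion rr).
Proof.
rewrite /inversion; case: (rr.1 <= rr.2) => /=; last first.
  by rewrite (_ : mkset _ = set0)//; apply/seteqP; split.
have : measurable_fun setT ((fun u => (CY u rr.1 < CY u rr.2)%N) : measurableTypeR R -> bool).
  by apply: measurable_fun_ltn; exact: mY.
by move=> /(_ measurableT [set true] Logic.I); rewrite setTI.
Qed.

Lemma measurable_good : measurable good.
Proof.
apply: measurableI.
  by apply: measurableC; apply: measurable_bigcup_count => rr; exact: measurable_inversion.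
apply: bigcup_measurable => n _.
rewrite (_ : mkset _ = ~` [set u | (0 < CY u n%:R)%N]); first exact: measurableC.
by apply/seteqP; split=> u /= => [->//|/negP]; rewrite -eqn0Ngt => /eqP.
Qed.

Lemma measurable_xi n : measurable_fun setT ((xi ^~ n) : measurableTypeR R -> R).
Proof.
apply: (@measurable_sup _ (measurableTypeR R) R rat (fun r => [set u | (n < CY u r)%N]) (fun r _ => ratr r)).
  by move=> r; exact: mlt.
move=> r c; apply: measurableI => //.
case: (boolP (c < ratr r)) => h; last by rewrite (_ : mkset _ = set0)//; apply/seteqP; split=> // u /=.
by rewrite (_ : mkset _ = setT)//; apply/seteqP; split.
Qed.

Lemma measurable_occurs n : measurable_fun setT ((occurs ^~ n) : measurableTypeR R -> bool).
Proof.
apply: measurable_and; apply: (measurable_fun_bool true); rewrite setTI.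
- rewrite (_ : _ @^-1` _ = good); first exact: measurable_good.
  by apply/seteqP; split=> w /=; [move/asboolP|move/asboolP].
- rewrite (_ : _ @^-1` _ = \bigcup_r [set u | (n < CY u r)%N]).
    by apply: measurable_bigcup_count => r; exact: mlt.
  by apply/seteqP; split=> w /=; [move/asboolP => -[r h]; exists r|move=> [r _ h]; apply/asboolP; exists r].
Qed.

Section good_sample.
Variable u : R.
Hypothesis gu : good u.

Lemma CY_mono (r r' : rat) : r <= r' -> (CY u r' <= CY u r)%N.
Proof.
move=> rr; rewrite leqNgt; apply/negP => h; case: gu => + _; apply.
by exists (r, r') => //; rewrite /inversion /= rr.
Qed.

Lemma xi_ge n r : (n < CY u r)%N -> ratr r <= xi u n.
Proof.
move=> h; apply: ub_le_sup; last by exists r.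
case: gu => _ [m _ /= hm]; exists (ratr m%:R) => _ [r' /= h' <-]; rewrite ler_rat leNgt.
by apply/negP => /ltW/CY_mono; rewrite hm leqn0 => /eqP e; rewrite e in h'.
Qed.

Lemma xi_gt n r : occurs u n -> ratr r < xi u n -> (n < CY u r)%N.
Proof.
move=> /andP[_ /asboolP[r0 h0]] h.
have hs : has_sup [set (ratr r : R) | r in [set r | (n < CY u r)%N]].
  split; first by exists (ratr r0), r0.
  case: gu => _ [m _ /= hm]; exists (ratr m%:R) => _ [r' /= h' <-]; rewrite ler_rat leNgt.
  by apply/negP => /ltW/CY_mono; rewrite hm leqn0 => /eqP e; rewrite e in h'.
have e0 : 0 < xi u n - ratr r by rewrite subr_gt0.
have [_ [r' /= h' <-] sr] := sup_adherent e0 hs.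
by apply: (leq_trans h'); apply: CY_mono; apply: ltW; move: sr; rewrite subKr ltr_rat.
Qed.

Lemma occurs_lt n r : (n < CY u r)%N -> occurs u n.
Proof. by move=> h; apply/andP; split; apply/asboolP => //; exists r. Qed.

End good_sample.

Definition limit_measure (u : measurableTypeR R) : {measure set (measurableTypeR R) -> \bar R} :=
  atoms (occurs u) (xi u : nat -> measurableTypeR R).

Lemma limit_kernel : exists N : R.-ker (measurableTypeR R) ~> (measurableTypeR R),
  forall u, N u = limit_measure u.
Proof.
have mf U : measurable U -> measurable_fun setT (limit_measure ^~ U).
  by move=> mU; apply: measurable_atoms => // n; [exact: measurable_occurs|exact: measurable_xi].
pose K := isKernel.Build _ _ (measurableTypeR R) (measurableTypeR R) R limit_measure mf.
by exists (Kernel.Pack (Kernel.Class K)).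
Qed.

(** The level - (n + 1) lies strictly below A, so the atoms in A have ranks below the finite count
    at that level. *)
Lemma limit_measure_locally_finite u (A : set (measurableTypeR R)) (n : nat) : measurable A ->
  (forall y, A y -> - n%:R <= y) -> (limit_measure u A < +oo)%E.
Proof.
move=> mA An.
apply: (@atoms_fin _ (measurableTypeR R) _ _ _ (CY u (- n.+1%:R))) => // m hm occ /An Am.
have gu : good u by have /andP[/asboolP] := occ.
have := @xi_gt u gu m (- n.+1%:R) occ; rewrite ltnNge hm => h.
suff : ratr (- n.+1%:R) < xi u m by move=> /h.
by rewrite (lt_le_trans _ Am)// rmorphN/= ratr_nat ltrN2 ltr_nat.
Qed.

Section good_null.
Variable Q : probability (measurableTypeR R) R.
Hypothesis Qinv : forall rr, Q (inversion rr) = 0%E.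
Variable la : R.
Hypothesis la0 : 0 < la.
Hypothesis Qtail : forall n : nat, (Q [set u | (0 < CY u n%:R)%N] <= (expR (- la * n%:R))%:E)%E.

(** There are countably many pairs of rationals, each with a null inversion, and the probability of
    points above every integer is at most e^(- la n) for all n. *)
Lemma good_null : Q (~` good) = 0%E.
Proof.
apply: measure_negligible; first by apply: measurableC; exact: measurable_good.
rewrite /good setCI setCK; apply: negligibleU.
  rewrite (_ : \bigcup_rr _ = \bigcup_(n : nat) if unpickle n is Some rr then inversion rr else set0).
    apply: negligible_bigcup => n; case: (unpickle n) => [rr|]; last exact: negligible_set0.
    by exists (inversion rr); split=> //; [exact: measurable_inversion|exact: Qinv].
  apply/seteqP; split=> u.
    by move=> [rr _ h]; exists (pickle rr); [exact: Logic.I|rewrite pickleK; exact: h].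
  by move=> [n _]; case: (unpickle n) => // rr h; exists rr.
set A := ~` _.
have mA : measurable A.
  apply: measurableC; apply: bigcup_measurable => n _.
  rewrite (_ : mkset _ = ~` [set u | (0 < CY u n%:R)%N]); first exact: measurableC.
  by apply/seteqP; split=> u /= => [->//|/negP]; rewrite -eqn0Ngt => /eqP.
exists A; split=> //; apply/eqP; rewrite eq_le measure_ge0 andbT.
have hn (n : nat) : (Q A <= (expR (- la * n%:R))%:E)%E.
  apply: le_trans (Qtail n); apply: le_measure; rewrite ?inE// => u /= nu.
  by rewrite lt0n; apply/eqP => h; apply: nu; exists n.
have Qf : Q A \is a fin_num by exact: fin_num_measure.
change (Q A <= 0%:E)%E; rewrite -(fineK Qf) lee_fin.
have h2 (n : nat) : fine (Q A) <= expR (- la * n%:R) by rewrite -lee_fin fineK.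
rewrite leNgt; apply/negP => q0.
pose n := (Num.truncn ((fine (Q A))^-1 / la)).+1.
have hx : (fine (Q A))^-1 <= la * n%:R.
  by rewrite mulrC -ler_pdivrMr// ltW// truncnS_gt.
have := h2 n; rewrite mulNr expRN -ler_pV2; last 2 first.
- by rewrite inE unitfE gt_eqF ?invr_gt0 ?expR_gt0.
- by rewrite inE unitfE gt_eqF.
rewrite invrK => h3; have := expR_ge1Dx (la * n%:R); lra.
Qed.

End good_null.

Section limit_integrals.
Variables (phi : R -> R) (L : R).
Hypotheses (mphi : measurable_fun setT phi) (phi0 : forall y, L <= `|y| -> phi y = 0).

Definition VY (u : measurableTypeR R) : R := \int[limit_measure u]_y phi y.

Lemma measurable_VY : measurable_fun setT VY.
Proof.
apply: measurable_Rintegral_atoms => // n; first exact: measurable_occurs.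
apply: measurable_funM; last exact: (measurableT_comp mphi (measurable_xi n)).
by apply: (measurableT_comp (f := fun b : bool => b%:R : R)) => //; exact: measurable_occurs.
Qed.

Variables (r : nat -> rat) (J : nat) (ph : nat -> R) (e : R).
Hypotheses (rmono : forall j, r j <= r j.+1) (r0 : ratr (r 0%N) = - L) (rJ : ratr (r J) = L) (e0 : 0 <= e).
Hypothesis ph_e : forall j y, (j < J)%N -> ratr (r j) <= y <= ratr (r j.+1) -> `|phi y - ph j| <= e.

Lemma VY_grid u : good u ->
  `|VY u - \sum_(j < J) ph j * ((CY u (r j))%:R - (CY u (r j.+1))%:R)| <= e * (CY u (r 0%N))%:R.
Proof.
move=> gu; pose N0 := CY u (r 0%N).
have low n : (N0 <= n)%N -> occurs u n -> phi (xi u n) = 0.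
  move=> Nn on; apply: phi0; rewrite ler_normr; apply/orP; right.
  rewrite lerNr -r0 leNgt; apply/negP => /(xi_gt gu on).
  by rewrite ltnNge Nn.
have VE : VY u = \sum_(n < N0) (occurs u n)%:R * phi (xi u n).
  by apply: Rintegral_atoms => // n; exact: low.
have r0j j : r 0%N <= r j by elim: j => // j IH; exact: le_trans IH (rmono j).
pose be n j := (n < CY u (r j))%N.
have cE j : \sum_(n < N0) ((be n j)%:R : R) = (CY u (r j))%:R.
  rewrite -natr_sum; congr (_%:R); rewrite /be.
  transitivity (\sum_(0 <= n < N0 | (n < CY u (r j))%N) 1)%N.
    by rewrite [RHS]big_mkcond big_mkord; apply: eq_bigr => n _; case: ifP.
  by rewrite -(@big_nat_widen _ _ _ 0 (CY u (r j)) N0 xpredT) ?sum_nat_const_nat ?subn0 ?muln1//; exact: CY_mono.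
rewrite VE -(cE 0%N).
under [in X in _ - X]eq_bigr do rewrite -!cE.
apply: (@grid_sum R N0 J (fun n => (occurs u n)%:R * phi (xi u n)) ph be e) => //.
- by move=> n j h; apply: (leq_trans h); exact: CY_mono.
- move=> n j jJ b1 b2; rewrite (occurs_lt gu b1) mul1r; apply: ph_e => //.
  rewrite xi_ge//= leNgt; apply/negP => h; move: b2; rewrite /be.
  by rewrite (xi_gt gu (occurs_lt gu b1) h).
- move=> n; rewrite /be -leqNgt => Nn; case: (boolP (occurs u n)) => on; last by rewrite mul0r.
  by rewrite low// mulr0.
- move=> n bn; rewrite phi0 ?mulr0// ler_normr -rJ; apply/orP; left; exact: xi_ge.
Qed.

End limit_integrals.

End limit_process.

(** * Convergence of the point processes *)

Lemma cex_indic d (T : measurableType d) {R : realType} (Q : probability T R) (b : T -> bool) :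
  measurable_fun setT b -> Q [set u | b u] = (cex Q setT (fun u => (b u)%:R))%:E.
Proof.
move=> mb; have mS : measurable [set u | b u].
  by move: (mb measurableT [set true] Logic.I); rewrite setTI.
rewrite /cex probability_setT divr1 /Rintegral.
rewrite (_ : (\int[Q]_u ((b u)%:R)%:E = Q [set u | b u])%E) ?fineK//; first exact: fin_num_measure.
transitivity (\int[Q]_u (\1_[set u | b u] u)%:E)%E; last by rewrite integral_indic// setIT.
apply: eq_integral => u _; rewrite indicE; congr ((_%:R)%:E).
by apply: congr1; apply/idP/idP => [/mem_set|/set_mem].
Qed.

Lemma bounded_on_compact {R : realType} (phi : R -> R) (L : R) : continuous phi ->
  exists2 Ph, 0 <= Ph & forall y, `|y| <= L -> `|phi y| <= Ph.
Proof.
move=> cphi.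
have cpt : compact (phi @` [set` `[- L, L]]).
  by apply: continuous_compact; [exact: continuous_subspaceT|exact: segment_compact].
have [M [_ hM]] := compact_bounded cpt.
exists (`|M| + 1) => [|y yL]; first by rewrite addr_ge0.
apply: hM; first by rewrite (le_lt_trans (ler_norm _))// ltrDl.
by exists y => //=; rewrite in_itv/= -ler_norml.
Qed.

Lemma test_function_support {R : realType} (phi : R -> R) : test_function phi ->
  exists L : nat, (0 < L)%N /\ forall y, L%:R <= `|y| -> phi y = 0.
Proof.
move=> [_ cpt]; have [M [_ hM]] := compact_bounded cpt.
exists (Num.truncn (`|M| + 1)).+1; split=> // y Ly; apply/eqP; apply: contraTT Ly => py.
rewrite -ltNge; apply: le_lt_trans (truncnS_gt _).
apply: hM; first by rewrite (le_lt_trans (ler_norm _))// ltrDl.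
exact: subset_closure.
Qed.

Section rational_grid.
Context {R : realType}.
Variables (L m : nat).
Hypothesis m0 : (0 < m)%N.

(** The nodes are rational because the limiting counts are; an integer L makes both ends of [- L, L]
    nodes. *)
Definition grid (j : nat) : rat := - L%:R + j%:R / m%:R.

Let mR : (m%:R : R) != 0. Proof. by rewrite pnatr_eq0 -lt0n. Qed.

Lemma gridE j : ratr (grid j) = - L%:R + j%:R / m%:R :> R.
Proof. by rewrite /grid rmorphD/= rmorphN/= fmorph_div/= !ratr_nat. Qed.

Lemma grid_mono j : grid j <= grid j.+1.
Proof. by rewrite lerD2l ler_wpM2r ?invr_ge0// ler_nat. Qed.

Lemma grid0 : ratr (grid 0) = - L%:R :> R.
Proof. by rewrite gridE mul0r addr0. Qed.

Lemma gridJ : ratr (grid (2 * L * m)) = L%:R :> R.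
Proof. by rewrite gridE natrM mulfK// natrM; ring. Qed.

Lemma gridS j : ratr (grid j.+1) = ratr (grid j) + m%:R^-1 :> R.
Proof. by rewrite !gridE -natr1; field. Qed.

Lemma grid_le j : (j <= 2 * L * m)%N -> `|ratr (grid j) : R| <= L%:R.
Proof.
move=> jJ; rewrite ler_norml -{1}grid0 -gridJ !gridE !lerD2l.
by rewrite !ler_wpM2r ?invr_ge0 ?ler_nat.
Qed.

End rational_grid.

Definition thresholds {R : realType} (j : nat) : R :=
  if @unpickle rat j is Some r then ratr r else 0.

Lemma thresholdsE {R : realType} (r : rat) : @thresholds R (pickle r) = ratr r.
Proof. by rewrite /thresholds pickleK. Qed.

Section point_process_limit.
Context d (T : measurableType d) {R : realType} (P : probability T R) (p : nat -> R).
Hypotheses (hp : offspring_law p).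
Variables (X : bbm_data R T) (bX : is_bbm P p X).
#[local] Existing Instance FF_proper.

Notation FF := (@FF R).
Notation cqX := (cq X thresholds).

Variable Y : R -> nat -> nat.
Hypothesis mY : forall j, measurable_fun setT (Y^~ j : measurableTypeR R -> nat).
Hypothesis hY : forall k (f : seq nat -> R) (B : R), (forall c, `|f c| <= B) ->
  cex P (Ev X i) (fun w => f (prefix_of (cqX i w) k)) @[i --> FF] -->
  cex (@unif R) setT (fun u => f (prefix_of (Y u) k)).

Lemma limit_functional (Phi : (nat -> nat) -> R) k Bd :
  (forall x y, (forall j, (j < k)%N -> x j = y j) -> Phi x = Phi y) -> (forall x, `|Phi x| <= Bd) ->
  cex P (Ev X i) (fun w => Phi (cqX i w)) @[i --> FF] --> cex (@unif R) setT (fun u => Phi (Y u)).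
Proof.
move=> loc bdd; have := @hY k (fun c => Phi (entry c)) Bd (fun c => bdd _).
have e x : Phi (entry (prefix_of x k)) = Phi x by apply: loc => j; exact: entry_prefix.
rewrite (_ : (fun u => Phi (entry (prefix_of (Y u) k))) = fun u => Phi (Y u)); last first.
  by apply/funext => u; rewrite e.
by under eq_fun do under eq_fun do rewrite e.
Qed.

(** Before the limit the counts are decreasing in the level, so the probability of an inversion is
    0, and so is its limit. *)
Lemma Y_inversion rr : (@unif R) (inversion Y rr) = 0%E.
Proof.
rewrite /inversion; case: (boolP (rr.1 <= rr.2)) => h /=; last first.
  by rewrite (_ : mkset _ = set0)// -subset0 => u /=.
rewrite (@cex_indic _ (measurableTypeR R)); last by apply: measurable_fun_ltn; exact: mY.
pose Phi (x : nat -> nat) : R := (x (pickle rr.1) < x (pickle rr.2))%N%:R.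
have c : cex P (Ev X i) (fun w => Phi (cqX i w)) @[i --> FF] --> cex (@unif R) setT (fun u => Phi (Y u)).
  apply: (@limit_functional Phi (maxn (pickle rr.1) (pickle rr.2)).+1 1) => [x y xy|x].
    by rewrite /Phi !xy// ltnS ?leq_maxl ?leq_maxr.
  by rewrite /Phi; case: (_ < _)%N; rewrite ?normr1 ?normr0.
have c0 : cex P (Ev X i) (fun w => Phi (cqX i w)) @[i --> FF] --> (0 : R).
  apply: cvg_near_cst; apply: filterS2 (near_prob_Ev hp bX) (@near_drift R) => i PE [t0 _].
  rewrite (_ : (fun w => _) = fun=> 0); first by rewrite (cex_cst (measurable_Ev bX i)).
  apply/funext => w; rewrite /Phi /cq t0 !thresholdsE (_ : (_ < _)%N = false)//.
  apply/negbTE; rewrite -leqNgt; apply: sub_count => u; apply: le_lt_trans.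
  by rewrite ler_rat.
by rewrite (cvg_unique _ c c0).
Qed.

(** A point above n means that the maximum exceeds n, whose conditional probability has a known
    limit. *)
Lemma Y_tail (n : nat) :
  ((@unif R) [set u | (0 < CY Y u n%:R)%N] <= (expR (- Num.sqrt 2 * n%:R))%:E)%E.
Proof.
rewrite (@cex_indic _ (measurableTypeR R)); last first.
  exact: (measurableT_comp (f := fun m => (0 < m)%N) _ (mY _)).
pose Phi (x : nat -> nat) : R := (0 < x (pickle (n%:R : rat)))%N%:R.
have c : cex P (Ev X i) (fun w => Phi (cqX i w)) @[i --> FF] --> cex (@unif R) setT (fun u => Phi (Y u)).
  apply: (@limit_functional Phi (pickle (n%:R : rat)).+1 1) => [x y xy|x].
    by rewrite /Phi !xy.
  by rewrite /Phi; case: (_ < _)%N; rewrite ?normr1 ?normr0.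
have c0 : cex P (Ev X i) (fun w => Phi (cqX i w)) @[i --> FF] --> expR (- Num.sqrt 2 * n%:R).
  apply: cvg_trans (cvg_tail hp bX (ler0n R n)); apply: near_eq_cvg.
  apply: filterS (@near_drift R) => i [t0 s0].
  apply: (cex_null (measurable_Ev bX i) (measurable_explosive bX (ltW t0)) (explosive_null hp bX t0)).
  - apply: (measurableT_comp (f := fun b : bool => b%:R : R)) => //.
    by apply: measurable_fun_ltr => //; exact: (measurable_smax bX).
  - apply: (measurableT_comp (f := fun b : bool => b%:R : R)) => //.
    exact: (measurableT_comp (f := fun m => (0 < m)%N) _ (measurable_cq bX _ _ _)).
  - move=> w good _; rewrite (smax_gt bX)// /Phi /cq t0 thresholdsE ratr_nat.
    by rewrite -has_count.
by rewrite lee_fin (cvg_unique _ c c0).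
Qed.

Lemma Y_good : (@unif R) (~` good Y) = 0%E.
Proof.
apply: (good_null mY Y_inversion (la := Num.sqrt 2)); first by rewrite sqrtr_gt0.
exact: Y_tail.
Qed.

Lemma cvg_point_process (phi g : R -> R) : test_function phi -> continuous g -> bounded_fun g ->
  cex P (Ev X i) (fun w => g (Vp X phi i w)) @[i --> FF] --> cex (@unif R) setT (fun u => g (VY Y phi u)).
Proof.
move=> tphi cg [B0 [_ gB0]].
have [Bd Bd0 gB] : exists2 Bd, 0 <= Bd & forall y, `|g y| <= Bd.
  exists (`|B0| + 1) => [|y]; first by rewrite addr_ge0.
  by apply: gB0 => //; rewrite (le_lt_trans (ler_norm _))// ltrDl.
have [cphi _] := tphi; have [L [L0 phi0]] := test_function_support tphi.
have [Ph Ph0 phB] := bounded_on_compact L%:R cphi.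
have mphi : measurable_fun setT phi by exact: continuous_measurable_fun.
have mg : measurable_fun setT g by exact: continuous_measurable_fun.
apply: cvg_by_approx => e e0; have e2 : 0 < e / 2 by rewrite divr_gt0.
have eB : 0 < e / 2 / (Bd + 1) by rewrite divr_gt0// ltr_wpDl.
have eBd : Bd * (e / 2 / (Bd + 1)) <= e / 2.
  by rewrite mulrCA ler_piMr ?(ltW e2)// ler_pdivrMr ?mul1r ?lerDl// ltr_wpDl.
have [K hK] := cq_tight hp bX thresholds (pickle (- L%:R : rat)) eB.
have [de de0 gmod] := uniform_modulus (Ph * K%:R) cg e2.
(* At most K atoms contribute, so an error e' for each stays within de; K + 1 avoids dividing by
   0. *)
pose e' := de / K.+1%:R.
have e'0 : 0 < e' by rewrite divr_gt0.
have eK : e' * K%:R <= de.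
  by rewrite /e' mulrAC ler_pdivrMr// ler_wpM2l ?(ltW de0)// ler_nat.
have [de' de'0 phmod] := uniform_modulus L%:R cphi e'0.
pose m := (Num.truncn de'^-1).+1.
have m0 : (0 < m)%N by [].
have mde : (m%:R^-1 : R) <= de'.
  by rewrite invf_ple ?posrE// ltW// truncnS_gt.
pose r := grid L m; pose J := (2 * L * m)%N.
pose ph j : R := phi (ratr (r j)).
pose S (x : nat -> nat) : R := \sum_(j < J) ph j * ((x (pickle (r j)))%:R - (x (pickle (r j.+1)))%:R).
have r0 : r 0%N = - L%:R by rewrite /r /grid mul0r addr0.
have ph_e j (y : R) : (j < J)%N -> ratr (r j) <= y <= ratr (r j.+1) -> `|phi y - ph j| <= e'.
  move=> jJ /andP[h1 h2]; rewrite distrC; apply: phmod; first exact: (grid_le m0 (ltnW jJ)).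
  by apply: le_trans mde; rewrite distrC ger0_norm ?subr_ge0// lerBlDl -gridS.
(* The grid estimate with zero step function and error Ph: it bounds the integral itself by Ph times
   the count. *)
have ph_0 j (y : R) : (j < J)%N -> ratr (r j) <= y <= ratr (r j.+1) -> `|phi y - 0| <= Ph.
  move=> jJ /andP[h1 h2]; rewrite subr0; apply: phB.
  have := grid_le (R := R) m0 (ltnW jJ); have := grid_le (R := R) m0 jJ.
  rewrite !ler_norml => /andP[_ h3] /andP[h4 _].
  by rewrite (le_trans h4 h1) (le_trans h2 h3).
pose pr0 := pickle (- L%:R : rat).
have rL : ratr (- L%:R) = - L%:R :> R by rewrite rmorphN/= ratr_nat.
have rr0 : ratr (r 0%N) = - L%:R :> R by exact: grid0.
have rrJ : ratr (r J) = L%:R :> R by exact: gridJ.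
have rS j : r j <= r j.+1 by exact: grid_mono.
have rS' j : ratr (r j) <= ratr (r j.+1) :> R by rewrite ler_rat.
have mS d' (T' : measurableType d') (x : T' -> nat -> nat) :
    (forall j, measurable_fun setT (x ^~ j)) -> measurable_fun setT (fun w => S (x w)).
  move=> mx; apply: measurable_sum => j; apply: measurable_funM => //.
  by apply: measurable_funB; apply: (measurableT_comp (f := fun m : nat => m%:R : R)).
pose Phi (x : nat -> nat) : R := g (S x) * (x pr0 <= K)%N%:R.
exists (fun i => cex P (Ev X i) (fun w => Phi (cqX i w))), (cex (@unif R) setT (fun u => Phi (Y u))).
split.
- pose k := (\max_(j < J.+2) (pickle (r j)).+1)%N.
  have hk j : (j < J.+2)%N -> (pickle (r j) < k)%N.
    by move=> jJ; exact: (leq_bigmax (F := fun j : 'I_J.+2 => (pickle (r j)).+1) (Ordinal jJ)).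
  apply: (@limit_functional Phi k Bd) => [x y xy|x].
    rewrite /Phi /pr0 -r0 xy ?hk//; congr (g _ * _); apply: eq_bigr => j _.
    by rewrite !xy// hk// ?ltnS ltnW// ltnS ltnW.
  by rewrite /Phi normrM; case: (_ <= _)%N; rewrite ?normr1 ?mulr1// normr0 mulr0.
- apply: filterS3 (near_prob_Ev hp bX) (@near_drift R) hK => i PE [t0 _] hKi.
  apply: le_trans (_ : e / 2 + Bd * cex P (Ev X i) (fun w => (K < cqX i w pr0)%N%:R) <= _); last first.
    have := ler_wpM2l Bd0 hKi; rewrite -/pr0; lra.
  have mc j : measurable_fun setT (fun w => cqX i w j) by exact: (measurable_cq bX).
  apply: (@trunc_error _ T R P (Ev X i) (explosive X i.2) (measurable_Ev bX i) PE
    (measurable_explosive bX (ltW t0)) (explosive_null hp bX t0) (Vp X phi i) (fun w => S (cqX i w))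
    (fun w => cqX i w pr0) (measurable_Vp bX mphi i) (mS _ _ (cqX i) mc) (mc pr0)
    g Bd Ph e' de (e / 2) K mg gB) => //.
  + move=> w good.
    have := Vp_grid bX mphi phi0 (fun j => rS' j) rr0 rrJ Ph0 ph_0 t0 good.
    by rewrite big1 ?subr0 => [|j _]; rewrite ?mul0r// /cq t0 thresholdsE rL.
  + move=> w good.
    have := Vp_grid bX mphi phi0 (fun j => rS' j) rr0 rrJ (ltW e'0) ph_e t0 good.
    rewrite /S /cq t0 thresholdsE rL.
    by under [in X in _ -> X]eq_bigr do rewrite !thresholdsE.
  + exact: ltW.
  + exact: ltW.
(* The tail bound on the count passes to the limit, so the same K serves the limit process. *)
- have tailK : cex (@unif R) setT (fun u => (K < Y u pr0)%N%:R) <= e / 2 / (Bd + 1).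
    pose Phi2 (x : nat -> nat) : R := (K < x pr0)%N%:R.
    have c : cex P (Ev X i) (fun w => Phi2 (cqX i w)) @[i --> FF] --> cex (@unif R) setT (fun u => Phi2 (Y u)).
      apply: (@limit_functional Phi2 pr0.+1 1) => [x y xy|x]; first by rewrite /Phi2 xy.
      by rewrite /Phi2; case: (_ < _)%N; rewrite ?normr1 ?normr0.
    have c2 : (e / 2 / (Bd + 1)) @[_ --> FF] --> e / 2 / (Bd + 1) by exact: cvg_cst.
    exact: (ler_cvgT c c2 hK).
  have PQ : 0 < fine (@unif R setT) by rewrite probability_setT.
  apply: le_trans (_ : e / 2 + Bd * cex (@unif R) setT (fun u => (K < Y u pr0)%N%:R) <= _); last first.
    have := ler_wpM2l Bd0 tailK; lra.
  apply: (@trunc_error _ (measurableTypeR R) R (@unif R) setT (~` good Y) measurableT PQ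
    (measurableC (measurable_good mY)) Y_good (VY Y phi) (fun u => S (Y u)) (fun u => Y u pr0)
    (measurable_VY mY mphi) (mS _ _ Y mY) (mY pr0) g Bd Ph e' de (e / 2) K mg gB) => //.
  + move=> u /contrapT gu.
    have := VY_grid mphi phi0 (fun j => rS j) rr0 rrJ Ph0 ph_0 gu.
    by rewrite r0 big1 ?subr0 => [|j _]; rewrite ?mul0r.
  + move=> u /contrapT gu.
    by have := VY_grid mphi phi0 (fun j => rS j) rr0 rrJ (ltW e'0) ph_e gu; rewrite r0.
  + exact: ltW.
  + exact: ltW.
Qed.

End point_process_limit.

Theorem proposition2p9 (R : realType) (d : measure_display)
    (T : measurableType d) (P : probability T R) (p : nat -> R)
    (X : bbm_data R T) (hp : offspring_law p) (hX : is_bbm P p X) :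
  let x (a b t : R) := - a * Num.sqrt t + b in
  let M (a b t : R) (w : T) :=
    x a b t + max_position X t w - Num.sqrt 2 * t in
  let E (a b t : R) := [set w | 0 < M a b t w] in
  (exists (d' : measure_display) (T' : measurableType d')
     (Q : probability T' R) (N : R.-ker T' ~> measurableTypeR R),
     random_radon_measure N /\
     forall a b : R, 0 < a ->
       cond_cvg_point_process P (E a b)
         (fun t => bbm_point_process X t
                     (fun y => x a b t + y - Num.sqrt 2 * t))
         Q N) /\
  (exists lambda : R, 0 < lambda /\
     forall a b : R, 0 < a ->
       cond_cvg_law P (E a b) (M a b) (exponential_prob lambda) id).
Proof.
move=> x M E.
have near_PE := near_prob_Ev hp hX.
have pFF := @FF_proper R.
split; last first.
  exists (Num.sqrt 2); split; first by rewrite sqrtr_gt0.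
  move=> a b a0 g cg bg.
  have c := @cvg_exponential _ T R P _ (@FF R) pFF (Ev X) (measurable_Ev hX) near_PE (smax X)
    (measurable_smax hX) (fun i w h => h) (Num.sqrt 2) _ (cvg_tail hp hX) g cg bg.
  have s2 : 0 < Num.sqrt 2 :> R by rewrite sqrtr_gt0.
  by have /cvg_FF := c s2; exact.
(* Y is obtained for the filter [FF] before a and b are fixed, so the same limit process serves all
   of them. *)
have [Y [mY hY]] := @discrete_limit _ T R P _ (@FF R) pFF (Ev X) (measurable_Ev hX) near_PE
  (cq X thresholds) (measurable_cq hX _) (fun l2 h => cvg_cq_pgf hp hX h)
  (fun j e h => cq_tight hp hX thresholds j h).
have [N NE] := limit_kernel mY.
exists _, (measurableTypeR R), (@unif R), N; split.
  move=> u K cK; rewrite NE.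
  have [B [_ hB]] := compact_bounded cK.
  apply: (@limit_measure_locally_finite R Y u K (Num.truncn (`|B| + 1)).+1).
    exact: compact_measurable.
  move=> y Ky; rewrite lerNl (le_trans (ler_norm _))// normrN.
  apply: (le_trans (hB (`|B| + 1) _ y Ky)); last exact/ltW/truncnS_gt.
  by rewrite (le_lt_trans (ler_norm _))// ltrDl.
move=> a b a0 phi tphi g cg bg.
have /cvg_FF/(_ a b a0) := cvg_point_process hp hX mY hY tphi cg bg.
have -> : cex (@unif R) setT (fun u => g (VY Y phi u)) =
    fine (\int[@unif R]_u (g (\int[N u]_y phi y))%:E)%E.
  rewrite /cex probability_setT divr1 /Rintegral; congr fine; apply: eq_integral => u _.
  by rewrite NE.
apply: cvg_trans; apply: near_eq_cvg; apply: nearW => t.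
have -> : (fun w => g (\int[bbm_point_process X t (fun y => x a b t + y - Num.sqrt 2 * t) w]_y phi y)) =
    (fun w => g (Vp X phi (a, b, t) w)).
  by apply/funext => w; rewrite /Vp -bbm_atoms.
by [].
Qed.
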